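(* Let $0<p<\infty$. There exists a constant $C_p<\infty$ such that $$\sup_{\theta\in\mathbb R}\int_{\theta}^{\theta+1}\left|P\!\left(\tfrac12+it\right)\right|^p\,dt\;\le\; C_p\,\|P\|_{\mathcal H^p}^{p}$$ for every Dirichlet polynomial $P$ if and only if $p\ge 2$.
   Context: A Dirichlet polynomial is a finite sum $P(s)=\sum_{n\in\mathcal F}a_n n^{-s}$ with $\mathcal F\subset\mathbb N$ finite and $a_n\in\mathbb C$. Writing $n=\prod_r r^{\nu_r(n)}$ (product over primes $r$) and $\nu(n)=(\nu_r(n))_r$, the Bohr lift of $P$ is the analytic polynomial $\mathcal BP(z)=\sum_{n\in\mathcal F}a_n z^{\nu(n)}$, $z^{\nu}=\prod_r z_r^{\nu_r}$, in the finitely many variables $z_r$ indexed by the primes $r\le y$, where $y\ge 2$ is any number such that all prime divisors of all $n\in\mathcal F$ are $\le y$. For $0<p<\infty$, $$\|P\|_{\mathcal H^p}^p=\int_{\mathbb T^{\pi(y)}}|\mathcal BP(z)|^p\,dm(z),$$ where $\mathbb T$ is the unit circle, $\pi(y)$ is the number of primes $\le y$ and $m$ is normalized Haar measure. *)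

(* Defs.v *)
From HB Require Import structures.
From mathcomp Require Import all_boot all_order all_algebra.
From mathcomp Require Import finmap complex.
From mathcomp Require Import all_classical all_reals all_analysis.
From mathcomp Require Import measurable_realfun.
Import Order.TTheory GRing.Theory Num.Theory.
Import numFieldNormedType.Exports.
Import ComplexField.Normc.

Set Implicit Arguments.
Unset Strict Implicit.
Unset Printing Implicit Defensive.

Local Open Scope classical_set_scope.
Local Open Scope ring_scope.

Definition cexp (R : realType) (z : R[i]) : R[i] :=
  (expR (complex.Re z))%:C%C * (cos (complex.Im z) +i* sin (complex.Im z))%C.

(* [n ^ z], meaningful for [0 < n] *)
Definition natcpow (R : realType) (n : nat) (z : R[i]) : R[i] :=
  cexp (z * (ln n%:R)%:C%C).

Record dirichlet_poly (R : realType) := DirichletPoly {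
  frequencies : {fset nat};
  frequencies_gt0 : forall n, n \in frequencies -> (0 < n)%N;
  dcoef : nat -> R[i]
}.

Definition dirichlet_eval (R : realType) (P : dirichlet_poly R) (s : R[i]) :
    R[i] :=
  \sum_(n <- frequencies P) dcoef P n * natcpow n (- s).

Definition primes_upto (R : realType) (y : R) : seq nat :=
  [seq r <- iota 0 (Num.truncn y).+1 | prime r].

Lemma mem_primes_upto (R : realType) (y : R) (r : nat) : 0 <= y ->
  (r \in primes_upto y) = prime r && (r%:R <= y).
Proof.
by move=> y0; rewrite mem_filter mem_iota/= add0n ltnS truncn_ge_nat.
Qed.

Definition prime_pi (R : realType) (y : R) : nat := size (primes_upto y).

Definition bohr_bound (R : realType) (P : dirichlet_poly R) (y : R) : Prop :=
  2 <= y /\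
  forall n r : nat, n \in frequencies P -> prime r -> (r %| n)%N -> r%:R <= y.

(* The variable [z_r] is the coordinate of [z] at the position of [r] in
   [primes_upto y]. *)
Definition bohr_lift (R : realType) (P : dirichlet_poly R) (y : R)
    (z : (prime_pi y).-tuple R[i]) : R[i] :=
  \sum_(n <- frequencies P) dcoef P n *
    \prod_(j < prime_pi y) tnth z j ^+ logn (nth 0%N (primes_upto y) j) n.

Section circle.
Variable R : realType.

Record circle := Circle { circle_val : R[i]; _ : normc circle_val == 1 }.

HB.instance Definition _ := [isSub for circle_val].
HB.instance Definition _ := [Choice of circle by <:].

Lemma normc_cis (t : R) : normc (cos t +i* sin t)%C == 1.
Proof. by rewrite /= cos2Dsin2 sqrtr1. Qed.

Definition cis (t : R) : circle := Circle (normc_cis t).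

HB.instance Definition _ := isPointed.Build circle (cis 0).

Lemma normc_circleM (z w : circle) :
  normc (circle_val z * circle_val w) == 1.
Proof.
by rewrite normcM (eqP (valP z)) (eqP (valP w)) mulr1.
Qed.

Definition circle_mul (z w : circle) : circle := Circle (normc_circleM z w).

Definition circle_coord (z : circle) : R * R :=
  (complex.Re (circle_val z), complex.Im (circle_val z)).

(* Borel sets: traces on the circle of the Borel sets of the plane *)
HB.instance Definition _ := Measurable.copy circle
  (g_sigma_algebra_preimageType circle_coord).

Lemma measurable_cis : measurable_fun [set: R] cis.
Proof.
move=> _ _ [B mB <-]; rewrite !setTI -comp_preimage.
have : measurable_fun [set: R] (fun t : R => (cos t, sin t)).
  apply: measurable_fun_pair; apply: continuous_measurable_fun.
    exact: continuous_cos.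
  exact: continuous_sin.
by move=> /(_ measurableT _ mB); rewrite setTI.
Qed.

Definition cis_turn (t : measurableTypeR R) : circle := cis (2 * pi * t).

Lemma measurable_cis_turn : measurable_fun [set: measurableTypeR R] cis_turn.
Proof.
apply: (measurableT_comp measurable_cis).
exact: measurable_funM.
Qed.

HB.instance Definition _ :=
  isMeasurableFun.Build _ _ _ _ cis_turn measurable_cis_turn.

Definition circle_haar : probability circle R :=
  distribution (uniform_prob (@ltr01 R)) cis_turn.

Local Notation mu := (@lebesgue_measure R).

Let mu_shift (a : R) (A : set (measurableTypeR R)) : measurable A ->
  mu [set x | A (x + a)] = mu A.
Proof.
move=> mA; apply/esym.
pose f (x : measurableTypeR R) : measurableTypeR R := x + a.
have mf : measurable_fun setT f by exact: measurable_funD.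
pose nu := measure_function_pushforward__canonical__measure_function_Measure
  mu mf.
suff : forall X, ocitv X -> mu X = nu X.
  by move=> /lebesgue_measure_unique -> .
move=> _ [[b c]] _ <-; rewrite /nu /= /pushforward /=.
rewrite (_ : _ @^-1` _ = `]b - a, c - a]%classic); last first.
  by apply/seteqP; split => x /=; rewrite !in_itv/= /f ltrBlDr lerBrDr.
rewrite !lebesgue_measure_itv/= !lte_fin ltrD2r.
by case: ifPn => // _; rewrite -!EFinD opprB addrA addrNK.
Qed.

Let cisD (a b : R) : circle_mul (cis a) (cis b) = cis (b + a).
Proof.
apply/val_inj/eqP; rewrite eq_complex /= cosD sinD.
apply/andP; split; apply/eqP.
  by rewrite mulrC [sin a * _]mulrC.
by rewrite mulrC [sin a * _]mulrC.
Qed.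

Let turn_mul (a t : R) :
  circle_mul (cis_turn a) (cis_turn t) = cis_turn (t + a).
Proof. by rewrite cisD -mulrDr. Qed.

Let cis2pi t : cis (t + 2 * pi) = cis t.
Proof.
rewrite mulr_natl; apply/val_inj; move: (sinD2pi t) (cosD2pi t).
by move: (t + _) => u su cu; rewrite /= su cu.
Qed.

Let turn1 t : cis_turn (t + 1) = cis_turn t.
Proof. by rewrite /cis_turn mulrDr mulr1 cis2pi. Qed.

Let cis_surj (w : circle) : exists2 b : R, 0 <= b <= 2 * pi & w = cis b.
Proof.
case: w => -[x y] xy1; have : Num.sqrt (x ^+ 2 + y ^+ 2) = 1 by exact/eqP.
move=> /(congr1 (fun z => z ^+ 2)); rewrite sqr_sqrtr ?addr_ge0 ?sqr_ge0//.
rewrite expr1n => e.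
have x11 : -1 <= x <= 1.
  rewrite -ler_norml -(@expr_le1 _ 2)// real_normK ?num_real//.
  by rewrite -e lerDl sqr_ge0.
have [/andP[a0 api] ca] := acos_def x11; have sa := sin_acos x11.
have sx : Num.sqrt (1 - x ^+ 2) = `|y| by rewrite -e addrC addKr sqrtr_sqr.
have a2pi : acos x <= 2 * pi.
  by rewrite (le_trans api)// ler_peMl ?pi_ge0// ler1n.
have [y0|y0] := leP 0 y.
  exists (acos x); first by rewrite a0.
  by apply/val_inj; rewrite /= ca sa sx ger0_norm.
exists (- acos x + 2 * pi); first by rewrite addrC subr_ge0 a2pi lerBlDr lerDl.
rewrite cis2pi.
by apply/val_inj; rewrite /= cosN sinN ca sa sx ltr0_norm// opprK.
Qed.

Let turn_surj (w : circle) : exists2 a : R, 0 <= a <= 1 & w = cis_turn a.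
Proof.
have [b /andP[b0 b2] ->] := cis_surj w.
have pi0 : 0 < 2 * pi :> R by rewrite mulr_gt0// pi_gt0.
exists (b / (2 * pi)).
  by rewrite divr_ge0 ?(ltW pi0)// ler_pdivrMr// mul1r.
by rewrite /cis_turn mulrC divfK// gt_eqF.
Qed.

Let measurable_turn (A : set circle) : measurable A ->
  measurable (cis_turn @^-1` A).
Proof.
by move=> mA; rewrite -[X in measurable X]setTI; exact: measurable_cis_turn.
Qed.

Let circle_haarE (A : set circle) : measurable A ->
  circle_haar A = mu (cis_turn @^-1` A `&` `[0, 1[).
Proof.
move=> /measurable_turn mB.
have -> : circle_haar A = uniform_prob (@ltr01 R) (cis_turn @^-1` A) by [].
rewrite /uniform_prob integral_uniform_pdf (eq_integral (cst 1%E)); last first.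
  move=> x; rewrite inE /= in_itv/= /uniform_pdf => -[_ ->].
  by rewrite subr0 invr1.
rewrite integral_cst//=; last exact: measurableI.
have -> : `[0, 1]%classic = `[0, 1[%classic `|` [set 1 : R].
  by rewrite setUitv1// bnd_simp.
rewrite mul1e setIUr measureU//=.
- rewrite [X in (_ + X)%E](_ : _ = 0%E) ?adde0//.
  apply: (@subset_measure0 _ _ _ mu _ [set 1 : R]) => //.
  + exact: measurableI.
  + exact: lebesgue_measure_set1.
- exact: measurableI.
- exact: measurableI.
- apply/seteqP; split => // x [[_ /=]]; rewrite in_itv/= => /andP[_ x1] [_ xE].
  by rewrite xE ltxx in x1.
Qed.

Lemma measurable_circle_mul (w : circle) :
  measurable_fun [set: circle] (circle_mul w).
Proof.
move=> _ _ [B mB <-].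
pose a := complex.Re (circle_val w); pose b := complex.Im (circle_val w).
pose L (z : R * R) := (a * z.1 - b * z.2, a * z.2 + b * z.1).
have mL : measurable_fun [set: R * R] L.
  apply: measurable_fun_pair.
    by apply: measurable_funB; apply: measurable_funM.
  by apply: measurable_funD; apply: measurable_funM.
exists (L @^-1` B); first by rewrite -[X in measurable X]setTI; exact: mL.
rewrite !setTI -[LHS]/((L \o circle_coord) @^-1` B).
rewrite -[RHS]/((circle_coord \o circle_mul w) @^-1` B); congr (_ @^-1` B).
by apply/funext => -[[x y] ?]; rewrite /L /a /b; case: (w) => -[].
Qed.

Lemma circle_haar_invariant (w : circle) (A : set circle) : measurable A ->
  circle_haar (circle_mul w @^-1` A) = circle_haar A.
Proof.
have [a /andP[a0 a1] ->] := turn_surj w => mA.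
pose B := cis_turn @^-1` A; have mB : measurable B := measurable_turn mA.
have B1 t : B (t + 1) <-> B t by rewrite /B /= turn1.
have circle_mulE : cis_turn @^-1` (circle_mul (cis_turn a) @^-1` A) =
    [set t | B (t + a)].
  by apply/seteqP; split => t /=; rewrite turn_mul.
have add (b c d : R) : b <= c -> c <= d ->
    mu (B `&` `[b, d[) = (mu (B `&` `[b, c[) + mu (B `&` `[c, d[))%E.
  move=> bc cd.
  rewrite -measureU//=; [|exact: measurableI|exact: measurableI|].
    by rewrite -setIUr -itv_bndbnd_setU// bnd_simp.
  apply/seteqP; split => // x [[_ /=]]; rewrite in_itv/= => /andP[_ xc] [_].
  by rewrite /= in_itv/= => /andP[]; rewrite leNgt xc.
have shift (b c d : R) (C : set R) : (forall t, B (t + b) <-> C t) ->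
    mu (B `&` `[c + b, d + b[) = mu (C `&` `[c, d[).
  move=> BC; rewrite -(mu_shift b); last exact: measurableI.
  congr (mu _); apply/seteqP; split => t /=; rewrite !in_itv/= lerD2r ltrD2r;
    by move=> [/BC].
rewrite !circle_haarE//; last first.
  by rewrite -[X in measurable X]setTI; exact: measurable_circle_mul.
rewrite circle_mulE -(shift a)// add0r (add a 1 (1 + a)) ?lerDl//.
have := shift 1 0 a B B1; rewrite add0r [a + 1]addrC => ->.
by rewrite (add 0 a 1)// addeC.
Qed.

Section torus.
Variable n : nat.

Definition torus_cons (z : circle * n.-tuple circle) : n.+1.-tuple circle :=
  [tuple of z.1 :: z.2].

Lemma measurable_torus_cons :
  measurable_fun [set: circle * n.-tuple circle] torus_cons.
Proof. exact: measurable_cons. Qed.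

HB.instance Definition _ :=
  isMeasurableFun.Build _ _ _ _ torus_cons measurable_torus_cons.

Definition torus_mul (w z : n.-tuple circle) : n.-tuple circle :=
  [tuple circle_mul (tnth w i) (tnth z i) | i < n].

End torus.

(* Product of [n] copies of [circle_haar]; by [torus_haar_invariant] below it is
   the translation invariant Borel probability on the torus, i.e. normalized
   Haar measure. *)
Fixpoint torus_haar (n : nat) : probability (n.-tuple circle) R :=
  if n is m.+1 then
    distribution (circle_haar \x torus_haar m)%E (@torus_cons m)
  else \d_[tuple].

Lemma torus_haar_invariant (n : nat) (w : n.-tuple circle)
    (A : set (n.-tuple circle)) : measurable A ->
  torus_haar n (torus_mul w @^-1` A) = torus_haar n A.
Proof.
elim: n w A => [|n IHn] w A mA.
  have -> // : torus_mul w @^-1` A = A.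
  by apply/seteqP; split => z /=; rewrite (tuple0 z) (tuple0 (torus_mul _ _)).
pose B := @torus_cons n @^-1` A.
have mB : measurable B.
  by rewrite -[X in measurable X]setTI; exact: measurable_torus_cons.
pose w0 := thead w; pose w' := [tuple of behead w].
pose g := (torus_haar n \o xsection B)%FUN.
have mg : measurable_fun setT g by exact: measurable_fun_xsection.
have gE : (\int[circle_haar]_x g (circle_mul w0 x) = \int[circle_haar]_x g x)%E.
  have := @ge0_integral_pushforward _ _ _ _ _ _ (measurable_circle_mul w0)
    circle_haar setT g measurableT mg (fun _ _ => measure_ge0 _ _).
  rewrite preimage_setT => <-.
  apply: eq_measure_integral => [|mf C mC _].
    exact: measurable_circle_mul.
  exact: circle_haar_invariant.
rewrite -[RHS]gE.
have wE x z : torus_mul w (torus_cons (x, z)) =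
    torus_cons (circle_mul w0 x, torus_mul w' z).
  apply/eq_from_tnth => i; rewrite tnth_mktuple.
  case: (unliftP ord0 i) => [j ->|->].
    rewrite !tnthS tnth_mktuple /w'; congr circle_mul.
    rewrite tnth_behead; congr (tnth w _); apply/val_inj.
    by rewrite /= inordK// ltnS.
  by rewrite !tnth0.
apply: eq_integral => x _ /=.
rewrite /g /= -(IHn w' (xsection B (circle_mul w0 x))); last first.
  exact: measurable_xsection.
congr (torus_haar n _); apply/seteqP.
by split => z; rewrite /= !xsectionE /B /= wE.
Qed.

End circle.

(* The [p]-th power of the [H^p] norm, computed with the primes up to [y]; to be
   used under [bohr_bound P y]. *)
Definition hardy_normXp (R : realType) (P : dirichlet_poly R) (y p : R) :
    \bar R :=
  (\int[torus_haar R (prime_pi y)]_z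
    (normc (bohr_lift P (map_tuple (@circle_val R) z)) `^ p)%R%:E)%E.

(* Main.v *)
Require Import Defs.
From HB Require Import structures.
From mathcomp Require Import all_boot all_order all_algebra.
From mathcomp Require Import finmap complex.
From mathcomp Require Import all_classical all_reals all_analysis.
From mathcomp Require Import measurable_realfun.
From mathcomp Require Import ring lra zify.
Import Order.TTheory GRing.Theory Num.Theory.
Import numFieldNormedType.Exports.
Import ComplexField.Normc.

Set Implicit Arguments.
Unset Strict Implicit.
Unset Printing Implicit Defensive.

Local Open Scope classical_set_scope.
Local Open Scope ring_scope.


Section WeightedIntegral.
Context d (T : measurableType d) (R : realType).
Implicit Types (m : {measure set T -> \bar R}) (w g : T -> R).

Definition bounded_on w g := measurable_fun setT g /\
  exists B, forall x, w x != 0 -> `|g x| <= B.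

Definition weight m w := m.-integrable setT (EFin \o w).

Definition wint m w g := \int[m]_x (w x * g x).

Lemma weight_measurable m w : weight m w -> measurable_fun setT w.
Proof. by case/integrableP => /measurable_EFinP. Qed.

Lemma wint_integrable m w g : weight m w -> bounded_on w g ->
  m.-integrable setT (EFin \o (fun x => w x * g x)).
Proof.
move=> ww [mg [B gB]]; have mw := weight_measurable ww.
have mwg : measurable_fun setT (fun x => w x * g x) by exact: measurable_funM.
apply: (@le_integrable _ _ _ m setT measurableT _ (EFin \o (fun x => `|B| * w x))).
- exact/measurable_EFinP.
- move=> x _ /=; rewrite lee_fin !normrM normr_id mulrC.
  have [->|w0] := eqVneq (w x) 0; first by rewrite normr0 !mulr0.
  by rewrite ler_wpM2r// (le_trans (gB _ w0))// ler_norm.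
- rewrite (_ : _ \o _ = (fun x => (`|B|)%:E * (EFin \o w) x)%E); last first.
    by apply/funext => x /=; rewrite EFinM.
  exact: integrableZl.
Qed.

Lemma eq_wint m w g h : (forall x, w x != 0 -> g x = h x) ->
  wint m w g = wint m w h.
Proof.
move=> gh; apply: eq_Rintegral => x _.
by have [->|w0] := eqVneq (w x) 0; rewrite ?mul0r// gh.
Qed.

Lemma wintZ m w g c : weight m w -> bounded_on w g ->
  wint m w (fun x => c * g x) = c * wint m w g.
Proof.
move=> ww bg; rewrite /wint -RintegralZl//; last exact: wint_integrable.
by apply: eq_Rintegral => x _; rewrite mulrCA.
Qed.

Lemma wintD m w g h : weight m w -> bounded_on w g -> bounded_on w h ->
  wint m w (fun x => g x + h x) = wint m w g + wint m w h.
Proof.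
move=> ww bg bh; rewrite /wint -RintegralD//; try exact: wint_integrable.
by apply: eq_Rintegral => x _; rewrite mulrDr.
Qed.

Lemma wint_ge0 m w g : (forall x, 0 <= w x) ->
  (forall x, w x != 0 -> 0 <= g x) -> 0 <= wint m w g.
Proof.
move=> w0 g0; apply: Rintegral_ge0 => x _.
by have [->|wx] := eqVneq (w x) 0; rewrite ?mul0r// mulr_ge0// g0.
Qed.

Lemma le_wint m w g h : weight m w -> (forall x, 0 <= w x) ->
  bounded_on w g -> bounded_on w h ->
  (forall x, w x != 0 -> g x <= h x) -> wint m w g <= wint m w h.
Proof.
move=> ww w0 bg bh gh; apply: le_Rintegral => //; try exact: wint_integrable.
move=> x _; have [->|wx] := eqVneq (w x) 0; first by rewrite !mul0r.
by rewrite ler_wpM2l// gh.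
Qed.

Lemma le_norm_wint m w g : weight m w -> (forall x, 0 <= w x) ->
  bounded_on w g -> `|wint m w g| <= wint m w (fun x => `|g x|).
Proof.
move=> ww w0 bg; apply: le_trans (le_normr_Rintegral _ _) _ => //.
  exact: wint_integrable.
rewrite le_eqVlt; apply/orP; left; apply/eqP; apply: eq_Rintegral => x _.
by rewrite normrM ger0_norm.
Qed.

Lemma bounded_on_cst w c : bounded_on w (fun=> c).
Proof. by split => //; exists `|c|. Qed.

Lemma bounded_onD w g h : bounded_on w g -> bounded_on w h ->
  bounded_on w (fun x => g x + h x).
Proof.
move=> [mg [B gB]] [mh [B' hB]]; split; first exact: measurable_funD.
exists (B + B') => x wx; rewrite (le_trans (ler_normD _ _))// lerD//; auto.
Qed.

Lemma bounded_onM w g h : bounded_on w g -> bounded_on w h ->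
  bounded_on w (fun x => g x * h x).
Proof.
move=> [mg [B gB]] [mh [B' hB]]; split; first exact: measurable_funM.
exists (B * B') => x wx; rewrite normrM ler_pM//; auto.
Qed.

Lemma bounded_onN w g : bounded_on w g -> bounded_on w (fun x => - g x).
Proof.
move=> [mg [B gB]]; split; first exact: measurableT_comp.
by exists B => x wx; rewrite normrN; exact: gB.
Qed.

Lemma bounded_on_norm w g : bounded_on w g -> bounded_on w (fun x => `|g x|).
Proof.
move=> [mg [B gB]]; split; first exact: measurableT_comp.
by exists B => x wx; rewrite normr_id; exact: gB.
Qed.

Lemma bounded_on_sum w (I : Type) (s : seq I) (P : pred I) (g : I -> T -> R) :
  (forall i, P i -> bounded_on w (g i)) ->
  bounded_on w (fun x => \sum_(i <- s | P i) g i x).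
Proof.
move=> bg; elim: s => [|i s IH].
  by rewrite (_ : (fun _ => _) = fun=> 0)//;
     [exact: bounded_on_cst|apply/funext => x; rewrite big_nil].
rewrite (_ : (fun _ => _) = fun x => (if P i then g i x else 0) +
    \sum_(j <- s | P j) g j x); last first.
  by apply/funext => x; rewrite big_cons; case: ifP; rewrite ?add0r.
apply: bounded_onD => //.
by case Pi: (P i); [exact: bg|exact: bounded_on_cst].
Qed.

Lemma wintB m w g h : weight m w -> bounded_on w g -> bounded_on w h ->
  wint m w (fun x => g x - h x) = wint m w g - wint m w h.
Proof.
move=> ww bg bh; rewrite (wintD ww bg (bounded_onN bh)).
congr (_ + _); rewrite -mulN1r -(wintZ _ ww bh).
by apply: eq_wint => x _; rewrite mulN1r.
Qed.

Lemma wint0 m w : wint m w (fun=> 0) = 0.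
Proof.
rewrite /wint (_ : (fun _ => _) = cst 0); last by apply/funext => x; rewrite mulr0.
by rewrite Rintegral_cst// mul0r.
Qed.

Lemma wint_sum m w (I : Type) (s : seq I) (P : pred I) (g : I -> T -> R) :
  weight m w -> (forall i, P i -> bounded_on w (g i)) ->
  wint m w (fun x => \sum_(i <- s | P i) g i x) =
  \sum_(i <- s | P i) wint m w (g i).
Proof.
move=> ww bg; elim: s => [|i s IH].
  rewrite [RHS]big_nil; apply: etrans (wint0 m w); apply: eq_wint => x _.
  by rewrite big_nil.
rewrite big_cons; case: ifP => Pi.
  rewrite -IH -(wintD ww (bg _ Pi) (bounded_on_sum s bg)).
  by apply: eq_wint => x _; rewrite big_cons Pi.
by rewrite -IH; apply: eq_wint => x _; rewrite big_cons Pi.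
Qed.

Lemma wint_cst m w c : weight m w -> wint m w (fun=> c) = c * wint m w (fun=> 1).
Proof.
move=> ww; rewrite -wintZ//; last exact: bounded_on_cst.
by apply: eq_wint => x _; rewrite mulr1.
Qed.

Lemma norm_wint_le m w g B : weight m w -> bounded_on w g ->
  (forall x, w x != 0 -> `|g x| <= B) ->
  `|wint m w g| <= B * wint m (fun x => `|w x|) (fun=> 1).
Proof.
move=> ww bg gB.
have mw := weight_measurable ww.
have wn : weight m (fun x => `|w x|).
  by have := integrable_norm ww.
apply: le_trans (le_normr_Rintegral _ _) _ => //; first exact: wint_integrable.
rewrite -(wint_cst _ wn); apply: le_Rintegral => //.
- exact/integrable_norm/wint_integrable.
- apply: wint_integrable => //; exact: bounded_on_cst.
- move=> x _; rewrite normrM; have [->|w0] := eqVneq (w x) 0.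
    by rewrite normr0 !mul0r.
  by rewrite ler_wpM2l// gB.
Qed.

End WeightedIntegral.

Section WeightedFubini.
Context d1 d2 (T1 : measurableType d1) (T2 : measurableType d2) (R : realType).
Variables (m1 : {sigma_finite_measure set T1 -> \bar R})
          (m2 : {sigma_finite_measure set T2 -> \bar R}).
Variables (w1 : T1 -> R) (w2 : T2 -> R) (k : T1 -> T2 -> R).
Hypothesis ww1 : weight m1 w1.
Hypothesis ww2 : weight m2 w2.
Hypothesis mk : measurable_fun setT (fun xy : T1 * T2 => k xy.1 xy.2).
Hypothesis bk : exists B, forall x y, w1 x != 0 -> w2 y != 0 -> `|k x y| <= B.

Let f (xy : T1 * T2) := (w1 xy.1 * (w2 xy.2 * k xy.1 xy.2)).

Let mw1 : measurable_fun setT (fun xy : T1 * T2 => w1 xy.1).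
Proof. by apply: measurableT_comp => //; exact: weight_measurable ww1. Qed.

Let mw2 : measurable_fun setT (fun xy : T1 * T2 => w2 xy.2).
Proof. by apply: measurableT_comp => //; exact: weight_measurable ww2. Qed.

Let mf : measurable_fun setT f.
Proof. by apply: measurable_funM => //; exact: measurable_funM. Qed.

Let int_f : (m1 \x m2)%E.-integrable setT (EFin \o f).
Proof.
have [B kB] := bk.
apply/integrable12ltyP; first exact/measurable_EFinP.
have [mw1' iw1] := integrableP _ _ _ ww1.
have [mw2' iw2] := integrableP _ _ _ ww2.
pose I2 := (\int[m2]_y `|(w2 y)%:E|)%E.
have I2fin : I2 \is a fin_num.
  by rewrite ge0_fin_numE//; exact: integral_ge0.
apply: (@le_lt_trans _ _ (\int[m1]_x ((fine I2 * `|B|)%:E * `|(w1 x)%:E|))%E).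
  apply: ge0_le_integral => //.
  - by move=> x _; exact: integral_ge0.
  - apply: (measurable_fun_fubini_tonelli_F (fun xy : T1 * T2 => `|(f xy)%:E|)%E) => //.
    by do 2 apply: measurableT_comp => //.
  - by apply: emeasurable_funM => //; exact: measurableT_comp.
  - move=> x _; have [w0|w0] := eqVneq (w1 x) 0.
      rewrite integral0_eq; last by move=> y _; rewrite /f /= w0 mul0r normr0.
      by rewrite w0 abse0 mule0.
    apply: (@le_trans _ _ (\int[m2]_y ((`|B| * `|w1 x|)%:E * `|(w2 y)%:E|))%E).
      apply: ge0_le_integral => //.
      + apply: measurableT_comp => //; apply/measurable_EFinP.
        exact: (measurableT_comp mf (measurable_pair1 x)).
      + by apply: emeasurable_funM => //; exact: measurableT_comp.
      + move=> y _; rewrite /= -EFinM lee_fin /f /= !normrM.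
        have [->|wy] := eqVneq (w2 y) 0; first by rewrite normr0 !(mul0r,mulr0).
        rewrite (_ : `|B| * _ * _ = `|w1 x| * (`|w2 y| * `|B|)); last by ring.
        rewrite !ler_wpM2l//.
        by rewrite (le_trans (kB _ _ w0 wy))// ler_norm.
    rewrite ge0_integralZl//; last exact: measurableT_comp.
    by rewrite -[X in (_ * X)%E](fineK I2fin) !EFinM [leLHS]muleC muleA.
rewrite ge0_integralZl//; last 2 first.
- exact: measurableT_comp.
- by rewrite lee_fin mulr_ge0// fine_ge0// integral_ge0.
apply: lte_mul_pinfty => //.
by rewrite lee_fin mulr_ge0// fine_ge0// integral_ge0.
Qed.

Let fineE1 x : (\int[m2]_y (f (x, y))%:E)%E =
   (w1 x * wint m2 w2 (k x))%:E.
Proof.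
have [w0|w0] := eqVneq (w1 x) 0.
  by rewrite integral0_eq ?w0 ?mul0r// => y _; rewrite /f /= w0 mul0r.
have [B kB] := bk.
have bkx : bounded_on w2 (k x).
  split; last by exists B => y; exact: kB.
  exact: (measurableT_comp mk (measurable_pair1 x)).
have := wint_integrable ww2 bkx => ik.
rewrite /wint /Rintegral EFinM fineK; last exact: integrable_fin_num.
rewrite -integralZl//.
Qed.

Let fineE2 y : (\int[m1]_x (f (x, y))%:E)%E =
   (w2 y * wint m1 w1 (k ^~ y))%:E.
Proof.
have [w0|w0] := eqVneq (w2 y) 0.
  by rewrite integral0_eq ?w0 ?mul0r// => x _; rewrite /f /= w0 mul0r mulr0.
have [B kB] := bk.
have bkx : bounded_on w1 (k ^~ y).
  split; last by exists B => x w1x; exact: kB.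
  exact: (measurableT_comp mk (measurable_pair2 y)).
have := wint_integrable ww1 bkx => ik.
rewrite /wint /Rintegral EFinM fineK; last exact: integrable_fin_num.
rewrite -integralZl//; apply: eq_integral => x _.
by rewrite -EFinM /f /= mulrCA.
Qed.

Lemma wint_swap :
  wint m1 w1 (fun x => wint m2 w2 (k x)) =
  wint m2 w2 (fun y => wint m1 w1 (k ^~ y)).
Proof.
congr fine; transitivity (\int[m1]_x \int[m2]_y (f (x, y))%:E)%E.
  by apply: eq_integral => x _; rewrite fineE1.
by rewrite (Fubini int_f); apply: eq_integral => y _; rewrite fineE2.
Qed.

End WeightedFubini.

Section WeightedParam.
Context d1 d2 (T1 : measurableType d1) (T2 : measurableType d2) (R : realType).
Variables (m2 : {sigma_finite_measure set T2 -> \bar R}).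
Variables (w2 : T2 -> R) (k : T1 -> T2 -> R).
Hypothesis ww2 : weight m2 w2.
Hypothesis mk : measurable_fun setT (fun xy : T1 * T2 => k xy.1 xy.2).

(** No boundedness is needed: the positive and negative parts are handled by
Tonelli's theorem, and [fine] is measurable. *)
Lemma measurable_wint : measurable_fun setT (fun x => wint m2 w2 (k x)).
Proof.
pose f (xy : T1 * T2) := w2 xy.2 * k xy.1 xy.2.
have mf : measurable_fun setT f.
  apply: measurable_funM => //; apply: measurableT_comp => //.
  exact: weight_measurable ww2.
apply: measurableT_comp => //.
rewrite (_ : (fun x => _) = (fun x => (\int[m2]_y ((EFin \o f)^\+ (x, y))) -
   (\int[m2]_y ((EFin \o f)^\- (x, y))))%E); last first.
  apply/funext => x; rewrite integralE.
  by congr (_ - _)%E; apply: eq_integral => y _; rewrite unlock.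
apply: emeasurable_funB.
  apply: (measurable_fun_fubini_tonelli_F (EFin \o f)^\+%E) => //.
  by apply: measurable_funepos; exact/measurable_EFinP.
apply: (measurable_fun_fubini_tonelli_F (EFin \o f)^\-%E) => //.
by apply: measurable_funeneg; exact/measurable_EFinP.
Qed.

End WeightedParam.

Section ComplexFacts.
Variable R : realType.
Local Notation C := R[i].
Implicit Types (z w : C).
Local Notation Re := complex.Re.
Local Notation Im := complex.Im.

Definition sqn (z : C) : R := Re z ^+ 2 + Im z ^+ 2.

Lemma sqn_ge0 z : 0 <= sqn z.
Proof. by rewrite addr_ge0 ?sqr_ge0. Qed.

Lemma ReD z w : Re (z + w) = Re z + Re w.
Proof. by case: z; case: w. Qed.

Lemma ImD z w : Im (z + w) = Im z + Im w.
Proof. by case: z; case: w. Qed.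

Lemma ReM z w : Re (z * w) = Re z * Re w - Im z * Im w.
Proof. by case: z; case: w. Qed.

Lemma ImM z w : Im (z * w) = Re z * Im w + Im z * Re w.
Proof. by case: z => a b; case: w => c e /=. Qed.

Lemma ReJ z : Re (z^*)%C = Re z.
Proof. by case: z. Qed.

Lemma ImJ z : Im (z^*)%C = - Im z.
Proof. by case: z. Qed.

Lemma ReN z : Re (- z) = - Re z.
Proof. by case: z. Qed.

Lemma ImN z : Im (- z) = - Im z.
Proof. by case: z. Qed.

Lemma complex_ext z w : Re z = Re w -> Im z = Im w -> z = w.
Proof. by case: z => a b; case: w => c e /= -> ->. Qed.

Lemma Re_sum (I : Type) (s : seq I) (P : pred I) (F : I -> C) :
  Re (\sum_(i <- s | P i) F i) = \sum_(i <- s | P i) Re (F i).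
Proof.
by elim/big_rec2: _ => [//|i x y _ <-]; rewrite ReD.
Qed.

Lemma Im_sum (I : Type) (s : seq I) (P : pred I) (F : I -> C) :
  Im (\sum_(i <- s | P i) F i) = \sum_(i <- s | P i) Im (F i).
Proof.
by elim/big_rec2: _ => [//|i x y _ <-]; rewrite ImD.
Qed.

Lemma sqnM z w : sqn (z * w) = sqn z * sqn w.
Proof. by rewrite /sqn ReM ImM; ring. Qed.

Lemma sqn1 : sqn 1 = 1.
Proof. by rewrite /sqn /=; ring. Qed.

Lemma sqn0 : sqn 0 = 0.
Proof. by rewrite /sqn /=; ring. Qed.

Lemma sqnN z : sqn (- z) = sqn z.
Proof. by rewrite /sqn ReN ImN !sqrrN. Qed.

Lemma sqnJ z : sqn (z^*)%C = sqn z.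
Proof. by rewrite /sqn ReJ ImJ sqrrN. Qed.

Lemma sqnR (a : R) : sqn (a%:C)%C = a ^+ 2.
Proof. by rewrite /sqn /= expr0n addr0. Qed.

Lemma sqnX z n : sqn (z ^+ n) = sqn z ^+ n.
Proof. by elim: n => [|n IH]; rewrite ?expr0 ?sqn1// !exprS sqnM IH. Qed.

Lemma sqn_prod (I : Type) (s : seq I) (P : pred I) (F : I -> C) :
  sqn (\prod_(i <- s | P i) F i) = \prod_(i <- s | P i) sqn (F i).
Proof.
by elim/big_rec2: _ => [|i x y _ <-]; rewrite ?sqn1 ?sqnM.
Qed.

Lemma sqn_eq0 z : (sqn z == 0) = (z == 0).
Proof.
rewrite /sqn paddr_eq0 ?sqr_ge0// !sqrf_eq0.
by case: z => a b; rewrite eq_complex.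
Qed.

Lemma sqnD z w : sqn (z + w) = sqn z + 2 * Re ((z^*)%C * w) + sqn w.
Proof. by rewrite /sqn ReD ImD ReM ReJ ImJ; ring. Qed.

Lemma mulJc z : z * (z^*)%C = ((sqn z)%:C)%C.
Proof. by apply: complex_ext; rewrite ?ReM ?ImM ReJ ImJ /= /sqn; ring. Qed.

Lemma normcE_sqn z : normc z = Num.sqrt (sqn z).
Proof. by case: z. Qed.

Lemma sqr_normc_sqn z : normc z ^+ 2 = sqn z.
Proof. by rewrite normcE_sqn sqr_sqrtr// sqn_ge0. Qed.

Lemma normc_ge0 z : 0 <= normc z.
Proof. by rewrite normcE_sqn sqrtr_ge0. Qed.

Lemma normc_powR z (p : R) : normc z `^ p = sqn z `^ (p / 2).
Proof.
by rewrite normcE_sqn -powR12_sqrt ?sqn_ge0// -powRrM mulrC.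
Qed.

Lemma sqr_Re_le z : Re z ^+ 2 <= sqn z.
Proof. by rewrite lerDl sqr_ge0. Qed.

Lemma normRe_le z : `|Re z| <= normc z.
Proof. by rewrite normcE_sqn -sqrtr_sqr ler_wsqrtr// sqr_Re_le. Qed.

Lemma normIm_le z : `|Im z| <= normc z.
Proof. by rewrite normcE_sqn -sqrtr_sqr ler_wsqrtr// lerDr sqr_ge0. Qed.

Lemma normcJ' z : normc (z^*)%C = normc z.
Proof. by rewrite !normcE_sqn sqnJ. Qed.

Lemma normcR (a : R) : normc (a%:C)%C = `|a|.
Proof. by rewrite normcE_sqn sqnR sqrtr_sqr. Qed.

Lemma normcX z n : normc (z ^+ n) = normc z ^+ n.
Proof. by elim: n => [|n IH]; rewrite ?normc1// !exprS normcM IH. Qed.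

Lemma normc_le1 z : (normc z <= 1) = (sqn z <= 1).
Proof. by rewrite -sqr_normc_sqn expr_le1 ?normc_ge0. Qed.

Lemma normc_sum_le (I : Type) (s : seq I) (P : pred I) (F : I -> C) :
  normc (\sum_(i <- s | P i) F i) <= \sum_(i <- s | P i) normc (F i).
Proof.
elim: s => [|i s IH]; first by rewrite !big_nil normc0.
rewrite !big_cons; case: ifP => // _.
by rewrite (le_trans (le_normcD _ _))// lerD.
Qed.

End ComplexFacts.

Section ComplexMeasurable.
Variable R : realType.
Local Notation C := R[i].
Local Notation Re := complex.Re.
Local Notation Im := complex.Im.

Definition cmeas d (T : measurableType d) (f : T -> C) :=
  measurable_fun setT (fun x => Re (f x)) /\
  measurable_fun setT (fun x => Im (f x)).

Section closure.
Context d (T : measurableType d).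
Implicit Types f g : T -> C.

Lemma cmeas_cst c : cmeas (fun _ : T => c).
Proof. by split. Qed.

Lemma cmeasJ f : cmeas f -> cmeas (fun x => (f x)^*%C).
Proof.
move=> [f1 f2]; split.
  by under eq_fun do rewrite ReJ.
by under eq_fun do rewrite ImJ; exact: measurableT_comp.
Qed.

Lemma cmeasM f g : cmeas f -> cmeas g -> cmeas (fun x => f x * g x).
Proof.
move=> [f1 f2] [g1 g2]; split.
  by under eq_fun do rewrite ReM; apply: measurable_funB; exact: measurable_funM.
by under eq_fun do rewrite ImM; apply: measurable_funD; exact: measurable_funM.
Qed.

Lemma cmeas_comp d' (T' : measurableType d') (h : T' -> T) f :
  measurable_fun setT h -> cmeas f -> cmeas (f \o h).
Proof.
move=> mh [f1 f2]; split; [exact: (measurableT_comp f1)|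
                           exact: (measurableT_comp f2)].
Qed.

End closure.

Lemma cmeas_circle : cmeas (@circle_val R).
Proof.
have m : measurable_fun [set: circle R] (@circle_coord R).
  move=> _ B mB; rewrite setTI; exists B => //; by rewrite setTI.
split.
  exact: (measurableT_comp measurable_fst m).
exact: (measurableT_comp measurable_snd m).
Qed.

Lemma sqn_circle (w : circle R) : sqn (circle_val w) = 1.
Proof. by rewrite -sqr_normc_sqn (eqP (valP w)) expr1n. Qed.

End ComplexMeasurable.

Section TorusExpectation.
Variable R : realType.
Local Notation C := R[i].
Local Notation Re := complex.Re.
Local Notation Im := complex.Im.
Local Notation point := (nat -> C).
Implicit Types (z : point) (g h : point -> R) (ps : seq nat).

Definition set_coord z (r : nat) (c : C) : point :=
  fun s => if s == r then c else z s.

Definition in_disc z := forall r, sqn (z r) <= 1.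

(** Test functions of finitely or infinitely many complex variables: bounded on
the closed unit polydisc and measurable along every measurable family of
points, so that no sigma-algebra on the space of points is needed. *)
Definition nice g := (exists B, forall z, in_disc z -> `|g z| <= B) /\
  forall d (T : measurableType d) (zeta : T -> point),
    (forall r, cmeas (zeta ^~ r)) -> measurable_fun setT (g \o zeta).

Fixpoint tmean ps g z : R :=
  if ps is r :: ps' then
    wint (circle_haar R) (fun=> 1)
      (fun w => tmean ps' g (set_coord z r (circle_val w)))
  else g z.

(** [torus_pt ps z u]: [u] is one of the points over which [tmean ps] averages. *)
Definition torus_pt ps z (u : point) :=
  (forall r, r \in ps -> sqn (u r) = 1) /\ (forall r, r \notin ps -> u r = z r).

Lemma haar_weight : weight (circle_haar R) (fun=> 1).
Proof.
apply: measurable_bounded_integrable => //.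
  by apply: (@le_lt_trans _ _ 1%E); [exact: probability_le1|rewrite ltry].
by exists 1; split => // M M1 x _; rewrite /= normr1 ltW.
Qed.

Lemma haar_weight1 : wint (circle_haar R) (fun=> 1) (fun=> 1) = 1.
Proof.
rewrite /wint (_ : (fun _ => _) = cst 1); last by apply/funext => x; rewrite mulr1.
rewrite Rintegral_cst// mul1r.
by rewrite [X in fine X](_ : _ = 1%E)//; exact: probability_setT.
Qed.

Lemma haar_cst c : wint (circle_haar R) (fun=> 1) (fun=> c) = c.
Proof.
apply: etrans (wint_cst _ haar_weight) _.
by rewrite haar_weight1 mulr1.
Qed.

Lemma cmeas_set_coord d (T : measurableType d) (zeta : T -> point) r (c : T -> C) :
  (forall s, cmeas (zeta ^~ s)) -> cmeas c ->
  forall s, cmeas (fun x => set_coord (zeta x) r (c x) s).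
Proof. by move=> mz mc s; rewrite /set_coord; case: eqP. Qed.

Lemma in_disc_set z r c : in_disc z -> sqn c <= 1 -> in_disc (set_coord z r c).
Proof. by move=> zd c1 s; rewrite /set_coord; case: eqP. Qed.

Lemma in_disc_circle z r (w : circle R) :
  in_disc z -> in_disc (set_coord z r (circle_val w)).
Proof. by move=> zd; apply: in_disc_set => //; rewrite sqn_circle. Qed.

Lemma torus_pt_set z r ps (w : circle R) u :
  torus_pt ps (set_coord z r (circle_val w)) u -> r \notin ps -> torus_pt (r :: ps) z u.
Proof.
move=> [u1 u2] rps; split => s; rewrite inE.
  move=> /orP[/eqP ->|]; last exact: u1.
  by rewrite u2// /set_coord eqxx sqn_circle.
by rewrite negb_or => /andP[sr sps]; rewrite u2// /set_coord (negbTE sr).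
Qed.

Lemma nice_set_coord g z r : nice g -> in_disc z ->
  bounded_on (fun=> 1 : R) (fun w : circle R => g (set_coord z r (circle_val w))).
Proof.
move=> [[B gB] mg] zd; split; last first.
  by exists B => w _; apply/gB/in_disc_circle.
apply: (mg _ _ (fun w => set_coord z r (circle_val w))).
by apply: cmeas_set_coord => [s|]; [exact: cmeas_cst|exact: cmeas_circle].
Qed.

Lemma nice_tmean ps g : nice g -> nice (tmean ps g).
Proof.
move=> ng; elim: ps => [//|r ps [[B IB] Im]] /=; split; last first.
  move=> d T zeta mz.
  apply: (@measurable_wint _ _ T _ _ _ _ (fun x w => tmean ps g
    (set_coord (zeta x) r (circle_val w))) haar_weight).
  apply: (Im _ _ (fun xw => set_coord (zeta xw.1) r (circle_val xw.2))).
  apply: cmeas_set_coord => [s|].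
    by apply: (cmeas_comp _ (mz s)).
  by apply: (cmeas_comp _ (@cmeas_circle R)).
exists B => z zd.
have bg : bounded_on (fun=> 1 : R)
   (fun w : circle R => tmean ps g (set_coord z r (circle_val w))).
  by apply: nice_set_coord => //; split => //; exists B.
have := norm_wint_le haar_weight bg (B := B).
rewrite [X in _ <= B * X](_ : _ = 1); last first.
  by rewrite -[RHS]haar_weight1; congr wint; apply/funext => x /=; rewrite normr1.
by rewrite mulr1; apply => w _; exact/IB/in_disc_circle.
Qed.

Lemma tmean_cat ps qs g z : tmean (ps ++ qs) g z = tmean ps (tmean qs g) z.
Proof.
elim: ps z => //= r ps IH z; apply: eq_wint => w _; exact: IH.
Qed.

Lemma eq_tmean ps g h z : uniq ps ->
  (forall u, torus_pt ps z u -> g u = h u) -> tmean ps g z = tmean ps h z.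
Proof.
elim: ps z => [|r ps IH] z /=; first by move=> _; apply.
move=> /andP[rps ups] gh; apply: eq_wint => w _; apply: IH => // u tu.
exact: (gh _ (torus_pt_set tu rps)).
Qed.

Lemma le_tmean ps g h z : uniq ps -> nice g -> nice h -> in_disc z ->
  (forall u, torus_pt ps z u -> g u <= h u) -> tmean ps g z <= tmean ps h z.
Proof.
move=> + ng nh; elim: ps z => [|r ps IH] z /=; first by move=> _ _; apply.
move=> /andP[rps ups] zd gh; apply: le_wint => //; first exact: haar_weight.
- exact/nice_set_coord/zd/nice_tmean.
- exact/nice_set_coord/zd/nice_tmean.
move=> w _; apply: IH => //; first exact: in_disc_circle.
by move=> u tu; exact: (gh _ (torus_pt_set tu rps)).
Qed.

Lemma tmeanD ps g h z : nice g -> nice h -> in_disc z ->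
  tmean ps (fun u => g u + h u) z = tmean ps g z + tmean ps h z.
Proof.
move=> ng nh; elim: ps z => [//|r ps IH] z zd /=.
rewrite -wintD//; [|exact: haar_weight|exact/nice_set_coord/zd/nice_tmean|
  exact/nice_set_coord/zd/nice_tmean].
by apply: eq_wint => w _; rewrite IH//; exact: in_disc_circle.
Qed.

Lemma tmeanZ ps g c z : nice g -> in_disc z ->
  tmean ps (fun u => c * g u) z = c * tmean ps g z.
Proof.
move=> ng; elim: ps z => [//|r ps IH] z zd /=.
rewrite -wintZ//; [|exact: haar_weight|exact/nice_set_coord/zd/nice_tmean].
by apply: eq_wint => w _; rewrite IH//; exact: in_disc_circle.
Qed.

Lemma tmean_cst ps c z : tmean ps (fun=> c) z = c.
Proof.
elim: ps z => [//|r ps IH] z /=.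
by rewrite -[RHS]haar_cst; apply: eq_wint => w _; rewrite IH.
Qed.

Lemma tmean_const ps g z c : uniq ps ->
  (forall u, torus_pt ps z u -> g u = c) -> tmean ps g z = c.
Proof. by move=> ups gc; rewrite (eq_tmean ups gc) tmean_cst. Qed.

Lemma nice_cst c : nice (fun=> c).
Proof.
by split; [exists (`|c|) | move=> *; exact: measurable_cst].
Qed.

Lemma niceD g h : nice g -> nice h -> nice (fun u => g u + h u).
Proof.
move=> [[B gB] mg] [[B' hB] mh]; split.
  exists (B + B') => z zd; rewrite (le_trans (ler_normD _ _))// lerD//; auto.
by move=> d T zeta mz; apply: measurable_funD; [exact: mg|exact: mh].
Qed.

Lemma niceM g h : nice g -> nice h -> nice (fun u => g u * h u).
Proof.
move=> [[B gB] mg] [[B' hB] mh]; split.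
  exists (B * B') => z zd; rewrite normrM ler_pM//; auto.
by move=> d T zeta mz; apply: measurable_funM; [exact: mg|exact: mh].
Qed.

Lemma niceZ c g : nice g -> nice (fun u => c * g u).
Proof. by move=> ng; apply: niceM => //; exact: nice_cst. Qed.

Lemma niceN g : nice g -> nice (fun u => - g u).
Proof.
move=> ng; rewrite (_ : (fun _ => _) = fun u => -1 * g u); first exact: niceZ.
by apply/funext => u; rewrite mulN1r.
Qed.

Lemma nice_sum (I : Type) (s : seq I) (P : pred I) (g : I -> point -> R) :
  (forall i, P i -> nice (g i)) -> nice (fun u => \sum_(i <- s | P i) g i u).
Proof.
move=> ng; elim: s => [|i s IH].
  by under eq_fun do rewrite big_nil; exact: nice_cst.
under eq_fun do rewrite big_cons.
by case Pi : (P i) => //; apply: niceD => //; exact: ng.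
Qed.

Lemma nice_prod (I : Type) (s : seq I) (P : pred I) (g : I -> point -> R) :
  (forall i, P i -> nice (g i)) -> nice (fun u => \prod_(i <- s | P i) g i u).
Proof.
move=> ng; elim: s => [|i s IH].
  by under eq_fun do rewrite big_nil; exact: nice_cst.
under eq_fun do rewrite big_cons.
by case Pi : (P i) => //; apply: niceM => //; exact: ng.
Qed.

Lemma tmean_sum ps (I : Type) (s : seq I) (P : pred I) (g : I -> point -> R) z :
  (forall i, P i -> nice (g i)) -> in_disc z ->
  tmean ps (fun u => \sum_(i <- s | P i) g i u) z =
  \sum_(i <- s | P i) tmean ps (g i) z.
Proof.
move=> ng zd; elim: s => [|i s IH].
  under eq_fun do rewrite big_nil.
  by rewrite big_nil tmean_cst.
under eq_fun do rewrite big_cons.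
rewrite big_cons; case Pi : (P i) => //.
by rewrite tmeanD ?IH//; [exact: ng|exact: nice_sum].
Qed.

(** Complex-valued test functions. *)
Definition cnice (F : point -> C) := nice (fun z => Re (F z)) /\ nice (fun z => Im (F z)).

Lemma cnice_cst c : cnice (fun=> c).
Proof. by split; exact: nice_cst. Qed.

Lemma cnice_coord r : cnice (fun z => z r).
Proof.
split; split.
- by exists 1 => z /(_ r); rewrite -normc_le1; apply/le_trans/normRe_le.
- by move=> d T zeta /(_ r)[].
- by exists 1 => z /(_ r); rewrite -normc_le1; apply/le_trans/normIm_le.
- by move=> d T zeta /(_ r)[].
Qed.

Lemma cniceD F G : cnice F -> cnice G -> cnice (fun z => F z + G z).
Proof.
move=> [F1 F2] [G1 G2]; split.
  by under eq_fun do rewrite ReD; exact: niceD.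
by under eq_fun do rewrite ImD; exact: niceD.
Qed.

Lemma cniceM F G : cnice F -> cnice G -> cnice (fun z => F z * G z).
Proof.
move=> [F1 F2] [G1 G2]; split.
  under eq_fun do rewrite ReM; apply: niceD; first exact: niceM.
  exact/niceN/niceM.
by under eq_fun do rewrite ImM; apply: niceD; exact: niceM.
Qed.

Lemma cniceJ F : cnice F -> cnice (fun z => (F z)^*%C).
Proof.
move=> [F1 F2]; split; first by under eq_fun do rewrite ReJ.
by under eq_fun do rewrite ImJ; exact: niceN.
Qed.

Lemma cniceX F n : cnice F -> cnice (fun z => F z ^+ n).
Proof.
move=> nF; elim: n => [|n IH]; first exact: cnice_cst.
by under eq_fun do rewrite exprS; exact: cniceM.
Qed.

Lemma cnice_sum (I : Type) (s : seq I) (P : pred I) (F : I -> point -> C) :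
  (forall i, P i -> cnice (F i)) -> cnice (fun u => \sum_(i <- s | P i) F i u).
Proof.
move=> nF; split.
  by under eq_fun do rewrite Re_sum; apply: nice_sum => i /nF[].
by under eq_fun do rewrite Im_sum; apply: nice_sum => i /nF[].
Qed.

Lemma cnice_prod (I : Type) (s : seq I) (P : pred I) (F : I -> point -> C) :
  (forall i, P i -> cnice (F i)) -> cnice (fun u => \prod_(i <- s | P i) F i u).
Proof.
move=> nF; elim: s => [|i s IH].
  by under eq_fun do rewrite big_nil; exact: cnice_cst.
under eq_fun do rewrite big_cons.
by case Pi : (P i) => //; apply: cniceM => //; exact: nF.
Qed.

Lemma nice_Re F : cnice F -> nice (fun z => Re (F z)).
Proof. by case. Qed.

Lemma nice_sqn F : cnice F -> nice (fun z => sqn (F z)).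
Proof.
move=> [F1 F2]; apply: niceD; exact: niceM.
Qed.

Lemma nice_powR g (a : R) : 0 <= a -> (forall z, 0 <= g z) -> nice g ->
  nice (fun z => g z `^ a).
Proof.
move=> a0 g0 [[B gB] mg]; split; last first.
  move=> d T zeta mz; apply: (measurableT_comp (measurable_powR a)).
  exact: mg.
exists (`|B| `^ a) => z zd; rewrite ger0_norm ?powR_ge0//.
rewrite ge0_ler_powR ?nnegrE// -[leLHS]ger0_norm// (le_trans (gB _ zd))//.
exact: ler_norm.
Qed.

Lemma nice_sqn_powR F (a : R) : 0 <= a -> cnice F -> nice (fun z => sqn (F z) `^ a).
Proof. by move=> a0 nF; apply: nice_powR => // [z|]; [exact: sqn_ge0|exact: nice_sqn]. Qed.

End TorusExpectation.

Section CircleOrthogonality.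
Variable R : realType.
Local Notation C := R[i].
Local Notation Re := complex.Re.
Local Notation Im := complex.Im.

Definition cisC (t : R) : C := (cos t +i* sin t)%C.

Lemma cisC_X t n : cisC t ^+ n = cisC (n%:R * t).
Proof.
elim: n => [|n IH]; first by rewrite expr0 mul0r /cisC cos0 sin0.
rewrite exprS IH /cisC -natr1 mulrDl mul1r cosD sinD.
by apply: complex_ext; rewrite ?ReM ?ImM /=; ring.
Qed.

Lemma wint_circle_rotate (v : circle R) (g : circle R -> R) :
  bounded_on (fun=> 1 : R) g ->
  wint (circle_haar R) (fun=> 1) (fun w => g (circle_mul v w)) =
  wint (circle_haar R) (fun=> 1) g.
Proof.
move=> bg; have mv := measurable_circle_mul v.
have ig : (circle_haar R).-integrable setT (EFin \o g).
  have := wint_integrable (haar_weight R) bg; congr (_.-integrable _ _).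
  by apply/funext => x /=; rewrite mul1r.
have igv : (circle_haar R).-integrable setT (EFin \o g \o circle_mul v).
  have bgv : bounded_on (fun=> 1 : R) (g \o circle_mul v).
    have [mg [B gB]] := bg; split; first exact: (measurableT_comp mg mv).
    by exists B => x _; apply: gB; rewrite oner_eq0.
  have := wint_integrable (haar_weight R) bgv; congr (_.-integrable _ _).
  by apply/funext => x /=; rewrite mul1r.
rewrite /wint /Rintegral; congr fine.
under eq_integral do rewrite mul1r.
under [RHS]eq_integral do rewrite mul1r.
have mg : measurable_fun setT (EFin \o g) by case/integrableP : ig.
have := @integral_pushforward _ _ _ _ _ _ mv (circle_haar R) setT (EFin \o g) mg igv measurableT.
rewrite preimage_setT => <-.
apply: eq_measure_integral => A mA _.
exact: circle_haar_invariant.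
Qed.

Lemma nice_circle_monomial (c : C) k l : bounded_on (fun=> 1 : R)
  (fun w : circle R => Re (c * (circle_val w ^+ k * (circle_val w)^*%C ^+ l))).
Proof.
have nF : cnice (fun z : nat -> C => c * (z 0%N ^+ k * (z 0%N)^*%C ^+ l)).
  apply: cniceM; first exact: cnice_cst.
  apply: cniceM; apply: cniceX; first exact: cnice_coord.
  exact/cniceJ/cnice_coord.
have := @nice_set_coord R _ (fun=> 0) 0%N (nice_Re nF); rewrite /set_coord eqxx.
by apply=> r; rewrite sqn0.
Qed.

Lemma wint_circle_monomial (c : C) k l :
  wint (circle_haar R) (fun=> 1)
    (fun w => Re (c * (circle_val w ^+ k * (circle_val w)^*%C ^+ l))) =
  if k == l then Re c else 0.
Proof.
have wJ (w : circle R) : circle_val w * (circle_val w)^*%C = 1.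
  by rewrite mulJc sqn_circle.
case: eqVneq => [->|kl].
  rewrite -[RHS]haar_cst; apply: eq_wint => w _.
  by rewrite -exprMn wJ expr1n mulr1.
pose I c := wint (circle_haar R) (fun=> 1)
    (fun w => Re (c * (circle_val w ^+ k * (circle_val w)^*%C ^+ l))).
have IN e : I (- e) = - I e.
  rewrite -[RHS]mulN1r -(wintZ _ (haar_weight R)); last exact: nice_circle_monomial.
  by apply: eq_wint => w _; rewrite mulNr ReN mulN1r.
suff [v vE] : exists v : circle R, circle_val v ^+ k * (circle_val v)^*%C ^+ l = -1.
  suff : I c = I (- c) by rewrite IN => /eqP; rewrite -subr_eq0 opprK -mulr2n mulrn_eq0 => /eqP.
  rewrite /I -(wint_circle_rotate v); last exact: nice_circle_monomial.
  apply: eq_wint => w _; congr Re.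
  rewrite -[circle_val (circle_mul v w)]/(circle_val v * circle_val w).
  rewrite rmorphM !exprMn mulNr -mulrN; congr (_ * _).
  by rewrite mulrACA vE mulN1r.
wlog kl' : k l kl {I IN} / (l < k)%N.
  move=> H; have [|lk] := ltnP l k; first exact: H.
  have [||v vE] := H l k; first by rewrite eq_sym.
    by rewrite ltn_neqAle kl.
  exists v; have := congr1 conjc vE.
  rewrite rmorphM !rmorphXn /= conjcK mulrC => ->.
  by apply: complex_ext => //=; rewrite ?oppr0.
exists (cis (pi / (k - l)%:R)).
rewrite -[X in _ ^+ X * _](subnK (ltnW kl')) exprD -mulrA -exprMn wJ expr1n mulr1.
rewrite -[circle_val _]/(cisC _) cisC_X mulrC divfK; last first.
  by rewrite pnatr_eq0 subn_eq0 -ltnNge.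
by rewrite /cisC cospi sinpi; apply: complex_ext => //=; rewrite oppr0.
Qed.

Lemma cnice_monomial (ps : seq nat) (k l : nat -> nat) :
  cnice (fun u : nat -> C => \prod_(r <- ps) (u r ^+ k r * (u r)^*%C ^+ l r)).
Proof.
apply: cnice_prod => r _; apply: cniceM; apply: cniceX; first exact: cnice_coord.
exact/cniceJ/cnice_coord.
Qed.

Lemma tmean_monomial ps (c : C) (k l : nat -> nat) z : uniq ps ->
  tmean ps (fun u => Re (c * \prod_(r <- ps) (u r ^+ k r * (u r)^*%C ^+ l r))) z =
  if all (fun r => k r == l r) ps then Re c else 0.
Proof.
elim: ps c z => [|r ps IH] c z /=; first by rewrite big_nil mulr1.
move=> /andP[rps ups].
transitivity (wint (circle_haar R) (fun=> 1) (fun w =>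
    if all (fun r => k r == l r) ps
    then Re (c * (circle_val w ^+ k r * (circle_val w)^*%C ^+ l r)) else 0)).
  apply: eq_wint => w _; rewrite -(IH _ (set_coord z r (circle_val w)))//.
  apply: eq_tmean => // u [_ /(_ r rps)]; rewrite /set_coord eqxx => urw.
  by rewrite big_cons urw mulrA.
case: (all _ ps); last by rewrite andbF wint0.
by rewrite andbT wint_circle_monomial.
Qed.

End CircleOrthogonality.

Section TorusLink.
Variable R : realType.
Local Notation C := R[i].
Local Notation Re := complex.Re.
Local Notation Im := complex.Im.
Local Notation point := (nat -> C).

Fixpoint assign (z : point) (ps : seq nat) (t : seq C) : point :=
  match ps, t with
  | r :: ps', c :: t' => assign (set_coord z r c) ps' t'
  | _, _ => z
  end.

Lemma assign_notin z ps t r : r \notin ps -> assign z ps t r = z r.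
Proof.
elim: ps z t => [|s ps IH] z [|c t]//=; rewrite inE negb_or => /andP[rs rps].
by rewrite IH// /set_coord (negbTE rs).
Qed.

Lemma assign_in z ps t r : uniq ps -> size t = size ps -> r \in ps ->
  assign z ps t r = nth 0 t (index r ps).
Proof.
elim: ps z t => [|s ps IH] z [|c t]//= /andP[sps ups] [st].
rewrite inE eq_sym; case: eqP => [<- _|_ /= rps] /=.
  by rewrite assign_notin// /set_coord eqxx.
by rewrite IH.
Qed.

Lemma measurable_circle_tuple n : forall j : nat,
  cmeas (fun w : n.-tuple (circle R) => nth 0 (map (@circle_val R) w) j).
Proof.
move=> j; have [jn|nj] := ltnP j n; last first.
  rewrite (_ : (fun _ => _) = fun=> 0); first exact: cmeas_cst.
  by apply/funext => w; rewrite nth_default// size_map size_tuple.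
rewrite (_ : (fun _ => _) = fun w => circle_val (tnth w (Ordinal jn))); last first.
  apply/funext => w; rewrite (nth_map (tnth w (Ordinal jn))) ?size_tuple//.
  by congr circle_val; rewrite [RHS](tnth_nth (tnth w (Ordinal jn))).
apply: (cmeas_comp (h := fun w => tnth w (Ordinal jn)) _ (@cmeas_circle R)).
exact: measurable_tnth.
Qed.

Lemma cmeas_assign d (T : measurableType d) (zeta : T -> point) (ps : seq nat)
    (t : T -> seq C) :
  (forall r, cmeas (zeta ^~ r)) -> (forall x, size (t x) = size ps) ->
  (forall j, cmeas (fun x => nth 0 (t x) j)) ->
  forall r, cmeas (fun x => assign (zeta x) ps (t x) r).
Proof.
elim: ps zeta t => [|s ps IH] zeta t mz st mt r /=; first exact: mz.
rewrite (_ : (fun _ => _) = fun x =>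
   assign (set_coord (zeta x) s (nth 0 (t x) 0)) ps (behead (t x)) r); last first.
  by apply/funext => x; move: (st x); case: (t x).
apply: IH.
- by apply: cmeas_set_coord => //; exact: mt.
- by move=> x; rewrite size_behead st.
- by move=> j; have := mt j.+1; congr cmeas; apply/funext => x; rewrite nth_behead.
Qed.

Lemma torus_haar_tmean ps (g : point -> R) z : nice g ->
  (forall u, 0 <= g u) -> in_disc z ->
  (\int[torus_haar R (size ps)]_w
     (g (assign z ps (map_tuple (@circle_val R) w)))%:E)%E = (tmean ps g z)%:E.
Proof.
move=> ng g0; elim: ps z => [|r ps IH] z zd.
  by rewrite /= integral_dirac//= diracT mul1e.
have mz : measurable_fun setT (fun w : (size ps).+1.-tuple (circle R) =>
    (g (assign z (r :: ps) (map_tuple (@circle_val R) w)))%:E).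
  apply/measurable_EFinP; have [_ mg] := ng.
  apply: (mg _ _ (fun w : (size ps).+1.-tuple (circle R) =>
    assign z (r :: ps) (map_tuple (@circle_val R) w))).
  apply: cmeas_assign; first by move=> s; exact: cmeas_cst.
    by move=> w; rewrite size_tuple.
  exact: measurable_circle_tuple.
rewrite [LHS](ge0_integral_pushforward (@measurable_torus_cons R (size ps)))//=; last first.
  by move=> w _; rewrite lee_fin.
rewrite preimage_setT.
rewrite (@fubini_tonelli1 _ _ _ _ _ (circle_haar R) (torus_haar R (size ps))
   (fun xy => (g (assign z (r :: ps) (map_tuple (@circle_val R) (torus_cons xy))))%:E))/=; last 2 first.
- exact: (measurableT_comp mz (@measurable_torus_cons R (size ps))).
- by move=> xy; rewrite lee_fin.
transitivity (\int[circle_haar R]_x (tmean ps g (set_coord z r (circle_val x)))%:E)%E.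
  by apply: eq_integral => x _; rewrite -IH//; exact: in_disc_circle.
have bg : bounded_on (fun=> 1 : R)
   (fun w : circle R => tmean ps g (set_coord z r (circle_val w))).
  by apply: nice_set_coord => //; exact: nice_tmean.
have ig := wint_integrable (haar_weight R) bg.
rewrite /wint /Rintegral fineK; last exact: integrable_fin_num.
by apply: eq_integral => x _; rewrite mul1r.
Qed.

End TorusLink.

Section DeriveTools.
Variable R : realType.
Implicit Types (f g : R -> R) (x : R).

Lemma derC (c : R) x : is_derive x 1 (fun _ : R => c) 0.
Proof. exact: is_derive_cst. Qed.

Lemma derI x : is_derive x 1 (fun s : R => s) 1.
Proof. exact: is_derive_id. Qed.

Lemma derD f g x a b : is_derive x 1 f a -> is_derive x 1 g b ->
  is_derive x 1 (fun s => f s + g s) (a + b).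
Proof. by move=> fa gb; apply: is_deriveD. Qed.

Lemma derN f x a : is_derive x 1 f a -> is_derive x 1 (fun s => - f s) (- a).
Proof. by move=> fa; apply: is_deriveN. Qed.

Lemma derB f g x a b : is_derive x 1 f a -> is_derive x 1 g b ->
  is_derive x 1 (fun s => f s - g s) (a - b).
Proof. by move=> fa gb; apply: is_deriveB. Qed.

Lemma derM f g x a b : is_derive x 1 f a -> is_derive x 1 g b ->
  is_derive x 1 (fun s => f s * g s) (a * g x + f x * b).
Proof.
move=> fa gb; apply: is_derive_eq (is_deriveM fa gb) _.
by rewrite addrC !/GRing.scale/= [g x * a]mulrC.
Qed.

Lemma derZ f x a c : is_derive x 1 f a -> is_derive x 1 (fun s => c * f s) (c * a).
Proof. by move=> fa; apply: is_derive_eq (derM (derC c x) fa) _; rewrite mul0r add0r. Qed.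

Lemma der_comp f g x a b : is_derive (g x) 1 f a -> is_derive x 1 g b ->
  is_derive x 1 (fun s => f (g s)) (a * b).
Proof. move=> fa gb; apply: is_derive_eq (is_derive1_comp fa gb) _; exact: erefl. Qed.

Lemma der_eq f x a b : is_derive x 1 f a -> a = b -> is_derive x 1 f b.
Proof. by move=> + <-. Qed.

Lemma derX x n : is_derive x 1 (fun s : R => s ^+ n.+1) (n.+1%:R * x ^+ n).
Proof.
elim: n => [|n IH].
  by rewrite expr0 mulr1; under eq_fun do rewrite expr1; exact: derI.
rewrite (_ : (fun _ => _) = fun s : R => s * s ^+ n.+1); last first.
  by apply/funext => s; rewrite -exprS.
apply: der_eq (derM (derI x) IH) _.
by rewrite mul1r mulrCA -exprS -[n.+2]addn1 natrD mulrDl mul1r addrC.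
Qed.

Lemma der_sum (I : Type) (s : seq I) (F : I -> R -> R) (dF : I -> R) x :
  (forall i, is_derive x 1 (F i) (dF i)) ->
  is_derive x 1 (fun t => \sum_(i <- s) F i t) (\sum_(i <- s) dF i).
Proof.
move=> dFi; elim: s => [|i s IH].
  by rewrite big_nil; under eq_fun do rewrite big_nil; exact: derC.
by rewrite big_cons; under eq_fun do rewrite big_cons; exact: derD.
Qed.

Lemma der_continuous f x a : is_derive x 1 f a -> {for x, continuous f}.
Proof.
by case=> df _; apply: differentiable_continuous; apply/derivable1_diffP.
Qed.

(** Mean value inequality on [0, 1]. *)
Lemma mean_value01 f df (B : R) :
  (forall x, 0 <= x <= 1 -> is_derive x 1 f (df x)) ->
  (forall x, 0 <= x <= 1 -> `|df x| <= B) -> `|f 1 - f 0| <= B.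
Proof.
move=> fdf dB; have [||c] := MVT ltr01 (f := f) (df := df).
- by move=> x; rewrite in_itv/= => /andP[/ltW x0 /ltW x1]; apply: fdf; rewrite x0.
- apply: continuous_in_subspaceT => x; rewrite inE/= in_itv/= => x01.
  exact: der_continuous (fdf _ x01).
rewrite in_itv/= => /andP[/ltW c0 /ltW c1] ->.
by rewrite subr0 mulr1 dB// c0.
Qed.

End DeriveTools.

Section Szego.
Variable R : realType.
Local Notation C := R[i].
Local Notation Re := complex.Re.
Local Notation Im := complex.Im.
Implicit Types (z w x : C).

Lemma ReRl (a : R) z : Re ((a%:C)%C * z) = a * Re z.
Proof. by rewrite ReM /= mul0r subr0. Qed.

Lemma ImRl (a : R) z : Im ((a%:C)%C * z) = a * Im z.
Proof. by rewrite ImM /= mul0r addr0. Qed.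

Lemma realCX (a : R) n : (a%:C)%C ^+ n = ((a ^+ n)%:C)%C :> C.
Proof. by rewrite rmorphXn. Qed.

Lemma normc_geB z : 1 - normc z <= normc (1 - z).
Proof.
rewrite lerBlDr; have := le_normcD (1 - z) z.
by rewrite subrK normc1.
Qed.

(** Taylor polynomials of [ln |1 - z|], via the mean value theorem along the
segment from [0] to [z]. *)
Lemma ln_sqn_taylor z m : normc z < 1 ->
  `|2^-1 * ln (sqn (1 - z)) + \sum_(0 <= l < m) (l.+1%:R)^-1 * Re (z ^+ l.+1)| <=
  normc z ^+ m.+1 / (1 - normc z).
Proof.
move=> z1; set a := Re z; set b := Im z.
pose D (s : R) := sqn (1 - (s%:C)%C * z).
have DE s : D s = (1 - s * a) ^+ 2 + (s * b) ^+ 2.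
  by rewrite /D /sqn ReD ImD ReN ImN ReM ImM /= -/a -/b; ring.
have nD (s : R) : 0 <= s <= 1 -> 1 - normc z <= normc (1 - (s%:C)%C * z).
  move=> /andP[s0 s1]; apply: le_trans (normc_geB _); rewrite lerD2l lerN2.
  by rewrite normcM normcR ger0_norm// ler_piMl// normc_ge0.
have D0 (s : R) : 0 <= s <= 1 -> 0 < D s.
  move=> s01; rewrite /D -sqr_normc_sqn exprn_gt0//.
  by rewrite (lt_le_trans _ (nD _ s01))// subr_gt0.
pose h (s : R) := 2^-1 * ln ((1 - s * a) ^+ 2 + (s * b) ^+ 2) +
  \sum_(l <- index_iota 0 m) (l.+1%:R)^-1 * Re (z ^+ l.+1) * s ^+ l.+1.
pose dh (s : R) := - (s ^+ m * Re (z ^+ m.+1 * ((1 - (s%:C)%C * z)^*)%C) / D s).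
have hd (s : R) : 0 <= s <= 1 -> is_derive s 1 h (dh s).
  move=> s01; have Ds := D0 _ s01.
  have der1 : is_derive s 1 (fun s => (1 - s * a) ^+ 2 + (s * b) ^+ 2)
     (- 2 * a * (1 - s * a) + 2 * b * (s * b)).
    have e1 : is_derive s 1 (fun s => 1 - s * a) (- a).
      apply: der_eq (derB (derC 1 s) (derM (derI s) (derC a s))) _; ring.
    have e2 : is_derive s 1 (fun s => s * b) b.
      apply: der_eq (derM (derI s) (derC b s)) _; ring.
    apply: der_eq (derD (derM e1 e1) (derM e2 e2)) _; ring.
  have der2 : is_derive ((1 - s * a) ^+ 2 + (s * b) ^+ 2) 1 (@ln R) (D s)^-1.
    by rewrite -DE; apply: is_derive1_ln.
  have der3 l : is_derive s 1 (fun s => (l.+1%:R)^-1 * Re (z ^+ l.+1) * s ^+ l.+1)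
     (s ^+ l * Re (z ^+ l.+1)).
    apply: der_eq (derZ _ (derX s l)) _.
    rewrite [_^-1 * _]mulrC -mulrA [_ * (_ * s ^+ l)]mulrA mulVf ?pnatr_eq0//.
    by rewrite mul1r mulrC.
  have der4 := der_sum (index_iota 0 m) der3.
  have der5 := derZ (2^-1) (der_comp (g := fun s : R =>
    (1 - s * a) ^+ 2 + (s * b) ^+ 2) der2 der1).
  apply: der_eq (derD der5 der4) _.
  rewrite /dh.
  have -> : \sum_(i <- index_iota 0 m) s ^+ i * Re (z ^+ i.+1) =
     Re ((z - (s%:C)%C ^+ m * z ^+ m.+1) * ((1 - (s%:C)%C * z)^*)%C) / D s.
    apply: (mulIf (lt0r_neq0 Ds)); rewrite divfK ?(lt0r_neq0 Ds)//.
    rewrite mulr_suml.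
    transitivity (Re ((\sum_(i <- index_iota 0 m) (s%:C)%C ^+ i * z ^+ i.+1) *
        ((1 - (s%:C)%C * z) * ((1 - (s%:C)%C * z)^*)%C))).
      rewrite mulJc -/(D s) mulr_suml Re_sum; apply: eq_bigr => i _.
      by rewrite realCX -[in RHS]mulrA ReRl [z ^+ _ * _]mulrC ReRl; ring.
    congr Re; rewrite mulrA; congr (_ * _).
    rewrite mulr_suml.
    rewrite (eq_bigr (fun i => - ((s%:C)%C ^+ i.+1 * z ^+ i.+2 -
       (s%:C)%C ^+ i * z ^+ i.+1))); last by move=> i _; rewrite !exprS; ring.
    rewrite sumrN telescope_sumr// expr0 mul1r expr1; ring.
  have -> : Re ((z - (s%:C)%C ^+ m * z ^+ m.+1) * ((1 - (s%:C)%C * z)^*)%C) =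
    (a * (1 - s * a) - s * b ^+ 2) - s ^+ m * Re (z ^+ m.+1 * ((1 - (s%:C)%C * z)^*)%C).
    rewrite mulrBl ReD ReN -mulrA realCX ReRl; congr (_ - _).
    by rewrite ReM ReJ ImJ ReD ImD ReN ImN ReM ImM /= -/a -/b; ring.
  by have := lt0r_neq0 Ds; move=> ?; field.
have h0 : h 0 = 0.
  rewrite /h big1 ?addr0; last by move=> i _; rewrite expr0n mulr0.
  by rewrite !mul0r subr0 expr1n expr0n addr0 ln1 mulr0.
have h1 : h 1 = 2^-1 * ln (sqn (1 - z)) +
    \sum_(0 <= l < m) (l.+1%:R)^-1 * Re (z ^+ l.+1).
  rewrite /h; congr (_ * ln _ + _).
    by rewrite -DE /D rmorph1 mul1r.
  by apply: eq_bigr => i _; rewrite expr1n mulr1.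
have := mean_value01 hd (B := normc z ^+ m.+1 / (1 - normc z)).
rewrite h0 h1 subr0.
apply => s s01; have Ds := D0 _ s01; have nDs := nD _ s01.
have nz : 0 < 1 - normc z by rewrite subr_gt0.
have nDs0 := lt_le_trans nz nDs.
rewrite /dh normrN !normrM normfV (gtr0_norm Ds).
move: s01 => /andP[s0 s1].
rewrite ger0_norm ?exprn_ge0// /D -sqr_normc_sqn.
have := normRe_le (z ^+ m.+1 * ((1 - (s%:C)%C * z)^*)%C).
rewrite normcM normcJ' normcX => rl.
rewrite ler_pdivrMr ?exprn_gt0//.
apply: (@le_trans _ _ (normc z ^+ m.+1 * normc (1 - (s%:C)%C * z))).
  apply: le_trans rl; rewrite ler_piMl//; exact: exprn_ile1.
rewrite -mulrA ler_wpM2l ?exprn_ge0 ?normc_ge0// ler_pdivlMl//.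
by rewrite expr2 ler_wpM2r ?normc_ge0.
Qed.

End Szego.

Section RealFacts.
Variable R : realType.
Implicit Types (a b x : R).

Lemma le_sqr_nneg a b : 0 <= b -> a ^+ 2 <= b ^+ 2 -> a <= b.
Proof.
move=> b0 ab; rewrite leNgt; apply/negP => ba.
suff : b ^+ 2 < a ^+ 2 by rewrite ltNge ab.
by rewrite !expr2; nra.
Qed.

Lemma expR_sub_sqr_le x : - 2^-1 <= x -> expR (x - 2 * x ^+ 2) <= 1 + x.
Proof.
move=> x2; have x1 : 0 < 1 + x by lra.
apply: (@le_trans _ _ (expR (x / (1 + x)))).
  rewrite ler_expR ler_pdivlMr//.
  have := sqr_ge0 x; nra.
rewrite -[leLHS]invrK -expRN invf_ple ?posrE ?expR_gt0//.
apply: le_trans (expR_ge1Dx _); rewrite le_eqVlt; apply/orP; left; apply/eqP.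
by field; rewrite lt0r_neq0.
Qed.

Lemma geometric_small (t e : R) : 0 <= t < 1 -> 0 < e ->
  exists M, forall m, (M <= m)%N -> t ^+ m <= e.
Proof.
move=> /andP[t0 t1] e0.
have : (t ^+ n @[n --> \oo] --> 0)%classic by apply: cvg_expr; rewrite ger0_norm.
move=> /cvgrPdist_le /(_ _ e0)[M _ HM]; exists M => m Mm.
have := HM m Mm; rewrite sub0r normrN ger0_norm//; exact: exprn_ge0.
Qed.

End RealFacts.

Section SzegoPointwise.
Variable R : realType.
Local Notation C := R[i].
Local Notation Re := complex.Re.
Local Notation Im := complex.Im.
Implicit Types (z x b c : C) (bs : seq C) (D E A B : {poly C}).

Lemma cauchy_schwarz_C (I : Type) (s : seq I) (P : pred I) (f g : I -> C) :
  sqn (\sum_(i <- s | P i) f i * g i) <=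
  (\sum_(i <- s | P i) sqn (f i)) * (\sum_(i <- s | P i) sqn (g i)).
Proof.
elim: s => [|i s IH]; first by rewrite !big_nil sqn0 mul0r.
rewrite !big_cons; case: (P i) => //.
set S := \sum_(j <- s | P j) f j * g j in IH *.
set F := \sum_(j <- s | P j) sqn (f j) in IH *.
set G := \sum_(j <- s | P j) sqn (g j) in IH *.
have F0 : 0 <= F by apply: sumr_ge0 => j _; exact: sqn_ge0.
have G0 : 0 <= G by apply: sumr_ge0 => j _; exact: sqn_ge0.
rewrite sqnD sqnM; set p := sqn (f i); set q := sqn (g i).
have p0 : 0 <= p := sqn_ge0 _; have q0 : 0 <= q := sqn_ge0 _.
set T := Re _.
suff : 2 * T <= p * G + F * q by move=> ?; nra.
have T2 : T ^+ 2 <= p * q * (F * G).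
  apply: le_trans (sqr_Re_le _) _; rewrite !sqnM sqnJ sqnM -/p -/q.
  by rewrite ler_wpM2l// mulr_ge0.
have h0 : 0 <= p * G + F * q by rewrite addr_ge0// mulr_ge0.
apply: le_sqr_nneg => //.
have := sqr_ge0 (p * G - F * q).
rewrite !expr2 in T2 *; nra.
Qed.

Lemma sqn_horner_coef D x :
  sqn D.[x] <= (\sum_(k < size D) sqn D`_k) * (\sum_(k < size D) sqn x ^+ k).
Proof.
rewrite horner_coef; apply: le_trans (cauchy_schwarz_C _ _ _ _) _.
by rewrite ler_wpM2l ?sumr_ge0// => [*|]; rewrite ?sqn_ge0//;
   apply: ler_sum => k _; rewrite sqnX.
Qed.

Lemma cnice_horner D r : cnice (fun u : nat -> C => D.[u r]).
Proof.
under eq_fun do rewrite horner_coef.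
apply: cnice_sum => i _; apply: cniceM; first exact: cnice_cst.
exact/cniceX/cnice_coord.
Qed.

Lemma wint_sqn_horner D :
  wint (circle_haar R) (fun=> 1) (fun w => sqn D.[circle_val w]) =
  \sum_(k < size D) sqn D`_k.
Proof.
transitivity (wint (circle_haar R) (fun=> 1) (fun w =>
   \sum_(k < size D) \sum_(l < size D) Re (D`_k * (D`_l)^*%C *
      (circle_val w ^+ k * (circle_val w)^*%C ^+ l)))).
  apply: eq_wint => w _.
  rewrite -[sqn _]/(Re ((sqn D.[circle_val w])%:C)%C) -mulJc.
  rewrite horner_coef rmorph_sum mulr_suml Re_sum; apply: eq_bigr => k _.
  rewrite mulr_sumr Re_sum; apply: eq_bigr => l _; congr Re.
  by rewrite rmorphM rmorphXn /=; ring.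
rewrite wint_sum; [|exact: haar_weight|]; last first.
  by move=> k _; apply: bounded_on_sum => l _; exact: nice_circle_monomial.
apply: eq_bigr => k _; rewrite wint_sum; [|exact: haar_weight|]; last first.
  by move=> l _; exact: nice_circle_monomial.
under eq_bigr do rewrite wint_circle_monomial.
rewrite (bigD1 k)//= eqxx big1 ?addr0; first by rewrite mulJc.
by move=> l lk; rewrite eq_sym; case: ifP => // /eqP /val_inj kl; rewrite kl eqxx in lk.
Qed.

Lemma poly_L2_pointwise D x : sqn x < 1 ->
  (1 - sqn x) * sqn D.[x] <=
  wint (circle_haar R) (fun=> 1) (fun w => sqn D.[circle_val w]).
Proof.
move=> x1; rewrite wint_sqn_horner.
apply: (@le_trans _ _ ((1 - sqn x) * ((\sum_(k < size D) sqn D`_k) *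
   (\sum_(k < size D) sqn x ^+ k)))).
  by rewrite ler_wpM2l ?sqn_horner_coef// subr_ge0 ltW.
rewrite mulrCA ler_piMr ?sumr_ge0// => [*|]; first exact: sqn_ge0.
by rewrite -opprB mulNr -subrX1 opprB lerBlDr lerDl exprn_ge0// sqn_ge0.
Qed.

End SzegoPointwise.

Section ZeroFreePowers.
Variable R : realType.
Local Notation C := R[i].
Local Notation Re := complex.Re.
Local Notation Im := complex.Im.
Implicit Types (z x b c : C) (bs : seq C) (D E A B : {poly C}).

Lemma poly_bounded D : exists2 K, 0 <= K & forall z, normc z <= 1 -> normc D.[z] <= K.
Proof.
exists (\sum_(i < size D) normc D`_i).
  by apply: sumr_ge0 => i _; exact: normc_ge0.
move=> z z1; rewrite horner_coef (le_trans (normc_sum_le _ _ _))//.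
apply: ler_sum => i _; rewrite normcM normcX ler_piMr ?normc_ge0//.
by rewrite exprn_ile1// normc_ge0.
Qed.

(** The exponential of a polynomial is a limit, uniform on the disc, of
polynomials [(1 + L/n)^n]. *)
Lemma exp_poly_approx (L : {poly C}) (e : R) : 0 < e ->
  exists E, forall z, normc z <= 1 ->
    expR (2 * Re L.[z] - e) <= sqn E.[z] <= expR (2 * Re L.[z] + e).
Proof.
move=> e0; have [K K0 LK] := poly_bounded L.
pose B := 2 * K + K ^+ 2.
have B0 : 0 <= B by rewrite /B; nra.
pose n := (Num.truncn (2 * B + (2 * B ^+ 2 + K ^+ 2) / e)).+1.
have n0 : 0 < n%:R :> R by rewrite ltr0n.
have nB : 2 * B + (2 * B ^+ 2 + K ^+ 2) / e < n%:R by exact: truncnS_gt.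
have d0 : 0 <= (2 * B ^+ 2 + K ^+ 2) / e.
  by rewrite divr_ge0 ?(ltW e0)// addr_ge0 ?mulr_ge0 ?sqr_ge0.
have nB1 : 2 * B <= n%:R by lra.
have nB2 : 2 * B ^+ 2 + K ^+ 2 <= e * n%:R.
  by rewrite -ler_pdivrMl// [_^-1 * _]mulrC; lra.
exists ((1 + ((n%:R^-1)%:C)%C%:P * L) ^+ n) => z z1.
rewrite horner_exp hornerD hornerM !hornerC sqnX.
set l := L.[z]; have lK : normc l <= K := LK _ z1.
have l2 : sqn l <= K ^+ 2.
  by rewrite -sqr_normc_sqn; have := normc_ge0 l; rewrite !expr2; nra.
have rl : `|Re l| <= K := le_trans (normRe_le _) lK.
pose y := 2 * Re l + sqn l / n%:R.
have sE : sqn (1 + ((n%:R^-1)%:C)%C * l) = 1 + y / n%:R.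
  rewrite sqnD sqn1 sqnM sqnR conjc1 mul1r ReRl /y.
  by field; rewrite lt0r_neq0.
rewrite sE.
have sl0 := sqn_ge0 l.
have sln : 0 <= sqn l / n%:R by rewrite divr_ge0// ltW.
have n1 : 1 <= n%:R :> R by rewrite ler1n.
have yB : `|y| <= B.
  rewrite (le_trans (ler_normD _ _))// lerD//.
    by rewrite normrM ger0_norm// ler_wpM2l.
  by rewrite ger0_norm// ler_pdivrMr//; nra.
have y2 : y ^+ 2 <= B ^+ 2.
  by rewrite -(ger0_norm (sqr_ge0 y)) normrX; have := normr_ge0 y; rewrite !expr2; nra.
have pos : 0 <= 1 + y / n%:R.
  by rewrite -sE sqn_ge0.
have yn : - 2^-1 <= y / n%:R.
  rewrite ler_pdivlMr//; have := ler_norm (- y); rewrite normrN; nra.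
apply/andP; split.
  apply: (@le_trans _ _ (expR (y / n%:R - 2 * (y / n%:R) ^+ 2) ^+ n)).
    rewrite -expRM_natl ler_expR.
    have -> : n%:R * (y / n%:R - 2 * (y / n%:R) ^+ 2) = y - 2 * y ^+ 2 / n%:R.
      by field; rewrite lt0r_neq0.
    have : 2 * y ^+ 2 / n%:R <= e.
      rewrite ler_pdivrMr//; have := sqr_ge0 K; nra.
    by rewrite /y; lra.
  rewrite lerXn2r// ?nnegrE ?expR_ge0//; exact: expR_sub_sqr_le.
apply: (@le_trans _ _ (expR (y / n%:R) ^+ n)).
  by rewrite lerXn2r// ?nnegrE ?expR_ge0//; exact: expR_ge1Dx.
rewrite -expRM_natl ler_expR mulrC divfK ?lt0r_neq0// /y lerD2l.
rewrite ler_pdivrMr//; have := sqr_ge0 B; nra.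
Qed.

Lemma log_tail_small bs (e : R) : (forall b, b \in bs -> normc b < 1) -> 0 < e ->
  exists M, forall m, (M <= m)%N ->
    \sum_(b <- bs) normc b ^+ m.+1 / (1 - normc b) <= e.
Proof.
elim: bs e => [|b bs IH] e bs1 e0.
  by exists 0%N => m _; rewrite big_nil ltW.
have e2 : 0 < e / 2 by rewrite divr_gt0.
have bs1' c : c \in bs -> normc c < 1.
  by move=> cbs; apply: bs1; rewrite inE cbs orbT.
have [M HM] := IH _ bs1' e2.
have b1 : normc b < 1 by apply: bs1; rewrite inE eqxx.
have b10 : 0 < 1 - normc b by rewrite subr_gt0.
have b01 : 0 <= normc b < 1 by rewrite normc_ge0.
have [M' HM'] := geometric_small b01 (mulr_gt0 e2 b10).
exists (maxn M M') => m; rewrite geq_max => /andP[Mm M'm].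
rewrite big_cons (splitr e) lerD ?HM// ler_pdivrMr// HM'//.
exact: leqW.
Qed.

(** Real powers of zero-free polynomials are, up to a factor close to 1, squared
moduli of polynomials: exponentiate a truncated logarithm. *)
Lemma zero_free_approx bs (a e : R) : 0 <= a ->
  (forall b, b \in bs -> normc b < 1) -> 0 < e ->
  exists E, forall z, normc z <= 1 ->
    expR (- e) * \prod_(b <- bs) sqn (1 - b * z) `^ a <= sqn E.[z] <=
    expR e * \prod_(b <- bs) sqn (1 - b * z) `^ a.
Proof.
move=> a0 bs1 e0.
have e4 : 0 < e / (4 * (a + 1)) by rewrite divr_gt0// mulr_gt0// ltr_wpDl.
have [M HM] := log_tail_small bs1 e4.
pose L : {poly C} := \sum_(b <- bs) \sum_(0 <= l < M)
   ((((- a) / l.+1%:R)%:C)%C * b ^+ l.+1) *: 'X^(l.+1).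
have LE z : Re L.[z] = - a * \sum_(b <- bs) \sum_(0 <= l < M)
      (l.+1%:R)^-1 * Re ((b * z) ^+ l.+1).
  rewrite /L horner_sum Re_sum mulr_sumr; apply: eq_bigr => b _.
  rewrite horner_sum Re_sum mulr_sumr; apply: eq_bigr => l _.
  by rewrite hornerZ hornerXn -mulrA -exprMn ReRl mulrA.
have e2 : 0 < e / 2 by rewrite divr_gt0.
have [E HE] := exp_poly_approx L e2.
exists E => z z1.
have bz b : b \in bs -> normc (b * z) <= normc b.
  by move=> _; rewrite normcM ler_piMr// normc_ge0.
have bz1 b : b \in bs -> normc (b * z) < 1.
  by move=> bbs; apply: le_lt_trans (bz _ bbs) (bs1 _ bbs).
have -> : \prod_(b <- bs) sqn (1 - b * z) `^ a =
    expR (a * \sum_(b <- bs) ln (sqn (1 - b * z))).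
  rewrite mulr_sumr expR_sum; apply: eq_big_seq => b bbs.
  rewrite /powR gt_eqF//.
  rewrite -sqr_normc_sqn exprn_gt0//; apply: lt_le_trans (normc_geB _).
  by rewrite subr_gt0 bz1.
rewrite -!expRD.
set S := a * _.
have LS : `|2 * Re L.[z] - S| <= e / 2.
  rewrite LE /S.
  apply: (@le_trans _ _ (2 * a * \sum_(b <- bs) normc b ^+ M.+1 / (1 - normc b))).
    rewrite (_ : _ - _ = - (2 * a * \sum_(b <- bs) (2^-1 * ln (sqn (1 - b * z)) +
       \sum_(0 <= l < M) (l.+1%:R)^-1 * Re ((b * z) ^+ l.+1)))); last first.
      by rewrite big_split/= -mulr_sumr; field.
    rewrite normrN normrM ger0_norm ?mulr_ge0// ler_wpM2l ?mulr_ge0//.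
    apply: le_trans (ler_norm_sum _ _ _) _.
    rewrite big_seq [leRHS]big_seq; apply: ler_sum => b bbs.
    apply: le_trans (ln_sqn_taylor _ (bz1 _ bbs)) _.
    have h1 : 0 < 1 - normc b by rewrite subr_gt0 bs1.
    have h2 : 0 < 1 - normc (b * z) by rewrite subr_gt0 bz1.
    apply: ler_pM; rewrite ?exprn_ge0 ?normc_ge0 ?invr_ge0 ?(ltW h2)//.
      by rewrite lerXn2r// ?nnegrE ?normc_ge0// bz.
    by rewrite lef_pV2 ?posrE// lerD2l lerN2 bz.
  have a1 : 0 < 4 * (a + 1) by rewrite mulr_gt0// ltr_wpDl.
  apply: (@le_trans _ _ (2 * a * (e / (4 * (a + 1))))).
    by rewrite ler_wpM2l ?mulr_ge0// HM.
  rewrite mulrA ler_pdivrMr//; nra.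
have /andP[H1 H2] := HE _ z1.
move: LS; rewrite ler_norml => /andP[L1 L2].
apply/andP; split.
  by apply: le_trans H1; rewrite ler_expR; lra.
by apply: le_trans H2 _; rewrite ler_expR; lra.
Qed.

End ZeroFreePowers.

Section PowerModulus.
Variable R : realType.
Implicit Types (a x y s t e : R).

Lemma powR_subadditive a x y : 0 <= a <= 1 -> 0 <= x -> 0 <= y ->
  (x + y) `^ a <= x `^ a + y `^ a.
Proof.
move=> /andP[a0 a1] x0 y0; have [z0|] := ltP 0 (x + y); last first.
  move=> xy; have [-> ->] : x = 0 /\ y = 0 by split; lra.
  by rewrite addr0 lerDl powR_ge0.
have key u : 0 <= u <= x + y -> u / (x + y) * (x + y) `^ a <= u `^ a.
  move=> /andP[u0 uz]; have [->|un0] := eqVneq u 0.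
    by rewrite !mul0r powR_ge0.
  have u_gt0 : 0 < u by rewrite lt_neqAle eq_sym un0.
  have uE : u = u / (x + y) * (x + y) by rewrite divfK// lt0r_neq0.
  rewrite [X in _ <= X `^ _]uE powRM ?divr_ge0 ?(ltW z0)//.
  rewrite ler_wpM2r ?powR_ge0// ger1_powR// divr_gt0//=.
  by rewrite ler_pdivrMr// mul1r.
have := key x; have := key y; rewrite !x0 !y0 lerDl lerDr y0 x0 /=.
move=> /(_ isT) ky /(_ isT) kx; apply: le_trans (lerD kx ky).
by rewrite -mulrDl -mulrDl divff ?mul1r// lt0r_neq0.
Qed.

Lemma powR_modulus a K e : 0 <= a -> 0 <= K -> 0 < e ->
  exists2 h, 0 < h & forall s t, 0 <= s <= K -> 0 <= t <= s + h -> t `^ a <= s `^ a + e.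
Proof.
move=> a0 K0 e0.
pose n := (Num.truncn a).+1.
have n0 : 0 < n%:R :> R by rewrite ltr0n.
have an : a / n%:R <= 1 by rewrite ler_pdivrMr// mul1r ltW// truncnS_gt.
pose c := a / n%:R; have c0 : 0 <= c by rewrite divr_ge0// ltW.
have [c00|cn0] := eqVneq c 0.
  exists 1 => // s t _ _; have -> : a = 0.
    by apply/eqP; move: c00 => /eqP; rewrite mulf_eq0 invr_eq0 (gt_eqF n0) orbF.
  by rewrite !powRr0 lerDl ltW.
have c1 : 0 < c by rewrite lt_neqAle eq_sym cn0.
pose M := K `^ c; have M0 : 0 <= M by exact: powR_ge0.
pose d := e / (n%:R * (M + 1) ^+ n.-1).
have M1 : 0 < (M + 1) ^+ n.-1 by rewrite exprn_gt0// ltr_wpDl.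
have d0 : 0 < d by rewrite divr_gt0// mulr_gt0.
pose d' := Num.min d 1; have d'0 : 0 < d' by rewrite lt_min d0/=.
exists (d' `^ c^-1); first exact: powR_gt0.
move=> s t /andP[s0 sK] /andP[t0 ts].
have aE u : 0 <= u -> u `^ a = (u `^ c) ^+ n.
  by move=> u0; rewrite -powR_mulrn ?powR_ge0// -powRrM /c divfK// lt0r_neq0.
rewrite !aE//.
have tc : t `^ c <= s `^ c + d'.
  apply: (@le_trans _ _ ((s + d' `^ c^-1) `^ c)).
    by apply: ge0_ler_powR; rewrite ?nnegrE// addr_ge0// powR_ge0.
  apply: le_trans (powR_subadditive _ _ _) _; rewrite ?powR_ge0 ?c0//.
  by rewrite lerD2l -powRrM mulVf// powRr1// ltW.
have sM : s `^ c <= M by apply: ge0_ler_powR; rewrite ?nnegrE.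
have sc0 : 0 <= s `^ c := powR_ge0 _ _.
apply: (@le_trans _ _ ((s `^ c + d') ^+ n)).
  by rewrite lerXn2r// ?nnegrE ?powR_ge0// addr_ge0// ltW.
rewrite -lerBlDl subrXX addrC addKr.
apply: (@le_trans _ _ (d * (n%:R * (M + 1) ^+ n.-1))); last first.
  by rewrite /d divfK// mulf_neq0 ?lt0r_neq0.
have d'1 : d' <= 1 by rewrite ge_min lexx orbT.
apply: ler_pM; rewrite ?(ltW d'0)//.
- apply: sumr_ge0 => i _; rewrite mulr_ge0// exprn_ge0//.
  by rewrite addr_ge0// ltW.
- by rewrite ge_min lexx.
apply: (@le_trans _ _ (\sum_(i < n) (M + 1) ^+ n.-1)); last first.
  by rewrite sumr_const card_ord mulr_natl.
apply: ler_sum => i _.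
have -> : (M + 1) ^+ n.-1 = (M + 1) ^+ (n.-1 - i) * (M + 1) ^+ i.
  by rewrite -exprD subnK// -ltnS; case: i.
apply: ler_pM; rewrite ?exprn_ge0//.
- by rewrite addr_ge0// ltW.
- rewrite lerXn2r ?nnegrE// ?addr_ge0 ?(ltW d'0)//; lra.
- by rewrite lerXn2r ?nnegrE// ?addr_ge0//; lra.
Qed.

Lemma prod_powR_modulus (I : eqType) (bs : seq I) a K e : 0 <= a -> 0 <= K -> 0 < e ->
  exists2 h, 0 < h & forall s t : I -> R,
    (forall b, b \in bs -> 0 <= s b <= K) ->
    (forall b, b \in bs -> 0 <= t b <= s b + h) ->
    \prod_(b <- bs) t b `^ a <= \prod_(b <- bs) s b `^ a + e.
Proof.
move=> a0 K0; elim: bs e => [|b bs IH] e e0.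
  by exists 1 => // s t _ _; rewrite !big_nil lerDl ltW.
pose M := K `^ a + (K `^ a) ^+ size bs + 1.
have Ka : 0 <= K `^ a := powR_ge0 _ _.
have Ks : 0 <= (K `^ a) ^+ size bs := exprn_ge0 _ Ka.
have M1 : 1 <= M by rewrite /M; lra.
have M0 : 0 < M := lt_le_trans ltr01 M1.
pose d := Num.min 1 (e / (3 * M)).
have d0 : 0 < d by rewrite lt_min ltr01 divr_gt0// mulr_gt0.
have d1 : d <= 1 by rewrite ge_min lexx.
have dM : d * M <= e / 3.
  rewrite -ler_pdivlMr// -mulrA -invfM; by rewrite ge_min lexx orbT.
have [h1 h10 H1] := IH _ d0; have [h2 h20 H2] := powR_modulus a0 K0 d0.
exists (Num.min h1 h2); first by rewrite lt_min h10.
move=> s t sK th; rewrite !big_cons.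
have bb : b \in b :: bs by rewrite inE eqxx.
have sub c : c \in bs -> c \in b :: bs by rewrite inE => ->; rewrite orbT.
have tb : t b `^ a <= s b `^ a + d.
  apply: H2; first exact: sK.
  have /andP[-> /le_trans->//] := th _ bb.
  by rewrite lerD2l ge_min lexx orbT.
have tbs : \prod_(c <- bs) t c `^ a <= \prod_(c <- bs) s c `^ a + d.
  apply: H1 => c cbs; first exact/sK/sub.
  have /andP[-> /le_trans->//] := th _ (sub _ cbs).
  by rewrite lerD2l ge_min lexx.
have tb0 : 0 <= t b `^ a := powR_ge0 _ _.
have sb0 : 0 <= s b `^ a := powR_ge0 _ _.
have sbK : s b `^ a <= K `^ a.
  by have /andP[? ?] := sK _ bb; apply: ge0_ler_powR; rewrite ?nnegrE.
have P0 (u : I -> R) : 0 <= \prod_(c <- bs) u c `^ a.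
  by apply: prodr_ge0 => c _; exact: powR_ge0.
have PK : \prod_(c <- bs) s c `^ a <= (K `^ a) ^+ size bs.
  have -> : (K `^ a) ^+ size bs = \prod_(c <- bs) K `^ a.
    by rewrite big_const_seq count_predT iter_mulr_1.
  rewrite big_seq [leRHS]big_seq; apply: ler_prod => c cbs.
  rewrite powR_ge0/=; have /andP[? ?] := sK _ (sub _ cbs).
  by apply: ge0_ler_powR; rewrite ?nnegrE.
apply: (@le_trans _ _ ((s b `^ a + d) * (\prod_(c <- bs) s c `^ a + d))).
  by apply: ler_pM.
have := P0 s; move: dM; rewrite /M; nra.
Qed.

End PowerModulus.

Section WeightedPointwise.
Variable R : realType.
Local Notation C := R[i].
Local Notation Re := complex.Re.
Local Notation Im := complex.Im.
Implicit Types (z x b c : C) (bs : seq C) (D E A B : {poly C}).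

Let haar := circle_haar R.

Lemma bounded_on_nice (g : C -> R) : nice (fun u : nat -> C => g (u 0%N)) ->
  bounded_on (fun=> 1 : R) (fun w : circle R => g (circle_val w)).
Proof.
move=> ng; have := @nice_set_coord R _ (fun=> 0) 0%N ng; rewrite /set_coord eqxx.
by apply=> r; rewrite sqn0.
Qed.

Lemma nice_prod_powR bs a B : 0 <= a ->
  nice (fun u : nat -> C =>
    \prod_(b <- bs) sqn (1 - b * u 0%N) `^ a * sqn B.[u 0%N]).
Proof.
move=> a0; apply: niceM; last exact/nice_sqn/cnice_horner.
apply: nice_prod => b _; apply: nice_sqn_powR => //.
have := cnice_horner (1 - b *: 'X) 0%N; congr cnice; apply/funext => u.
by rewrite hornerD hornerN hornerZ hornerX hornerC.
Qed.

Lemma bounded_prod_powR bs a B : 0 <= a -> bounded_on (fun=> 1 : R)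
  (fun w : circle R => \prod_(b <- bs) sqn (1 - b * circle_val w) `^ a *
     sqn B.[circle_val w]).
Proof.
move=> a0; apply: (@bounded_on_nice (fun z =>
  \prod_(b <- bs) sqn (1 - b * z) `^ a * sqn B.[z])).
exact: nice_prod_powR.
Qed.

Lemma zero_free_pointwise bs a B x : 0 <= a ->
  (forall b, b \in bs -> normc b < 1) -> sqn x < 1 ->
  (1 - sqn x) * (\prod_(b <- bs) sqn (1 - b * x) `^ a * sqn B.[x]) <=
  wint haar (fun=> 1) (fun w => \prod_(b <- bs) sqn (1 - b * circle_val w) `^ a *
    sqn B.[circle_val w]).
Proof.
move=> a0 bs1 x1.
set X := (1 - _) * _; set Y := wint _ _ _.
have bY := bounded_prod_powR bs B a0.
have Y0 : 0 <= Y.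
  apply: wint_ge0 => // w _; rewrite mulr_ge0 ?sqn_ge0//.
  by apply: prodr_ge0 => b _; exact: powR_ge0.
have XY e : 0 < e -> X <= expR (2 * e) * Y.
  move=> e0; have [E HE] := zero_free_approx a0 bs1 e0.
  have X1 : expR (- e) * X <= (1 - sqn x) * sqn (E * B).[x].
    rewrite hornerM sqnM /X mulrCA ler_wpM2l ?subr_ge0 ?(ltW x1)// mulrA.
    rewrite ler_wpM2r ?sqn_ge0//.
    have nx1 : normc x <= 1 by rewrite normc_le1 ltW.
    by have /andP[] := HE _ nx1.
  have X2 := le_trans X1 (poly_L2_pointwise (E * B) x1).
  have X3 : wint haar (fun=> 1) (fun w => sqn (E * B).[circle_val w]) <= expR e * Y.
    rewrite /Y -(wintZ _ (haar_weight R))//.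
    apply: le_wint => //; first exact: haar_weight.
    - exact/(@bounded_on_nice (fun z => sqn (E * B).[z]))/nice_sqn/cnice_horner.
    - by apply: bounded_onM => //; exact: bounded_on_cst.
    move=> w _; rewrite hornerM sqnM mulrA ler_wpM2r ?sqn_ge0//.
    have nw1 : normc (circle_val w) <= 1 by rewrite normc_le1 sqn_circle.
    by have /andP[] := HE _ nw1.
  have := le_trans X2 X3.
  rewrite expRN ler_pdivrMl ?expR_gt0// mulrA -expRD.
  by rewrite (_ : e + e = 2 * e)//; ring.
rewrite leNgt; apply/negP => YX.
have X0 : 0 < X := le_lt_trans Y0 YX.
have [Y00|Yn0] := eqVneq Y 0.
  by have := XY _ ltr01; rewrite Y00 mulr0 leNgt X0.
have Y1 : 0 < Y by rewrite lt_neqAle eq_sym Yn0.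
have q1 : 1 < X / Y by rewrite ltr_pdivlMr// mul1r.
have := XY (ln (X / Y) / 4).
rewrite divr_gt0 ?ln_gt0// => /(_ isT); rewrite leNgt => /negP; apply.
rewrite -ltr_pdivlMr//.
have -> : 2 * (ln (X / Y) / 4) = ln (X / Y) / 2 by field.
rewrite -[ltRHS]lnK ?posrE ?divr_gt0// ltr_expR.
have := ln_gt0 q1; lra.
Qed.

(** Dilating moves zeros off the circle. *)
Lemma dilated_factor b z (t : R) : normc b <= 1 -> normc z <= 1 -> 0 <= t <= 1 ->
  `|sqn (1 - ((1 - t)%:C)%C * b * z) - sqn (1 - b * z)| <= 4 * t.
Proof.
move=> b1 z1 /andP[t0 t1]; rewrite -mulrA; set y := b * z.
have y1 : normc y <= 1 by rewrite normcM mulr_ile1 ?normc_ge0.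
have ry : `|Re y| <= 1 := le_trans (normRe_le _) y1.
have sy : 0 <= sqn y <= 1 by rewrite sqn_ge0 -normc_le1.
have -> : sqn (1 - ((1 - t)%:C)%C * y) - sqn (1 - y) = 2 * t * Re y - t * (2 - t) * sqn y.
  by rewrite /sqn !ReD !ImD !ReN !ImN ReRl ImRl /=; ring.
move: ry; rewrite ler_norml => /andP[r1 r2]; move: sy => /andP[s1 s2].
rewrite ler_norml; apply/andP; split; nra.
Qed.

Lemma closed_zero_free_pointwise bs a B x : 0 <= a ->
  (forall b, b \in bs -> normc b <= 1) -> sqn x < 1 ->
  (1 - sqn x) * (\prod_(b <- bs) sqn (1 - b * x) `^ a * sqn B.[x]) <=
  wint haar (fun=> 1) (fun w => \prod_(b <- bs) sqn (1 - b * circle_val w) `^ a *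
    sqn B.[circle_val w]).
Proof.
move=> a0 bs1 x1.
have nx1 : normc x <= 1 by rewrite normc_le1 ltW.
have [K K0 BK] := poly_bounded B.
apply/ler_addgt0Pr => e e0.
pose e' := e / (2 * (K ^+ 2 + 1)).
have K2 : 0 < K ^+ 2 + 1 by rewrite ltr_wpDl// sqr_ge0.
have e'0 : 0 < e' by rewrite divr_gt0// mulr_gt0.
have e'E : e' * (K ^+ 2 + 1) = e / 2 by rewrite /e'; field; rewrite lt0r_neq0.
have four0 : 0 <= 4 :> R by [].
have [h h0 H] := prod_powR_modulus bs a0 four0 e'0.
pose t := Num.min (1/2) (h / 4).
have t0 : 0 < t by rewrite lt_min divr_gt0//= divr_gt0.
have t1 : t <= 1 by rewrite ge_min; apply/orP; left; lra.
have th : 4 * t <= h by rewrite mulrC -ler_pdivlMr// ge_min lexx orbT.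
pose ds := [seq ((1 - t)%:C)%C * b | b <- bs].
have ds1 d : d \in ds -> normc d < 1.
  move=> /mapP[b /bs1 b1 ->]; rewrite normcM normcR ger0_norm ?subr_ge0//.
  by rewrite (le_lt_trans (ler_piMr _ b1)) ?subr_ge0// ltrBlDr ltrDl.
have := zero_free_pointwise B a0 ds1 x1; rewrite big_map => main.
have sq4 b z : normc b <= 1 -> normc z <= 1 -> 0 <= sqn (1 - b * z) <= 4.
  move=> b1 z1; rewrite sqn_ge0/= -sqr_normc_sqn.
  have : normc (1 - b * z) <= 2.
    rewrite (le_trans (le_normcD _ _))// normc1 normcN lerD2l.
    by rewrite normcM mulr_ile1 ?normc_ge0.
  by have := normc_ge0 (1 - b * z); rewrite expr2; nra.
have s1b z b : normc z <= 1 -> b \in bs ->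
    0 <= sqn (1 - b * z) <= sqn (1 - ((1 - t)%:C)%C * b * z) + h.
  move=> z1 /bs1 b1; rewrite sqn_ge0/=.
  have := dilated_factor b1 z1 (t := t); rewrite (ltW t0) t1 => /(_ isT).
  rewrite ler_norml => /andP[]; lra.
have s2b z b : normc z <= 1 -> b \in bs ->
    0 <= sqn (1 - ((1 - t)%:C)%C * b * z) <= sqn (1 - b * z) + h.
  move=> z1 /bs1 b1; rewrite sqn_ge0/=.
  have := dilated_factor b1 z1 (t := t); rewrite (ltW t0) t1 => /(_ isT).
  rewrite ler_norml => /andP[]; lra.
have tb1 b : b \in bs -> normc (((1 - t)%:C)%C * b) <= 1.
  by move=> bbs; apply/ltW/ds1/map_f.
have P1 := H (fun b => sqn (1 - ((1 - t)%:C)%C * b * x)) (fun b => sqn (1 - b * x)).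
have {}P1 := P1 (fun b bbs => sq4 _ _ (tb1 _ bbs) nx1) (fun b => s1b x b nx1).
have sB z : normc z <= 1 -> 0 <= sqn B.[z] <= K ^+ 2.
  move=> z1; rewrite sqn_ge0 -sqr_normc_sqn/= lerXn2r// ?nnegrE ?normc_ge0//.
  exact: BK.
set P := \prod_(b <- bs) sqn (1 - b * x) `^ a in P1 *.
set Q := \prod_(b <- bs) sqn (1 - _ * b * x) `^ a in P1 main *.
have step1 : (1 - sqn x) * (P * sqn B.[x]) <= (1 - sqn x) * (Q * sqn B.[x]) + e' * K ^+ 2.
  have /andP[B0 BK2] := sB _ nx1.
  have sx := sqn_ge0 x.
  have : P * sqn B.[x] <= Q * sqn B.[x] + e' * K ^+ 2.
    apply: (@le_trans _ _ ((Q + e') * sqn B.[x])); first by rewrite ler_wpM2r.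
    by rewrite mulrDl lerD2l ler_wpM2l// ltW.
  have := mulr_ge0 (ltW e'0) (sqr_ge0 K); nra.
apply: le_trans step1 _.
have -> : e = e' * (K ^+ 2 + 1) * 2 by rewrite e'E; field.
have bW := bounded_prod_powR bs B a0.
have bW' := bounded_prod_powR ds B a0.
have step2 : wint haar (fun=> 1) (fun w =>
    \prod_(b <- bs) sqn (1 - ((1 - t)%:C)%C * b * circle_val w) `^ a * sqn B.[circle_val w]) <=
    wint haar (fun=> 1) (fun w => \prod_(b <- bs) sqn (1 - b * circle_val w) `^ a *
    sqn B.[circle_val w]) + e' * K ^+ 2.
  rewrite -[X in _ <= _ + X]haar_cst -(wintD (haar_weight R))//; last exact: bounded_on_cst.
  apply: le_wint => //; first exact: haar_weight.
  - by move: bW'; under [X in bounded_on _ X -> _]eq_fun do rewrite big_map.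
  - by apply: bounded_onD => //; exact: bounded_on_cst.
  move=> w _; have nw : normc (circle_val w) <= 1 by rewrite normc_le1 sqn_circle.
  have P2 := H (fun b => sqn (1 - b * circle_val w))
    (fun b => sqn (1 - ((1 - t)%:C)%C * b * circle_val w)).
  have {}P2 := P2 (fun b bbs => sq4 _ _ (bs1 _ bbs) nw) (fun b => s2b _ b nw).
  have /andP[B0 BK2] := sB _ nw.
  apply: (@le_trans _ _ ((\prod_(b <- bs) sqn (1 - b * circle_val w) `^ a + e') *
      sqn B.[circle_val w])); first by rewrite ler_wpM2r.
  by rewrite mulrDl lerD2l ler_wpM2l// ltW.
have := le_trans main (le_trans _ step2).
under [X in X <= _ -> _]eq_wint do rewrite big_map.
move=> /(_ (lexx _)); have := e'0; lra.
Qed.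

End WeightedPointwise.

Section PolyPointwise.
Variable R : realType.
Local Notation C := R[i].
Local Notation Re := complex.Re.
Local Notation Im := complex.Im.
Implicit Types (D E A B : {poly C}).

Let haar := circle_haar R.

Lemma prod_powR (I : Type) (s : seq I) (f : I -> R) a : (forall i, 0 <= f i) ->
  (\prod_(i <- s) f i) `^ a = \prod_(i <- s) f i `^ a.
Proof.
move=> f0; elim: s => [|i s IH]; first by rewrite !big_nil powR1.
by rewrite !big_cons powRM// ?IH//; apply: prodr_ge0.
Qed.

(** The inequality behind Szego's theorem. On the circle [|A|] agrees with the
modulus of a polynomial without zeros in the open disc (reflect the zeros),
which dominates [|A|] inside; a real power of that polynomial is
approximately a squared modulus, for which the claim is Cauchy-Schwarz. *)
Lemma poly_weighted_pointwise A B a (x : C) : 0 <= a -> sqn x < 1 ->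
  (1 - sqn x) * (sqn A.[x] `^ a * sqn B.[x]) <=
  wint haar (fun=> 1)
    (fun w => sqn A.[circle_val w] `^ a * sqn B.[circle_val w]).
Proof.
move=> a0 x1; have [rs AE] := closed_field_poly_normal A.
pose refl (r : C) : C := if normc r <= 1 then (r^*)%C else r^-1.
pose coef (r : C) : C := if normc r <= 1 then 1 else - r.
have refl1 (r : C) : normc (refl r) <= 1.
  rewrite /refl; case: ifP => [|/negbT]; first by rewrite normcJ'.
  by rewrite -ltNge normcV => r1; rewrite invf_le1 ?(ltW r1)// (lt_trans ltr01).
have key (r z : C) : normc r <= 1 -> sqn (1 - (r^*)%C * z) - sqn (z - r) = (1 - sqn z) * (1 - sqn r).
  by move=> _; rewrite /sqn !ReD !ImD !ReN !ImN ReM ImM ReJ ImJ /=; ring.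
have outside (r z : C) : ~~ (normc r <= 1) -> z - r = - r * (1 - r^-1 * z).
  move=> r1; have r_neq0 : r != 0 by apply: contraNneq r1 => ->; rewrite normc0.
  by rewrite mulrBr mulr1 mulNr mulrA divff// mul1r opprK addrC.
have on_circle (r z : C) : sqn z = 1 -> sqn (z - r) = sqn (coef r) * sqn (1 - refl r * z).
  move=> z1; rewrite /coef /refl; case: ifPn => r1.
    by rewrite sqn1 mul1r; apply/esym/eqP; rewrite -subr_eq0 key// z1 subrr mul0r.
  by rewrite outside// sqnM.
have inside (r z : C) : sqn z <= 1 -> sqn (z - r) <= sqn (coef r) * sqn (1 - refl r * z).
  move=> z1; rewrite /coef /refl; case: ifPn => r1.
    by rewrite sqn1 mul1r -subr_ge0 key// mulr_ge0 ?subr_ge0// -normc_le1.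
  by rewrite outside// sqnM.
have sA (z : C) : sqn A.[z] = sqn (lead_coef A) * \prod_(r <- rs) sqn (z - r).
  rewrite {1}AE hornerZ sqnM horner_prod sqn_prod; congr (_ * _).
  by apply: eq_bigr => r _; rewrite hornerXsubC.
pose bs := map refl rs; pose k := (sqn (lead_coef A) * \prod_(r <- rs) sqn (coef r)) `^ a.
have k0 : 0 <= k := powR_ge0 _ _.
have prodE (z : C) : \prod_(b <- bs) sqn (1 - b * z) `^ a =
    (\prod_(r <- rs) sqn (1 - refl r * z)) `^ a.
  by rewrite big_map prod_powR// => r; exact: sqn_ge0.
have pr0 (f : C -> C) : 0 <= \prod_(r <- rs) sqn (f r).
  by apply: prodr_ge0 => r _; exact: sqn_ge0.
have sA_circle z : sqn z = 1 ->
    sqn A.[z] `^ a = k * \prod_(b <- bs) sqn (1 - b * z) `^ a.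
  move=> z1; rewrite sA prodE /k -powRM ?mulr_ge0 ?sqn_ge0//.
  rewrite -mulrA -big_split/=; congr ((_ * _) `^ _).
  by apply: eq_bigr => r _; exact: on_circle.
have sA_inside : sqn A.[x] `^ a <= k * \prod_(b <- bs) sqn (1 - b * x) `^ a.
  rewrite sA prodE /k -powRM ?mulr_ge0 ?sqn_ge0//.
  apply: ge0_ler_powR; rewrite ?nnegrE ?mulr_ge0 ?sqn_ge0//.
  rewrite -mulrA ler_wpM2l ?sqn_ge0// -big_split/=.
  by apply: ler_prod => r _; rewrite sqn_ge0 inside// ltW.
have bs1 b : b \in bs -> normc b <= 1 by move=> /mapP[r _ ->].
have := closed_zero_free_pointwise B a0 bs1 x1.
move=> main'.
apply: (@le_trans _ _ (k * ((1 - sqn x) *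
   (\prod_(b <- bs) sqn (1 - b * x) `^ a * sqn B.[x])))).
  rewrite [leRHS]mulrCA ler_wpM2l ?subr_ge0 ?(ltW x1)// mulrA.
  by rewrite ler_wpM2r ?sqn_ge0.
apply: le_trans (ler_wpM2l k0 main') _.
rewrite -(wintZ _ (haar_weight R)); last exact: bounded_prod_powR.
rewrite le_eqVlt; apply/orP; left; apply/eqP; apply: eq_wint => w _.
by rewrite mulrA -sA_circle// sqn_circle.
Qed.

(** [F] is a polynomial in each of the variables listed in [ps]. *)
Definition poly_in (ps : seq nat) (F : (nat -> C) -> C) :=
  forall (z : nat -> C) r, r \in ps -> exists A, forall c, F (set_coord z r c) = A.[c].

Lemma set_coord_id (z : nat -> C) r : set_coord z r (z r) = z.
Proof. by apply/funext => s; rewrite /set_coord; case: eqP => [->|]. Qed.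

Lemma set_coord_other (z : nat -> C) r s c : s != r -> set_coord z r c s = z s.
Proof. by rewrite /set_coord => /negbTE ->. Qed.

Lemma tmean_weighted_pointwise ps (F G : (nat -> C) -> C) a x : 0 <= a ->
  uniq ps -> cnice F -> cnice G -> poly_in ps F -> poly_in ps G ->
  in_disc x -> (forall r, r \in ps -> sqn (x r) < 1) ->
  \prod_(r <- ps) (1 - sqn (x r)) * (sqn (F x) `^ a * sqn (G x)) <=
  tmean ps (fun u => sqn (F u) `^ a * sqn (G u)) x.
Proof.
move=> a0 + nF nG; elim: ps x => [|r ps IH] x /=.
  by move=> _ _ _ _ _; rewrite big_nil mul1r.
move=> /andP[rps ups] pF pG xd x1.
have sub s : s \in ps -> s \in r :: ps by rewrite inE => ->; rewrite orbT.
have pF' : poly_in ps F by move=> z s /sub; exact: pF.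
have pG' : poly_in ps G by move=> z s /sub; exact: pG.
pose g u := sqn (F u) `^ a * sqn (G u).
have ng : nice g by apply: niceM; [exact: nice_sqn_powR|exact: nice_sqn].
set P := \prod_(s <- ps) (1 - sqn (x s)).
have P0 : 0 <= P.
  by rewrite /P big_seq; apply: prodr_ge0 => s /sub /x1 h; rewrite subr_ge0 ltW.
have [A HA] := pF x r (mem_head _ _); have [B HB] := pG x r (mem_head _ _).
have x1r : sqn (x r) < 1 by apply: x1; rewrite mem_head.
rewrite big_cons -/P (_ : _ * P * _ = P * ((1 - sqn (x r)) * g x)); last first.
  by rewrite /g; ring.
apply: (@le_trans _ _ (P * wint haar (fun=> 1)
   (fun w => g (set_coord x r (circle_val w))))).
  rewrite ler_wpM2l//.
  have := poly_weighted_pointwise A B a0 x1r.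
  rewrite -HA -HB set_coord_id => /le_trans; apply.
  rewrite le_eqVlt; apply/orP; left; apply/eqP; apply: eq_wint => w _.
  by rewrite /g HA HB.
rewrite -(wintZ _ (haar_weight R)); last exact: nice_set_coord.
apply: le_wint => //.
- exact: haar_weight.
- by apply: bounded_onM; [exact: bounded_on_cst|exact: nice_set_coord].
- exact/nice_set_coord/xd/nice_tmean.
move=> w _.
have := IH (set_coord x r (circle_val w)) ups pF' pG' (in_disc_circle _ _ xd).
have PE : \prod_(s <- ps) (1 - sqn (set_coord x r (circle_val w) s)) = P.
  rewrite /P; apply: eq_big_seq => s sps; rewrite set_coord_other//.
  by apply: contraNneq rps => <-.
rewrite PE; apply => s sps; rewrite set_coord_other; first exact/x1/sub.
by apply: contraNneq rps => <-.
Qed.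

End PolyPointwise.

Section Chebyshev.

Lemma prod_primes_dvd (s : seq nat) m : uniq s -> (forall r, r \in s -> prime r) ->
  (forall r, r \in s -> (r %| m)%N) -> (\prod_(r <- s) r %| m)%N.
Proof.
elim: s m => [|r s IH] m /=; first by rewrite big_nil dvd1n.
move=> /andP[rs us] ps ds; rewrite big_cons Gauss_dvd.
  rewrite ds ?mem_head//=; apply: IH => // t ts; [apply: ps|apply: ds];
  by rewrite inE ts orbT.
rewrite big_seq; apply: (big_ind (fun x => coprime r x)).
- exact: coprimen1.
- by move=> a b ra rb; rewrite coprimeMr ra.
move=> t ts; have pr : prime r by apply: ps; rewrite mem_head.
rewrite prime_coprime// dvdn_prime2//; last first.
  by apply: ps; rewrite inE ts orbT.
by apply: contraNneq rs => ->.
Qed.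

Lemma primorial_binomial n :
  (\prod_(n.+1 <= r < n.*2.+1 | prime r) r <= 4 ^ n)%N.
Proof.
apply: (@leq_trans 'C(n.*2, n)); last first.
  apply: (@leq_trans (\sum_(i < n.*2.+1) 'C(n.*2, i))).
    have nn : (n < n.*2.+1)%N by rewrite ltnS -addnn leq_addr.
    by rewrite (bigD1 (Ordinal nn))//= leq_addr.
  have -> : \sum_(i < n.*2.+1) 'C(n.*2, i) = (2 ^ n.*2)%N.
    rewrite -[in RHS](addn1 1) expnDn; apply: eq_bigr => i _.
    by rewrite !exp1n !muln1.
  by rewrite -muln2 mulnC expnM.
have C0 : (0 < 'C(n.*2, n))%N by rewrite bin_gt0 -addnn leq_addr.
apply: dvdn_leq => //.
rewrite -big_filter; apply: prod_primes_dvd.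
- by rewrite filter_uniq// iota_uniq.
- by move=> r; rewrite mem_filter => /andP[].
move=> r; rewrite mem_filter mem_index_iota => /andP[pr /andP[nr rn]].
have : (r %| (n.*2)`!)%N.
  by apply: dvdn_fact; rewrite prime_gt0.
have nn : (n <= n.*2)%N by rewrite -addnn leq_addr.
rewrite -(bin_fact nn) -addnn addnK Euclid_dvdM// => /orP[//|].
rewrite Euclid_dvdM// orbb => rnf; exfalso; move: rnf.
apply/negP; elim: (n) nr => [_|k IH kr].
  by rewrite fact0 Euclid_dvd1.
rewrite factS Euclid_dvdM// negb_or IH ?andbT; last exact: ltnW.
by rewrite gtnNdvd.
Qed.

Variable R : realType.

Lemma ln2_ge : 2^-1 <= ln 2 :> R.
Proof.
have := @expR_ge1Dx R (- 2^-1); rewrite expRN => h.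
have e2 : expR (2^-1) <= 2 :> R.
  rewrite -[leLHS]invrK invf_ple ?posrE ?invr_gt0 ?expR_gt0//; lra.
by rewrite -[leLHS]expRK ler_ln ?posrE ?expR_gt0.
Qed.

Lemma ln2_le1 : ln 2 <= 1 :> R.
Proof. by have := @le_ln1Dx R 1; rewrite -natr1; apply; lra. Qed.

Lemma ln_natX (a n : nat) : (0 < a)%N -> ln ((a ^ n)%:R : R) = n%:R * ln a%:R.
Proof. by move=> a0; rewrite natrX lnXn ?ltr0n// mulr_natl. Qed.

Lemma ln_nat_ge0 (n : nat) : 0 <= ln (n%:R : R).
Proof. by case: n => [|n]; [rewrite ln0|rewrite ln_ge0// ler1n]. Qed.

Lemma sum_ln_primes n :
  \sum_(n.+1 <= r < n.*2.+1 | prime r) ln (r%:R : R) <= n%:R * (2 * ln 2).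
Proof.
have -> : \sum_(n.+1 <= r < n.*2.+1 | prime r) ln (r%:R : R) =
    ln ((\prod_(n.+1 <= r < n.*2.+1 | prime r) r)%:R).
  suff [] : (0 < \prod_(n.+1 <= r < n.*2.+1 | prime r) r)%N /\
    ln ((\prod_(n.+1 <= r < n.*2.+1 | prime r) r)%:R : R) =
    \sum_(n.+1 <= r < n.*2.+1 | prime r) ln (r%:R : R) by [].
  elim/big_rec2: _ => [|r x y pr [y0 <-]]; first by rewrite ln1.
  by rewrite muln_gt0 prime_gt0// y0 natrM lnM// posrE ltr0n// prime_gt0.
have -> : n%:R * (2 * ln 2) = ln ((4 ^ n)%:R : R).
  by rewrite ln_natX// -[4%N]/(2 ^ 2)%N ln_natX.
rewrite ler_ln ?posrE ?ltr0n ?expn_gt0//; last first.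
  by elim/big_ind: _ => [//|a b a0 b0|r /prime_gt0 //]; rewrite muln_gt0 a0.
by rewrite ler_nat primorial_binomial.
Qed.

(** Dyadic form of Chebyshev's bound; the term [2 ^ j] is counted whether or not
it is prime. *)
Lemma dyadic_ln_primes j : \sum_(2 ^ j <= r < 2 ^ j.+1 | prime r)
  ln (r%:R : R) / r%:R <= 3 * ln 2.
Proof.
have j2 : (2 ^ j < 2 ^ j.+1)%N by rewrite ltn_exp2l.
have P2 k : 0 < (2 ^ k)%:R :> R by rewrite ltr0n expn_gt0.
rewrite big_ltn_cond//.
have first_term : ln ((2 ^ j)%:R : R) / (2 ^ j)%:R <= ln 2.
  rewrite ler_pdivrMr// ln_natX// mulrC ler_wpM2l ?ln_nat_ge0//.
  by rewrite ler_nat ltnW// ltn_expl.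
have rest : \sum_((2 ^ j).+1 <= r < 2 ^ j.+1 | prime r) ln (r%:R : R) / r%:R <= 2 * ln 2.
  apply: (@le_trans _ _ (\sum_((2 ^ j).+1 <= r < (2 ^ j).*2.+1 | prime r)
       ln (r%:R : R) / (2 ^ j)%:R)).
    rewrite expnS mul2n [leRHS](big_cat_nat _ (n := (2 ^ j).*2))//=; last first.
      by rewrite -addnn -addn1 leq_add2l expn_gt0.
    rewrite -[leLHS]addr0; apply: lerD; last first.
      by apply: sumr_ge0 => r _; rewrite divr_ge0 ?ln_nat_ge0.
    rewrite big_nat_cond [leRHS]big_nat_cond.
    apply: ler_sum => r /andP[/andP[jr _] pr].
    rewrite ler_wpM2l ?ln_nat_ge0// lef_pV2 ?posrE ?P2//.
      by rewrite ler_nat ltnW.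
    by rewrite ltr0n prime_gt0.
  rewrite -mulr_suml ler_pdivrMr// mulrC; exact: sum_ln_primes.
case: ifP => _; last by have := @ln_nat_ge0 2; lra.
by rewrite (_ : 3 * ln 2 = ln 2 + 2 * ln 2) ?lerD//; ring.
Qed.

Lemma dyadic_inv_primes j : (0 < j)%N ->
  \sum_(2 ^ j <= r < 2 ^ j.+1 | prime r) (r%:R : R)^-1 <= 3 / j%:R.
Proof.
move=> j0; have j0' : 0 < j%:R :> R by rewrite ltr0n.
have l2 : 0 < ln 2 :> R by rewrite ln_gt0// ltr1n.
rewrite ler_pdivlMr// -(ler_pM2l l2) [leRHS]mulrC.
apply: le_trans (dyadic_ln_primes j).
rewrite mulrC -mulrA mulr_suml big_nat_cond [leRHS]big_nat_cond.
apply: ler_sum => r /andP[/andP[jr _] pr]; rewrite mulrC ler_wpM2r ?invr_ge0//.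
rewrite -ln_natX// ler_ln ?posrE ?ltr0n ?expn_gt0 ?prime_gt0//.
by rewrite ler_nat.
Qed.

Lemma sum_ln_div_primes K : \sum_(0 <= r < 2 ^ K | prime r)
  ln (r%:R : R) / r%:R <= 3 * ln 2 * K%:R.
Proof.
elim: K => [|K IH]; first by rewrite mulr0 expn0 big_nat_cond big1// => r;
  case: r => [|r]//; rewrite ltnS.
rewrite (big_cat_nat _ (n := 2 ^ K))//=; last by rewrite leq_exp2l.
by rewrite -[K.+1%:R]natr1 mulrDr mulr1 lerD//; exact: dyadic_ln_primes.
Qed.

Lemma sum_dyadic (F : nat -> R) J K : (J <= K)%N ->
  \sum_(2 ^ J <= r < 2 ^ K | prime r) F r =
  \sum_(J <= j < K) \sum_(2 ^ j <= r < 2 ^ j.+1 | prime r) F r.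
Proof.
elim: K => [|K IH]; first by rewrite leqn0 => /eqP ->; rewrite !big_geq.
rewrite leq_eqVlt => /orP[/eqP ->|]; first by rewrite !big_geq.
rewrite ltnS => JK; rewrite big_nat_recr//= -IH//.
by rewrite (big_cat_nat _ (n := 2 ^ K))//= leq_exp2l.
Qed.

(** Bounded total mass of the lattice sums of a Cauchy density, by telescoping
[u / (1 + |u|)]. *)
Lemma cauchy_lattice_sum (y : R) J K :
  \sum_(J <= j < K) (1 + (y - j%:R) ^+ 2)^-1 <= 8.
Proof.
pose g (u : R) := u / (1 + `|u|).
have d0 (u : R) : 0 < 1 + `|u| :> R by rewrite ltr_pwDl.
have g1 (u : R) : `|g u| <= 1.
  rewrite normrM normfV (gtr0_norm (d0 u)) ler_pdivrMr// mul1r.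
  by rewrite lerDr.
have step (u : R) : (1 + u ^+ 2)^-1 <= 4 * (g (u + 1) - g u).
  have s0 : 0 < 1 + u ^+ 2 by rewrite ltr_pwDl// sqr_ge0.
  rewrite -div1r ler_pdivrMr//.
  have gpos (v : R) : 0 <= v -> 1 <= 4 * (g (v + 1) - g v) * (1 + (v + 1) ^+ 2) /\
      1 <= 4 * (g (v + 1) - g v) * (1 + v ^+ 2).
    move=> v0; have v10 : 0 <= v + 1 by lra.
    rewrite /g !ger0_norm//.
    have -> : (v + 1) / (1 + (v + 1)) - v / (1 + v) = ((1 + v) * (2 + v))^-1.
      by field; apply/andP; split; apply: lt0r_neq0; lra.
    have p0 : 0 < (1 + v) * (2 + v) by nra.
    by split; rewrite mulrAC ler_pdivlMr// mul1r; nra.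
  have [u0|u0] := leP 0 u; first by have [] := gpos _ u0.
  have [u1|u1] := leP u (-1).
    have v0 : 0 <= - u - 1 by lra.
    have [+ _] := gpos _ v0; rewrite subrK sqrrN.
    suff -> : g (- u) - g (- u - 1) = g (u + 1) - g u by [].
    by rewrite /g -opprD !normrN !mulNr opprK addrC.
  rewrite /g (ler0_norm (ltW u0)) ger0_norm; last by lra.
  have e1 : (u + 1) / 2 <= (u + 1) / (1 + (u + 1)).
    by rewrite ler_wpM2l ?lef_pV2 ?posrE//; lra.
  have e2 : - u / 2 <= - u / (1 - u).
    by rewrite ler_wpM2l ?lef_pV2 ?posrE//; lra.
  have := sqr_ge0 u; rewrite !mulNr in e2 *; nra.
have [JK|KJ] := leqP J K; last by rewrite big_geq ?ler0n// ltnW.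
apply: (@le_trans _ _ (\sum_(J <= j < K) 4 * (g (j.+1%:R - y) - g (j%:R - y)))).
  apply: ler_sum => j _; rewrite -sqrrN opprB; apply: le_trans (step _) _.
  by rewrite -[j.+1%:R]natr1 (addrAC j%:R).
rewrite -mulr_sumr (telescope_sumr (fun j => g (j%:R - y)))//.
have := g1 (K%:R - y); have := g1 (J%:R - y).
by rewrite !ler_norml => /andP[? ?] /andP[? ?]; lra.
Qed.

(** A unit window (in logarithmic scale) catches a proportion at most [C / J] of
the primes above [2 ^ J]. *)
Lemma prime_window (x : R) J K : (0 < J)%N ->
  \sum_(2 ^ J <= r < 2 ^ K | prime r)
     (r%:R)^-1 * (1 + (x - ln r%:R) ^+ 2)^-1 <= 288 / J%:R.
Proof.
move=> J0; have J0' : 0 < J%:R :> R by rewrite ltr0n.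
have [JK|KJ] := leqP J K; last first.
  by rewrite big_geq ?divr_ge0// leq_exp2l// ltnW.
rewrite sum_dyadic//; set l : R := ln 2.
have l2 := ln2_ge; have l1 := ln2_le1; rewrite -/l in l2 l1.
pose y := x / l.
apply: (@le_trans _ _ (\sum_(J <= j < K) (36 / J%:R) * (1 + (y - j%:R) ^+ 2)^-1)); last first.
  rewrite -mulr_sumr (_ : 288 / J%:R = 36 / J%:R * 8); last by field; rewrite lt0r_neq0.
  by rewrite ler_wpM2l ?divr_ge0//; exact: cauchy_lattice_sum.
rewrite big_nat_cond [leRHS]big_nat_cond.
apply: ler_sum => j /andP[/andP[Jj _] _].
have j0 : (0 < j)%N := leq_trans J0 Jj.
apply: (@le_trans _ _ (\sum_(2 ^ j <= r < 2 ^ j.+1 | prime r)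
    (r%:R)^-1 * (12 * (1 + (y - j%:R) ^+ 2)^-1))).
  rewrite big_nat_cond [leRHS]big_nat_cond.
  apply: ler_sum => r /andP[/andP[jr rj] pr].
  rewrite ler_wpM2l ?invr_ge0// -[12]invrK -invfM lef_pV2 ?posrE; last 2 first.
  - by rewrite ltr_pwDl// sqr_ge0.
  - by rewrite mulr_gt0 ?invr_gt0// ltr_pwDl// sqr_ge0.
  rewrite mulrC ler_pdivrMr//.
  have r0 : 0 < r%:R :> R by rewrite ltr0n prime_gt0.
  have lr1 : j%:R * l <= ln r%:R.
    have -> : j%:R * l = ln ((2 ^ j)%:R) by rewrite ln_natX.
    by rewrite ler_ln ?posrE ?ltr0n ?expn_gt0 ?prime_gt0// ler_nat.
  have lr2 : ln r%:R <= j%:R * l + l.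
    have -> : j%:R * l + l = ln ((2 ^ j.+1)%:R) by rewrite ln_natX// -[j.+1%:R]natr1 mulrDl mul1r.
    by rewrite ler_ln ?posrE ?ltr0n ?expn_gt0 ?prime_gt0// ler_nat ltnW.
  have -> : y - j%:R = (x - j%:R * l) / l by rewrite /y; field; rewrite lt0r_neq0//; lra.
  rewrite expr_div_n.
  have s0 := sqr_ge0 (x - j%:R * l).
  have : (x - j%:R * l) ^+ 2 / l ^+ 2 <= 4 * (x - j%:R * l) ^+ 2.
    rewrite ler_pdivrMr ?exprn_gt0//; last lra.
    have : 1 <= 4 * l ^+ 2 by nra.
    nra.
  have : (x - j%:R * l) ^+ 2 <= 2 * (x - ln r%:R) ^+ 2 + 2.
    have := sqr_ge0 (x - ln r%:R - (ln r%:R - j%:R * l)).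
    set p := ln r%:R in lr1 lr2 *; set q := j%:R * l in lr1 lr2 *; nra.
  by have := sqr_ge0 (x - ln r%:R); lra.
rewrite -mulr_suml mulrA ler_wpM2r ?invr_ge0//.
  by rewrite addr_ge0// sqr_ge0.
apply: (@le_trans _ _ (3 / j%:R * 12)).
  by rewrite ler_wpM2r// dyadic_inv_primes.
have -> : 3 / j%:R * 12 = 36 / j%:R :> R by field; rewrite lt0r_neq0// ltr0n.
by rewrite ler_pM2l// lef_pV2 ?posrE ?ltr0n// ler_nat.
Qed.

End Chebyshev.

Section DirichletWeights.
Variable R : realType.
Implicit Types (a : R) (ps : seq nat).

Lemma ler_sum_subset (T : eqType) (s t : seq T) (f : T -> R) : uniq s ->
  {subset s <= t} -> (forall x, 0 <= f x) ->
  \sum_(x <- s) f x <= \sum_(x <- t) f x.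
Proof.
move=> + + f0; elim: s t => [|x s IH] t /=.
  by move=> _ _; rewrite big_nil sumr_ge0.
move=> /andP[xs us] st; have xt : x \in t by apply: st; rewrite mem_head.
rewrite big_cons [leRHS](perm_big _ (perm_to_rem xt)) big_cons lerD2l.
apply: IH => // y ys; have : y \in x :: rem x t.
  by rewrite -(perm_mem (perm_to_rem xt)) st// inE ys orbT.
by rewrite inE => /orP[/eqP yx|//]; rewrite -yx ys in xs.
Qed.

Definition npow a (n : nat) : R := expR (- (a * ln n%:R)).

Lemma npow_ge0 a n : 0 <= npow a n. Proof. exact: expR_ge0. Qed.

Lemma npow_gt0 a n : 0 < npow a n. Proof. exact: expR_gt0. Qed.

Lemma npow1 a : npow a 1 = 1.
Proof. by rewrite /npow ln1 mulr0 oppr0 expR0. Qed.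

Lemma npowM a m n : (0 < m)%N -> (0 < n)%N -> npow a (m * n) = npow a m * npow a n.
Proof.
by move=> m0 n0; rewrite /npow natrM lnM ?posrE ?ltr0n// mulrDr opprD expRD.
Qed.

Lemma npowD a b n : npow (a + b) n = npow a n * npow b n.
Proof. by rewrite /npow mulrDl opprD expRD. Qed.

Lemma npow_inv n : (0 < n)%N -> npow 1 n = (n%:R)^-1.
Proof. by move=> n0; rewrite /npow mul1r -lnV ?posrE ?ltr0n// lnK// posrE invr_gt0 ltr0n. Qed.

Lemma npow_le a b n : a <= b -> npow b n <= npow a n.
Proof. by move=> ab; rewrite ler_expR lerN2 ler_wpM2r// ln_nat_ge0. Qed.

Lemma npow_lt1 a n : 0 < a -> (1 < n)%N -> npow a n < 1.
Proof.
by move=> a0 n1; rewrite -[ltRHS]expR0 ltr_expR oppr_lt0 mulr_gt0// ln_gt0// ltr1n.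
Qed.

(** Telescoping [\int_n^(n+1) u^(-1-d) du]. *)
Lemma npow_telescope d n : 0 < d -> (0 < n)%N ->
  d * npow (1 + d) n.+1 <= npow d n - npow d n.+1.
Proof.
move=> d0 n0; rewrite npowD npow_inv//.
have N0 : 0 < n%:R :> R by rewrite ltr0n.
have N1 : 0 < n.+1%:R :> R by rewrite ltr0n.
have -> : npow d n = npow d n.+1 * expR (d * (ln n.+1%:R - ln n%:R)).
  by rewrite /npow -expRD; congr expR; ring.
have l1 : n.+1%:R^-1 <= ln (n.+1%:R : R) - ln n%:R.
  rewrite -ln_div ?posrE// -[leRHS]opprK -lnV ?posrE ?divr_gt0// lerNr invf_div.
  have -> : n%:R / n.+1%:R = 1 - n.+1%:R^-1 :> R.
    have -> : n%:R = n.+1%:R - 1 :> R by rewrite -[n.+1%:R]natr1 addrK.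
    by rewrite mulrBl divff ?lt0r_neq0// mul1r.
  apply: le_trans (le_ln1Dx _) _ => //.
  by rewrite ltrN2 invf_lt1// ltr1n ltnS.
have e1 := expR_ge1Dx (d * (ln n.+1%:R - ln n%:R)).
have p0 := npow_gt0 d n.+1.
have : d * n.+1%:R^-1 <= expR (d * (ln n.+1%:R - ln n%:R)) - 1.
  by rewrite lerBrDl; apply: le_trans e1; rewrite lerD2l ler_pM2l.
move: p0 (expR _) (n.+1%:R^-1) => p0 e i h.
have : npow d n.+1 * (d * i) <= npow d n.+1 * (e - 1) by rewrite ler_pM2l.
by rewrite mulrBr mulr1 mulrCA [i * _]mulrC.
Qed.

Lemma sum_npow_le d N : 0 < d -> \sum_(1 <= n < N.+1) npow (1 + d) n <= 1 + d^-1.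
Proof.
move=> d0; case: N => [|N]; first by rewrite big_geq// addr_ge0// invr_ge0 ltW.
rewrite big_ltn// npow1 lerD2l -(ler_pM2l d0) divff ?gt_eqF// big_add1/= mulr_sumr.
apply: (@le_trans _ _ (\sum_(1 <= n < N.+1) (npow d n - npow d n.+1))).
  rewrite big_nat_cond [leRHS]big_nat_cond; apply: ler_sum => n /andP[/andP[n0 _] _].
  exact: npow_telescope.
under eq_bigr do rewrite -opprB.
rewrite sumrN telescope_sumr// opprB npow1.
by have := npow_ge0 d N.+1; lra.
Qed.

Definition sieve_sum a ps N :=
  \sum_(n <- iota 1 N | all (fun r => ~~ (r %| n)%N) ps) npow a n.

Lemma sieve_sum_mono a ps M N : (M <= N)%N -> sieve_sum a ps M <= sieve_sum a ps N.
Proof.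
move=> MN; rewrite /sieve_sum -big_filter -[leRHS]big_filter.
apply: ler_sum_subset; [by rewrite filter_uniq ?iota_uniq| |by move=> ?; exact: npow_ge0].
move=> n; rewrite !mem_filter !mem_iota => /andP[-> /andP[-> h]] /=.
by rewrite (leq_trans h)// leq_add2l.
Qed.

Lemma sieve_sum_cons a r ps N : prime r -> (forall t, t \in ps -> prime t) -> r \notin ps ->
  sieve_sum a (r :: ps) N + npow a r * sieve_sum a ps N <= sieve_sum a ps (r * N).
Proof.
move=> pr pps rps; have r0 := prime_gt0 pr.
rewrite /sieve_sum [leRHS](bigID (fun n => (r %| n)%N))/= [leRHS]addrC; apply: lerD.
  rewrite -[leLHS]big_filter -[leRHS]big_filter. apply: ler_sum_subset.
  - by rewrite filter_uniq ?iota_uniq.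
  - move=> n; rewrite !mem_filter !mem_iota /= => /andP[/andP[rn ->] /andP[-> h]].
    by rewrite rn /= (leq_trans h)// leq_add2l leq_pmull.
  - by move=> ?; exact: npow_ge0.
rewrite mulr_sumr -[leLHS]big_filter -[leRHS]big_filter.
rewrite [leLHS](_ : _ = \sum_(n <- [seq (r * m)%N | m <- iota 1 N & all (fun t => ~~ (t %| m)%N) ps]) npow a n).
  apply: ler_sum_subset; last by move=> ?; exact: npow_ge0.
    rewrite map_inj_uniq ?filter_uniq ?iota_uniq// => x y /eqP.
    by rewrite eqn_pmul2l// => /eqP.
  move=> n /mapP[m]; rewrite mem_filter mem_iota => /andP[am /andP[m1 mN]] ->.
 rewrite mem_filter mem_iota dvdn_mulr//= andbT muln_gt0 r0 m1 /=.
  rewrite ltnS leq_mul2l orbC -ltnS mN /= andbT.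
  apply/allP => t tps; rewrite Euclid_dvdM ?pps// negb_or (allP am)// andbT.
  rewrite (dvdn_prime2 (pps _ tps) pr); apply/eqP => tr; by rewrite -tr tps in rps.
rewrite big_map big_seq [RHS]big_seq; apply: eq_bigr => m.
by rewrite mem_filter mem_iota => /andP[_ /andP[m0 _]]; rewrite npowM.
Qed.

(** Euler product bounded below through the sieve: the integers prime to the
list have total mass [\prod (1 - r^-a)] times that of all integers, and at least
[1] is among them. *)
Lemma euler_prod_ge a ps B : 0 < a -> uniq ps -> (forall r, r \in ps -> prime r) ->
  (forall N, \sum_(1 <= n < N.+1) npow a n <= B) ->
  1 <= B * \prod_(r <- ps) (1 - npow a r).
Proof.
move=> a0 + + hB.
suff main : uniq ps -> (forall r, r \in ps -> prime r) ->
    forall N, sieve_sum a ps N <= B * \prod_(r <- ps) (1 - npow a r).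
  move=> up pps; apply: le_trans (main up pps 1%N).
  rewrite /sieve_sum /= big_cons big_nil npow1 addr0.
  suff -> : all (fun r => ~~ (r %| 1)%N) ps by [].
  by apply/allP => r /pps pr; rewrite Euclid_dvd1.
elim: ps => [|r ps IH] /=.
  move=> _ _ N; rewrite big_nil mulr1 /sieve_sum /=.
  by have := hB N; rewrite /index_iota subSS subn0.
move=> /andP[rps up] pps N.
have pr : prime r by apply: pps; rewrite mem_head.
have pps' t : t \in ps -> prime t by move=> h; apply: pps; rewrite inE h orbT.
have {}IH := IH up pps'.
rewrite big_cons mulrCA; set B' := B * _ in IH *.
pose E := [set sieve_sum a ps M | M in [set: nat]].
have hE : has_sup E.
  by split; [exists (sieve_sum a ps 0), 0%N|exists B' => _ [M _ <-]; exact: IH].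
have x1 : npow a r < 1 by rewrite npow_lt1// prime_gt1.
have x0 := npow_gt0 a r.
have supB : sup E <= B'.
  by apply: ge_sup; [exact: hE.1|move=> _ [M _ <-]; exact: IH].
have key M : sieve_sum a (r :: ps) N + npow a r * sieve_sum a ps M <= sup E.
  apply: (@le_trans _ _ (sieve_sum a ps (r * maxn N M))); last first.
    by apply: ub_le_sup; [exact: hE.2|exists (r * maxn N M)%N].
  apply: le_trans (sieve_sum_cons a (maxn N M) pr pps' rps).
  by rewrite lerD ?sieve_sum_mono ?leq_maxl// ler_pM2l// sieve_sum_mono ?leq_maxr.
have : sup E <= (sup E - sieve_sum a (r :: ps) N) / npow a r.
  apply: ge_sup; first exact: hE.1.
  by move=> _ [M _ <-]; rewrite ler_pdivlMr// lerBrDl mulrC.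
rewrite ler_pdivlMr// => h; apply: (@le_trans _ _ ((1 - npow a r) * sup E)); first lra.
by rewrite ler_wpM2l// subr_ge0 ltW.
Qed.

Definition smooth ps n := all (fun r => prime r ==> (r %| n)%N ==> (r \in ps)) (iota 0 n.+1).

Lemma smoothP ps n : (0 < n)%N ->
  reflect (forall r, prime r -> (r %| n)%N -> r \in ps) (smooth ps n).
Proof.
move=> n0; apply: (iffP allP) => [h r pr rn|h r _].
  have ri : r \in iota 0 n.+1 by rewrite mem_iota leq0n ltnS dvdn_leq.
  by have := h r ri; rewrite pr rn.
by apply/implyP => pr; apply/implyP; exact: h.
Qed.

Lemma smooth_nil n : (0 < n)%N -> smooth [::] n -> n = 1%N.
Proof.
move=> n0 /(smoothP _ n0) h; apply/eqP; rewrite eqn_leq n0 andbT leqNgt.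
by apply/negP => n1; have := h _ (pdiv_prime n1) (pdiv_dvd n).
Qed.

Lemma smooth_divr ps r m : (0 < m)%N -> (0 < r)%N -> smooth ps (r * m) -> smooth ps m.
Proof.
move=> m0 r0 /smoothP h; apply/smoothP => // t pt tm; apply: h => //.
  by rewrite muln_gt0 r0.
by rewrite dvdn_mull.
Qed.

Lemma smooth_sum_le a ps N : 0 < a -> (forall r, r \in ps -> prime r) ->
  (\prod_(r <- ps) (1 - npow a r)) * \sum_(n <- iota 1 N | smooth ps n) npow a n <= 1.
Proof.
move=> a0; elim: ps => [|r ps IH] pps.
  rewrite big_nil mul1r -big_filter; apply: (@le_trans _ _ (\sum_(n <- [:: 1%N]) npow a n)).
    apply: ler_sum_subset; [by rewrite filter_uniq ?iota_uniq| |by move=> ?; exact: npow_ge0].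
    move=> n; rewrite mem_filter mem_iota => /andP[sn /andP[n0 _]].
    by rewrite inE (smooth_nil n0 sn).
  by rewrite big_seq1 npow1.
have pr : prime r by apply: pps; rewrite mem_head.
have pps' t : t \in ps -> prime t by move=> h; apply: pps; rewrite inE h orbT.
have {}IH := IH pps'; have r0 := prime_gt0 pr.
have pos : 0 <= \prod_(t <- ps) (1 - npow a t).
  rewrite big_seq; apply: prodr_ge0 => t /pps' pt.
  by rewrite subr_ge0 ltW// npow_lt1// prime_gt1.
rewrite big_cons mulrAC mulrC; apply: le_trans IH.
rewrite ler_wpM2l//; set H := \sum_(_ <- _ | _) _.
suff : H <= \sum_(n <- iota 1 N | smooth ps n) npow a n + npow a r * H by lra.
rewrite {1}/H (bigID (fun n => (r %| n)%N))/= addrC; apply: lerD.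
  rewrite -[leLHS]big_filter -[leRHS]big_filter.
  apply: ler_sum_subset; [by rewrite filter_uniq ?iota_uniq| |by move=> ?; exact: npow_ge0].
  move=> n; rewrite !mem_filter mem_iota => /andP[/andP[sn rn] /andP[n0 ->]].
  rewrite n0 !andbT; apply/smoothP => // t pt tn; move/smoothP: sn => /(_ n0 t pt tn).
  by rewrite inE => /orP[/eqP tr|//]; rewrite -tr tn in rn.
rewrite /H mulr_sumr -[leLHS]big_filter -[leRHS]big_filter.
rewrite [leRHS](_ : _ = \sum_(n <- [seq (r * m)%N | m <- iota 1 N & smooth (r :: ps) m]) npow a n).
  apply: ler_sum_subset; [by rewrite filter_uniq ?iota_uniq| |by move=> ?; exact: npow_ge0].
  move=> n; rewrite mem_filter mem_iota => /andP[/andP[sn /dvdnP[m nE]] /andP[n0 nN]].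
  have m0 : (0 < m)%N by move: n0; rewrite nE muln_gt0 => /andP[].
  apply/mapP; exists m; last by rewrite nE mulnC.
  rewrite mem_filter mem_iota m0 (leq_ltn_trans _ nN) ?andbT//; last first.
    by rewrite nE leq_pmulr.
  by apply: (@smooth_divr _ r) => //; rewrite mulnC -nE.
rewrite big_map big_seq [RHS]big_seq; apply: eq_bigr => m.
by rewrite mem_filter mem_iota => /andP[_ /andP[m0 _]]; rewrite npowM.
Qed.

(** Every [n > 1] of the sum is [r * m] with [r] in the list and [m] smooth. *)
Lemma smooth_sum_kernel a ps s N (k : R -> R) B x : 0 < a ->
  (forall r, r \in ps -> prime r) -> uniq s ->
  (forall n, n \in s -> [/\ (1 < n)%N, (n < N)%N & smooth ps n]) ->
  (forall u, 0 <= k u) ->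
  (forall y, \sum_(r <- ps) npow a r * k (y - ln r%:R) <= B) ->
  (\prod_(r <- ps) (1 - npow a r)) * \sum_(n <- s) npow a n * k (x - ln n%:R) <= B.
Proof.
move=> a0 pps us hs k0 hB.
have B0 : 0 <= B.
  by apply: le_trans (hB 0); apply: sumr_ge0 => r _; rewrite mulr_ge0 ?npow_ge0.
have pos : 0 <= \prod_(t <- ps) (1 - npow a t).
  rewrite big_seq; apply: prodr_ge0 => t /pps pt.
  by rewrite subr_ge0 ltW// npow_lt1// prime_gt1.
pose t := [seq (r * m)%N | m <- [seq m <- iota 1 N | smooth ps m], r <- ps].
have le1 : \sum_(n <- s) npow a n * k (x - ln n%:R) <= \sum_(n <- t) npow a n * k (x - ln n%:R).
  apply: ler_sum_subset => //; last by move=> n; rewrite mulr_ge0 ?npow_ge0.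
  move=> n /hs[n1 nN sn]; have n0 := ltnW n1.
  have pd := pdiv_prime n1; have p0 := prime_gt0 pd; have dn := pdiv_dvd n.
  have nE : (pdiv n * (n %/ pdiv n) = n)%N by rewrite mulnC divnK.
  have m0 : (0 < n %/ pdiv n)%N by rewrite divn_gt0 ?prime_gt0// dvdn_leq.
  apply/allpairsP; exists ((n %/ pdiv n)%N, pdiv n) => /=; split => //.
    rewrite mem_filter mem_iota m0 (@smooth_divr _ (pdiv n)) ?nE//=.
    by rewrite add1n ltnS (leq_trans (leq_div _ _))// ltnW.
  by move/smoothP: sn => /(_ n0 _ pd dn).
apply: le_trans (ler_wpM2l pos le1) _.
rewrite /t big_allpairs_dep/= big_filter.
apply: (@le_trans _ _ ((\prod_(r <- ps) (1 - npow a r)) *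
   \sum_(m <- iota 1 N | smooth ps m) npow a m * B)); last first.
  rewrite -mulr_suml mulrA -[leRHS]mul1r ler_wpM2r//; exact: smooth_sum_le.
rewrite ler_wpM2l// big_seq_cond [leRHS]big_seq_cond; apply: ler_sum => m /andP[].
rewrite mem_iota => /andP[m0 _] _.
apply: le_trans (ler_wpM2l (npow_ge0 a m) (hB (x - ln m%:R))).
rewrite mulr_sumr big_seq [leRHS]big_seq; apply: ler_sum => r /pps pr.
have r0 := prime_gt0 pr; rewrite (npowM a r0 m0) natrM lnM ?posrE ?ltr0n//.
have -> : x - (ln r%:R + ln m%:R) = x - ln m%:R - ln r%:R by ring.
by rewrite mulrA [npow a m * _]mulrC.
Qed.

End DirichletWeights.

Section PrimeBlocks.
Variable R : realType.
Implicit Types (a x : R).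

Definition primes_in m n := [seq r <- index_iota m n | prime r].

Lemma primes_in_uniq m n : uniq (primes_in m n).
Proof. by rewrite filter_uniq ?iota_uniq. Qed.

Lemma mem_primes_in m n r : (r \in primes_in m n) = [&& prime r, (m <= r)%N & (r < n)%N].
Proof. by rewrite mem_filter mem_index_iota. Qed.

Lemma primes_in_prime m n r : r \in primes_in m n -> prime r.
Proof. by rewrite mem_primes_in => /and3P[]. Qed.

Lemma primes_in_cat l m n : (l <= m)%N -> (m <= n)%N ->
  primes_in l n = primes_in l m ++ primes_in m n.
Proof.
move=> lm mn; rewrite /primes_in -filter_cat /index_iota.
by rewrite (_ : (n - l = (m - l) + (n - m))%N) ?iotaD ?subnKC//; lia.
Qed.

Lemma expR_le_1D2 x : 0 <= x <= 2^-1 -> expR x <= 1 + 2 * x.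
Proof.
move=> /andP[x0 x1]; have := expR_ge1Dx (- x); have p0 := expR_gt0 x.
rewrite expRN => h; have : (1 - x) * expR x <= 1 by rewrite -ler_pdivlMr// div1r.
nra.
Qed.

Lemma npow_half a (r : nat) : 2^-1 <= a -> (1 < r)%N -> npow a r <= 3 / 4.
Proof.
move=> a2 r1; have r0 : (0 < r)%N by exact: ltnW.
apply: le_trans (npow_le r a2) _.
apply: le_sqr_nneg; first by lra.
rewrite expr2 -npowD (_ : 2^-1 + 2^-1 = 1 :> R); last by field.
rewrite npow_inv//; apply: (@le_trans _ _ 2^-1); last by lra.
by rewrite lef_pV2 ?posrE ?ltr0n// ler_nat.
Qed.

Lemma euler_factor x y : x <= 3 / 4 -> y <= x -> 1 - y <= (1 - x) * expR (4 * (x - y)).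
Proof.
move=> x1 yx; have := expR_ge1Dx (4 * (x - y)) => h.
apply: (@le_trans _ _ ((1 - x) * (1 + 4 * (x - y)))); first nra.
by rewrite ler_wpM2l//; lra.
Qed.

Lemma euler_prod_compare (ps : seq nat) (x y : nat -> R) :
  (forall r, r \in ps -> [/\ x r <= 3 / 4, y r <= x r & 0 <= y r]) ->
  \prod_(r <- ps) (1 - y r) <=
  (\prod_(r <- ps) (1 - x r)) * expR (4 * \sum_(r <- ps) (x r - y r)).
Proof.
elim: ps => [|r ps IH] h; first by rewrite !big_nil mulr0 expR0 mulr1.
have [x1 yx y0] := h r (mem_head _ _).
rewrite !big_cons mulrDr expRD mulrACA; apply: ler_pM.
- by lra.
- rewrite big_seq; apply: prodr_ge0 => t tps.
  by have [] := h t; [rewrite inE tps orbT|lra].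
- exact: euler_factor.
by apply: IH => t tps; apply: h; rewrite inE tps orbT.
Qed.

Section block.
Variables (J : nat) (J0 : (0 < J)%N).
Let lam : R := J%:R * ln 2.

Let J1 : 1 <= J%:R :> R. Proof. by rewrite ler1n. Qed.

Lemma block_scale_ge : 2^-1 <= lam.
Proof. by have := @ln2_ge R; rewrite /lam; have := J1; nra. Qed.

Let lam_gt0 : 0 < lam. Proof. by have := block_scale_ge; lra. Qed.

Lemma ln_block m (r : nat) : (0 < r)%N -> (2 ^ m <= r)%N -> m%:R * ln 2 <= ln (r%:R : R).
Proof.
move=> r0 h; have -> : m%:R * ln 2 = ln ((2 ^ m)%:R) :> R by rewrite ln_natX.
by rewrite ler_ln ?posrE ?ltr0n ?expn_gt0// ler_nat.
Qed.

Lemma ln_block_le m (r : nat) : (0 < r)%N -> (r <= 2 ^ m)%N -> ln (r%:R : R) <= m%:R * ln 2.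
Proof.
move=> r0 h; have -> : m%:R * ln 2 = ln ((2 ^ m)%:R) :> R by rewrite ln_natX.
by rewrite ler_ln ?posrE ?ltr0n ?expn_gt0// ler_nat.
Qed.

Lemma exponent_half a : 1 - (4 * lam)^-1 <= a -> 2^-1 <= a.
Proof.
have := block_scale_ge => l2 h; apply: le_trans h.
have : (4 * lam)^-1 <= 2^-1 by rewrite lef_pV2 ?posrE//; lra.
lra.
Qed.

Definition past_const : R := 3 * expR 18.

(** Mertens' upper bound for the Euler product, at all exponents down to
[1 - 1 / (4 lam)]: compare with the exponent [1 + 1 / lam]. *)
Lemma euler_past a : 1 - (4 * lam)^-1 <= a ->
  1 <= past_const * lam * \prod_(r <- primes_in 0 (2 ^ J)) (1 - npow a r).
Proof.
move=> ha; set ps := primes_in _ _.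
pose a' := 1 - (4 * lam)^-1; pose b := 1 + lam^-1.
have l2 := block_scale_ge.
have a'2 : 2^-1 <= a' by exact: exponent_half.
have r1 r : r \in ps -> (1 < r)%N by move=> /primes_in_prime /prime_gt1.
have ab : a' <= b.
  have i1 : 0 < (4 * lam)^-1 by rewrite invr_gt0 mulr_gt0.
  by have i2 : 0 < lam^-1; [rewrite invr_gt0|rewrite /a' /b; lra].
have mono : \prod_(r <- ps) (1 - npow a' r) <= \prod_(r <- ps) (1 - npow a r).
  rewrite big_seq [leRHS]big_seq; apply: ler_prod => r /r1 h1.
  by rewrite subr_ge0 ltW ?npow_lt1//= ?lerD2l ?lerN2 ?npow_le//; lra.
have p3 : 0 <= 3 * lam by rewrite mulr_ge0// ltW.
apply: (@le_trans _ _ (past_const * lam * \prod_(r <- ps) (1 - npow a' r))); last first.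
  by apply: ler_wpM2l mono; rewrite /past_const mulrAC mulr_ge0 ?expR_ge0.
have hz : 1 <= (1 + lam) * \prod_(r <- ps) (1 - npow b r).
  have : forall N, \sum_(1 <= n < N.+1) npow b n <= 1 + lam.
    by move=> N; rewrite -[in leRHS](invrK lam) sum_npow_le// invr_gt0.
  apply: euler_prod_ge => //.
  - by rewrite /b addr_gt0// invr_gt0.
  - exact: primes_in_uniq.
  - by move=> r /primes_in_prime.
apply: le_trans hz _.
have sumd : \sum_(r <- ps) (npow a' r - npow b r) <= 9 / 2.
  apply: (@le_trans _ _ (\sum_(r <- ps) (3 / (2 * lam)) * (ln r%:R / r%:R))).
    rewrite big_seq [leRHS]big_seq; apply: ler_sum => r rps.
    have r0 : (0 < r)%N by apply: ltnW; exact: r1.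
    set t := ln r%:R / lam.
    have t0 : 0 <= t by rewrite divr_ge0 ?ln_nat_ge0// ltW.
    have t1 : t <= 1.
      rewrite ler_pdivrMr// mul1r; apply: ln_block_le => //.
      by move: rps; rewrite mem_primes_in => /and3P[_ _ /ltnW].
    have -> : npow a' r = (r%:R)^-1 * expR (t / 4).
      rewrite -npow_inv// /npow -expRD; congr expR; rewrite /a' /t; field.
      by rewrite lt0r_neq0.
    have -> : npow b r = (r%:R)^-1 * expR (- t).
      rewrite -npow_inv// /npow -expRD; congr expR; rewrite /b /t; field.
      by rewrite lt0r_neq0.
    have -> : 3 / (2 * lam) * (ln r%:R / r%:R) = (r%:R)^-1 * (3 / 2 * t).
      by rewrite /t; field; rewrite ?lt0r_neq0 ?ltr0n.
    rewrite -mulrBr ler_wpM2l ?invr_ge0//.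
    have : expR (t / 4) <= 1 + 2 * (t / 4) by apply: expR_le_1D2; apply/andP; split; lra.
    have := expR_ge1Dx (- t); lra.
  rewrite -mulr_sumr /ps /primes_in big_filter.
  have := @sum_ln_div_primes R J; set S := \sum_(_ <= _ < _ | _) _ => hS.
  have -> : 9 / 2 = 3 / (2 * lam) * (3 * ln 2 * J%:R).
    rewrite -[3 * ln 2 * J%:R]mulrA (mulrC (ln 2)) -/lam; field; exact: lt0r_neq0.
  by rewrite ler_wpM2l// divr_ge0//; lra.
have cmp := @euler_prod_compare ps (npow a') (npow b).
apply: (@le_trans _ _ ((1 + lam) * ((\prod_(r <- ps) (1 - npow a' r)) * expR 18))).
  rewrite ler_wpM2l//; first by lra.
  apply: le_trans (cmp _) _.
    move=> r /r1 h1; split; [exact: npow_half|exact: npow_le|exact: npow_ge0].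
  rewrite ler_wpM2l//; last by rewrite ler_expR; lra.
  rewrite big_seq; apply: prodr_ge0 => r /r1 h1.
  by rewrite subr_ge0 ltW// npow_lt1//; lra.
set Q := \prod_(_ <- _) _.
have Q0 : 0 <= Q.
  rewrite /Q big_seq; apply: prodr_ge0 => r /r1 h1.
  by rewrite subr_ge0 ltW// npow_lt1//; lra.
rewrite (_ : past_const * lam * Q = 3 * lam * (Q * expR 18)).
  by rewrite ler_wpM2r ?mulr_ge0 ?expR_ge0//; lra.
by rewrite /past_const; ring.
Qed.

Let ps := primes_in (2 ^ J) (2 ^ (8 * J)).

Let ps_prime r : r \in ps -> prime r. Proof. exact: primes_in_prime. Qed.

Let ps_gt1 r : r \in ps -> (1 < r)%N. Proof. by move=> /ps_prime /prime_gt1. Qed.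

Lemma npow_block a r : 1 - (4 * lam)^-1 <= a -> r \in ps ->
  npow a r <= expR 2 * expR (- (lam * (a - 1))) * (r%:R)^-1.
Proof.
move=> ha rps; have r0 : (0 < r)%N by exact: ltnW (ps_gt1 rps).
move: rps; rewrite mem_primes_in => /and3P[_ rJ rK].
have l1 : lam <= ln r%:R by exact: ln_block.
have l2 : ln (r%:R : R) <= 8 * lam.
  by have := ln_block_le r0 (ltnW rK); rewrite natrM -mulrA.
rewrite -npow_inv// /npow -!expRD ler_expR.
suff : (1 - a) * (ln r%:R - lam) <= 2 by nra.
have [a1|a1] := leP 1 a; first by nra.
have : (1 - a) * (4 * lam) <= 1.
  by rewrite -ler_pdivlMr ?div1r; [lra|have := lam_gt0; lra].
nra.
Qed.

Lemma block_decay_le a : 1 - (4 * lam)^-1 <= a -> expR (- (lam * (a - 1))) <= expR 1.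
Proof.
move=> ha; rewrite ler_expR.
have : (1 - a) * (4 * lam) <= 1.
  by rewrite -ler_pdivlMr ?div1r; [lra|have := lam_gt0; lra].
nra.
Qed.

Lemma sum_inv_block : \sum_(r <- ps) (r%:R : R)^-1 <= 21.
Proof.
rewrite /ps /primes_in big_filter sum_dyadic ?leq_pmull//.
apply: (@le_trans _ _ (\sum_(J <= j < 8 * J) 3 / J%:R)).
  rewrite big_nat_cond [leRHS]big_nat_cond; apply: ler_sum => j /andP[/andP[Jj _] _].
  apply: le_trans (dyadic_inv_primes R (leq_trans J0 Jj)) _.
  by rewrite ler_wpM2l// lef_pV2 ?posrE ?ltr0n ?(leq_trans J0 Jj)// ler_nat.
rewrite big_const_nat iter_addr_0 -[leLHS]mulr_natr natrB ?leq_pmull// natrM.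
have := J1; set j := J%:R => j1.
by rewrite (_ : 3 / j * (8 * j - j) = 21)//; field; rewrite lt0r_neq0//; lra.
Qed.

Definition block_const : R := expR (4 * (expR 3 * 21)).

Lemma euler_block a : 1 - (4 * lam)^-1 <= a ->
  1 <= block_const * \prod_(r <- ps) (1 - npow a r).
Proof.
move=> ha; have a2 := exponent_half ha.
have := @euler_prod_compare ps (npow a) (fun=> 0).
rewrite big1 => [|i _]; last by rewrite subr0.
move=> h; apply: le_trans (h _) _.
  move=> r /ps_gt1 r1; split; [exact: npow_half|exact: npow_ge0|by []].
rewrite mulrC ler_wpM2r//.
  rewrite big_seq; apply: prodr_ge0 => r /ps_gt1 r1.
  by rewrite subr_ge0 ltW// npow_lt1//; lra.
rewrite ler_expR ler_pM2l//.
apply: (@le_trans _ _ (\sum_(r <- ps) expR 3 * (r%:R)^-1)); last first.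
  by rewrite -mulr_sumr ler_pM2l ?expR_gt0// sum_inv_block.
rewrite big_seq [leRHS]big_seq; apply: ler_sum => r rps; rewrite subr0.
apply: le_trans (npow_block ha rps) _; rewrite ler_wpM2r ?invr_ge0//.
rewrite (_ : 3 = 2 + 1 :> R) ?expRD ?ler_wpM2l ?expR_ge0//; last by ring.
exact: block_decay_le.
Qed.

Definition block_mass : R := block_const * (expR 2 * 288).

Section sums.
Variables (a : R) (ha : 1 - (4 * lam)^-1 <= a) (s : seq nat) (us : uniq s).
Hypothesis hs : forall n, n \in s -> (1 < n)%N /\ smooth ps n.

Let decay := expR (- (lam * (a - 1))).

Let kernel_bound (k : R -> R) B : (forall u, 0 <= k u) ->
  (forall y, \sum_(r <- ps) (r%:R)^-1 * k (y - ln r%:R) <= B) ->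
  forall x, \sum_(n <- s) npow a n * k (x - ln n%:R) <= block_const * (expR 2 * decay * B).
Proof.
move=> k0 hB x; have a0 : 0 < a by have := exponent_half ha; lra.
pose N := (\max_(n <- s) n).+1.
have hk y : \sum_(r <- ps) npow a r * k (y - ln r%:R) <= expR 2 * decay * B.
  apply: (@le_trans _ _ (\sum_(r <- ps) expR 2 * decay * ((r%:R)^-1 * k (y - ln r%:R)))).
    rewrite big_seq [leRHS]big_seq; apply: ler_sum => r rps.
    by rewrite mulrA ler_wpM2r//; exact: npow_block.
  by rewrite -mulr_sumr ler_wpM2l// mulr_ge0 ?expR_ge0.
have := @smooth_sum_kernel R a ps s N k _ x a0 ps_prime us _ k0 hk.
set P := \prod_(_ <- _) _; set S := \sum_(_ <- s) _ => h.
have {}h : P * S <= expR 2 * decay * B.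
  apply: h => n ns; have [n1 sn] := hs ns; split=> //.
  by rewrite ltnS; exact: leq_bigmax_seq.
have S0 : 0 <= S by apply: sumr_ge0 => n _; rewrite mulr_ge0 ?npow_ge0.
apply: (@le_trans _ _ (block_const * (P * S))); last by rewrite ler_pM2l ?expR_gt0.
by rewrite mulrA ler_peMl//; exact: euler_block.
Qed.

Lemma block_sum_kernel x :
  \sum_(n <- s) npow a n * (1 + (x - ln n%:R) ^+ 2)^-1 <= block_mass * decay / lam.
Proof.
have k0 (u : R) : 0 <= (1 + u ^+ 2)^-1 by rewrite invr_ge0 addr_ge0// sqr_ge0.
apply: le_trans (kernel_bound (B := 288 / J%:R) k0 _ x) _.
  by move=> y; rewrite /ps /primes_in big_filter; exact: prime_window.
have -> : block_mass * decay / lam = block_const * (expR 2 * decay * (288 / lam)).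
  by rewrite /block_mass; move: decay lam_gt0 => d l0; field; rewrite lt0r_neq0.
rewrite ler_pM2l ?expR_gt0// ler_pM2l ?mulr_gt0 ?expR_gt0// ler_pM2l//.
rewrite lef_pV2 ?posrE//; first by rewrite /lam; have := @ln2_le1 R; have := J1; nra.
by have := J1; lra.
Qed.

Lemma block_sum_npow : \sum_(n <- s) npow a n <= block_mass * decay.
Proof.
have h := kernel_bound (k := fun=> 1) (B := 21) (fun=> ler01) _ 0.
have -> : \sum_(n <- s) npow a n = \sum_(n <- s) npow a n * 1.
  by apply: eq_bigr => n _; rewrite mulr1.
apply: le_trans (h _) _.
  by move=> y; under eq_bigr do rewrite mulr1; exact: sum_inv_block.
have -> : block_mass * decay = block_const * (expR 2 * decay * 288).
  by rewrite /block_mass; move: decay => d; ring.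
by rewrite ler_pM2l ?expR_gt0// ler_pM2l ?mulr_gt0 ?expR_gt0// ler_nat.
Qed.

End sums.
End block.
End PrimeBlocks.

Section ConvexPowers.
Variable R : realType.
Implicit Types (q u v w y h s t : R).

Lemma le_powR q s t : 0 <= q -> 0 <= s -> s <= t -> s `^ q <= t `^ q.
Proof.
by move=> q0 s0 st; apply: ge0_ler_powR => //; rewrite nnegrE// (le_trans s0).
Qed.

Lemma powR_tangent q u v : 1 <= q -> 0 <= u -> 0 <= v ->
  u `^ q + q * u `^ (q - 1) * (v - u) <= v `^ q.
Proof.
move=> q1 u0 v0; have q0 : 0 < q by lra.
have key : q * (u `^ (q - 1) * v) <= v `^ q + (q - 1) * u `^ q.
  move: q1; rewrite le_eqVlt => /predU1P[<-|q1].
    by rewrite subrr powRr0 mul0r addr0 !mul1r powRr1.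
  have q10 : 0 < q - 1 by lra.
  have qq : q / (q - 1) > 0 by rewrite divr_gt0.
  have := @conjugate_powR R v (u `^ (q - 1)) q (q / (q - 1)) v0 (powR_ge0 _ _) q0 qq.
  rewrite -powRrM (_ : (q - 1) * (q / (q - 1)) = q); last by field; rewrite lt0r_neq0.
  have -> : q^-1 + (q / (q - 1))^-1 = 1 by field; rewrite !lt0r_neq0.
  move=> /(_ erefl) h.
  rewrite [u `^ _ * v]mulrC (le_trans (ler_wpM2l (ltW q0) h))//.
  by rewrite le_eqVlt; apply/orP; left; apply/eqP; field; rewrite !lt0r_neq0.
have := mulr_powRB1 u0 q0; nra.
Qed.

Lemma powR_superadditive q s t : 1 <= q -> 0 <= s -> 0 <= t ->
  s `^ q + t `^ q <= (s + t) `^ q.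
Proof.
move=> q1 s0 t0; have q0 : 0 < q by lra.
rewrite -!(mulr_powRB1 _ q0)// ?addr_ge0// mulrDl.
by apply: lerD; rewrite ler_wpM2l// le_powR//; lra.
Qed.

Lemma powR_sum2_le q s t : 0 <= q -> 0 <= s -> 0 <= t ->
  (s + t) `^ q <= 2 `^ q * (s `^ q + t `^ q).
Proof.
move=> q0 s0 t0; have [st|/ltW ts] := leP s t.
  apply: (@le_trans _ _ ((2 * t) `^ q)).
    by apply: le_powR; lra.
  by rewrite powRM// ler_wpM2l ?powR_ge0// lerDr powR_ge0.
apply: (@le_trans _ _ ((2 * s) `^ q)).
  by apply: le_powR; lra.
by rewrite powRM// ler_wpM2l ?powR_ge0// lerDl powR_ge0.
Qed.

Lemma powR_split q x : 1 <= q -> 0 <= x -> x `^ q = x `^ (q - 1) * x.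
Proof. by move=> q1 x0; rewrite mulrC mulr_powRB1//; lra. Qed.

Definition conv_lo q : R := (24 `^ q)^-1.

Lemma conv_lo_gt0 q : 0 < conv_lo q.
Proof. by rewrite invr_gt0 powR_gt0. Qed.

(** Clarkson-type strengthening of convexity: [u], [h], [y] stand for [|a|^2],
[2 Re (conj a * b)] and [|b|^2], so that [u + h + y] is [|a + b|^2]. *)
Lemma powR_expand_ge q u h y : 1 <= q -> 0 <= u -> 0 <= y -> h ^+ 2 <= 4 * u * y ->
  u `^ q + q * u `^ (q - 1) * h + conv_lo q * (u `^ (q - 1) * y + y `^ q) <=
  (u + h + y) `^ q.
Proof.
move=> q1 u0 y0 hh; have q0 : 0 < q by lra.
have uq0 := powR_ge0 u (q - 1).
have w0 : 0 <= u + h + y.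
  have : - h <= u + y.
    by apply: le_sqr_nneg; [lra|rewrite sqrrN; have := sqr_ge0 (u - y); nra].
  lra.
have c0 := conv_lo_gt0 q.
have c1 : conv_lo q * 12 `^ q <= 2 `^ (- q).
  rewrite /conv_lo (_ : 24 = 2 * 12 :> R); last by ring.
  by rewrite powRM// invfM powRN mulfVK// gt_eqF// powR_gt0.
have half : 2 `^ (- q) <= 2^-1 :> R.
  rewrite powRN lef_pV2 ?posrE ?powR_gt0// -[leLHS]powRr1//.
  by rewrite ler_powR ?ler1n.
have c2 : conv_lo q <= 2 `^ (- q).
  have h12 : 1 <= 12 `^ q :> R by rewrite -[leLHS](powRr0 12) ler_powR ?ler1n ?ltW.
  by apply: le_trans c1; rewrite ler_peMr// ltW.
have [s0|s0] := leP 0 (u + h + y / 2).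
  have := powR_superadditive q1 s0 (_ : 0 <= y / 2).
  rewrite (_ : _ + y / 2 + y / 2 = u + h + y); last by field.
  move=> /(_ ltac:(lra)) sup; apply: le_trans sup.
  have tg := powR_tangent q1 u0 s0.
  have -> : (y / 2) `^ q = 2 `^ (- q) * y `^ q.
    by rewrite powRM ?invr_ge0// -powR_inv1// -powRrM mulN1r mulrC.
  have e1 : conv_lo q * y `^ q <= 2 `^ (- q) * y `^ q by rewrite ler_wpM2r ?powR_ge0.
  have e2 : conv_lo q * (u `^ (q - 1) * y) <= q / 2 * (u `^ (q - 1) * y).
    by rewrite ler_wpM2r ?mulr_ge0//; lra.
  nra.
have y12 : y <= 12 * u.
  have h0 : h < 0 by lra.
  have : (u + y / 2) ^+ 2 <= h ^+ 2 by nra.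
  nra.
have tg := powR_tangent q1 u0 w0.
have e1 : y `^ q <= 12 `^ q * (u `^ (q - 1) * y).
  rewrite powR_split// mulrA ler_wpM2r//.
  apply: (@le_trans _ _ ((12 * u) `^ (q - 1))).
    by apply: le_powR; lra.
  by rewrite powRM// ler_wpM2r// ler_powR ?ler1n//; lra.
have e2 : conv_lo q * y `^ q <= 2^-1 * (u `^ (q - 1) * y).
  apply: (@le_trans _ _ (conv_lo q * (12 `^ q * (u `^ (q - 1) * y)))).
    by rewrite ler_pM2l.
  by rewrite mulrA ler_wpM2r ?mulr_ge0//; lra.
have e3 : conv_lo q * (u `^ (q - 1) * y) <= 2^-1 * (u `^ (q - 1) * y).
  by rewrite ler_wpM2r ?mulr_ge0//; lra.
have e4 : u `^ (q - 1) * y <= q * (u `^ (q - 1) * y) by rewrite ler_peMl ?mulr_ge0.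
nra.
Qed.

Lemma expR_taylor2 (x : R) : expR x <= 1 + x + x ^+ 2 * expR `|x|.
Proof.
have h1 := expR_ge1Dx x; have h2 := expR_ge1Dx (- x); rewrite expRN in h2.
have p0 := expR_gt0 x.
have h3 : (1 - x) * expR x <= 1 by rewrite -ler_pdivlMr// div1r.
have [x0|x0] := leP 0 x; first by rewrite ger0_norm//; nra.
have : 1 <= expR `|x| by rewrite -expR0 ler_expR.
have := sqr_ge0 x; nra.
Qed.

Lemma powR_quadratic q s : 1 <= q -> -1 <= s <= 3 ->
  (1 + s) `^ q <= 1 + q * s + (q ^+ 2 * expR (3 * q)) * s ^+ 2.
Proof.
move=> q1 /andP[s1 s3].
apply: (@le_trans _ _ (expR (q * s))).
  have -> : expR (q * s) = expR s `^ q by rewrite /powR gt_eqF ?expR_gt0// expRK.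
  by apply: le_powR; [lra|lra|exact: expR_ge1Dx].
apply: le_trans (expR_taylor2 _) _; rewrite lerD2l exprMn mulrAC.
rewrite ler_wpM2r ?sqr_ge0// ler_wpM2l ?sqr_ge0// ler_expR normrM ger0_norm; last lra.
by rewrite mulrC ler_wpM2r ?ler_norml; [|lra|apply/andP; split; lra].
Qed.

Definition conv_hi q : R := q + 10 * (q ^+ 2 * expR (3 * q)) + 4 `^ q + 2 * q.

Lemma powR_expand_le q u h y : 1 <= q -> 0 < u -> 0 <= y -> h ^+ 2 <= 4 * u * y ->
  (u + h + y) `^ q <=
  u `^ q + q * u `^ (q - 1) * h + conv_hi q * (u `^ (q - 1) * y + y `^ q).
Proof.
move=> q1 u0 y0 hh; have q0 : 0 < q by lra.
have uq0 := powR_ge0 u (q - 1); have yq0 := powR_ge0 y q.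
have w0 : 0 <= u + h + y.
  have : - h <= u + y.
    by apply: le_sqr_nneg; [lra|rewrite sqrrN; have := sqr_ge0 (u - y); nra].
  lra.
have c0 : 0 <= q ^+ 2 * expR (3 * q) by rewrite mulr_ge0 ?sqr_ge0 ?expR_ge0.
have c4 := powR_ge0 4 q.
set E := q ^+ 2 * _ in c0 *.
have [yu|uy] := leP y u.
  have hu : `|h| <= 2 * u.
    by apply: le_sqr_nneg; [lra|rewrite real_normK ?num_real//; nra].
  move: hu; rewrite ler_norml => /andP[h1 h2].
  pose s := (h + y) / u.
  have sE : u * s = h + y by rewrite /s mulrC divfK// gt_eqF.
  have s13 : -1 <= s <= 3.
    rewrite /s ler_pdivlMr// ler_pdivrMr//; apply/andP; split; last lra.
    suff : 0 <= u + h + y by lra.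
    exact: w0.
  have -> : u + h + y = u * (1 + s) by rewrite mulrDr sE; ring.
  have s1 : 0 <= 1 + s by have /andP[? ?] := s13; lra.
  rewrite (powRM _ (ltW u0) s1).
  apply: le_trans (ler_wpM2l (powR_ge0 _ _) (powR_quadratic q1 s13)) _.
  rewrite -/E (powR_split q1 (ltW u0)).
  have -> : u `^ (q - 1) * u * (1 + q * s + E * s ^+ 2) =
    u `^ (q - 1) * u + q * u `^ (q - 1) * (u * s) + u `^ (q - 1) * E * (u * s ^+ 2) by ring.
  have us2 : u * s ^+ 2 <= 10 * y.
    rewrite -(ler_pM2l u0).
    have -> : u * (u * s ^+ 2) = (u * s) ^+ 2 by ring.
    rewrite sE; have := sqr_ge0 (h - y); nra.
  rewrite sE -!addrA lerD2l mulrDr -addrA lerD2l.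
  have : u `^ (q - 1) * E * (u * s ^+ 2) <= u `^ (q - 1) * E * (10 * y).
    by apply: ler_wpM2l us2; exact: mulr_ge0.
  have : 0 <= u `^ (q - 1) * y by rewrite mulr_ge0.
  rewrite /conv_hi -/E; nra.
have hy : `|h| <= 2 * y.
  by apply: le_sqr_nneg; [lra|rewrite real_normK ?num_real//; nra].
move: hy; rewrite ler_norml => /andP[h1 h2].
have e1 : (u + h + y) `^ q <= 4 `^ q * y `^ q.
  by rewrite -powRM//; apply: le_powR; lra.
have e2 : u `^ (q - 1) * y <= y `^ q.
  by rewrite (powR_split q1 y0) ler_wpM2r//; apply: le_powR; lra.
have e3 : - (2 * q * y `^ q) <= q * u `^ (q - 1) * h.
  apply: (@le_trans _ _ (- (2 * q * (u `^ (q - 1) * y)))); first by nra.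
  have : 0 <= q * u `^ (q - 1) by rewrite mulr_ge0// ltW.
  nra.
have e4 := powR_ge0 u q.
have e5 : 0 <= u `^ (q - 1) * y by rewrite mulr_ge0.
rewrite /conv_hi -/E; nra.
Qed.

End ConvexPowers.

Section Jensen.
Variable R : realType.
Local Notation point := (nat -> R[i]).

Lemma tmean_ge0 ps (g : point -> R) z : uniq ps -> nice g -> in_disc z ->
  (forall u, torus_pt ps z u -> 0 <= g u) -> 0 <= tmean ps g z.
Proof.
move=> ups ng zd h; rewrite -(tmean_cst ps 0 z).
exact: le_tmean (nice_cst 0) ng zd h.
Qed.

Lemma tmean_jensen ps (g : point -> R) (q : R) z : 1 <= q -> uniq ps -> nice g ->
  (forall u, 0 <= g u) -> in_disc z ->
  (tmean ps g z) `^ q <= tmean ps (fun u => g u `^ q) z.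
Proof.
move=> q1 ups ng g0 zd; set m := tmean ps g z.
have m0 : 0 <= m by apply: tmean_ge0.
have q0 : 0 <= q by lra.
apply: (@le_trans _ _ (tmean ps (fun u => (m `^ q - q * m `^ (q - 1) * m) +
    q * m `^ (q - 1) * g u) z)).
  rewrite tmeanD//; [|exact: nice_cst|exact: niceZ].
  by rewrite tmean_cst tmeanZ// -/m subrK.
apply: le_tmean => //.
- by apply: niceD; [exact: nice_cst|exact: niceZ].
- exact: nice_powR.
move=> u _; apply: le_trans (powR_tangent q1 m0 (g0 u)).
by rewrite mulrBr addrAC addrA.
Qed.

End Jensen.

Section BlockPart.
Implicit Types (P B : seq nat) (n m r : nat).

Definition bpart B n := (\prod_(r <- B) r ^ logn r n)%N.

Lemma bpart_gt0 B n : (forall r, r \in B -> prime r) -> (0 < bpart B n)%N.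
Proof.
move=> pB; rewrite /bpart big_seq; elim/big_ind: _ => [//|x y x0 y0|r /pB pr].
  by rewrite muln_gt0 x0.
by rewrite expn_gt0 prime_gt0.
Qed.

Lemma logn_bpart B n r : (forall t, t \in B -> prime t) -> uniq B ->
  logn r (bpart B n) = if r \in B then logn r n else 0%N.
Proof.
rewrite /bpart; elim: B => [|t B IH] pB; first by rewrite big_nil logn1.
move=> /= /andP[tB uB]; have pt := pB t (mem_head _ _).
have pB' u : u \in B -> prime u by move=> h; apply: pB; rewrite inE h orbT.
have b0 := bpart_gt0 n pB'; have p0 : (0 < t ^ logn t n)%N by rewrite expn_gt0 prime_gt0.
rewrite big_cons (lognM _ p0 b0) IH//.
rewrite inE; have [->|rt] /= := eqVneq r t.
  by rewrite (negbTE tB) addn0 pfactorK.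
suff -> : logn r (t ^ logn t n) = 0%N by [].
rewrite lognX; have [pr|npr] := boolP (prime r); last by rewrite /logn (negbTE npr) muln0.
by rewrite (lognE r) pr (prime_gt0 pt) /= dvdn_prime2// (negbTE rt) muln0.
Qed.

Lemma bpart_id B n : (forall t, t \in B -> prime t) -> uniq B -> (0 < n)%N ->
  smooth B n -> bpart B n = n.
Proof.
move=> pB uB n0 /(smoothP _ n0) sn; have b0 := bpart_gt0 n pB.
apply: eqn_from_log => // r; rewrite logn_bpart//; case: ifP => // rB.
apply/esym; rewrite lognE; case: ifP => // /and3P[pr _ rn].
by rewrite sn in rB.
Qed.

Lemma smooth_bpart B n : (forall t, t \in B -> prime t) -> uniq B -> smooth B (bpart B n).
Proof.
move=> pB uB; have b0 := bpart_gt0 n pB; apply/smoothP => // r pr rb.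
have : (0 < logn r (bpart B n))%N by rewrite logn_gt0 mem_primes pr b0.
by rewrite logn_bpart//; case: ifP.
Qed.

Lemma smooth_logn P n r : (0 < n)%N -> smooth P n -> r \notin P -> logn r n = 0%N.
Proof.
move=> n0 /(smoothP _ n0) sn rP; apply/eqP; rewrite -leqn0 leqNgt logn_gt0 mem_primes.
by apply: contra rP => /and3P[pr _ rn]; exact: sn.
Qed.

Lemma smooth_sub P Q n : (0 < n)%N -> {subset P <= Q} -> smooth P n -> smooth Q n.
Proof.
by move=> n0 PQ /(smoothP _ n0) sn; apply/smoothP => // r pr rn; apply/PQ/sn.
Qed.

End BlockPart.

Section Blocks.
Variable R : realType.
Local Notation C := R[i].
Local Notation Re := complex.Re.
Local Notation Im := complex.Im.
Local Notation point := (nat -> C).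
Implicit Types (P B : seq nat) (z u : point).

Definition mon P n z : C := \prod_(r <- P) z r ^+ logn r n.

Lemma cnice_mon P n : cnice (mon P n).
Proof. by apply: cnice_prod => r _; apply/cniceX/cnice_coord. Qed.

Lemma mon_cat P B n z : mon (P ++ B) n z = mon P n z * mon B n z.
Proof. exact: big_cat. Qed.

Lemma eq_mon P n z u : (forall r, r \in P -> z r = u r) -> mon P n z = mon P n u.
Proof. by move=> zu; rewrite /mon big_seq [RHS]big_seq; apply: eq_bigr => r /zu ->. Qed.

Lemma mon_bpart B n z : (forall t, t \in B -> prime t) -> uniq B ->
  mon B (bpart B n) z = mon B n z.
Proof.
move=> pB uB; rewrite /mon big_seq [RHS]big_seq; apply: eq_bigr => r rB.
by rewrite logn_bpart// rB.
Qed.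

Lemma mon_coprime P B n z : (0 < n)%N -> smooth P n -> (forall r, r \in B -> r \notin P) ->
  mon B n z = 1.
Proof.
move=> n0 sn BP; rewrite /mon big_seq big1// => r /BP rP.
by rewrite (smooth_logn n0 sn rP).
Qed.

Lemma torus_in_disc P z u : in_disc z -> torus_pt P z u -> in_disc u.
Proof.
move=> zd [h1 h2] r; have [rP|rP] := boolP (r \in P); first by rewrite h1.
by rewrite h2.
Qed.

Lemma sqnE_ReJ (w : C) : sqn w = Re (w * (w^*)%C).
Proof. by rewrite mulJc. Qed.

Lemma ReJ_mul_sum (M : seq nat) (c w : nat -> C) :
  sqn (\sum_(m <- M) c m * w m) =
  \sum_(m <- M) \sum_(k <- M) Re ((c m * (c k)^*%C) * (w m * (w k)^*%C)).
Proof.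
rewrite sqnE_ReJ rmorph_sum mulr_suml Re_sum; apply: eq_bigr => m _.
rewrite mulr_sumr Re_sum; apply: eq_bigr => k _.
by congr Re; rewrite rmorphM/= mulrACA.
Qed.

(** Parseval for a polynomial whose monomials have distinct exponents. *)
Lemma tmean_parseval B (M : seq nat) (c : nat -> C) z : uniq B -> uniq M ->
  (forall t, t \in B -> prime t) ->
  (forall m, m \in M -> (0 < m)%N /\ smooth B m) -> in_disc z ->
  tmean B (fun u => sqn (\sum_(m <- M) c m * mon B m u)) z = \sum_(m <- M) sqn (c m).
Proof.
move=> uB uM pB hM zd.
have nt m k : nice (fun u => Re ((c m * (c k)^*%C) * (mon B m u * (mon B k u)^*%C))).
  apply: nice_Re; apply: cniceM; first exact: cnice_cst.
  by apply: cniceM; [exact: cnice_mon|apply: cniceJ; exact: cnice_mon].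
rewrite (eq_tmean (h := fun u => \sum_(m <- M) \sum_(k <- M)
   Re ((c m * (c k)^*%C) * (mon B m u * (mon B k u)^*%C))) uB); last first.
  by move=> u _; rewrite ReJ_mul_sum.
rewrite tmean_sum//; last by move=> m _; apply: nice_sum => k _.
rewrite big_seq [RHS]big_seq; apply: eq_bigr => m mM.
rewrite tmean_sum// (bigD1_seq m)//= big_seq_cond big1 ?addr0.
  rewrite (eq_tmean (h := fun u => Re ((c m * (c m)^*%C) * \prod_(r <- B)
     (u r ^+ logn r m * (u r)^*%C ^+ logn r m))) uB); last first.
    by move=> u _; rewrite big_split/= -/(mon B m u) rmorph_prod; congr (Re (_ * (_ * _)));
      apply: eq_bigr => r _; rewrite rmorphXn.
  by rewrite tmean_monomial// (introT allP) ?mulJc.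
move=> k /andP[kM km].
rewrite (eq_tmean (h := fun u => Re ((c m * (c k)^*%C) * \prod_(r <- B)
     (u r ^+ logn r m * (u r)^*%C ^+ logn r k))) uB); last first.
  by move=> u _; rewrite big_split/= -/(mon B m u) rmorph_prod; congr (Re (_ * (_ * _)));
    apply: eq_bigr => r _; rewrite rmorphXn.
rewrite tmean_monomial//; case: ifP => // /allP h; exfalso; move/eqP: km; apply.
have [[m0 sm] [k0 sk]] := (hM m mM, hM k kM).
rewrite -(bpart_id pB uB m0 sm) -(bpart_id pB uB k0 sk) /bpart big_seq [RHS]big_seq.
by apply: eq_bigr => r rB; rewrite (eqP (h r rB)).
Qed.

Section poly.
Variables (s : seq nat) (a : nat -> C).
Hypothesis s_gt0 : forall n, n \in s -> (0 < n)%N.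

Definition dpoly P z := \sum_(n <- s | smooth P n) a n * mon P n z.

Lemma cnice_dpoly P : cnice (dpoly P).
Proof. by apply: cnice_sum => n _; apply: cniceM; [exact: cnice_cst|exact: cnice_mon]. Qed.

Lemma eq_dpoly P z u : (forall r, r \in P -> z r = u r) -> dpoly P z = dpoly P u.
Proof. by move=> zu; apply: eq_bigr => n _; rewrite (eq_mon n zu). Qed.

Section block.
Variables (P B : seq nat).
Hypothesis (uPB : uniq (P ++ B)) (pB : forall t, t \in B -> prime t).

Let uB : uniq B. Proof. by move: uPB; rewrite cat_uniq => /and3P[]. Qed.

Let BP r : r \in B -> r \notin P.
Proof.
move=> rB; move: uPB; rewrite cat_uniq => /and3P[_ /hasPn h _]; exact: h.
Qed.

Let new n := smooth (P ++ B) n && ~~ smooth P n.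

Definition dblock z := \sum_(n <- s | new n) a n * mon (P ++ B) n z.

Lemma cnice_dblock : cnice dblock.
Proof. by apply: cnice_sum => n _; apply: cniceM; [exact: cnice_cst|exact: cnice_mon]. Qed.

Lemma dpoly_cat z : dpoly (P ++ B) z = dpoly P z + dblock z.
Proof.
rewrite /dpoly (bigID (smooth P))/=; congr +%R.
rewrite big_seq_cond [RHS]big_seq_cond; apply: eq_big => n.
  have [/s_gt0 n0|//] := boolP (n \in s).
  rewrite /= andb_idl// => sn; apply: smooth_sub sn => // r rP.
  by rewrite mem_cat rP.
move=> /andP[/s_gt0 n0 /andP[_ sn]].
by rewrite mon_cat (mon_coprime z n0 sn BP) mulr1.
Qed.

Definition bfreq := undup [seq bpart B n | n <- s & new n].

Definition bcoef m z := \sum_(n <- s | new n && (bpart B n == m)) a n * mon P n z.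

Lemma cnice_bcoef m : cnice (bcoef m).
Proof. by apply: cnice_sum => n _; apply: cniceM; [exact: cnice_cst|exact: cnice_mon]. Qed.

Lemma eq_bcoef m z u : (forall r, r \in P -> z r = u r) -> bcoef m z = bcoef m u.
Proof. by move=> zu; apply: eq_bigr => n _; rewrite (eq_mon n zu). Qed.

Lemma bfreqP m : m \in bfreq -> (1 < m)%N /\ smooth B m.
Proof.
rewrite mem_undup => /mapP[n]; rewrite mem_filter => /andP[/andP[sn nsn] ns] ->.
split; last exact: smooth_bpart.
rewrite ltn_neqAle bpart_gt0// andbT; apply: contra nsn => /eqP b1.
have n0 := s_gt0 ns; apply/smoothP => // r pr rn.
have /(smoothP _ n0)/(_ r pr rn) := sn; rewrite mem_cat => /orP[//|rB].
have : (0 < logn r (bpart B n))%N by rewrite logn_bpart// rB logn_gt0 mem_primes pr n0.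
by rewrite -b1 logn1.
Qed.

Lemma dblockE z : dblock z = \sum_(m <- bfreq) bcoef m z * mon B m z.
Proof.
rewrite /bcoef; under eq_bigr do rewrite mulr_suml big_mkcond.
rewrite exchange_big/= /dblock big_mkcond big_seq [RHS]big_seq.
apply: eq_bigr => n ns; case: ifP => nn; last by rewrite big1// => m _; rewrite ?nn.
have bM : bpart B n \in bfreq.
  by rewrite mem_undup; apply/mapP; exists n => //; rewrite mem_filter nn.
rewrite (bigD1_seq (bpart B n)) ?undup_uniq//= eqxx ?nn /= big1 => [|m mn].
  by rewrite addr0 mon_bpart// mon_cat mulrA.
by rewrite eq_sym (negbTE mn) ?andbF.
Qed.

Let past_eq z u : torus_pt B z u -> forall r, r \in P -> z r = u r.
Proof. by move=> [_ h] r rP; rewrite h//; apply/negP => /BP; rewrite rP. Qed.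

Lemma dblock_parseval z : in_disc z ->
  tmean B (fun u => sqn (dblock u)) z = \sum_(m <- bfreq) sqn (bcoef m z).
Proof.
move=> zd; rewrite -(tmean_parseval (B := B) (fun m => bcoef m z) uB _ pB _ zd).
- apply: eq_tmean => // u tu; rewrite dblockE; congr sqn; apply: eq_bigr => m _.
  by rewrite (eq_bcoef m (past_eq tu)).
- exact: undup_uniq.
- by move=> m /bfreqP[m1 sm]; split => //; exact: ltnW.
Qed.

Lemma dblock_mean0 (c : C) z : in_disc z -> tmean B (fun u => Re (c * dblock u)) z = 0.
Proof.
move=> zd; rewrite (eq_tmean (h := fun u => \sum_(m <- bfreq) Re ((c * bcoef m z) *
   \prod_(r <- B) (u r ^+ logn r m * (u r)^*%C ^+ 0))) uB); last first.
  move=> u tu; rewrite dblockE mulr_sumr Re_sum; apply: eq_bigr => m _.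
  rewrite (eq_bcoef m (past_eq tu)) mulrA; congr (Re (_ * _)).
  by apply: eq_bigr => r _; rewrite expr0 mulr1.
rewrite tmean_sum//; last first.
  move=> m _; apply: nice_Re; apply: cniceM; first exact: cnice_cst.
  exact: (@cnice_monomial R B (fun r => logn r m) (fun=> 0%N)).
rewrite big_seq big1// => m /bfreqP[m1 sm].
rewrite (tmean_monomial _ (fun r => logn r m) (fun=> 0%N))//; case: ifP => // /allP h.
have m0 := ltnW m1.
have pd : pdiv m \in B by apply: (elimT (smoothP _ m0) sm); rewrite ?pdiv_prime ?pdiv_dvd.
have := h _ pd; rewrite -leqn0 leqNgt logn_gt0 mem_primes pdiv_prime// m0 pdiv_dvd.
by [].
Qed.

End block.
End poly.

Section TorusStep.
Variables (P B : seq nat) (F D : point -> C) (q d : R).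
Hypotheses (uPB : uniq (P ++ B)) (q1 : 1 <= q).
Hypotheses (cF : cnice F) (cD : cnice D).
Hypothesis F_past : forall z u, (forall r, r \in P -> z r = u r) -> F z = F u.
Hypothesis D_mean0 : forall (c : C) z, in_disc z -> tmean B (fun u => Re (c * D u)) z = 0.

Let uB : uniq B. Proof. by move: uPB; rewrite cat_uniq => /and3P[]. Qed.

Let BP r : r \in B -> r \notin P.
Proof.
move=> rB; move: uPB; rewrite cat_uniq => /and3P[_ /hasPn h _]; exact: h.
Qed.

Definition smooth_pow (e : R) (G : point -> C) z : R := (sqn (G z) + d ^+ 2) `^ e.

Definition increment z : R :=
  smooth_pow (q - 1) F z * sqn (D z) + sqn (D z) `^ q.

Lemma nice_smooth_pow e G : 0 <= e -> cnice G -> nice (smooth_pow e G).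
Proof.
move=> e0 cG; apply: nice_powR => //.
  by move=> z; rewrite addr_ge0 ?sqr_ge0 ?sqn_ge0.
by apply: niceD; [exact: nice_sqn|exact: nice_cst].
Qed.

Lemma nice_increment : nice increment.
Proof.
have q10 : 0 <= q - 1 by rewrite subr_ge0.
apply: niceD; last by apply: nice_sqn_powR => //; exact: le_trans q1.
by apply: niceM; [exact: nice_smooth_pow|exact: nice_sqn].
Qed.

Lemma sqn_cross_le (x y : C) : (2 * Re ((x^*)%C * y)) ^+ 2 <= 4 * (sqn x + d ^+ 2) * sqn y.
Proof.
have := sqr_Re_le ((x^*)%C * y); rewrite sqnM sqnJ => h.
have := mulr_ge0 (sqr_ge0 d) (sqn_ge0 y); move: h.
by move: (Re _) (sqn x) (sqn y) (d ^+ 2) => r X Y D2; rewrite exprMn; lra.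
Qed.

(** The cross term has mean zero over the new variables. *)
Lemma torus_step z : in_disc z ->
  tmean (P ++ B) (smooth_pow q F) z + conv_lo q * tmean (P ++ B) increment z <=
  tmean (P ++ B) (smooth_pow q (fun u => F u + D u)) z.
Proof.
move=> zd; have q0 : 0 <= q by exact: le_trans q1.
have uP : uniq P by move: uPB; rewrite cat_uniq => /and3P[].
have cFD : cnice (fun u => F u + D u) by exact: cniceD.
have nI := nice_increment.
rewrite -tmeanZ// -tmeanD//; [|exact: nice_smooth_pow|exact: niceZ].
rewrite !tmean_cat; apply: le_tmean => //.
- by apply: nice_tmean; apply: niceD; [exact: nice_smooth_pow|exact: niceZ].
- by apply: nice_tmean; exact: nice_smooth_pow.
move=> u tu; have ud := torus_in_disc zd tu.
pose c := (((q * (sqn (F u) + d ^+ 2) `^ (q - 1) * 2)%:C)%C * (F u)^*%C).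
rewrite -[leLHS]addr0 -(D_mean0 c ud) -tmeanD//; last 2 first.
- by apply: niceD; [exact: nice_smooth_pow|exact: niceZ].
- by apply: nice_Re; apply: cniceM; [exact: cnice_cst|].
apply: le_tmean => //.
- apply: niceD; first by apply: niceD; [exact: nice_smooth_pow|exact: niceZ].
  by apply: nice_Re; apply: cniceM; [exact: cnice_cst|].
- exact: nice_smooth_pow.
move=> v [_ tv].
have FE : F v = F u by apply: F_past => r rP; rewrite tv//; apply/negP => /BP; rewrite rP.
have := @powR_expand_ge R q (sqn (F u) + d ^+ 2) (2 * Re ((F u)^*%C * D v)) (sqn (D v)) q1
  (addr_ge0 (sqn_ge0 _) (sqr_ge0 _)) (sqn_ge0 _) (sqn_cross_le _ _).
have cE : Re (c * D v) = q * (sqn (F u) + d ^+ 2) `^ (q - 1) * 2 * Re ((F u)^*%C * D v).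
  by rewrite /c -mulrA ReRl.
rewrite /increment /smooth_pow FE sqnD cE.
have -> : sqn (F u) + 2 * Re ((F u)^*%C * D v) + sqn (D v) + d ^+ 2 =
  sqn (F u) + d ^+ 2 + 2 * Re ((F u)^*%C * D v) + sqn (D v) by ring.
by rewrite -!mulrA [X in _ -> X <= _]addrAC.
Qed.

End TorusStep.
End Blocks.

Section HalfLine.
Variable R : realType.
Local Notation leb := (@lebesgue_measure R).
Implicit Types (mu b x t : R).

Definition ew mu b x : R := (b <= x)%R%:R * expR (- (mu * x)).

Lemma ew_ge0 mu b x : 0 <= ew mu b x.
Proof. by rewrite mulr_ge0 ?ler0n ?expR_ge0. Qed.

Lemma ew_neq0 mu b x : ew mu b x != 0 -> b <= x.
Proof. by rewrite /ew; case: (b <= x) => //; rewrite mul0r eqxx. Qed.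

Lemma ewE mu b x : b <= x -> ew mu b x = expR (- (mu * x)).
Proof. by rewrite /ew => ->; rewrite mul1r. Qed.

Lemma expR_decay0 mu : 0 < mu -> expR (- (mu * x)) @[x --> +oo] --> (0 : R).
Proof.
move=> mu0; have := @cvgr_expR R => h.
apply: (@cvg_comp _ _ _ (fun x : R => mu * x) (fun x : R => expR (- x)) _ _ _ _ h).
by apply: gt0_cvgMry => //; exact: cvg_id.
Qed.

Lemma der_decay mu x : is_derive x 1 (fun x => expR (- (mu * x))) (- mu * expR (- (mu * x))).
Proof.
apply: (der_eq (der_comp (f := expR) (is_derive_expR _) (derN (derZ mu (derI x))))).
by rewrite mulr1 mulrC.
Qed.

Lemma der_exp_decay mu x c : is_derive x 1 (fun x => c * expR (- (mu * x)))
  (c * (- mu * expR (- (mu * x)))).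
Proof. exact/derZ/der_decay. Qed.

Lemma continuous_decay mu : continuous (fun x => expR (- (mu * x))).
Proof. by move=> x; exact: der_continuous (der_decay mu x). Qed.

Lemma continuous_expM mu : continuous (fun x => expR (mu * x)).
Proof.
move=> x; exact: der_continuous (der_comp (f := expR) (is_derive_expR _) (derZ mu (derI x))).
Qed.

Section FTC.
Variables (mu b C : R) (H h : R -> R).
Hypotheses (mu0 : 0 < mu) (dH : forall x, is_derive x 1 H (h x)) (ch : continuous h).
Hypotheses (HC : forall x, b <= x -> `|H x| <= C * expR (- (mu * x))).
Hypotheses (hC : forall x, b <= x -> `|h x| <= C * expR (- (mu * x))).

Lemma halfline_ge0 :
  (\int[leb]_(x in `[b, +oo[) (h x + C * expR (- (mu * x)))%:E = (- H b + C / mu * expR (- (mu * b)))%:E)%E.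
Proof.
pose F x := H x + - (C / mu) * expR (- (mu * x)).
have dF x : is_derive x 1 F (h x + C * expR (- (mu * x))).
  apply: (der_eq (derD (dH x) (der_exp_decay mu x (- (C / mu))))).
  by congr +%R; field; rewrite gt_eqF.
have cF x : {for x, continuous F} by exact: der_continuous (dF x).
have -> : - H b + C / mu * expR (- (mu * b)) = 0 - F b by rewrite /F; ring.
rewrite EFinB; apply: ge0_continuous_FTC2y.
- move=> x bx; have := hC bx; rewrite ler_norml => /andP[+ _]; lra.
- apply: continuous_subspaceT => x; apply: cvgD; first exact: ch.
  by apply: (der_continuous (der_exp_decay mu x C)).
- pose K := `|C| + `|C / mu|.
  apply/cvgr0Pnorm_lt => e e0.
  have K0 : 0 <= K by rewrite addr_ge0.
  have eK : 0 < e / (K + 1) by rewrite divr_gt0//; lra.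
  have /cvgr0Pnorm_lt /(_ _ eK) h1 := expR_decay0 mu0.
  have h2 := nbhs_pinfty_ge (num_real b).
  near=> x; have : `|expR (- (mu * x))| < e / (K + 1) by near: x; exact: h1.
  have : b <= x by near: x; exact: h2.
  move=> bx; rewrite ger0_norm ?expR_ge0// ltr_pdivlMr; last by lra.
  move=> he; have p0 := expR_gt0 (- (mu * x)).
  apply: (@le_lt_trans _ _ (K * expR (- (mu * x)))); last by nra.
  rewrite /F (le_trans (ler_normD _ _))// mulrDl; apply: lerD.
    by rewrite (le_trans (HC bx))// ler_wpM2r ?expR_ge0// ler_norm.
  by rewrite normrM normrN (ger0_norm (expR_ge0 _)).
- by move=> x _; have [] := dF x.
- apply: cvg_at_right_filter; exact: cF.
- by move=> x _; rewrite derive1E; have [_ ->] := dF x.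
Unshelve. all: by end_near.
Qed.

Lemma halfline_ge0_wint : weight leb (ew mu b) ->
  wint leb (ew mu b) (fun x => expR (mu * x) * (h x + C * expR (- (mu * x)))) = - H b + C / mu * expR (- (mu * b)).
Proof.
move=> _; rewrite /wint -[RHS]/(fine (_%:E)) -halfline_ge0 [in RHS]integral_mkcond.
congr fine; apply: eq_integral => x _; rewrite patchE /ew mem_setE/= in_itv/= andbT.
case: (b <= x); rewrite ?mul0r// mul1r mulrA -expRD addNr expR0 mul1r.
by [].
Qed.

End FTC.

Lemma ew_weight mu b : 0 < mu -> weight leb (ew mu b).
Proof.
move=> mu0; have mw : measurable_fun setT (ew mu b).
  apply: measurable_funM.
    rewrite (_ : (fun x => _) = \1_(`[b, +oo[ : set R)); first exact: measurable_indic.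
    by apply/funext => x; rewrite indicE mem_setE in_itv/= andbT.
  by apply: continuous_measurable_fun; exact: continuous_decay.
apply/integrableP; split; first exact/measurable_EFinP.
have dC x : is_derive x 1 (fun=> 0 : R) 0 by exact: derC.
have bnd x : b <= x -> `|0 : R| <= 1 * expR (- (mu * x)) by rewrite normr0 mul1r expR_ge0.
have E := halfline_ge0 mu0 dC (fun x => cvg_cst 0) bnd bnd.
rewrite integral_mkcond in E.
apply: (@le_lt_trans _ _ ((- 0 + 1 / mu * expR (- (mu * b)))%:E)); last exact: ltry.
rewrite -E le_eqVlt; apply/orP; left; apply/eqP; apply: eq_integral => x _.
rewrite /= patchE mem_setE/= in_itv/= andbT ger0_norm ?ew_ge0// /ew.
by case: (b <= x); rewrite ?mul0r// !mul1r add0r.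
Qed.

(** Fundamental theorem on a half-line for exponentially decaying primitives. *)
Lemma halfline_FTC mu b C (H h : R -> R) : 0 < mu ->
  (forall x, is_derive x 1 H (h x)) -> continuous h ->
  (forall x, b <= x -> `|H x| <= C * expR (- (mu * x))) ->
  (forall x, b <= x -> `|h x| <= C * expR (- (mu * x))) ->
  wint leb (ew mu b) (fun x => expR (mu * x) * h x) = - H b.
Proof.
move=> mu0 dH ch HC hC; have ww := ew_weight b mu0.
have C0 : 0 <= C.
  have := le_trans (normr_ge0 _) (HC b (lexx b)).
  by rewrite pmulr_lge0 ?expR_gt0.
have e1 := halfline_ge0_wint mu0 dH ch HC hC ww.
have bnd x : b <= x -> `|0 : R| <= C * expR (- (mu * x)).
  by rewrite normr0 mulr_ge0 ?expR_ge0.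
have e2 := halfline_ge0_wint mu0 (fun x => derC 0 x) (fun x => cvg_cst 0) bnd bnd ww.
have ee x : expR (mu * x) * (C * expR (- (mu * x))) = C.
  by rewrite mulrCA -expRD addrN expR0 mulr1.
have me : measurable_fun setT (fun x : R => expR (mu * x)).
  by apply: continuous_measurable_fun; exact: continuous_expM.
have bg : bounded_on (ew mu b) (fun x => expR (mu * x) * h x).
  split; first by apply: measurable_funM => //; exact: continuous_measurable_fun.
  exists C => x /ew_neq0 bx; rewrite normrM ger0_norm ?expR_ge0//.
  by rewrite -(ee x) ler_wpM2l ?expR_ge0// hC.
have {}e2 : wint leb (ew mu b) (fun=> C) = C / mu * expR (- (mu * b)).
  move: e2; rewrite oppr0 add0r => <-.
  by apply: eq_wint => x _; rewrite add0r ee.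
have e3 : wint leb (ew mu b) (fun x => expR (mu * x) * h x + C) =
    - H b + C / mu * expR (- (mu * b)).
  by rewrite -e1; apply: eq_wint => x _; rewrite mulrDr ee.
move: e3; rewrite wintD//; last exact: bounded_on_cst.
by rewrite e2 => /addIr.
Qed.

Lemma wint_ew1 mu b : 0 < mu -> wint leb (ew mu b) (fun=> 1) = expR (- (mu * b)) / mu.
Proof.
move=> mu0; pose H x := - mu^-1 * expR (- (mu * x)).
have dH x : is_derive x 1 H (expR (- (mu * x))).
  apply: (der_eq (der_exp_decay mu x (- mu^-1))).
  by field; rewrite gt_eqF.
have -> : expR (- (mu * b)) / mu = - H b by rewrite /H mulNr opprK mulrC.
rewrite -(@halfline_FTC mu b (1 + mu^-1) H (fun x => expR (- (mu * x)))) //.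
- by apply: eq_wint => x _; rewrite -expRD addrN expR0.
- exact: continuous_decay.
- move=> x _; rewrite /H normrM normrN (ger0_norm (expR_ge0 _)) ler_wpM2r ?expR_ge0//.
  by rewrite ger0_norm ?invr_ge0 ?(ltW mu0)// lerDr.
- move=> x _; rewrite (ger0_norm (expR_ge0 _)) -[leLHS]mul1r ler_wpM2r ?expR_ge0//.
  by rewrite lerDl invr_ge0 ltW.
Qed.

Definition Lt (g : R -> R) := wint leb (ew 1 0) g.

(** Mean of [g] against the two-sided exponential density [exp (- |t|) / 2]. *)
Definition tavg (g : R -> R) := 2^-1 * (Lt g + Lt (fun t => g (- t))).

Lemma Lt_derive (g g' : R -> R) B : (forall t, is_derive t 1 g (g' t)) ->
  continuous g' -> (forall t, 0 <= t -> `|g t| <= B) -> (forall t, 0 <= t -> `|g' t| <= B) ->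
  Lt g' = Lt g - g 0.
Proof.
move=> dg cg' gB g'B.
have cg : continuous g by move=> t; exact: der_continuous (dg t).
have ww := ew_weight 0 (ltr01 : 0 < (1 : R)).
have bd k : continuous k -> (forall t, 0 <= t -> `|k t| <= B) -> bounded_on (ew 1 0) k.
  move=> ck kB; split; first exact: continuous_measurable_fun.
  by exists B => t /ew_neq0; exact: kB.
have := @halfline_FTC 1 0 (2 * B) (fun t => expR (- (1 * t)) * g t)
   (fun t => expR (- (1 * t)) * (g' t - g t)) ltr01.
move=> h.
have d t : is_derive t 1 (fun t => expR (- (1 * t)) * g t) (expR (- (1 * t)) * (g' t - g t)).
  by apply: (der_eq (derM (der_decay 1 t) (dg t))); ring.
have c : continuous (fun t => expR (- (1 * t)) * (g' t - g t)).
  move=> t; apply: cvgM; first exact: continuous_decay.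
  by apply: cvgB; [exact: cg'|exact: cg].
have b1 t : 0 <= t -> `|expR (- (1 * t)) * g t| <= 2 * B * expR (- (1 * t)).
  move=> t0; rewrite normrM (ger0_norm (expR_ge0 _)) mulrC ler_wpM2r ?expR_ge0//.
  by have := gB t t0; have := normr_ge0 (g t); lra.
have b2 t : 0 <= t -> `|expR (- (1 * t)) * (g' t - g t)| <= 2 * B * expR (- (1 * t)).
  move=> t0; rewrite normrM (ger0_norm (expR_ge0 _)) mulrC ler_wpM2r ?expR_ge0//.
  by have := gB t t0; have := g'B t t0; have := ler_normB (g' t) (g t); lra.
have {}h := h d c b1 b2.
have {}h : wint leb (ew 1 0) (fun t => g' t - g t) = - g 0.
  rewrite (_ : - g 0 = - (expR (- (1 * 0)) * g 0)); last by rewrite mulr0 oppr0 expR0 mul1r.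
  by rewrite -h; apply: eq_wint => t _; rewrite mulrA -expRD addrN expR0 mul1r.
rewrite wintB// in h; [|exact: bd|exact: bd].
by move/eqP: h; rewrite subr_eq addrC => /eqP.
Qed.

Section tavg_theory.
Implicit Types (f g : R -> R).

Definition tbounded g := measurable_fun setT g /\ exists B, forall t, `|g t| <= B.

Lemma tbounded_on g : tbounded g -> bounded_on (ew 1 0) g /\ bounded_on (ew 1 0) (fun t => g (- t)).
Proof.
move=> [mg [B gB]]; split; split; [by []|by exists B| |by exists B].
by apply: measurableT_comp => //.
Qed.

Let ww : weight leb (ew 1 0). Proof. exact: ew_weight. Qed.

Lemma tavgD f g : tbounded f -> tbounded g ->
  tavg (fun t => f t + g t) = tavg f + tavg g.
Proof.
move=> /tbounded_on[f1 f2] /tbounded_on[g1 g2].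
by rewrite /tavg /Lt !wintD//; ring.
Qed.

Lemma tavgZ c f : tbounded f -> tavg (fun t => c * f t) = c * tavg f.
Proof.
move=> /tbounded_on[f1 f2]; by rewrite /tavg /Lt !wintZ//; ring.
Qed.

Lemma le_tavg f g : tbounded f -> tbounded g -> (forall t, f t <= g t) -> tavg f <= tavg g.
Proof.
move=> /tbounded_on[f1 f2] /tbounded_on[g1 g2] fg.
rewrite ler_pM2l ?invr_gt0//; apply: lerD; apply: le_wint => //; exact: ew_ge0.
Qed.

Lemma eq_tavg f g : (forall t, f t = g t) -> tavg f = tavg g.
Proof. by move=> /funext ->. Qed.

Lemma tavg_cst c : tavg (fun=> c) = c.
Proof.
rewrite /tavg /Lt (wint_cst c ww) wint_ew1// mulr0 oppr0 expR0 divr1 mulr1.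
by field.
Qed.

Lemma tavg_ge0 f : (forall t, 0 <= f t) -> 0 <= tavg f.
Proof.
move=> f0; rewrite mulr_ge0 ?invr_ge0// addr_ge0//; apply: wint_ge0 => //; exact: ew_ge0.
Qed.

Lemma tbounded_cst c : tbounded (fun=> c).
Proof. by split; [exact: measurable_cst|exists `|c|]. Qed.

Lemma tboundedD f g : tbounded f -> tbounded g -> tbounded (fun t => f t + g t).
Proof.
move=> [mf [A fA]] [mg [B gB]]; split; first exact: measurable_funD.
by exists (A + B) => t; rewrite (le_trans (ler_normD _ _))// lerD.
Qed.

Lemma tboundedM f g : tbounded f -> tbounded g -> tbounded (fun t => f t * g t).
Proof.
move=> [mf [A fA]] [mg [B gB]]; split; first exact: measurable_funM.
by exists (A * B) => t; rewrite normrM ler_pM.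
Qed.

Lemma tbounded_norm f : tbounded f -> tbounded (fun t => `|f t|).
Proof.
move=> [mf [A fA]]; split; last by exists A => t; rewrite normr_id.
by apply: measurableT_comp => //; exact: measurable_normr.
Qed.

Lemma tbounded_sum (I : Type) (s : seq I) (P : pred I) (F : I -> R -> R) :
  (forall i, P i -> tbounded (F i)) -> tbounded (fun t => \sum_(i <- s | P i) F i t).
Proof.
move=> FB; elim: s => [|i s IH].
  rewrite (_ : (fun _ => _) = fun=> 0); first exact: tbounded_cst.
  by apply/funext => t; rewrite big_nil.
rewrite (_ : (fun _ => _) = fun t => (if P i then F i t else 0) + \sum_(i <- s | P i) F i t).
  by apply: tboundedD => //; case Pi : (P i); [exact: FB|exact: tbounded_cst].
by apply/funext => t; rewrite big_cons; case: (P i); rewrite ?add0r.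
Qed.

Lemma tavg_sum (I : Type) (s : seq I) (P : pred I) (F : I -> R -> R) :
  (forall i, P i -> tbounded (F i)) ->
  tavg (fun t => \sum_(i <- s | P i) F i t) = \sum_(i <- s | P i) tavg (F i).
Proof.
move=> FB; elim: s => [|i s IH].
  by rewrite big_nil -[RHS](tavg_cst 0); apply: eq_tavg => t; rewrite big_nil.
rewrite big_cons; case Pi : (P i).
  rewrite -IH -tavgD; [|exact: FB|exact: tbounded_sum].
  by apply: eq_tavg => t; rewrite big_cons Pi.
by rewrite -IH; apply: eq_tavg => t; rewrite big_cons Pi.
Qed.

Lemma norm_tavg_le f : tbounded f -> `|tavg f| <= tavg (fun t => `|f t|).
Proof.
move=> bf; have bn := tbounded_norm bf; rewrite ler_norml; apply/andP; split.
  rewrite lerNl -[leLHS]mulN1r -tavgZ//; apply: le_tavg => //.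
    by apply: (tboundedM (f := fun=> -1)) => //; exact: tbounded_cst.
  by move=> t; rewrite mulN1r -normrN ler_norm.
by apply: le_tavg => // t; exact: ler_norm.
Qed.

(** [tavg] inverts [1 - d^2/dt^2]. *)
Lemma tavg_derive2 (g g' g'' : R -> R) B :
  (forall t, is_derive t 1 g (g' t)) -> (forall t, is_derive t 1 g' (g'' t)) ->
  continuous g'' -> (forall t, [/\ `|g t| <= B, `|g' t| <= B & `|g'' t| <= B]) ->
  tavg g'' = tavg g - g 0.
Proof.
move=> dg dg' cg'' bB.
have cg' : continuous g' by move=> t; exact: der_continuous (dg' t).
have dopp (k k' : R -> R) t : (forall t, is_derive t 1 k (k' t)) ->
    is_derive t 1 (fun t => k (- t)) (- k' (- t)).
  move=> dk; apply: (der_eq (der_comp (dk (- t)) (derN (derI t)))).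
  by rewrite mulrN1.
have copp (k : R -> R) : continuous k -> continuous (fun t => k (- t)).
  by move=> ck t; apply: (continuous_comp (f := fun t : R => - t)); [exact: der_continuous (derN (derI t))|exact: ck].
have d3 t : is_derive t 1 (fun t => - g' (- t)) (g'' (- t)).
  by apply: (der_eq (derN (dopp _ _ t dg'))); rewrite opprK.
have d4 t := dopp _ _ t dg.
have c4 : continuous (fun t => - g' (- t)) by move=> t; apply: cvgN; exact: (copp _ cg').
have b0 t : `|g t| <= B by have [] := bB t.
have b1 t : `|g' t| <= B by have [] := bB t.
have b2 t : `|g'' t| <= B by have [] := bB t.
have b1N t : `|- g' (- t)| <= B by rewrite normrN.
have e1 := Lt_derive dg' cg'' (fun t _ => b1 t) (fun t _ => b2 t).
have e2 := Lt_derive dg cg' (fun t _ => b0 t) (fun t _ => b1 t).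
have e3 := Lt_derive d3 (copp _ cg'') (fun t _ => b1N t) (fun t _ => b2 (- t)).
have e4 := Lt_derive d4 c4 (fun t _ => b0 (- t)) (fun t _ => b1N t).
by rewrite /tavg e1 e3 e2 e4 oppr0; field.
Qed.

Lemma tavg_derive_le (g g' : R -> R) B :
  (forall t, is_derive t 1 g (g' t)) -> continuous g' ->
  (forall t, `|g t| <= B) -> (forall t, `|g' t| <= B) ->
  `|tavg g'| <= tavg (fun t => `|g t|).
Proof.
move=> dg cg' gB g'B.
have cg : continuous g by move=> t; exact: der_continuous (dg t).
have e2 := Lt_derive dg cg' (fun t _ => gB t) (fun t _ => g'B t).
have dopp t : is_derive t 1 (fun t => - g (- t)) (g' (- t)).
  apply: (der_eq (derN (der_comp (dg (- t)) (derN (derI t))))).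
  by rewrite mulrN1 opprK.
have copp (k : R -> R) : continuous k -> continuous (fun t => k (- t)).
  by move=> ck t; apply: (continuous_comp (f := fun t : R => - t)); [exact: der_continuous (derN (derI t))|exact: ck].
have bN t : `|- g (- t)| <= B by rewrite normrN.
have e4 := Lt_derive dopp (copp _ cg') (fun t _ => bN t) (fun t _ => g'B (- t)).
have bg : tbounded g by split; [exact: continuous_measurable_fun|exists B].
have [b1 b2] := tbounded_on bg; have [n1 n2] := tbounded_on (tbounded_norm bg).
have b3 : bounded_on (ew 1 0) (fun t => - g (- t)) by exact: bounded_onN.
have -> : tavg g' = 2^-1 * (Lt g + Lt (fun t => - g (- t))).
  by rewrite /tavg e2 e4 oppr0; field.
rewrite /tavg normrM (ger0_norm (_ : 0 <= 2^-1)) ?invr_ge0// ler_pM2l ?invr_gt0//.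
rewrite (le_trans (ler_normD _ _))//; apply: lerD.
  by apply: le_norm_wint => //; exact: ew_ge0.
rewrite (_ : Lt (fun t => `|g (- t)|) = Lt (fun t => `|- g (- t)|)).
  by apply: le_norm_wint => //; exact: ew_ge0.
by rewrite /Lt; apply: eq_wint => t _; rewrite normrN.
Qed.

Lemma tavg_cos x : tavg (fun t => cos (x * t)) = (1 + x ^+ 2)^-1.
Proof.
have dlin t : is_derive t 1 (fun t => x * t) x by apply: (der_eq (derZ x (derI t))); rewrite mulr1.
have d1 t : is_derive t 1 (fun t => cos (x * t)) (- x * sin (x * t)).
  by apply: (der_eq (der_comp (f := cos) (is_derive_cos _) (dlin t))); ring.
have d2 t : is_derive t 1 (fun t => - x * sin (x * t)) (- x ^+ 2 * cos (x * t)).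
  by apply: (der_eq (derZ (- x) (der_comp (f := sin) (is_derive_sin _) (dlin t)))); ring.
have d3 t : is_derive t 1 (fun t => - x ^+ 2 * cos (x * t)) (- x ^+ 2 * (- x * sin (x * t))).
  exact: derZ.
have c1 t : `|cos (x * t)| <= 1 by rewrite ler_norml cos_geN1 cos_le1.
have s1 t : `|sin (x * t)| <= 1 by rewrite ler_norml sin_geN1 sin_le1.
have bc : tbounded (fun t => cos (x * t)).
  split; last by exists 1.
  by apply: continuous_measurable_fun => t; exact: der_continuous (d1 t).
have bb t : [/\ `|cos (x * t)| <= 1 + `|x| + x ^+ 2, `|- x * sin (x * t)| <= 1 + `|x| + x ^+ 2
    & `|- x ^+ 2 * cos (x * t)| <= 1 + `|x| + x ^+ 2].
  have x0 := normr_ge0 x; have x2 := sqr_ge0 x; split.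
  - by rewrite (le_trans (c1 t))//; lra.
  - by rewrite normrM normrN; have := s1 t; nra.
  - rewrite normrM normrN (ger0_norm x2); have := c1 t; nra.
have h := tavg_derive2 d1 d2 (fun t => der_continuous (d3 t)) bb.
rewrite mulr0 cos0 in h.
rewrite tavgZ// in h.
have x2 : 0 < 1 + x ^+ 2 by rewrite ltr_pwDl// sqr_ge0.
apply: (mulfI (lt0r_neq0 x2)); rewrite divff ?lt0r_neq0//; lra.
Qed.

Lemma tavg_sin x : tavg (fun t => sin (x * t)) = 0.
Proof.
have ms : measurable_fun setT (fun t => sin (x * t)).
  apply: measurableT_comp; first by apply: continuous_measurable_fun; exact: continuous_sin.
  exact: measurable_funM.
have b1 : tbounded (fun t => sin (x * t)).
  by split => //; exists 1 => t; rewrite ler_norml sin_geN1 sin_le1.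
have [s1 s2] := tbounded_on b1.
rewrite /tavg (_ : Lt (fun t => sin (x * - t)) = - Lt (fun t => sin (x * t))).
  by rewrite addrN mulr0.
rewrite -mulN1r /Lt -wintZ//; apply: eq_wint => t _.
by rewrite mulrN sinN mulN1r.
Qed.

End tavg_theory.
End HalfLine.

Lemma npow_half_sqr (R : realType) (sg : R) n :
  npow (2^-1 + sg) n ^+ 2 = npow (1 + 2 * sg) n.
Proof.
rewrite expr2 -npowD; have -> // : 2^-1 + sg + (2^-1 + sg) = 1 + 2 * sg.
by field.
Qed.

Section VerticalPoint.
Variable R : realType.
Local Notation C := R[i].
Local Notation Re := complex.Re.
Local Notation Im := complex.Im.
Local Notation point := (nat -> C).
Variable theta : R.
Implicit Types (sg t : R).

(** [n ^ (- (1/2 + sg + i (theta + t)))], and, as a function of the primes, the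
point of the polydisc where a Bohr lift has to be evaluated. *)
Definition nz sg t : point := fun n =>
  (npow (2^-1 + sg) n)%:C%C * cisC (- ((theta + t) * ln n%:R)).

Lemma cisCD (x y : R) : cisC (x + y) = cisC x * cisC y.
Proof.
by apply: complex_ext; rewrite ?ReM ?ImM /= ?cosD ?sinD; ring.
Qed.

Lemma sqn_cisC (x : R) : sqn (cisC x) = 1.
Proof. by rewrite /sqn /= cos2Dsin2. Qed.

Lemma polarMJ (a b x y : R) :
  (a%:C%C * cisC x) * (b%:C%C * cisC y)^*%C = (a * b)%:C%C * cisC (x - y).
Proof.
apply: complex_ext; rewrite ?(ReM, ImM, ReJ, ImJ) /= ?(cosB, sinB); ring.
Qed.

Lemma nzM sg t m n : (0 < m)%N -> (0 < n)%N -> nz sg t (m * n) = nz sg t m * nz sg t n.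
Proof.
move=> m0 n0; rewrite /nz npowM// natrM lnM ?posrE ?ltr0n// mulrDr opprD cisCD.
by rewrite rmorphM /= mulrACA.
Qed.

Lemma nz1 sg t : nz sg t 1 = 1.
Proof.
rewrite /nz npow1 ln1 mulr0 oppr0 mul1r.
by apply: complex_ext; rewrite /= ?cos0 ?sin0.
Qed.

Lemma nzX sg t m k : (0 < m)%N -> nz sg t (m ^ k) = nz sg t m ^+ k.
Proof.
move=> m0; elim: k => [|k IH]; first by rewrite nz1 expr0.
by rewrite expnS nzM ?expn_gt0 ?m0// IH exprS.
Qed.

Lemma sqn_nz sg t n : sqn (nz sg t n) = npow (1 + 2 * sg) n.
Proof.
by rewrite /nz sqnM sqn_cisC mulr1 sqnR npow_half_sqr.
Qed.

Lemma nz_in_disc sg t : - 2^-1 <= sg -> in_disc (nz sg t).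
Proof.
move=> h r; rewrite sqn_nz -[leRHS]expR0 ler_expR oppr_le0 mulr_ge0 ?ln_nat_ge0//.
by lra.
Qed.

Lemma mon_nz P n sg t : (forall r, r \in P -> prime r) ->
  mon P n (nz sg t) = nz sg t (bpart P n).
Proof.
move=> pP; rewrite /mon /bpart; elim: P pP => [|r P IH] pP; first by rewrite !big_nil nz1.
have pr : prime r by apply: pP; rewrite mem_head.
have pP' u : u \in P -> prime u by move=> h; apply: pP; rewrite inE h orbT.
have b0 := bpart_gt0 n pP'; have r0 : (0 < r ^ logn r n)%N by rewrite expn_gt0 prime_gt0.
by rewrite !big_cons IH// (nzM _ _ r0 b0) nzX ?prime_gt0.
Qed.

Lemma continuous_Re_nz sg n : continuous (fun t => Re (nz sg t n)) /\
  continuous (fun t => Im (nz sg t n)).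
Proof.
have dl t : is_derive t 1 (fun t => - ((theta + t) * ln n%:R)) (- (ln n%:R)).
  by apply: (der_eq (derN (derM (derD (derC theta t) (derI t)) (derC (ln n%:R) t)))); ring.
split.
  rewrite (_ : (fun t => _) = fun t => npow (2^-1 + sg) n * cos (- ((theta + t) * ln n%:R))).
    by move=> t; exact: der_continuous (derZ _ (der_comp (f := cos) (is_derive_cos _) (dl t))).
  by apply/funext => t; rewrite ReRl.
rewrite (_ : (fun t => _) = fun t => npow (2^-1 + sg) n * sin (- ((theta + t) * ln n%:R))).
  by move=> t; exact: der_continuous (derZ _ (der_comp (f := sin) (is_derive_sin _) (dl t))).
by apply/funext => t; rewrite ImRl.
Qed.

Lemma cmeas_nz sg n : cmeas (fun t : measurableTypeR R => nz sg t n).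
Proof.
by have [c1 c2] := continuous_Re_nz sg n; split; exact: continuous_measurable_fun.
Qed.

Lemma tbounded_nice sg (g : point -> R) : - 2^-1 <= sg -> nice g ->
  tbounded (fun t => g (nz sg t)).
Proof.
move=> h [[B gB] mg]; split; last by exists B => t; apply/gB/nz_in_disc.
exact: (mg _ _ (fun t : measurableTypeR R => nz sg t) (fun r => cmeas_nz sg r)).
Qed.

End VerticalPoint.

Section BlockMeanSquare.
Variable R : realType.
Local Notation C := R[i].
Local Notation Re := complex.Re.
Local Notation Im := complex.Im.
Local Notation point := (nat -> C).
Variable theta : R.
Local Notation nz := (nz theta).
Variables (J : nat) (J0 : (0 < J)%N).
Let lam : R := J%:R * ln 2.
Let B := primes_in (2 ^ J) (2 ^ (8 * J)).
Variables (sg : R) (hsg : - (8 * lam)^-1 <= sg).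
Variables (M : seq nat) (uM : uniq M).
Hypothesis hM : forall m, m \in M -> (1 < m)%N /\ smooth B m.

Let exponent : 1 - (4 * lam)^-1 <= 1 + 2 * sg.
Proof.
have := hsg; have -> : (8 * lam)^-1 = 2^-1 * (4 * lam)^-1.
  have l0 : lam != 0 by rewrite lt0r_neq0//; have := block_scale_ge R J0; rewrite -/lam; lra.
  by move: (lam) l0 => l l0; field.
by lra.
Qed.

Let decayE : expR (- (lam * (1 + 2 * sg - 1))) = expR (- (2 * lam * sg)).
Proof. by congr expR; ring. Qed.

Lemma block_sup (c : nat -> C) t :
  sqn (\sum_(m <- M) c m * nz sg t m) <=
  block_mass R * expR (- (2 * lam * sg)) * \sum_(m <- M) sqn (c m).
Proof.
apply: le_trans (cauchy_schwarz_C _ _ _ _) _; rewrite mulrC ler_wpM2r//.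
  by apply: sumr_ge0 => m _; exact: sqn_ge0.
under eq_bigr do rewrite sqn_nz.
by rewrite -decayE; exact: block_sum_npow.
Qed.

Lemma tbounded_cross (z : C) x a : tbounded (fun t => Re (z * cisC (a + x * t))).
Proof.
split.
  rewrite (_ : (fun t => _) = fun t => Re z * cos (a + x * t) - Im z * sin (a + x * t)).
    apply: measurable_funB; apply: measurable_funM => //.
      apply: measurableT_comp; first by apply: continuous_measurable_fun; exact: continuous_cos.
      by apply: measurable_funD => //; exact: measurable_funM.
    apply: measurableT_comp; first by apply: continuous_measurable_fun; exact: continuous_sin.
    by apply: measurable_funD => //; exact: measurable_funM.
  by apply/funext => t; rewrite ReM.
exists (normc z) => t; apply: le_trans (normRe_le _) _.
by rewrite normcM [normc (cisC _)]normcE_sqn sqn_cisC sqrtr1 mulr1.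
Qed.

Lemma tavg_cross (z : C) x a :
  tavg (fun t => Re (z * cisC (a + x * t))) = Re (z * cisC a) * (1 + x ^+ 2)^-1.
Proof.
pose w := z * cisC a.
have tc : tbounded (fun t => cos (x * t)).
  split; last by exists 1 => t; rewrite ler_norml cos_geN1 cos_le1.
  apply: measurableT_comp; first by apply: continuous_measurable_fun; exact: continuous_cos.
  exact: measurable_funM.
have ts : tbounded (fun t => sin (x * t)).
  split; last by exists 1 => t; rewrite ler_norml sin_geN1 sin_le1.
  apply: measurableT_comp; first by apply: continuous_measurable_fun; exact: continuous_sin.
  exact: measurable_funM.
rewrite (@eq_tavg _ _ (fun t => Re w * cos (x * t) + - Im w * sin (x * t))); last first.
  by move=> t; rewrite cisCD mulrA -/w ReM mulNr.
rewrite tavgD; [|exact: tboundedM (tbounded_cst _) tc|exact: tboundedM (tbounded_cst _) ts].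
by rewrite !tavgZ// tavg_cos tavg_sin mulr0 addr0.
Qed.

Let cross_eq (c : nat -> C) t m k :
  Re ((c m * (c k)^*%C) * (nz sg t m * (nz sg t k)^*%C)) =
  Re ((c m * (c k)^*%C * ((npow (2^-1 + sg) m * npow (2^-1 + sg) k)%:C)%C) *
    cisC (theta * (ln k%:R - ln m%:R) + (ln k%:R - ln m%:R) * t)).
Proof.
congr Re; rewrite -[RHS]mulrA; congr (_ * _).
by rewrite /nz polarMJ; congr (_ * cisC _); ring.
Qed.

(** Mean square of a block: the Fourier transform of the weight makes the
off-diagonal terms decay, and Schur's test applies. *)
Lemma block_mean_square (c : nat -> C) :
  tavg (fun t => sqn (\sum_(m <- M) c m * nz sg t m)) <=
  block_mass R * expR (- (2 * lam * sg)) / lam * \sum_(m <- M) sqn (c m).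
Proof.
pose p m : R := npow (2^-1 + sg) m.
pose x m k : R := ln k%:R - ln m%:R.
rewrite (@eq_tavg _ _ (fun t => \sum_(m <- M) \sum_(k <- M)
   Re ((c m * (c k)^*%C * ((p m * p k)%:C)%C) * cisC (theta * x m k + x m k * t)))); last first.
  move=> t; rewrite ReJ_mul_sum; apply: eq_bigr => m _; apply: eq_bigr => k _.
  exact: cross_eq.
rewrite tavg_sum; last by move=> m _; apply: tbounded_sum => k _; exact: tbounded_cross.
under eq_bigr => m _.
  rewrite tavg_sum; last by move=> k _; exact: tbounded_cross.
  under eq_bigr do rewrite tavg_cross.
  over.
have p2 m : p m ^+ 2 = npow (1 + 2 * sg) m.
  exact: npow_half_sqr.
pose T m k := sqn (c m) * (npow (1 + 2 * sg) k * (1 + x m k ^+ 2)^-1).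
have xs m k : x m k ^+ 2 = x k m ^+ 2 by rewrite /x -sqrrN opprB.
apply: (@le_trans _ _ (\sum_(m <- M) \sum_(k <- M) (2^-1 * T m k + 2^-1 * T k m))).
  apply: ler_sum => m _; apply: ler_sum => k _.
  have i0 : 0 <= (1 + x m k ^+ 2)^-1 by rewrite invr_ge0 addr_ge0// sqr_ge0.
  rewrite /T -(xs m k) mulrA [X in _ <= _ + X]mulrA !mulrA -mulrDl ler_wpM2r//.
  apply: (@le_trans _ _ (p m * p k * (normc (c m) * normc (c k)))).
    apply: le_trans (ler_norm _) _; apply: le_trans (normRe_le _) _.
    rewrite !normcM [normc (cisC _)]normcE_sqn sqn_cisC sqrtr1 mulr1 normcJ' normcR.
    by rewrite ger0_norm ?mulr_ge0 ?npow_ge0// mulrC.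
  rewrite -!p2 -!sqr_normc_sqn.
  have := sqr_ge0 (normc (c m) * p k - normc (c k) * p m); nra.
have TE : \sum_(m <- M) \sum_(k <- M) (2^-1 * T m k + 2^-1 * T k m) =
    \sum_(m <- M) \sum_(k <- M) T m k.
  have ex : \sum_(m <- M) \sum_(k <- M) T k m = \sum_(m <- M) \sum_(k <- M) T m k.
    by rewrite exchange_big.
  transitivity (\sum_(m <- M) (2^-1 * (\sum_(k <- M) T m k) + 2^-1 * (\sum_(k <- M) T k m))).
    by apply: eq_bigr => m _; rewrite big_split/= !mulr_sumr.
  by rewrite big_split/= -!mulr_sumr ex; field.
rewrite TE mulr_sumr; apply: ler_sum => m _.
rewrite /T -mulr_sumr mulrC ler_wpM2r ?sqn_ge0// -decayE.
under eq_bigr do rewrite xs.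
exact: block_sum_kernel.
Qed.

End BlockMeanSquare.

Section Separable.
Variable R : realType.
Local Notation C := R[i].
Local Notation Re := complex.Re.
Local Notation Im := complex.Im.
Local Notation point := (nat -> C).
Implicit Types (z u v : point).

Lemma tmean_base (Q P : seq nat) (g : point -> R) z z' :
  (forall u v, (forall r, r \in Q -> u r = v r) -> g u = g v) ->
  (forall r, r \in Q -> r \notin P -> z r = z' r) ->
  tmean P g z = tmean P g z'.
Proof.
move=> gQ; elim: P z z' => [|r P IH] z z' zz' /=.
  by apply: gQ => r rQ; exact: zz'.
apply: eq_wint => w _; apply: IH => t tQ tP; rewrite /set_coord.
by case: eqP => // /eqP tr; apply: zz' => //; rewrite inE negb_or tr.
Qed.

Lemma tavg_tmean_sum (P : seq nat) (I : Type) (s : seq I) (g : I -> point -> R) (h : I -> R -> R) z :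
  (forall i, nice (g i)) -> (forall i, tbounded (h i)) -> in_disc z -> uniq P ->
  tavg (fun t => tmean P (fun u => \sum_(i <- s) g i u * h i t) z) =
  tmean P (fun u => \sum_(i <- s) g i u * tavg (h i)) z.
Proof.
move=> ng bh zd uP.
have ni i c : nice (fun u => g i u * c) by apply: niceM => //; exact: nice_cst.
have e c i : tmean P (fun u => g i u * c) z = c * tmean P (g i) z.
  by rewrite -tmeanZ//; apply: eq_tmean => // u _; rewrite mulrC.
rewrite tmean_sum//; under [RHS]eq_bigr do rewrite e.
rewrite (@eq_tavg _ _ (fun t => \sum_(i <- s) tmean P (g i) z * h i t)); last first.
  move=> t; rewrite tmean_sum//; apply: eq_bigr => i _; by rewrite e mulrC.
rewrite tavg_sum; last by move=> i _; apply: tboundedM => //; exact: tbounded_cst.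
by apply: eq_bigr => i _; rewrite tavgZ// mulrC.
Qed.

Lemma sqn_expand (M : seq nat) (b w : nat -> C) :
  sqn (\sum_(m <- M) b m * w m) =
  \sum_(x <- [seq (m, k) | m <- M, k <- M])
    (Re (b x.1 * (b x.2)^*%C) * Re (w x.1 * (w x.2)^*%C) +
     - Im (b x.1 * (b x.2)^*%C) * Im (w x.1 * (w x.2)^*%C)).
Proof.
rewrite ReJ_mul_sum big_allpairs_dep/=; apply: eq_bigr => m _; apply: eq_bigr => k _.
by rewrite ReM mulNr.
Qed.

Lemma tavg_tmean_sqn (P : seq nat) (M : seq nat) (phi : point -> R) (b : nat -> point -> C)
    (w : nat -> R -> C) z :
  nice phi -> (forall m, cnice (b m)) ->
  (forall m, tbounded (fun t => Re (w m t)) /\ tbounded (fun t => Im (w m t))) ->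
  in_disc z -> uniq P ->
  tavg (fun t => tmean P (fun u => phi u * sqn (\sum_(m <- M) b m u * w m t)) z) =
  tmean P (fun u => phi u * tavg (fun t => sqn (\sum_(m <- M) b m u * w m t))) z.
Proof.
move=> nphi nb bw zd uP.
pose I := (nat * nat * bool)%type.
pose s : seq I := [seq (x, e) | x <- [seq (m, k) | m <- M, k <- M], e <- [:: true; false]].
pose g (i : I) u := phi u * (if i.2 then Re (b i.1.1 u * (b i.1.2 u)^*%C)
   else - Im (b i.1.1 u * (b i.1.2 u)^*%C)).
pose h (i : I) t := if i.2 then Re (w i.1.1 t * (w i.1.2 t)^*%C)
   else Im (w i.1.1 t * (w i.1.2 t)^*%C).
have ng i : nice (g i).
  have [n1 n2] : cnice (fun u => b i.1.1 u * (b i.1.2 u)^*%C).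
    by apply: cniceM => //; exact: cniceJ.
  by apply: niceM => //; case: (i.2) => //; exact: niceN.
have bN f : tbounded f -> tbounded (fun t => - f t).
  move=> bf; rewrite (_ : (fun _ => _) = (fun t => -1 * f t)).
    by apply: tboundedM => //; exact: tbounded_cst.
  by apply/funext => t; rewrite mulN1r.
have bh i : tbounded (h i).
  have [r1 i1] := bw i.1.1; have [r2 i2] := bw i.1.2.
  rewrite /h; case: (i.2).
    rewrite (_ : (fun _ => _) = (fun t => Re (w i.1.1 t) * Re (w i.1.2 t) +
       Im (w i.1.1 t) * Im (w i.1.2 t))); first by apply: tboundedD; exact: tboundedM.
    by apply/funext => t; rewrite ReM ReJ ImJ; ring.
  rewrite (_ : (fun _ => _) = (fun t => - (Re (w i.1.1 t) * Im (w i.1.2 t)) +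
       Im (w i.1.1 t) * Re (w i.1.2 t))).
    by apply: tboundedD; [apply: bN|]; exact: tboundedM.
  by apply/funext => t; rewrite ImM ReJ ImJ; ring.
have sumE u t : phi u * sqn (\sum_(m <- M) b m u * w m t) = \sum_(i <- s) g i u * h i t.
  rewrite sqn_expand mulr_sumr /s [RHS]big_allpairs_dep/=; apply: eq_bigr => x _.
  by rewrite big_cons big_seq1 /g /h /= mulrDr !mulrA.
rewrite (@eq_tavg _ _ (fun t => tmean P (fun u => \sum_(i <- s) g i u * h i t) z)); last first.
  by move=> t; apply: eq_tmean => // u _; exact: sumE.
rewrite tavg_tmean_sum//; apply: eq_tmean => // u _.
have bs : tbounded (fun t => sqn (\sum_(m <- M) b m u * w m t)).
  rewrite (_ : (fun _ => _) = fun t => \sum_(x <- [seq (m, k) | m <- M, k <- M])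
    (Re (b x.1 u * (b x.2 u)^*%C) * h (x, true) t +
     - Im (b x.1 u * (b x.2 u)^*%C) * h (x, false) t)).
    apply: tbounded_sum => x _; apply: tboundedD; apply: tboundedM => //; exact: tbounded_cst.
  by apply/funext => t; rewrite sqn_expand.
rewrite -tavgZ// (@eq_tavg _ _ (fun t => \sum_(i <- s) g i u * h i t))//.
rewrite tavg_sum; last by move=> i _; apply: tboundedM => //; exact: tbounded_cst.
by apply: eq_bigr => i _; rewrite tavgZ.
Qed.

Lemma poly_in_dpoly s (a : nat -> C) (Pn : pred nat) (L P : seq nat) : uniq L ->
  poly_in P (fun z => \sum_(n <- s | Pn n) a n * mon L n z).
Proof.
move=> uL z r _.
pose e n := \prod_(t <- rem r L) z t ^+ logn t n.
have [rL|rL] := boolP (r \in L); last first.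
  exists (\sum_(n <- s | Pn n) a n * mon L n z)%:P => c; rewrite hornerC.
  apply: eq_bigr => n _; congr (_ * _); apply: eq_mon => t tL.
  by rewrite set_coord_other//; apply: contraNneq rL => <-.
exists (\sum_(n <- s | Pn n) (a n * e n) *: 'X^(logn r n)) => c.
rewrite horner_sum; apply: eq_bigr => n _.
rewrite hornerZ hornerXn -mulrA; congr (_ * _).
rewrite /mon (perm_big _ (perm_to_rem rL)) big_cons {1}/set_coord eqxx mulrC; congr (_ * _).
rewrite big_seq /e [RHS]big_seq; apply: eq_bigr => t tL.
by rewrite set_coord_other//; move: tL; rewrite mem_rem_uniq// inE => /andP[].
Qed.

End Separable.

Lemma transfer_arith (R : realType) (x1 x2 x3 k2 K e b c E1 E2 : R) :
  k2 * x1 <= k2 * (K * e * E1) -> k2 * x2 <= k2 * (K * e * E1) ->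
  x3 <= K * e * (b * E2) -> K * e * (b * E2) <= K * e * (c * E2) ->
  0 <= K * e * (c * E1) -> 0 <= K * e * (k2 * E2) ->
  k2 * x1 + k2 * x2 + x3 <= K * (k2 * 2 + c) * e * (E1 + E2).
Proof. by nra. Qed.

Section Transfer.
Variable R : realType.
Local Notation C := R[i].
Local Notation Re := complex.Re.
Local Notation Im := complex.Im.
Local Notation point := (nat -> C).
Variable theta : R.
Local Notation nz := (nz theta).
Variables (s : seq nat) (a : nat -> C).
Hypothesis s_gt0 : forall n, n \in s -> (0 < n)%N.
Variables (J : nat) (J0 : (0 < J)%N).
Let lam : R := J%:R * ln 2.
Let P := primes_in 0 (2 ^ J).
Let B := primes_in (2 ^ J) (2 ^ (8 * J)).
Variables (q d : R).
Hypothesis q1 : 1 <= q.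
Variables (sg : R) (hsg : - (8 * lam)^-1 <= sg).

Let A := dpoly s a P.
Let D := dblock s a P B.
Let M := bfreq s P B.
Let b := bcoef s a P B.

Let uPB : uniq (P ++ B).
Proof. by rewrite /P /B -primes_in_cat ?primes_in_uniq// leq_exp2l// leq_pmull. Qed.

Let uP : uniq P. Proof. exact: primes_in_uniq. Qed.

Let uB : uniq B. Proof. exact: primes_in_uniq. Qed.

Let pP r : r \in P -> prime r. Proof. exact: primes_in_prime. Qed.

Let pB r : r \in B -> prime r. Proof. exact: primes_in_prime. Qed.

Let hM m : m \in M -> (1 < m)%N /\ smooth B m. Proof. exact: bfreqP. Qed.

Let uM : uniq M. Proof. exact: undup_uniq. Qed.

Let lam_ge : 2^-1 <= lam. Proof. exact: block_scale_ge. Qed.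

Let lam_gt0 : 0 < lam. Proof. by have := lam_ge; lra. Qed.

Let sg_ge : - 4^-1 <= sg.
Proof.
have l8 : 4 <= 8 * lam by have := lam_ge; lra.
apply: le_trans hsg; rewrite lerN2 lef_pV2 ?posrE//; exact: lt_le_trans l8.
Qed.

Let sg_half : - 2^-1 <= sg. Proof. by have := sg_ge; lra. Qed.

Let exponent : 1 - (4 * lam)^-1 <= 1 + 2 * sg.
Proof.
have := hsg; have -> : (8 * lam)^-1 = 2^-1 * (4 * lam)^-1.
  have l0 : lam != 0 by rewrite lt0r_neq0.
  by move: (lam) l0 => l l0; field.
by lra.
Qed.

Let dec := expR (- (2 * lam * sg)).

Let dec_gt0 : 0 < dec. Proof. exact: expR_gt0. Qed.

Let dec_le : dec <= expR 1.
Proof.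
rewrite ler_expR; have h : - sg <= (8 * lam)^-1 by rewrite lerNl.
have l8 : 0 < 8 * lam by rewrite mulr_gt0.
have : - sg * (8 * lam) <= 1 by rewrite -ler_pdivlMr// div1r.
by move: (lam) => l; lra.
Qed.

Let S u := \sum_(m <- M) sqn (b m u).

Let cb m : cnice (b m). Proof. exact: cnice_bcoef. Qed.

Let nS : nice S. Proof. by apply: nice_sum => m _; exact: nice_sqn. Qed.

Let S0 u : 0 <= S u. Proof. by apply: sumr_ge0 => m _; exact: sqn_ge0. Qed.

Let cA : cnice A. Proof. exact: cnice_dpoly. Qed.

Let cD : cnice D. Proof. exact: cnice_dblock. Qed.

Let Dt t u := \sum_(m <- M) b m u * nz sg t m.

Let wb m : tbounded (fun t => Re (nz sg t m)) /\ tbounded (fun t => Im (nz sg t m)).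
Proof.
have [c1 c2] := continuous_Re_nz theta sg m.
have nb t : normc (nz sg t m) <= 1.
  by rewrite normc_le1; exact: nz_in_disc.
split; split; [exact: continuous_measurable_fun| |exact: continuous_measurable_fun|];
  by exists 1 => t; rewrite (le_trans _ (nb t))// ?normRe_le ?normIm_le.
Qed.

Let D_nz t u : torus_pt P (nz sg t) u -> D u = Dt t u.
Proof.
move=> [_ h]; rewrite /D dblockE//; apply: eq_big_seq => m mM; congr (_ * _).
have [m1 sm] := hM mM.
have -> : mon B m u = mon B m (nz sg t).
  apply: eq_mon => r rB; apply: h; apply/negP => rP.
  move: rB rP; rewrite !mem_primes_in => /and3P[_ h1 _] /and3P[_ _ h2].
  by move: (leq_trans h2 h1); rewrite ltnn.
by rewrite mon_nz// bpart_id//; exact: ltnW.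
Qed.

Let past_le (F G : point -> C) e t : 0 <= e -> cnice F -> cnice G ->
  poly_in P F -> poly_in P G ->
  sqn (F (nz sg t)) `^ e * sqn (G (nz sg t)) <=
  past_const R * lam * tmean P (fun u => sqn (F u) `^ e * sqn (G u)) (nz sg t).
Proof.
move=> e0 cF cG pF pG; have zd := nz_in_disc theta t sg_half.
have h := tmean_weighted_pointwise e0 uP cF cG pF pG zd.
have hr r : r \in P -> sqn (nz sg t r) < 1.
  move=> /pP pr; rewrite sqn_nz npow_lt1 ?prime_gt1//.
  by have := sg_ge; lra.
have {h} := h hr; under eq_bigr do rewrite sqn_nz.
have := euler_past J0 exponent; rewrite -/lam -/P.
set Q := \prod_(_ <- _) _ => Q1.
set X := _ * sqn (G _); set Y := tmean _ _ _ => h.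
have X0 : 0 <= X by rewrite mulr_ge0 ?powR_ge0 ?sqn_ge0.
apply: (@le_trans _ _ (past_const R * lam * Q * X)); first by rewrite ler_peMl.
by rewrite -mulrA ler_wpM2l// mulr_ge0 ?(ltW lam_gt0)// /past_const mulr_ge0 ?expR_ge0.
Qed.

Let pA : poly_in P A. Proof. exact: poly_in_dpoly. Qed.

Let pD : poly_in P D. Proof. exact: poly_in_dpoly. Qed.

Let eqA u v : (forall r, r \in P -> u r = v r) -> A u = A v.
Proof. exact: eq_dpoly. Qed.

Let eqb m u v : (forall r, r \in P -> u r = v r) -> b m u = b m v.
Proof. exact: eq_bcoef. Qed.

Let cDt t : cnice (Dt t).
Proof. by apply: cnice_sum => m _; apply: cniceM => //; exact: cnice_cst. Qed.

Variables (z0 : point) (z0d : in_disc z0).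

Let Kc := past_const R * block_mass R.

Let Kc0 : 0 <= Kc.
Proof. by rewrite /Kc /past_const /block_mass /block_const !mulr_ge0 ?expR_ge0. Qed.

Let bm0 : 0 <= block_mass R.
Proof. by rewrite /block_mass /block_const !mulr_ge0 ?expR_ge0. Qed.

(** The common shape of all the terms: a nonnegative function of the old
variables times the mean square of the block. *)
Let main_le (phi : point -> R) (g : R -> R) : nice phi -> (forall u, 0 <= phi u) ->
  (forall u v, (forall r, r \in P -> u r = v r) -> phi u = phi v) ->
  tbounded g ->
  (forall t, g t <= past_const R * lam * tmean P (fun u => phi u * sqn (Dt t u)) (nz sg t)) ->
  tavg g <= Kc * dec * tmean P (fun u => phi u * S u) z0.
Proof.
move=> nphi phi0 ephi bg gle.
have pl0 : 0 <= past_const R * lam.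
  by rewrite mulr_ge0 ?(ltW lam_gt0)// /past_const mulr_ge0 ?expR_ge0.
pose G t := tmean P (fun u => phi u * sqn (Dt t u)) z0.
have base t : tmean P (fun u => phi u * sqn (Dt t u)) (nz sg t) = G t.
  apply: (tmean_base (Q := P)) => [u v uv|r -> //].
  rewrite (ephi _ _ uv); congr (_ * sqn _); apply: eq_bigr => m _.
  by rewrite (eqb m uv).
have GE : tavg G = tmean P (fun u => phi u * tavg (fun t => sqn (Dt t u))) z0.
  have h0 := @tavg_tmean_sqn R P M phi b (fun m t => nz sg t m) z0 nphi cb.
  have h1 := h0 wb.
  have h2 := h1 z0d uP.
  rewrite /G /Dt.
  exact: h2.
have bG : tbounded G.
  have [[Bp hp] mp] := nphi.
  have nB : nice (fun u => phi u * (block_mass R * dec * S u)).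
    by apply: niceM => //; exact: niceZ.
  have ng t : nice (fun u => phi u * sqn (Dt t u)).
    by apply: niceM => //; apply: nice_sqn; exact: cDt.
  split; last first.
    exists (tmean P (fun u => phi u * (block_mass R * dec * S u)) z0) => t.
    rewrite ger0_norm; last by apply: tmean_ge0 => // u _; rewrite mulr_ge0 ?sqn_ge0.
    apply: le_tmean => // u _; rewrite ler_wpM2l//.
    exact: block_sup.
  rewrite (_ : G = fun t => \sum_(x <- [seq (m, k) | m <- M, k <- M])
    (tmean P (fun u => phi u * Re (b x.1 u * (b x.2 u)^*%C)) z0 *
       Re (nz sg t x.1 * (nz sg t x.2)^*%C) +
     tmean P (fun u => phi u * - Im (b x.1 u * (b x.2 u)^*%C)) z0 *
        Im (nz sg t x.1 * (nz sg t x.2)^*%C))).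
    have cn n := cmeas_nz theta sg n.
    have mm x : cmeas (fun t : measurableTypeR R => nz sg t x.1 * (nz sg t x.2)^*%C).
      by apply: cmeasM => //; exact: cmeasJ.
    elim: [seq _ | _ <- _, _ <- _] => [|x l IH].
      by under eq_fun do rewrite big_nil; exact: measurable_cst.
    under eq_fun do rewrite big_cons.
    by apply: measurable_funD => //; apply: measurable_funD; apply: measurable_funM => //;
      have [] := mm x.
  have nb x : nice (fun u => phi u * Re (b x.1 u * (b x.2 u)^*%C)) /\
      nice (fun u => phi u * - Im (b x.1 u * (b x.2 u)^*%C)).
    have [n1 n2] : cnice (fun u => b x.1 u * (b x.2 u)^*%C).
      by apply: cniceM => //; exact: cniceJ.
    by split; apply: niceM => //; exact: niceN.
  apply/funext => t; rewrite /G.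
  rewrite (eq_tmean (h := fun u => \sum_(x <- [seq (m, k) | m <- M, k <- M])
    (Re (nz sg t x.1 * (nz sg t x.2)^*%C) * (phi u * Re (b x.1 u * (b x.2 u)^*%C)) +
     Im (nz sg t x.1 * (nz sg t x.2)^*%C) * (phi u * - Im (b x.1 u * (b x.2 u)^*%C)))) uP); last first.
    move=> u _; rewrite sqn_expand mulr_sumr; apply: eq_bigr => x _; ring.
  rewrite tmean_sum//; last by move=> x _; have [n1 n2] := nb x; apply: niceD; exact: niceZ.
  apply: eq_bigr => x _; have [n1 n2] := nb x.
  rewrite tmeanD//; [|exact: niceZ|exact: niceZ].
  by rewrite !tmeanZ//; congr (_ + _); rewrite mulrC.
apply: (@le_trans _ _ (tavg (fun t => past_const R * lam * G t))).
  apply: le_tavg => //; first by apply: tboundedM => //; exact: tbounded_cst.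
  by move=> t; rewrite -base.
rewrite tavgZ// GE /Kc.
have -> : past_const R * block_mass R * dec * tmean P (fun u => phi u * S u) z0 =
  past_const R * lam * tmean P (fun u => block_mass R * dec / lam * (phi u * S u)) z0.
  rewrite tmeanZ//; last exact: niceM.
  by field; rewrite lt0r_neq0.
rewrite ler_wpM2l//.
have nav : nice (fun u => phi u * tavg (fun t => sqn (Dt t u))).
  have [[Bp hp] mp] := nphi; apply: niceM => //.
  rewrite (_ : (fun u => _) = fun u => \sum_(x <- [seq (m, k) | m <- M, k <- M])
    (tavg (fun t => Re (nz sg t x.1 * (nz sg t x.2)^*%C)) * Re (b x.1 u * (b x.2 u)^*%C) +
     tavg (fun t => Im (nz sg t x.1 * (nz sg t x.2)^*%C)) * - Im (b x.1 u * (b x.2 u)^*%C))).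
    apply: nice_sum => x _.
    have [n1 n2] : cnice (fun u => b x.1 u * (b x.2 u)^*%C).
      by apply: cniceM => //; exact: cniceJ.
    by apply: niceD; apply: niceZ => //; exact: niceN.
  apply/funext => u.
  have bnz x : tbounded (fun t => Re (nz sg t x.1 * (nz sg t x.2)^*%C)) /\
     tbounded (fun t => Im (nz sg t x.1 * (nz sg t x.2)^*%C)).
    have mm : cmeas (fun t : measurableTypeR R => nz sg t x.1 * (nz sg t x.2)^*%C).
      by apply: cmeasM; [|apply: cmeasJ]; exact: cmeas_nz.
    have nn t : normc (nz sg t x.1 * (nz sg t x.2)^*%C) <= 1.
      rewrite normc_le1 sqnM sqnJ mulr_ile1 ?sqn_ge0//; exact: nz_in_disc.
    by case: mm => m1 m2; split; split => //; exists 1 => t;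
      rewrite (le_trans _ (nn t))// ?normRe_le ?normIm_le.
  rewrite (@eq_tavg _ _ (fun t => \sum_(x <- [seq (m, k) | m <- M, k <- M])
    (Re (b x.1 u * (b x.2 u)^*%C) * Re (nz sg t x.1 * (nz sg t x.2)^*%C) +
     - Im (b x.1 u * (b x.2 u)^*%C) * Im (nz sg t x.1 * (nz sg t x.2)^*%C)))); last first.
    by move=> t; rewrite sqn_expand.
  rewrite tavg_sum; last first.
    by move=> x _; have [b1 b2] := bnz x; apply: tboundedD; apply: tboundedM => //;
      exact: tbounded_cst.
  apply: eq_bigr => x _; have [b1 b2] := bnz x.
  rewrite tavgD; [|by apply: tboundedM => //; exact: tbounded_cst
    |by apply: tboundedM => //; exact: tbounded_cst].
  by rewrite !tavgZ//; congr (_ + _); rewrite mulrC.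
apply: le_tmean => //; first by apply: niceZ; exact: niceM.
move=> u _; rewrite [leRHS]mulrCA ler_wpM2l//.
exact: block_mean_square.
Qed.

Definition transfer_const : R :=
  Kc * (2 `^ (q - 1) * 2 + block_mass R `^ (q - 1) * expR 1 `^ (q - 1)).

(** The increments seen on a vertical line, slightly to the left of the critical
one, are controlled by those on the torus. *)
Lemma transfer :
  tavg (fun t => increment A D q d (nz sg t)) <=
  transfer_const * expR (- (2 * lam * sg)) * tmean (P ++ B) (increment A D q d) z0.
Proof.
have q10 : 0 <= q - 1 by rewrite subr_ge0.
have q0 : 0 <= q by exact: le_trans q1.
have dd0 : 0 <= d ^+ 2 by exact: sqr_ge0.
have KD : 0 <= Kc * dec by rewrite mulr_ge0// ltW.
rewrite -/dec.
have nA : nice (fun u => sqn (A u) `^ (q - 1)) by exact: nice_sqn_powR.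
have nsD : nice (fun u => sqn (D u)) by exact: nice_sqn.
have nI := nice_increment d q1 cA cD.
have nsp : nice (smooth_pow d (q - 1) A) by exact: nice_smooth_pow.
have SE u : in_disc u -> tmean B (fun v => sqn (D v)) u = S u.
  by move=> ud; exact: dblock_parseval.
have BP r : r \in B -> r \notin P.
  move=> rB; move: uPB; rewrite cat_uniq => /and3P[_ /hasPn h _]; exact: h.
have meanS (phi : point -> R) : nice phi ->
    (forall u v, (forall r, r \in P -> u r = v r) -> phi u = phi v) ->
    tmean P (fun u => phi u * S u) z0 = tmean (P ++ B) (fun u => phi u * sqn (D u)) z0.
  move=> nphi ephi; rewrite tmean_cat; apply: eq_tmean => // u tu.
  have ud := torus_in_disc z0d tu; rewrite -SE// -tmeanZ//.
  apply: eq_tmean => // v [_ tv]; congr (_ * _); apply: ephi => r rP.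
  by rewrite tv//; apply/negP => /BP; rewrite rP.
pose E1 := tmean (P ++ B) (fun u => smooth_pow d (q - 1) A u * sqn (D u)) z0.
pose E2 := tmean (P ++ B) (fun u => sqn (D u) `^ q) z0.
have EE : tmean (P ++ B) (increment A D q d) z0 = E1 + E2.
  by rewrite /E1 /E2 -tmeanD//; [exact: niceM|exact: nice_sqn_powR].
have E10 : 0 <= E1.
  apply: tmean_ge0 => //; first exact: niceM.
  by move=> u _; rewrite mulr_ge0 ?powR_ge0 ?sqn_ge0.
have E20 : 0 <= E2.
  by apply: tmean_ge0 => //; [exact: nice_sqn_powR|move=> u _; exact: powR_ge0].
have tb g : nice g -> tbounded (fun t => g (nz sg t)) by exact: tbounded_nice.
have t1 : tavg (fun t => sqn (A (nz sg t)) `^ (q - 1) * sqn (D (nz sg t))) <= Kc * dec * E1.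
  apply: (@le_trans _ _ (Kc * dec * tmean P (fun u => sqn (A u) `^ (q - 1) * S u) z0)).
    apply: main_le => //.
    - by move=> u; exact: powR_ge0.
    - by move=> u v /eqA ->.
    - by apply: (tb (fun u => sqn (A u) `^ (q - 1) * sqn (D u))); exact: niceM.
    move=> t; apply: le_trans (past_le t q10 cA cD pA pD) _.
    rewrite le_eqVlt; apply/orP; left; apply/eqP; congr (_ * _).
    by apply: eq_tmean => // u /D_nz ->.
  rewrite meanS//; last by move=> u v /eqA ->.
  apply: (ler_wpM2l KD); rewrite /E1; apply: le_tmean => //.
  - exact: niceM.
  - exact: niceM.
  move=> u _; rewrite ler_wpM2r ?sqn_ge0//; apply: le_powR => //; first exact: sqn_ge0.
  by rewrite lerDl.
have t2 : tavg (fun t => (d ^+ 2) `^ (q - 1) * sqn (D (nz sg t))) <= Kc * dec * E1.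
  have nd : nice (fun u : point => (d ^+ 2) `^ (q - 1)) by exact: nice_cst.
  apply: (@le_trans _ _ (Kc * dec * tmean P (fun u => (d ^+ 2) `^ (q - 1) * S u) z0)).
    apply: main_le => //.
    - by move=> u; exact: powR_ge0.
    - by apply: (tb (fun u => (d ^+ 2) `^ (q - 1) * sqn (D u))); exact: niceM.
    move=> t.
    have h : sqn (D (nz sg t)) <=
        past_const R * lam * tmean P (fun u => sqn (Dt t u)) (nz sg t).
      have := past_le t (lexx 0) cD cD pD pD; rewrite powRr0 mul1r.
      rewrite (eq_tmean (h := fun u => sqn (Dt t u)) uP)// => u /D_nz ->.
      by rewrite powRr0 mul1r.
    apply: le_trans (ler_wpM2l (powR_ge0 _ _) h) _.
    have nDt : nice (fun u => sqn (Dt t u)) by apply: (@nice_sqn R (Dt t)); exact: cDt.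
    by rewrite mulrCA -[X in _ * X <= _]tmeanZ//; exact: nz_in_disc.
  rewrite meanS//; apply: (ler_wpM2l KD); rewrite /E1; apply: le_tmean => //.
  - exact: niceM.
  - exact: niceM.
  move=> u _; rewrite ler_wpM2r ?sqn_ge0//; apply: le_powR => //.
  by rewrite lerDr sqn_ge0.
pose bq := (block_mass R * dec) `^ (q - 1).
have bd0 : 0 <= block_mass R * dec by rewrite mulr_ge0// ltW.
have nSq e : 0 <= e -> nice (fun u => S u `^ e) by move=> e0; exact: nice_powR.
have t3 : tavg (fun t => sqn (D (nz sg t)) `^ q) <= Kc * dec * (bq * E2).
  apply: (@le_trans _ _ (Kc * dec * tmean P (fun u => (bq * S u `^ (q - 1)) * S u) z0)).
    apply: (@main_le (fun u => bq * S u `^ (q - 1)) (fun t => sqn (D (nz sg t)) `^ q)).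
    - by apply: niceZ; exact: nSq.
    - by move=> u; rewrite mulr_ge0 ?powR_ge0.
    - move=> u v uv; congr (_ * _ `^ _); apply: eq_bigr => m _.
      by rewrite (eqb m uv).
    - by apply: (tb (fun u => sqn (D u) `^ q)); exact: nice_sqn_powR.
    move=> t; rewrite powR_split ?sqn_ge0//.
    apply: le_trans (past_le t q10 cD cD pD pD) _.
    rewrite ler_wpM2l//.
      by rewrite mulr_ge0 ?(ltW lam_gt0)// /past_const mulr_ge0 ?expR_ge0.
    apply: le_tmean => //.
    - by apply: niceM => //; exact: nice_sqn_powR.
    - by apply: niceM; [apply: niceZ; exact: nSq|apply: nice_sqn; exact: cDt].
    - exact: nz_in_disc.
    move=> u /D_nz ->; rewrite ler_wpM2r ?sqn_ge0// /bq -powRM//.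
    by apply: le_powR => //; [exact: sqn_ge0|exact: block_sup].
  apply: (ler_wpM2l KD).
  rewrite (eq_tmean (h := fun u => bq * S u `^ q) uP); last first.
    by move=> u _; rewrite -mulrA -powR_split.
  rewrite tmeanZ//; last exact: nSq.
  rewrite ler_wpM2l ?powR_ge0// /E2 tmean_cat; apply: le_tmean => //.
  - exact: nSq.
  - by apply: nice_tmean; exact: nice_sqn_powR.
  move=> u tu; have ud := torus_in_disc z0d tu.
  rewrite -SE//; apply: tmean_jensen => // v; exact: sqn_ge0.
have cst_b c (f : R -> R) : tbounded f -> tbounded (fun t => c * f t).
  by move=> bf; apply: tboundedM => //; exact: tbounded_cst.
have b1 : tbounded (fun t => sqn (A (nz sg t)) `^ (q - 1) * sqn (D (nz sg t))).
  by apply: (tb (fun u => sqn (A u) `^ (q - 1) * sqn (D u))); exact: niceM.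
have b2 : tbounded (fun t => (d ^+ 2) `^ (q - 1) * sqn (D (nz sg t))).
  by apply: cst_b; apply: (tb (fun u => sqn (D u))).
have b3 : tbounded (fun t => sqn (D (nz sg t)) `^ q).
  by apply: (tb (fun u => sqn (D u) `^ q)); exact: nice_sqn_powR.
apply: (@le_trans _ _ (tavg (fun t => (2 `^ (q - 1) * (sqn (A (nz sg t)) `^ (q - 1) * sqn (D (nz sg t))) +
   2 `^ (q - 1) * ((d ^+ 2) `^ (q - 1) * sqn (D (nz sg t)))) + sqn (D (nz sg t)) `^ q))).
  apply: le_tavg.
  - exact: tb.
  - by apply: tboundedD => //; apply: tboundedD; exact: cst_b.
  move=> t; rewrite /increment lerD2r -mulrDr -mulrDl mulrA ler_wpM2r ?sqn_ge0//.
  exact: powR_sum2_le (sqn_ge0 _) dd0.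
have c1 := cst_b (2 `^ (q - 1)) _ b1; have c2 := cst_b (2 `^ (q - 1)) _ b2.
rewrite (tavgD (tboundedD c1 c2) b3) (tavgD c1 c2) (tavgZ _ b1) (tavgZ _ b2) EE /transfer_const.
have p2 : 0 <= 2 `^ (q - 1) :> R by exact: powR_ge0.
have bq_le : bq <= block_mass R `^ (q - 1) * expR 1 `^ (q - 1).
  rewrite /bq (powRM _ bm0 (ltW dec_gt0)); apply: ler_wpM2l; first exact: powR_ge0.
  apply: le_powR; [exact: q10|exact: ltW dec_gt0|exact: dec_le].
set c3 := block_mass R `^ (q - 1) * _ in bq_le *.
have c30 : 0 <= c3 by rewrite mulr_ge0 ?powR_ge0.
have h1 := ler_wpM2l p2 t1; have h2 := ler_wpM2l p2 t2.
have h3 : Kc * dec * (bq * E2) <= Kc * dec * (c3 * E2) by apply: ler_wpM2l => //; exact: ler_wpM2r.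
have h4 := mulr_ge0 KD (mulr_ge0 c30 E10).
have h5 := mulr_ge0 KD (mulr_ge0 p2 E20).
exact: (transfer_arith h1 h2 t3 h3 h4 h5).
Qed.

End Transfer.

Section HalfLineIntegral.
Variable R : realType.
Local Notation leb := (@lebesgue_measure R).
Implicit Types (mu b x t lam : R) (k : R -> R).

Definition hint b k : R := \int[leb]_x ((b <= x)%R%:R * k x).

(** Integrands on a half-line with a common exponential rate of decay. *)
Definition hdec b mu k := measurable_fun setT k /\
  exists C, forall x, b <= x -> `|k x| <= C * expR (- (mu * x)).

Lemma hint_wint b mu k : hint b k = wint leb (ew mu b) (fun x => expR (mu * x) * k x).
Proof.
apply: eq_Rintegral => x _; rewrite /ew -mulrA; congr (_ * _).
by rewrite mulrA -expRD addNr expR0 mul1r.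
Qed.

Lemma measurable_expM mu : measurable_fun setT (fun x : R => expR (mu * x)).
Proof. by apply: continuous_measurable_fun; exact: continuous_expM. Qed.

Lemma hdec_bounded b mu k : hdec b mu k -> bounded_on (ew mu b) (fun x => expR (mu * x) * k x).
Proof.
move=> [mk [C kC]]; split; first by apply: measurable_funM => //; exact: measurable_expM.
exists C => x /ew_neq0 bx; rewrite normrM ger0_norm ?expR_ge0//.
apply: (le_trans (ler_wpM2l (expR_ge0 _) (kC _ bx))).
by rewrite mulrCA -expRD addrN expR0 mulr1.
Qed.

Section fixed_rate.
Variables (b mu : R).
Hypothesis mu0 : 0 < mu.

Let ww := ew_weight b mu0.

Lemma hintD k1 k2 : hdec b mu k1 -> hdec b mu k2 ->
  hint b (fun x => k1 x + k2 x) = hint b k1 + hint b k2.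
Proof.
move=> /hdec_bounded h1 /hdec_bounded h2; rewrite !(hint_wint b mu) -wintD//.
by apply: eq_wint => x _; rewrite mulrDr.
Qed.

Lemma hintZ c k : hdec b mu k -> hint b (fun x => c * k x) = c * hint b k.
Proof.
move=> /hdec_bounded h1; rewrite !(hint_wint b mu) -wintZ//.
by apply: eq_wint => x _; rewrite mulrCA.
Qed.

Lemma le_hint k1 k2 : hdec b mu k1 -> hdec b mu k2 ->
  (forall x, b <= x -> k1 x <= k2 x) -> hint b k1 <= hint b k2.
Proof.
move=> /hdec_bounded h1 /hdec_bounded h2 k12; rewrite !(hint_wint b mu).
apply: le_wint => //; first exact: ew_ge0.
by move=> x /ew_neq0 bx; rewrite ler_wpM2l ?expR_ge0// k12.
Qed.

Lemma hdecD k1 k2 : hdec b mu k1 -> hdec b mu k2 -> hdec b mu (fun x => k1 x + k2 x).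
Proof.
move=> [m1 [A h1]] [m2 [B h2]]; split; first exact: measurable_funD.
exists (A + B) => x bx; rewrite (le_trans (ler_normD _ _))// mulrDl.
by apply: lerD; [exact: h1|exact: h2].
Qed.

(** The factor need only be bounded on the half-line. *)
Lemma hdecM k1 k2 : measurable_fun setT k1 -> (exists B, forall x, b <= x -> `|k1 x| <= B) ->
  hdec b mu k2 -> hdec b mu (fun x => k1 x * k2 x).
Proof.
move=> m1 [B h1] [m2 [A h2]]; split; first exact: measurable_funM.
exists (B * A) => x bx; rewrite normrM -mulrA.
by apply: ler_pM => //; [exact: h1|exact: h2].
Qed.

Lemma hdecZ c k : hdec b mu k -> hdec b mu (fun x => c * k x).
Proof. by move=> h; apply: hdecM => //; exists `|c|. Qed.

End fixed_rate.

Lemma hdec_exp b mu lam : mu <= lam -> hdec b mu (fun x => expR (- (lam * x))).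
Proof.
move=> ml; split; first by apply: continuous_measurable_fun; exact: continuous_decay.
exists (expR (- ((lam - mu) * b))) => x bx; rewrite ger0_norm ?expR_ge0// -expRD ler_expR.
by have : (lam - mu) * b <= (lam - mu) * x; [rewrite ler_wpM2l// subr_ge0|lra].
Qed.

Lemma hint_exp b lam : 0 < lam -> hint b (fun x => expR (- (lam * x))) = expR (- (lam * b)) / lam.
Proof.
move=> l0; rewrite (hint_wint b lam) -wint_ew1//; apply: eq_wint => x _.
by rewrite -expRD addrN expR0.
Qed.

Lemma hint_FTC b mu C (H h : R -> R) : 0 < mu ->
  (forall x, is_derive x 1 H (h x)) -> continuous h ->
  (forall x, b <= x -> `|H x| <= C * expR (- (mu * x))) ->
  (forall x, b <= x -> `|h x| <= C * expR (- (mu * x))) -> hint b h = - H b.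
Proof. by move=> *; rewrite (hint_wint b mu); exact: (halfline_FTC (C := C)). Qed.

Lemma hint_restrict b c k : b <= c -> hint c k = hint b (fun x => (c <= x)%R%:R * k x).
Proof.
move=> bc; apply: eq_Rintegral => x _; have [cx|cx] := leP c x.
  by rewrite (le_trans bc cx) /= !mul1r.
by rewrite /= !mul0r mulr0.
Qed.

Lemma eq_hint b k1 k2 : (forall x, b <= x -> k1 x = k2 x) -> hint b k1 = hint b k2.
Proof.
move=> k12; apply: eq_Rintegral => x _; have [bx|_] := leP b x; last by rewrite /= !mul0r.
by rewrite k12.
Qed.

Lemma hint_interval c (K k : R -> R) : c < 0 -> (forall x, is_derive x 1 K (k x)) ->
  continuous k -> hint c (fun x => (x <= 0)%R%:R * k x) = K 0 - K c.
Proof.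
move=> c0 dK ck; rewrite -[RHS]/(fine (_%:E)) EFinB.
rewrite -(continuous_FTC2 (f := k) c0).
- rewrite /hint /Rintegral [in RHS]integral_mkcond; congr fine; apply: eq_integral => x _.
  rewrite patchE mem_setE/= in_itv/= mulrA.
  by case: (c <= x); case: (x <= 0); rewrite /= ?mul1r ?mul0r ?mulr0.
- exact: continuous_subspaceT.
- have cK x : {for x, continuous K} by exact: der_continuous (dK x).
  split; first by move=> x _; have [] := dK x.
  + by apply: cvg_at_right_filter; exact: cK.
  + by apply: cvg_at_left_filter; exact: cK.
- by move=> x _; rewrite derive1E; have [_ ->] := dK x.
Qed.

Definition xi lam x : R := lam^-1 * expR (- 1 - lam * x) + (x <= 0)%R%:R * x.

Lemma expR_shift lam x : expR (- 1 - lam * x) = expR (-1) * expR (- (lam * x)).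
Proof. by rewrite -expRD. Qed.

Lemma xi_ge0 lam x : 0 < lam -> 0 <= xi lam x.
Proof.
move=> l0; rewrite /xi; have [x0|x0] := leP x 0; last first.
  by rewrite /= mul0r addr0 mulr_ge0 ?expR_ge0// invr_ge0 ltW.
rewrite /= mul1r -(pmulr_rge0 _ l0) mulrDr mulrA divff ?gt_eqF// mul1r.
by have := expR_ge1Dx (- 1 - lam * x); lra.
Qed.

Lemma hdec_bounded_fun b mu lam (G : R -> R) B : continuous G -> mu <= lam ->
  (forall x, b <= x -> `|G x| <= B) -> hdec b mu (fun x => expR (- (lam * x)) * G x).
Proof.
move=> cG ml GB; rewrite (_ : (fun _ => _) = fun x => G x * expR (- (lam * x))); last first.
  by apply/funext => x; rewrite mulrC.
apply: hdecM; [exact: continuous_measurable_fun|by exists B|exact: hdec_exp].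
Qed.

(** Value at [0] of a function, from its mean against an exponential density
carried by [[- 1 / lam, +oo[], which has mean [0]. *)
Lemma exp_mean_expansion lam B (G G' G'' : R -> R) : 0 < lam ->
  (forall x, is_derive x 1 G (G' x)) -> (forall x, is_derive x 1 G' (G'' x)) ->
  continuous G'' ->
  (forall x, - lam^-1 <= x -> [/\ `|G x| <= B, `|G' x| <= B & `|G'' x| <= B]) ->
  hint (- lam^-1) (fun x => lam * expR (- 1 - lam * x) * G x) =
  G 0 + hint (- lam^-1) (fun x => xi lam x * G'' x).
Proof.
move=> l0 dG dG' cG'' bB; set b := - lam^-1.
have cG : continuous G by move=> x; exact: der_continuous (dG x).
have cG' : continuous G' by move=> x; exact: der_continuous (dG' x).
have b0 x : b <= x -> `|G x| <= B by move=> /bB[].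
have b1 x : b <= x -> `|G' x| <= B by move=> /bB[].
have b2 x : b <= x -> `|G'' x| <= B by move=> /bB[].
pose e x := expR (- (lam * x)).
have eb : e b = expR 1 by rewrite /e /b mulrN divff ?gt_eqF// opprK.
have step (F F' : R -> R) : (forall x, is_derive x 1 F (F' x)) -> continuous F -> continuous F' ->
    (forall x, b <= x -> `|F x| <= B) -> (forall x, b <= x -> `|F' x| <= B) ->
    hint b (fun x => e x * F' x) = lam * hint b (fun x => e x * F x) - expR 1 * F b.
  move=> dF cF cF' bF bF'.
  have hF := hdec_bounded_fun cF (lexx lam) bF; have hF' := hdec_bounded_fun cF' (lexx lam) bF'.
  have key : hint b (fun x => e x * (F' x + - lam * F x)) =
      hint b (fun x => e x * F' x) + - lam * hint b (fun x => e x * F x).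
    rewrite -(hintZ l0)// -(hintD l0)//; last exact: hdecZ.
    by apply: eq_hint => x _; ring.
  have dd x : is_derive x 1 (fun x => e x * F x) (e x * (F' x + - lam * F x)).
    by apply: (der_eq (derM (der_decay lam x) (dF x))); rewrite /e; ring.
  have cc : continuous (fun x => e x * (F' x + - lam * F x)).
    move=> x; apply: cvgM; first exact: continuous_decay.
    by apply: cvgD; [exact: cF'|apply: cvgM; [exact: cvg_cst|exact: cF]].
  have B0 : 0 <= B by apply: le_trans (bF b (lexx b)).
  have h := @hint_FTC b lam (B + lam * B) _ _ l0 dd cc.
  rewrite key eb in h; have {}h := h _ _; rewrite -h.
  - by ring.
  - move=> x bx; rewrite normrM (ger0_norm (expR_ge0 _)) mulrC ler_wpM2r ?expR_ge0//.
    have lB : 0 <= lam * B by rewrite mulr_ge0// ltW.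
    by rewrite (le_trans (bF x bx))// lerDl.
  - move=> x bx; rewrite normrM (ger0_norm (expR_ge0 _)) mulrC ler_wpM2r ?expR_ge0//.
    rewrite (le_trans (ler_normD _ _))// lerD ?bF'// normrM normrN (gtr0_norm l0).
    by rewrite ler_pM2l ?bF.
have s1 := step _ _ dG cG cG' b0 b1; have s2 := step _ _ dG' cG' cG'' b1 b2.
have hG := hdec_bounded_fun cG (lexx lam) b0.
have hG'' := hdec_bounded_fun cG'' (lexx lam) b2.
have dK x : is_derive x 1 (fun x => x * G' x - G x) (x * G'' x).
  by apply: (der_eq (derB (derM (derI x) (dG' x)) (dG x))); ring.
have cK : continuous (fun x => x * G'' x).
  by move=> x; apply: cvgM; [exact: cvg_id|exact: cG''].
have bneg : b < 0 by rewrite oppr_lt0 invr_gt0.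
have s3 := hint_interval bneg dK cK.
have lhsE : hint b (fun x => lam * expR (- 1 - lam * x) * G x) =
    lam * expR (-1) * hint b (fun x => e x * G x).
  by rewrite -(hintZ l0)//; apply: eq_hint => x _; rewrite expR_shift /e; ring.
have rhsE : hint b (fun x => xi lam x * G'' x) =
    lam^-1 * expR (-1) * hint b (fun x => e x * G'' x) +
    hint b (fun x => (x <= 0)%R%:R * (x * G'' x)).
  rewrite -(hintZ l0)// -(hintD l0).
  - by apply: eq_hint => x _; rewrite /xi expR_shift /e; ring.
  - exact: hdecZ.
  split.
    apply: measurable_funM; last exact: continuous_measurable_fun.
    rewrite (_ : (fun x => _) = \1_(`]-oo, 0] : set R)); first exact: measurable_indic.
    by apply/funext => x; rewrite indicE mem_setE in_itv/=.
  have B0 : 0 <= B by apply: le_trans (b0 b (lexx b)).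
  exists (lam^-1 * B) => x bx; have [x0|x0] := leP x 0; last first.
    by rewrite /= mul0r normr0 mulr_ge0 ?expR_ge0// mulr_ge0// invr_ge0 ltW.
  rewrite /= mul1r normrM (ler0_norm x0) -[leLHS]mulr1.
  apply: ler_pM => //.
  + by rewrite mulr_ge0// oppr_ge0.
  + by apply: ler_pM => //; [rewrite oppr_ge0|rewrite lerNl|exact: b2].
  + by rewrite -[leLHS]expR0 ler_expR oppr_ge0 mulr_ge0_le0// ltW.
rewrite lhsE rhsE s3 s2 s1 mul0r sub0r /b.
have ee : expR (-1) * expR 1 = 1 :> R by rewrite -expRD addNr expR0.
have -> : expR (-1) = (expR 1)^-1 :> R by rewrite expRN.
by field; rewrite !gt_eqF// expR_gt0.
Qed.

(** The mean of a decaying function against the same density only sees its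
derivative. *)
Lemma exp_mean_decay lam mu C (G G' : R -> R) : 0 < mu -> mu <= lam ->
  (forall x, is_derive x 1 G (G' x)) -> continuous G' ->
  (forall x, - lam^-1 <= x -> `|G x| <= C * expR (- (mu * x))) ->
  (forall x, - lam^-1 <= x -> `|G' x| <= C * expR (- (mu * x))) ->
  hint (- lam^-1) (fun x => lam * expR (- 1 - lam * x) * G x) =
  - hint (- lam^-1) (fun x => (1 - expR (- 1 - lam * x)) * G' x).
Proof.
move=> mu0 ml dG cG' GC G'C; set b := - lam^-1.
have l0 : 0 < lam by exact: lt_le_trans ml.
have cG : continuous G by move=> x; exact: der_continuous (dG x).
have C0 : 0 <= C by have := le_trans (normr_ge0 _) (GC b (lexx b)); rewrite pmulr_lge0 ?expR_gt0.
pose e x := expR (- 1 - lam * x).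
have de x : is_derive x 1 e (- lam * e x).
  rewrite /e (_ : (fun x => _) = fun x => expR (-1) * expR (- (lam * x))).
    by rewrite expR_shift; apply: (der_eq (der_exp_decay lam x (expR (-1)))); ring.
  by apply/funext => y; rewrite expR_shift.
have ce : continuous e by move=> x; exact: der_continuous (de x).
have e01 x : b <= x -> 0 <= e x <= 1.
  move=> bx; rewrite expR_ge0 /= -expR0 ler_expR.
  have : lam * b <= lam * x by rewrite ler_pM2l.
  by rewrite {1}/b mulrN divff ?gt_eqF//; lra.
have dH x : is_derive x 1 (fun x => (1 - e x) * G x) (lam * e x * G x + (1 - e x) * G' x).
  by apply: (der_eq (derM (derB (derC 1 x) (de x)) (dG x))); ring.
have hd (F k : R -> R) B : measurable_fun setT k -> continuous F ->
    (forall x, b <= x -> `|k x| <= B) ->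
    (forall x, b <= x -> `|F x| <= C * expR (- (mu * x))) -> hdec b mu (fun x => k x * F x).
  move=> mk cF kB FC; apply: hdecM => //; first by exists B.
  by split; [exact: continuous_measurable_fun|exists C].
have h1 : hdec b mu (fun x => lam * e x * G x).
  apply: (hd _ _ lam) => //.
    by apply: measurable_funM => //; exact: continuous_measurable_fun.
  move=> x /e01/andP[e0 e1]; rewrite ger0_norm ?mulr_ge0 ?(ltW l0)//.
  by rewrite ler_piMr// ltW.
have n1 x : b <= x -> `|1 - e x| <= 1.
  by move=> /e01/andP[e0 e1]; rewrite ler_norml; apply/andP; split; lra.
have h2 : hdec b mu (fun x => (1 - e x) * G' x).
  apply: (hd _ _ 1) => //.
  by apply: measurable_funB => //; exact: continuous_measurable_fun.
have cH : continuous (fun x => lam * e x * G x + (1 - e x) * G' x).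
  move=> x; apply: cvgD; apply: cvgM; [|exact: cG| |exact: cG'].
    by apply: cvgM; [exact: cvg_cst|exact: ce].
  by apply: cvgB; [exact: cvg_cst|exact: ce].
have ec0 x : 0 <= C * expR (- (mu * x)) by rewrite mulr_ge0 ?expR_ge0.
have := @hint_FTC b mu ((lam + 1) * C) _ _ mu0 dH cH.
rewrite (hintD mu0)//.
have -> : (1 - e b) * G b = 0.
  by rewrite /e /b mulrN divff ?gt_eqF// opprK addNr expR0 subrr mul0r.
rewrite oppr0 => h; apply/eqP; rewrite -subr_eq0 opprK h//.
- move=> x bx; rewrite normrM -mulrA; apply: ler_pM => //; last exact: GC.
  by rewrite (le_trans (n1 x bx))// lerDr ltW.
- move=> x bx; rewrite (le_trans (ler_normD _ _))//.
  rewrite (_ : (lam + 1) * C * _ = lam * (C * expR (- (mu * x))) + C * expR (- (mu * x))); last by ring.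
  apply: lerD.
    rewrite normrM; apply: ler_pM => //; last exact: GC.
    have /andP[e0 e1] := e01 x bx; rewrite ger0_norm ?mulr_ge0 ?(ltW l0)//.
    by rewrite ler_piMr// ltW.
  by rewrite normrM -[leRHS]mul1r; apply: ler_pM => //; [exact: n1|exact: G'C].
Qed.

Definition jmeas (k : R -> R -> R) :=
  measurable_fun setT (fun xy : measurableTypeR R * measurableTypeR R => k xy.1 xy.2).

Lemma hint_tavg b mu C (k : R -> R -> R) : 0 < mu -> jmeas k ->
  (forall x t, b <= x -> `|k x t| <= C * expR (- (mu * x))) ->
  hint b (fun x => tavg (k x)) = tavg (fun t => hint b (k ^~ t)).
Proof.
move=> mu0 mk kC; pose k' x t := expR (mu * x) * k x t.
have bk x t : b <= x -> `|k' x t| <= C.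
  move=> bx; rewrite normrM ger0_norm ?expR_ge0//.
  apply: (le_trans (ler_wpM2l (expR_ge0 _) (kC _ _ bx))).
  by rewrite mulrCA -expRD addrN expR0 mulr1.
have mk' : jmeas k'.
  apply: measurable_funM => //.
  by apply: (measurableT_comp (measurable_expM mu)); exact: measurable_fst.
have mkN : jmeas (fun x t => k' x (- t)).
  rewrite /jmeas (_ : (fun _ => _) = (fun xy => k' xy.1 xy.2) \o
    (fun xy : measurableTypeR R * measurableTypeR R =>
      (xy.1, - xy.2) : measurableTypeR R * measurableTypeR R))//.
  apply: measurableT_comp => //; apply: measurable_fun_pair => //.
  by apply: measurableT_comp => //.
have wb := ew_weight b mu0; have w1 := ew_weight 0 (ltr01 : 0 < (1 : R)).
have sw (g : R -> R -> R) : jmeas g -> (forall x t, b <= x -> `|g x t| <= C) ->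
    wint leb (ew mu b) (fun x => Lt (g x)) = Lt (fun t => wint leb (ew mu b) (g ^~ t)).
  by move=> mg gC; apply: wint_swap => //; exists C => x y /ew_neq0 bx _; exact: gC.
have bLt (g : R -> R -> R) : jmeas g -> (forall x t, b <= x -> `|g x t| <= C) ->
    bounded_on (ew mu b) (fun x => Lt (g x)).
  move=> mg gC; split; first exact: measurable_wint.
  exists (C * Lt (fun=> 1)) => x /ew_neq0 bx.
  rewrite /Lt -(wint_cst C w1); apply: le_trans (le_norm_wint _ _ _) _ => //.
  - exact: ew_ge0.
  - by split; [exact: (measurableT_comp mg (measurable_pair1 x))|exists C => t _; exact: gC].
  apply: le_wint => //; first exact: ew_ge0.
  - apply: bounded_on_norm.
    by split; [exact: (measurableT_comp mg (measurable_pair1 x))|exists C => t _; exact: gC].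
  - exact: bounded_on_cst.
  by move=> t _; exact: gC.
have bk1 x : b <= x -> bounded_on (ew 1 0) (k x) /\ bounded_on (ew 1 0) (fun t => k x (- t)).
  move=> bx; apply: tbounded_on; split; first exact: (measurableT_comp mk (measurable_pair1 x)).
  by exists (C * expR (- (mu * x))) => t; exact: kC.
transitivity (wint leb (ew mu b) (fun x => 2^-1 * (Lt (k' x) + Lt (fun t => k' x (- t))))).
  rewrite (hint_wint b mu); apply: eq_wint => x /ew_neq0 /bk1[b1 b2].
  by rewrite /tavg mulrCA; congr (_ * _); rewrite mulrDr /Lt -!wintZ.
have kNC x t : b <= x -> `|k' x (- t)| <= C by move=> bx; exact: bk.
have B1 := bLt _ mk' bk; have B2 := bLt _ mkN kNC.
have e1 := wintZ 2^-1 wb (bounded_onD B1 B2).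
have e2 := wintD wb B1 B2.
have e3 := sw _ mk' bk.
have e4 := sw _ mkN kNC.
rewrite e1 e2 e3 e4 /tavg /Lt.
have e5 t : wint leb (ew mu b) (fun x => k' x t) = hint b (k ^~ t).
  exact: (esym (hint_wint b mu (k ^~ t))).
have e6 : (fun t => wint leb (ew mu b) (fun x => k' x t)) = (fun t => hint b (k ^~ t)).
  by apply/funext => t; exact: e5.
have e7 : (fun t => wint leb (ew mu b) (fun x => k' x (- t))) = (fun t => hint b (k ^~ (- t))).
  by apply/funext => t; exact: e5.
by rewrite e6 e7.
Qed.

End HalfLineIntegral.

Section Strip.
Variable R : realType.
Local Notation leb := (@lebesgue_measure R).
Variables (b mu : R).
Hypothesis mu0 : 0 < mu.
Implicit Types (k : R -> R -> R) (sg t : R).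

(** Functions of [(sg, t)] that are bounded on the half-plane [b <= sg]. *)
Definition reg k := [/\ jmeas k, forall t, continuous (k ^~ t), forall sg, continuous (k sg) &
  exists B, forall sg t, b <= sg -> `|k sg t| <= B].

Definition decay k := exists C, forall sg t, b <= sg -> `|k sg t| <= C * expR (- (mu * sg)).

Lemma reg_cst c : reg (fun _ _ => c).
Proof.
split; [exact: measurable_cst|by move=> t x; exact: cvg_cst|by move=> t x; exact: cvg_cst|].
by exists `|c|.
Qed.

Lemma regD k1 k2 : reg k1 -> reg k2 -> reg (fun x t => k1 x t + k2 x t).
Proof.
move=> [m1 c1 d1 [A h1]] [m2 c2 d2 [B h2]]; split.
- exact: measurable_funD.
- by move=> t x; apply: cvgD; [exact: c1|exact: c2].
- by move=> t x; apply: cvgD; [exact: d1|exact: d2].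
- by exists (A + B) => x t bx; rewrite (le_trans (ler_normD _ _))// lerD ?h1 ?h2.
Qed.

Lemma regM k1 k2 : reg k1 -> reg k2 -> reg (fun x t => k1 x t * k2 x t).
Proof.
move=> [m1 c1 d1 [A h1]] [m2 c2 d2 [B h2]]; split.
- exact: measurable_funM.
- by move=> t x; apply: cvgM; [exact: c1|exact: c2].
- by move=> t x; apply: cvgM; [exact: d1|exact: d2].
- by exists (A * B) => x t bx; rewrite normrM ler_pM ?h1 ?h2.
Qed.

Lemma regZ c k : reg k -> reg (fun x t => c * k x t).
Proof. exact/regM/reg_cst. Qed.

Lemma regN k : reg k -> reg (fun x t => - k x t).
Proof.
move=> [m1 c1 d1 [A h1]]; split.
- by apply: measurableT_comp => //.
- by move=> t x; apply: cvgN; exact: c1.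
- by move=> t x; apply: cvgN; exact: d1.
- by exists A => x t bx; rewrite normrN h1.
Qed.

Lemma regX2 k : reg k -> reg (fun x t => k x t ^+ 2).
Proof. by move=> rk; exact: regM. Qed.

Lemma reg_norm k : reg k -> reg (fun x t => `|k x t|).
Proof.
move=> [m1 c1 d1 [A h1]]; split.
- by apply: measurableT_comp => //; exact: measurable_normr.
- by move=> t x; apply: cvg_norm; exact: c1.
- by move=> t x; apply: cvg_norm; exact: d1.
- by exists A => x t bx; rewrite normr_id h1.
Qed.

Lemma reg_powR k e r : 0 < e -> (forall x t, e <= k x t) -> reg k ->
  reg (fun x t => k x t `^ r).
Proof.
move=> e0 ke [m1 c1 d1 [A h1]].
have k0 x t : 0 < k x t by exact: lt_le_trans (ke x t).
have cp y : 0 < y -> {for y, continuous (fun z : R => z `^ r)}.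
  by move=> y0; have := is_derive1_powR r y0; exact: der_continuous.
split.
- by apply: (measurableT_comp (f := fun y => y `^ r)) => //; exact: measurable_powR.
- move=> t x; apply: (continuous_comp (f := k ^~ t) (g := fun z => z `^ r)); first exact: c1.
  exact: cp.
- move=> t x; apply: (continuous_comp (f := k t) (g := fun z => z `^ r)); first exact: d1.
  exact: cp.
exists (`|A| `^ `|r| + e^-1 `^ `|r|) => x t bx.
have kx := k0 x t; rewrite ger0_norm ?powR_ge0//; have [r0|r0] := leP 0 r.
  apply: ler_wpDr; first exact: powR_ge0.
  rewrite (ger0_norm r0); apply: le_powR => //; first exact: ltW.
  by have := h1 x t bx; rewrite (gtr0_norm kx) => /le_trans; apply; exact: ler_norm.
apply: ler_wpDl; first exact: powR_ge0.
rewrite (ltr0_norm r0) -(powR_inv1 (ltW e0)) -powRrM mulN1r opprK.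
rewrite /powR !gt_eqF// ler_expR ler_wnM2l ?(ltW r0)// ler_ln ?posrE//.
Qed.

Lemma decayD k1 k2 : decay k1 -> decay k2 -> decay (fun x t => k1 x t + k2 x t).
Proof.
move=> [A h1] [B h2]; exists (A + B) => x t bx.
by rewrite (le_trans (ler_normD _ _))// mulrDl lerD ?h1 ?h2.
Qed.

Lemma decayM k1 k2 : reg k1 -> decay k2 -> decay (fun x t => k1 x t * k2 x t).
Proof.
move=> [_ _ _ [A h1]] [B h2]; exists (A * B) => x t bx.
by rewrite normrM -mulrA ler_pM ?h1 ?h2.
Qed.

Lemma decayN k : decay k -> decay (fun x t => - k x t).
Proof. by move=> [A h]; exists A => x t bx; rewrite normrN h. Qed.

Lemma decay_norm k : decay k -> decay (fun x t => `|k x t|).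
Proof. by move=> [A h]; exists A => x t bx; rewrite normr_id h. Qed.

Lemma reg_tbounded k sg : b <= sg -> reg k -> tbounded (k sg).
Proof.
move=> bs [_ _ c [B h]]; split; first exact: continuous_measurable_fun.
by exists B => t; exact: h.
Qed.

Lemma measurable_tavg k : jmeas k -> measurable_fun setT (fun x => tavg (k x)).
Proof.
move=> mk; have w1 := ew_weight 0 (ltr01 : 0 < (1 : R)).
have mkN : jmeas (fun x t => k x (- t)).
  rewrite /jmeas (_ : (fun _ => _) = (fun xy => k xy.1 xy.2) \o
    (fun xy : measurableTypeR R * measurableTypeR R =>
      (xy.1, - xy.2) : measurableTypeR R * measurableTypeR R))//.
  apply: measurableT_comp => //; apply: measurable_fun_pair => //.
  by apply: measurableT_comp => //.
by apply: measurable_funM => //; apply: measurable_funD;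
  [exact (measurable_wint w1 mk)|exact (measurable_wint w1 mkN)].
Qed.

Lemma tavg_bound k B x : tbounded (k x) -> (forall t, `|k x t| <= B) -> `|tavg (k x)| <= B.
Proof.
move=> bk kB; apply: le_trans (norm_tavg_le bk) _; rewrite -[leRHS](tavg_cst B).
by apply: le_tavg => //; [exact: tbounded_norm|exact: tbounded_cst].
Qed.

Lemma hdec_tavg c k : b <= c -> reg k -> decay k -> hdec c mu (fun x => tavg (k x)).
Proof.
move=> bc rk [C kC]; split; first by apply: measurable_tavg; case: rk.
exists C => x cx; have bx := le_trans bc cx; apply: tavg_bound; first exact: reg_tbounded.
by move=> t; exact: kC.
Qed.

Lemma bounded_tavg k : reg k -> measurable_fun setT (fun x => tavg (k x)) /\
  exists B, forall x, b <= x -> `|tavg (k x)| <= B.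
Proof.
move=> rk; split; first by apply: measurable_tavg; case: rk.
have [_ _ _ [B kB]] := rk; exists B => x bx; apply: tavg_bound; first exact: reg_tbounded.
by move=> t; exact: kB.
Qed.

Lemma hdec_tavg_exp c lam k : mu <= lam -> b <= c -> reg k ->
  hdec c mu (fun x => expR (- (lam * x)) * tavg (k x)).
Proof.
move=> ml bc /bounded_tavg[mk [B kB]].
rewrite (_ : (fun _ => _) = fun x => tavg (k x) * expR (- (lam * x))); last first.
  by apply/funext => x; rewrite mulrC.
apply: hdecM => //; last exact: hdec_exp.
by exists B => x cx; apply: kB; exact: le_trans cx.
Qed.

Lemma tbounded_hint c k C : b <= c -> jmeas k ->
  (forall x t, c <= x -> `|k x t| <= C * expR (- (mu * x))) ->
  tbounded (fun t => hint c (k ^~ t)).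
Proof.
move=> bc mk kC; split.
  rewrite (_ : (fun t => _) = fun t => wint leb (ew mu c) (fun x => expR (mu * x) * k x t)); last first.
    by apply/funext => t; exact: hint_wint.
  have mk' : jmeas (fun t x => expR (mu * x) * k x t).
    apply: measurable_funM.
      by apply: (measurableT_comp (measurable_expM mu)); exact: measurable_snd.
    rewrite (_ : (fun _ => _) = (fun xy => k xy.1 xy.2) \o
      (fun xy : measurableTypeR R * measurableTypeR R =>
        (xy.2, xy.1) : measurableTypeR R * measurableTypeR R))//.
    by apply: measurableT_comp => //; apply: measurable_fun_pair.
  exact (measurable_wint (ew_weight c mu0) mk').
exists (C * (expR (- (mu * c)) / mu)) => t.
have hk : hdec c mu (k ^~ t).
  by split; [exact: (measurableT_comp mk (measurable_pair2 t))|exists C => x; exact: kC].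
have he : hdec c mu (fun x => expR (- (mu * x))) by exact: hdec_exp.
rewrite -(hint_exp c mu0) -(hintZ mu0)// ler_norml; apply/andP; split.
  rewrite -mulN1r -(hintZ mu0); last exact: hdecZ.
  apply: (le_hint mu0); [by do 2 apply: hdecZ|by []|move=> x cx].
  by have := kC x t cx; rewrite ler_norml mulN1r => /andP[].
apply: (le_hint mu0); [by []|exact: hdecZ|move=> x cx].
by have := kC x t cx; rewrite ler_norml => /andP[].
Qed.

Lemma jmeas_fst (f : R -> R) : measurable_fun setT f -> jmeas (fun x _ => f x).
Proof. by move=> mf; apply: (measurableT_comp mf); exact: measurable_fst. Qed.

Lemma tavg_expansion lam (N N1 N2 : R -> R -> R) : mu <= lam -> b <= - lam^-1 ->
  reg N -> reg N1 -> reg N2 ->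
  (forall x t : R, is_derive x 1 (N ^~ t) (N1 x t)) ->
  (forall x t : R, is_derive x 1 (N1 ^~ t) (N2 x t)) ->
  hint (- lam^-1) (fun x => lam * expR (- 1 - lam * x) * tavg (N x)) =
  tavg (N 0) + hint (- lam^-1) (fun x => xi lam x * tavg (N2 x)).
Proof.
move=> ml bl rN rN1 rN2 dN dN1; set c := - lam^-1.
have l0 : 0 < lam := lt_le_trans mu0 ml.
have c0 : c <= 0 by rewrite oppr_le0 invr_ge0 ltW.
have [mN cN _ [B0 hN]] := rN; have [_ cN1 _ [B1 hN1]] := rN1; have [mN2 cN2 _ [B2 hN2]] := rN2.
have [C0 C00] : exists C0, forall x, c <= x -> expR (- (lam * x)) <= C0 * expR (- (mu * x)).
  have [_ [C0 h]] := hdec_exp c ml; exists C0 => x cx.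
  by have := h x cx; rewrite ger0_norm ?expR_ge0.
have C0g : 0 <= C0.
  have := le_trans (expR_ge0 _) (C00 c (lexx c)); by rewrite pmulr_lge0 ?expR_gt0.
have mexi : measurable_fun setT (xi lam).
  apply: measurable_funD; apply: measurable_funM => //.
    rewrite (_ : (fun x => _) = fun x => expR (-1) * expR (- (lam * x))).
      apply: measurable_funM => //.
      by apply: continuous_measurable_fun; exact: continuous_decay.
    by apply/funext => x; rewrite expR_shift.
  rewrite (_ : (fun x => _) = \1_(`]-oo, 0] : set R)); first exact: measurable_indic.
  by apply/funext => x; rewrite indicE mem_setE in_itv/=.
have xi_le x : c <= x -> `|xi lam x| <= lam^-1 * expR (-1) * expR (- (lam * x)).
  move=> cx; rewrite ger0_norm ?xi_ge0// /xi expR_shift mulrA gerDl.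
  by have [x0|x0] := leP x 0; rewrite /= ?mul1r ?mul0r.
pose k1 x t := lam * expR (- 1 - lam * x) * N x t.
pose k2 x t := xi lam x * N2 x t.
have m1 : jmeas k1.
  apply: measurable_funM => //; apply: (jmeas_fst (f := fun x => lam * expR (- 1 - lam * x))).
  rewrite (_ : (fun x => _) = fun x => lam * expR (-1) * expR (- (lam * x))).
    apply: measurable_funM => //.
    by apply: continuous_measurable_fun; exact: continuous_decay.
  by apply/funext => x; rewrite expR_shift mulrA.
have m2 : jmeas k2 by apply: measurable_funM => //; exact: jmeas_fst.
have b1 x t : c <= x -> `|k1 x t| <= lam * expR (-1) * C0 * B0 * expR (- (mu * x)).
  move=> cx; rewrite /k1 normrM ger0_norm ?mulr_ge0 ?expR_ge0 ?(ltW l0)// expR_shift.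
  have := hN x t (le_trans bl cx); have := C00 x cx => h1 h2.
  have e1 := expR_ge0 (-1 : R).
  apply: (@le_trans _ _ (lam * (expR (-1) * (C0 * expR (- (mu * x)))) * B0)).
    apply: ler_pM => //; first by rewrite !mulr_ge0 ?expR_ge0// ltW.
    by rewrite ler_pM2l// ler_pM2l ?expR_gt0.
  by rewrite le_eqVlt; apply/orP; left; apply/eqP; ring.
have b2 x t : c <= x -> `|k2 x t| <= lam^-1 * expR (-1) * C0 * B2 * expR (- (mu * x)).
  move=> cx; rewrite /k2 normrM.
  have := hN2 x t (le_trans bl cx); have := C00 x cx => h1 h2.
  apply: (@le_trans _ _ (lam^-1 * expR (-1) * (C0 * expR (- (mu * x))) * B2)).
    apply: ler_pM => //; apply: le_trans (xi_le x cx) _.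
    by rewrite ler_wpM2l// mulr_ge0 ?expR_ge0// invr_ge0 ltW.
  by rewrite le_eqVlt; apply/orP; left; apply/eqP; ring.
have e1 := hint_tavg mu0 m1 b1; have e2 := hint_tavg mu0 m2 b2.
have t1 : hint c (fun x => lam * expR (- 1 - lam * x) * tavg (N x)) = hint c (fun x => tavg (k1 x)).
  by apply: eq_hint => x cx; rewrite -tavgZ//; apply: (reg_tbounded _ rN); exact: le_trans cx.
have t2 : hint c (fun x => xi lam x * tavg (N2 x)) = hint c (fun x => tavg (k2 x)).
  by apply: eq_hint => x cx; rewrite -tavgZ//; apply: (reg_tbounded _ rN2); exact: le_trans cx.
rewrite t1 t2 e1 e2 -tavgD; last 2 first.
- by apply: (reg_tbounded _ rN); exact: le_trans c0.
- exact: tbounded_hint b2.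
apply: eq_tavg => t.
apply: (exp_mean_expansion (B := Num.max B0 (Num.max B1 B2)) l0 (dN ^~ t) (dN1 ^~ t) (cN2 t)).
move=> x cx; have bx := le_trans bl cx; rewrite !le_max hN// hN1// hN2//.
by rewrite !orbT.
Qed.

Lemma tavg_decay_mean lam (H H1 : R -> R -> R) : mu <= lam -> b <= - lam^-1 ->
  reg H -> reg H1 -> decay H -> decay H1 ->
  (forall x t : R, is_derive x 1 (H ^~ t) (H1 x t)) ->
  hint (- lam^-1) (fun x => lam * expR (- 1 - lam * x) * tavg (H x)) =
  - hint (- lam^-1) (fun x => (1 - expR (- 1 - lam * x)) * tavg (H1 x)).
Proof.
move=> ml bl rH rH1 [CH hH] [CH1 hH1] dH; set c := - lam^-1.
have l0 : 0 < lam := lt_le_trans mu0 ml.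
have [mH cH _ _] := rH; have [mH1 cH1 _ _] := rH1.
have e01 x : c <= x -> 0 <= expR (- 1 - lam * x) <= 1.
  move=> bx; rewrite expR_ge0 /= -[leRHS]expR0 ler_expR.
  have : lam * c <= lam * x by rewrite ler_pM2l.
  by rewrite {1}/c mulrN divff ?gt_eqF//; lra.
have me : measurable_fun setT (fun x : R => expR (- 1 - lam * x)).
  rewrite (_ : (fun x => _) = fun x => expR (-1) * expR (- (lam * x))).
    apply: measurable_funM => //.
    by apply: continuous_measurable_fun; exact: continuous_decay.
  by apply/funext => x; rewrite expR_shift.
pose k1 x t := lam * expR (- 1 - lam * x) * H x t.
pose k2 x t := (1 - expR (- 1 - lam * x)) * H1 x t.
have m1 : jmeas k1.
  apply: measurable_funM => //; apply: (jmeas_fst (f := fun x => lam * expR (- 1 - lam * x))).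
  exact: measurable_funM.
have m2 : jmeas k2.
  apply: measurable_funM => //; apply: (jmeas_fst (f := fun x => 1 - expR (- 1 - lam * x))).
  exact: measurable_funB.
have b1 x t : c <= x -> `|k1 x t| <= lam * CH * expR (- (mu * x)).
  move=> cx; have /andP[e0 e1] := e01 x cx.
  rewrite /k1 normrM ger0_norm ?mulr_ge0 ?(ltW l0)// -mulrA.
  by apply: ler_pM => //; [rewrite mulr_ge0// ltW|rewrite ler_piMr// ltW|apply: hH; exact: le_trans cx].
have b2 x t : c <= x -> `|k2 x t| <= CH1 * expR (- (mu * x)).
  move=> cx; have /andP[e0 e1] := e01 x cx.
  rewrite /k2 normrM -[leRHS]mul1r; apply: ler_pM => //.
    by rewrite ger0_norm ?subr_ge0// gerBl.
  by apply: hH1; exact: le_trans cx.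
have e1 := hint_tavg mu0 m1 b1; have e2 := hint_tavg mu0 m2 b2.
have t1 : hint c (fun x => lam * expR (- 1 - lam * x) * tavg (H x)) = hint c (fun x => tavg (k1 x)).
  by apply: eq_hint => x cx; rewrite -tavgZ//; apply: (reg_tbounded _ rH); exact: le_trans cx.
have t2 : hint c (fun x => (1 - expR (- 1 - lam * x)) * tavg (H1 x)) = hint c (fun x => tavg (k2 x)).
  by apply: eq_hint => x cx; rewrite -tavgZ//; apply: (reg_tbounded _ rH1); exact: le_trans cx.
rewrite t1 t2 e1 e2 -mulN1r -tavgZ; last exact: tbounded_hint b2.
apply: eq_tavg => t; rewrite mulN1r.
apply: (exp_mean_decay (C := Num.max CH CH1) mu0 ml (dH ^~ t) (cH1 t)) => x cx;
  have bx := le_trans bl cx; [apply: le_trans (hH _ _ bx) _|apply: le_trans (hH1 _ _ bx) _];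
  by rewrite ler_wpM2r ?expR_ge0// le_max lexx ?orbT.
Qed.

End Strip.

Section XiDecay.
Variable R : realType.

Lemma expR_affine_decay (b mu lam : R) : mu <= lam -> hdec b mu (fun x => expR (- 1 - lam * x)).
Proof.
move=> ml; rewrite (_ : (fun x => _) = fun x => expR (-1) * expR (- (lam * x))).
  by apply: hdecZ; exact: hdec_exp.
by apply/funext => x; rewrite expR_shift.
Qed.

Lemma measurable_le_cst (c : R) : measurable_fun setT (fun x : R => (c <= x)%R%:R : R).
Proof.
rewrite (_ : (fun x => _) = \1_(`[c, +oo[ : set R)); first exact: measurable_indic.
by apply/funext => x; rewrite indicE mem_setE in_itv/= andbT.
Qed.

Lemma hdec_xi (mu lam : R) (k : R -> R) : 0 < mu -> mu <= lam -> measurable_fun setT k ->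
  (exists B, forall x, - lam^-1 <= x -> `|k x| <= B) -> hdec (- lam^-1) mu (fun x => xi lam x * k x).
Proof.
move=> mu0 ml mk [B kB]; have l0 : 0 < lam := lt_le_trans mu0 ml.
have [me [C eC]] := expR_affine_decay (- lam^-1) ml; split.
  apply: measurable_funM => //; apply: measurable_funD; apply: measurable_funM => //.
  rewrite (_ : (fun x => _) = \1_(`]-oo, 0] : set R)); first exact: measurable_indic.
  by apply/funext => x; rewrite indicE mem_setE in_itv/=.
exists (lam^-1 * C * B) => x cx; rewrite normrM ger0_norm ?xi_ge0//.
apply: (@le_trans _ _ (lam^-1 * (C * expR (- (mu * x))) * B)); last first.
  by rewrite le_eqVlt; apply/orP; left; apply/eqP; ring.
apply: ler_pM => //; [exact: xi_ge0| |exact: kB].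
have := eC x cx; rewrite ger0_norm ?expR_ge0// => h.
apply: (@le_trans _ _ (lam^-1 * expR (- 1 - lam * x))).
  by rewrite /xi gerDl; have [x0|x0] := leP x 0; rewrite /= ?mul1r ?mul0r.
by rewrite ler_wpM2l// invr_ge0 ltW.
Qed.

Lemma hdec_restrict (b c mu : R) (k : R -> R) : hdec c mu k -> hdec b mu (fun x => (c <= x)%R%:R * k x).
Proof.
move=> [mk [C kC]]; split; first by apply: measurable_funM => //; exact: measurable_le_cst.
exists `|C| => x bx; have [cx|cx] := leP c x; rewrite /= ?mul1r ?mul0r.
  by rewrite (le_trans (kC x cx))// ler_wpM2r ?expR_ge0// ler_norm.
by rewrite normr0 mulr_ge0 ?expR_ge0.
Qed.

End XiDecay.

Section OneStep.
Variable R : realType.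
Local Notation leb := (@lebesgue_measure R).
Implicit Types (x t sg : R).

Lemma der_powR (g : R -> R) (x a r : R) : is_derive x 1 g a -> 0 < g x ->
  is_derive x 1 (fun s => g s `^ r) (r * g x `^ (r - 1) * a).
Proof. by move=> dg g0; exact: (der_comp (f := fun y => y `^ r) (is_derive1_powR r g0) dg). Qed.

(** Real and imaginary parts of a function and of its derivative in
[sg + i t]. *)
Definition holo (X Y X1 Y1 : R -> R -> R) :=
  [/\ forall x t : R, is_derive x 1 (X ^~ t) (X1 x t), forall x t : R, is_derive x 1 (Y ^~ t) (Y1 x t),
      forall x t : R, is_derive t 1 (X x) (- Y1 x t) & forall x t : R, is_derive t 1 (Y x) (X1 x t)].

Lemma amgm2 (c A B V W : R) : 0 < c ->
  2 * `|A * V + B * W| <= c * (A ^+ 2 + B ^+ 2) + c^-1 * (V ^+ 2 + W ^+ 2).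
Proof.
move=> c0; have i0 : 0 < c^-1 by rewrite invr_gt0.
have sq (x y : R) : 2 * `|x * y| <= c * x ^+ 2 + c^-1 * y ^+ 2.
  rewrite normrM -(real_normK (num_real x)) -(real_normK (num_real y)).
  have cc : c * c^-1 = 1 by rewrite divff ?gt_eqF.
  have := mulr_ge0 (ltW c0) (sqr_ge0 (`|x| - c^-1 * `|y|)).
  have -> : c * (`|x| - c^-1 * `|y|) ^+ 2 = c * `|x| ^+ 2 - 2 * (c * c^-1) * (`|x| * `|y|) +
      (c * c^-1) * (c^-1 * `|y| ^+ 2) by ring.
  by rewrite cc; lra.
have := sq A V; have := sq B W; have := ler_normD (A * V) (B * W); lra.
Qed.

Variables (X Y X1 Y1 X2 Y2 V W V1 W1 : R -> R -> R) (d q : R).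
Hypotheses (d0 : 0 < d) (q1 : 1 <= q).
Hypotheses (hf : holo X Y X1 Y1) (hf1 : holo X1 Y1 X2 Y2) (hD : holo V W V1 W1).

Definition uu x t := X x t ^+ 2 + Y x t ^+ 2 + d ^+ 2.
Definition us x t := 2 * (X x t * X1 x t + Y x t * Y1 x t).
Definition ut x t := 2 * (Y x t * X1 x t - X x t * Y1 x t).
Definition NN x t := uu x t `^ q.
Definition N1s x t := q * uu x t `^ (q - 1) * us x t.
Definition N1t x t := q * uu x t `^ (q - 1) * ut x t.
Definition N2s x t := q * (q - 1) * uu x t `^ (q - 1 - 1) * us x t ^+ 2 +
  2 * q * uu x t `^ (q - 1) * (X1 x t ^+ 2 + Y1 x t ^+ 2 + X x t * X2 x t + Y x t * Y2 x t).
Definition N2t x t := q * (q - 1) * uu x t `^ (q - 1 - 1) * ut x t ^+ 2 +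
  2 * q * uu x t `^ (q - 1) * (X1 x t ^+ 2 + Y1 x t ^+ 2 - X x t * X2 x t - Y x t * Y2 x t).
Definition h1 x t := uu x t `^ (q - 1) * (X x t * V x t + Y x t * W x t).
Definition h2 x t := uu x t `^ (q - 1) * (X x t * W x t - Y x t * V x t).
Definition h1s x t := (q - 1) * uu x t `^ (q - 1 - 1) * us x t * (X x t * V x t + Y x t * W x t) +
  uu x t `^ (q - 1) * (X1 x t * V x t + X x t * V1 x t + Y1 x t * W x t + Y x t * W1 x t).
Definition h2t x t := (q - 1) * uu x t `^ (q - 1 - 1) * ut x t * (X x t * W x t - Y x t * V x t) +
  uu x t `^ (q - 1) * (X x t * V1 x t - Y1 x t * W x t - X1 x t * V x t + Y x t * W1 x t).
Definition incr x t := uu x t `^ (q - 1) * (V x t ^+ 2 + W x t ^+ 2) + (V x t ^+ 2 + W x t ^+ 2) `^ q.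
Definition Nnew x t := ((X x t + V x t) ^+ 2 + (Y x t + W x t) ^+ 2 + d ^+ 2) `^ q.

Lemma dd_gt0 : 0 < d ^+ 2. Proof. exact: exprn_gt0. Qed.

Lemma uu_ge x t : d ^+ 2 <= uu x t.
Proof. by rewrite lerDr addr_ge0// sqr_ge0. Qed.

Lemma uu_gt0 x t : 0 < uu x t. Proof. exact: lt_le_trans dd_gt0 (uu_ge x t). Qed.

Lemma der_sqr (g : R -> R) (x a : R) : is_derive x 1 g a -> is_derive x 1 (fun s => g s ^+ 2) (2 * (g x * a)).
Proof.
move=> dg; rewrite (_ : (fun s => _) = fun s => g s * g s)//.
by apply: (der_eq (derM dg dg)); ring.
Qed.

Lemma d_uu_s x t : is_derive x 1 (uu ^~ t) (us x t).
Proof.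
have [dX dY _ _] := hf.
apply: (der_eq (derD (derD (der_sqr (dX x t)) (der_sqr (dY x t))) (derC (d ^+ 2) x))).
by rewrite /us; ring.
Qed.

Lemma d_uu_t x t : is_derive t 1 (uu x) (ut x t).
Proof.
have [_ _ dX dY] := hf.
apply: (der_eq (derD (derD (der_sqr (dX x t)) (der_sqr (dY x t))) (derC (d ^+ 2) t))).
by rewrite /ut; ring.
Qed.

Lemma d_NN_s x t : is_derive x 1 (NN ^~ t) (N1s x t).
Proof. exact: der_powR (d_uu_s x t) (uu_gt0 x t). Qed.

Lemma d_NN_t x t : is_derive t 1 (NN x) (N1t x t).
Proof. exact: der_powR (d_uu_t x t) (uu_gt0 x t). Qed.

Lemma d_N1s x t : is_derive x 1 (N1s ^~ t) (N2s x t).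
Proof.
have [dX dY _ _] := hf; have [dX1 dY1 _ _] := hf1.
have dp := der_powR (q - 1) (d_uu_s x t) (uu_gt0 x t).
apply: (der_eq (derM (derZ q dp) (derZ 2 (derD (derM (dX x t) (dX1 x t)) (derM (dY x t) (dY1 x t)))))).
by rewrite /N2s /us; ring.
Qed.

Lemma d_N1t x t : is_derive t 1 (N1t x) (N2t x t).
Proof.
have [_ _ dX dY] := hf; have [_ _ dX1 dY1] := hf1.
have dp := der_powR (q - 1) (d_uu_t x t) (uu_gt0 x t).
apply: (der_eq (derM (derZ q dp) (derZ 2 (derB (derM (dY x t) (dX1 x t)) (derM (dX x t) (dY1 x t)))))).
by rewrite /N2t /ut; ring.
Qed.

Lemma d_h1 x t : is_derive x 1 (h1 ^~ t) (h1s x t).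
Proof.
have [dX dY _ _] := hf; have [dV dW _ _] := hD.
have dp := der_powR (q - 1) (d_uu_s x t) (uu_gt0 x t).
apply: (der_eq (derM dp (derD (derM (dX x t) (dV x t)) (derM (dY x t) (dW x t))))).
by rewrite /h1s; ring.
Qed.

Lemma d_h2 x t : is_derive t 1 (h2 x) (h2t x t).
Proof.
have [_ _ dX dY] := hf; have [_ _ dV dW] := hD.
have dp := der_powR (q - 1) (d_uu_t x t) (uu_gt0 x t).
apply: (der_eq (derM dp (derB (derM (dX x t) (dW x t)) (derM (dY x t) (dV x t))))).
by rewrite /h2t; ring.
Qed.

Lemma powR_q2 x t : uu x t `^ (q - 1 - 1) * uu x t = uu x t `^ (q - 1).
Proof.
have u0 := uu_gt0 x t; rewrite -{2}(powRr1 (ltW u0)) -powRD ?subrK//.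
by rewrite (gt_eqF u0) implybT.
Qed.

Lemma laplacian_ge x t : 4 * q * uu x t `^ (q - 1) * (X1 x t ^+ 2 + Y1 x t ^+ 2) <= N2s x t + N2t x t.
Proof.
have a0 : 0 <= q * (q - 1) * uu x t `^ (q - 1 - 1).
  by rewrite mulr_ge0 ?powR_ge0// mulr_ge0 ?subr_ge0// (le_trans _ q1).
rewrite /N2s /N2t; have := mulr_ge0 a0 (sqr_ge0 (us x t)); have := mulr_ge0 a0 (sqr_ge0 (ut x t)).
by move: (_ * us x t ^+ 2) (_ * ut x t ^+ 2) => A B; lra.
Qed.

(** Cauchy-Riemann: up to a term without derivatives of [V], [W], the
[sg]-derivative of the cross term is a [t]-derivative. *)
Lemma cross_remainder x t : `|h1s x t - h2t x t| <=
  2 * q * uu x t `^ (q - 1) * `|X1 x t * V x t + Y1 x t * W x t|.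
Proof.
have -> : h1s x t - h2t x t = 2 * (X1 x t * V x t + Y1 x t * W x t) *
   ((q - 1) * (uu x t `^ (q - 1 - 1) * (X x t ^+ 2 + Y x t ^+ 2)) + uu x t `^ (q - 1)).
  by rewrite /h1s /h2t /us /ut; ring.
have p2 := powR_ge0 (uu x t) (q - 1 - 1); have p1 := powR_ge0 (uu x t) (q - 1).
have xy : 0 <= X x t ^+ 2 + Y x t ^+ 2 by rewrite addr_ge0 ?sqr_ge0.
have le1 : uu x t `^ (q - 1 - 1) * (X x t ^+ 2 + Y x t ^+ 2) <= uu x t `^ (q - 1).
  by rewrite -powR_q2 ler_wpM2l// lerDl sqr_ge0.
have q10 : 0 <= q - 1 by rewrite subr_ge0.
have ge0 : 0 <= (q - 1) * (uu x t `^ (q - 1 - 1) * (X x t ^+ 2 + Y x t ^+ 2)) by rewrite !mulr_ge0.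
rewrite !normrM (ger0_norm (_ : 0 <= 2))// (ger0_norm (addr_ge0 ge0 p1)).
have : (q - 1) * (uu x t `^ (q - 1 - 1) * (X x t ^+ 2 + Y x t ^+ 2)) <= (q - 1) * uu x t `^ (q - 1).
  by rewrite ler_wpM2l.
set Z := _ * (_ * (X x t ^+ 2 + _)) => le2.
have n0 := normr_ge0 (X1 x t * V x t + Y1 x t * W x t).
set n := `|_ + _| in n0 *; set p := uu x t `^ (q - 1) in p1 le2 *.
have : n * (Z + p) <= n * (q * p) by rewrite ler_wpM2l//; lra.
by lra.
Qed.

Variables (lam mu : R).
Hypotheses (mu0 : 0 < mu) (ml : mu <= lam) (lam2 : lam^-1 <= 2).
Let b := - lam^-1.
Let lam' := 8 * lam.
Let b' := - lam'^-1.

Let l0 : 0 < lam := lt_le_trans mu0 ml.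
Let l'0 : 0 < lam'. Proof. by rewrite mulr_gt0. Qed.

Let ml' : mu <= lam'. Proof. by have := ml; have := l0; rewrite /lam'; lra. Qed.

Let bb' : b <= b'.
Proof. by rewrite lerN2 lef_pV2 ?posrE// /lam'; have := l0; lra. Qed.

Hypotheses (rX : reg b X) (rY : reg b Y) (rX1 : reg b X1) (rY1 : reg b Y1)
  (rX2 : reg b X2) (rY2 : reg b Y2) (rV : reg b V) (rW : reg b W)
  (rV1 : reg b V1) (rW1 : reg b W1).
Hypotheses (eV : decay b mu V) (eW : decay b mu W) (eV1 : decay b mu V1) (eW1 : decay b mu W1).

Let ruu : reg b uu.
Proof. by apply: regD; [apply: regD; exact: regX2|exact: reg_cst]. Qed.

Let rus : reg b us. Proof. by apply: regZ; apply: regD; exact: regM. Qed.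

Let rut : reg b ut. Proof. by apply: regZ; apply: regD; [|apply: regN]; exact: regM. Qed.

Let rp r : reg b (fun x t => uu x t `^ r).
Proof. exact: reg_powR dd_gt0 uu_ge ruu. Qed.

Let rNN : reg b NN. Proof. exact: rp. Qed.

Let rN1s : reg b N1s. Proof. by apply: regM => //; apply: regZ; exact: rp. Qed.

Let rN1t : reg b N1t. Proof. by apply: regM => //; apply: regZ; exact: rp. Qed.

Let rN2s : reg b N2s.
Proof.
apply: regD; first by apply: regM; [apply: regZ; exact: rp|exact: regX2].
apply: regM; first by apply: regZ; exact: rp.
by do ! apply: regD; [exact: regX2|exact: regX2|exact: regM|exact: regM].
Qed.

Let rN2t : reg b N2t.
Proof.
apply: regD; first by apply: regM; [apply: regZ; exact: rp|exact: regX2].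
apply: regM; first by apply: regZ; exact: rp.
by do ! apply: regD; [exact: regX2|exact: regX2|apply: regN; exact: regM|apply: regN; exact: regM].
Qed.

Let rh1 : reg b h1. Proof. by apply: regM; [exact: rp|apply: regD; exact: regM]. Qed.

Let rh2 : reg b h2.
Proof. by apply: regM; [exact: rp|apply: regD; [|apply: regN]; exact: regM]. Qed.

Let rh1s : reg b h1s.
Proof.
apply: regD.
  by apply: regM; [apply: regM => //; apply: regZ; exact: rp|apply: regD; exact: regM].
by apply: regM; [exact: rp|do ! apply: regD; exact: regM].
Qed.

Let rh2t : reg b h2t.
Proof.
apply: regD.
  by apply: regM; [apply: regM => //; apply: regZ; exact: rp|
    apply: regD; [|apply: regN]; exact: regM].
apply: regM; first exact: rp.
by do ! apply: regD; [exact: regM|apply: regN; exact: regM|apply: regN; exact: regM|exact: regM].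
Qed.

Let eh1 : decay b mu h1.
Proof. by apply: decayM; [exact: rp|apply: decayD; exact: decayM]. Qed.

Let eh2 : decay b mu h2.
Proof. by apply: decayM; [exact: rp|apply: decayD; [|apply: decayN]; exact: decayM]. Qed.

Let eh1s : decay b mu h1s.
Proof.
apply: decayD.
  by apply: decayM; [apply: regM => //; apply: regZ; exact: rp|apply: decayD; exact: decayM].
by apply: decayM; [exact: rp|do ! apply: decayD; exact: decayM].
Qed.

Let eh2t : decay b mu h2t.
Proof.
apply: decayD.
  by apply: decayM; [apply: regM => //; apply: regZ; exact: rp|
    apply: decayD; [|apply: decayN]; exact: decayM].
apply: decayM; first exact: rp.
by do ! apply: decayD; [exact: decayM|apply: decayN; exact: decayM
  |apply: decayN; exact: decayM|exact: decayM].
Qed.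

Let Rr x t := h1s x t - h2t x t.

Let rRr : reg b Rr. Proof. by apply: regD => //; exact: regN. Qed.

Let eRr : decay b mu Rr. Proof. by apply: decayD => //; exact: decayN. Qed.

Definition xmean (l : R) (k : R -> R -> R) :=
  hint (- l^-1) (fun x => l * expR (- 1 - l * x) * tavg (k x)).

(** What the Laplacian gains at the abscissa [x]. *)
Let Lp x := tavg (fun t => N2s x t + N2t x t).

Lemma tavg_N2s_ge x : b <= x -> Lp x - tavg (NN x) <= tavg (N2s x).
Proof.
move=> bx; have tb k : reg b k -> tbounded (k x) by exact: reg_tbounded.
rewrite /Lp tavgD; [|exact: tb|exact: tb].
have [_ _ c2 [B2 hB2]] := rN2t; have [_ _ _ [B1 hB1]] := rN1t; have [_ _ _ [B0 hB0]] := rNN.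
rewrite (tavg_derive2 (B := Num.max B0 (Num.max B1 B2)) (d_NN_t x) (d_N1t x) (c2 x)); last first.
  by move=> t; rewrite !le_max hB0// hB1// hB2// !orbT.
by have := powR_ge0 (uu x 0) q; rewrite -/(NN x 0); lra.
Qed.

Lemma tavg_h1s_le x : b <= x ->
  `|tavg (h1s x)| <= tavg (fun t => `|h2 x t|) + tavg (fun t => `|Rr x t|).
Proof.
move=> bx; have tb k : reg b k -> tbounded (k x) by exact: reg_tbounded.
have -> : tavg (h1s x) = tavg (h2t x) + tavg (Rr x).
  by rewrite -tavgD; [apply: eq_tavg => t; rewrite /Rr addrC subrK|exact: tb|exact: tb].
apply: le_trans (ler_normD _ _) _; apply: lerD; last by apply: norm_tavg_le; exact: tb.
have [_ _ c2 [B2 hB2]] := rh2t; have [_ _ _ [B0 hB0]] := rh2.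
apply: (tavg_derive_le (B := Num.max B0 B2) (d_h2 x) (c2 x)).
  by move=> t; rewrite le_max hB0.
by move=> t; rewrite le_max hB2// orbT.
Qed.

Let rD2 : reg b (fun x t => V x t ^+ 2 + W x t ^+ 2).
Proof. by apply: regD; exact: regX2. Qed.

Let rS : reg b (fun x t => uu x t `^ (q - 1) * (V x t ^+ 2 + W x t ^+ 2)).
Proof. by apply: regM => //; exact: rp. Qed.

Let rG : reg b (fun x t => uu x t `^ (q - 1) * (X1 x t ^+ 2 + Y1 x t ^+ 2)).
Proof. by apply: regM; [exact: rp|apply: regD; exact: regX2]. Qed.

Let Sx x := tavg (fun t => uu x t `^ (q - 1) * (V x t ^+ 2 + W x t ^+ 2)).

Let rho x : R := lam^-1 * expR (- 1 - lam * x).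

Let rho0 x : 0 < rho x. Proof. by rewrite mulr_gt0 ?expR_gt0 ?invr_gt0. Qed.

Lemma cross_absorb x : b <= x ->
  2 * q * (tavg (fun t => `|h2 x t|) + tavg (fun t => `|Rr x t|)) <=
  q * expR (- (lam * x)) * tavg (NN x) + 2^-1 * rho x * Lp x +
  (q * expR (lam * x) + 2 * q ^+ 3 * (rho x)^-1) * Sx x.
Proof.
move=> bx; have tb k : reg b k -> tbounded (k x) by exact: reg_tbounded.
have q0 : 0 < q by exact: lt_le_trans q1.
have tbZ c k : reg b k -> tbounded (fun t => c * k x t).
  by move=> rk; apply: tboundedM; [exact: tbounded_cst|exact: tb].
have rA2 : reg b (fun x t => `|h2 x t|) by exact: reg_norm.
have rAR : reg b (fun x t => `|Rr x t|) by exact: reg_norm.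
have rLp : reg b (fun x t => N2s x t + N2t x t) by exact: regD.
rewrite -(tavgD (tb _ rA2) (tb _ rAR)) -(tavgZ _ (tboundedD (tb _ rA2) (tb _ rAR))).
rewrite /Lp /Sx -(tavgZ _ (tb _ rNN)) -(tavgZ _ (tb _ rLp)) -(tavgZ _ (tb _ rS)).
have b1 := tbZ (q * expR (- (lam * x))) _ rNN.
have b2 := tbZ (2^-1 * rho x) _ rLp.
have b3 := tbZ (q * expR (lam * x) + 2 * q ^+ 3 * (rho x)^-1) _ rS.
rewrite -(tavgD b1 b2) -(tavgD (tboundedD b1 b2) b3).
apply: le_tavg.
- by apply: tboundedM; [exact: tbounded_cst|apply: tboundedD; [exact: (tb _ rA2)|exact: (tb _ rAR)]].
- by apply: tboundedD => //; exact: tboundedD.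
move=> t.
have p1 := powR_ge0 (uu x t) (q - 1).
have e0 := expR_gt0 (- (lam * x)).
have eV' : (expR (- (lam * x)))^-1 = expR (lam * x) by rewrite -expRN opprK.
have a2 : 2 * `|h2 x t| <= expR (- (lam * x)) * NN x t +
    expR (lam * x) * (uu x t `^ (q - 1) * (V x t ^+ 2 + W x t ^+ 2)).
  rewrite /h2 normrM (ger0_norm p1).
  have := amgm2 (X x t) (- Y x t) (W x t) (V x t) e0; rewrite eV' mulNr sqrrN => h.
  have hu : X x t ^+ 2 + Y x t ^+ 2 <= uu x t by rewrite lerDl sqr_ge0.
  have NE : NN x t = uu x t `^ (q - 1) * uu x t by rewrite /NN powR_split// ltW// uu_gt0.
  rewrite NE.
  have : expR (- (lam * x)) * (X x t ^+ 2 + Y x t ^+ 2) <= expR (- (lam * x)) * uu x t.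
    by rewrite ler_pM2l.
  move: h; set n := `|_ + _|; set z := uu x t `^ (q - 1) in p1 *.
  set E1 := expR (- (lam * x)); set E2 := expR (lam * x) => h hh.
  have : z * (2 * n) <= z * (E1 * uu x t + E2 * (V x t ^+ 2 + W x t ^+ 2)).
    by rewrite ler_wpM2l//; rewrite [W x t ^+ 2 + _]addrC in h; lra.
  by lra.
have aR : 2 * `|Rr x t| <= 2 * rho x * (uu x t `^ (q - 1) * (X1 x t ^+ 2 + Y1 x t ^+ 2)) +
    2 * q ^+ 2 * (rho x)^-1 * (uu x t `^ (q - 1) * (V x t ^+ 2 + W x t ^+ 2)).
  have r0 : 0 < rho x / q by rewrite divr_gt0.
  have := amgm2 (X1 x t) (Y1 x t) (V x t) (W x t) r0; rewrite invf_div => h.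
  have := cross_remainder x t; rewrite -/(Rr x t).
  move: h; set n := `|_ + _|; set z := uu x t `^ (q - 1) in p1 *.
  set A := X1 x t ^+ 2 + _; set B := V x t ^+ 2 + _ => h hR.
  have : (2 * q * z) * (2 * n) <= (2 * q * z) * (rho x / q * A + q / rho x * B).
    by rewrite ler_wpM2l// !mulr_ge0// ltW.
  have -> : 2 * q * z * (rho x / q * A + q / rho x * B) =
     2 * rho x * (z * A) + 2 * q ^+ 2 * (rho x)^-1 * (z * B).
    by field; rewrite !gt_eqF.
  by move: hR; lra.
have aL := laplacian_ge x t.
have aL' : 2 * q * rho x * (uu x t `^ (q - 1) * (X1 x t ^+ 2 + Y1 x t ^+ 2)) <=
    2^-1 * rho x * (N2s x t + N2t x t).
  apply: le_trans (ler_wpM2l _ aL); last by rewrite mulr_ge0 ?invr_ge0// ltW.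
  by rewrite le_eqVlt; apply/orP; left; apply/eqP; field.
have a2' := ler_wpM2l (ltW q0) a2; have aR' := ler_wpM2l (ltW q0) aR.
move: a2' aR' aL'; move: (uu x t `^ (q - 1) * (V x t ^+ 2 + _)) => S1.
move: (uu x t `^ (q - 1) * (X1 x t ^+ 2 + _)) => G1.
move: (expR (- (lam * x))) (expR (lam * x)) (rho x) (rho x)^-1 (NN x t) `|h2 x t| `|Rr x t| (N2s x t + N2t x t).
by move=> E1 E2 r ri N0 A2 AR L; rewrite !exprS expr0 !mulr1; lra.
Qed.

Lemma Nnew_le x t : Nnew x t <= NN x t + 2 * q * h1 x t + conv_hi q * incr x t.
Proof.
pose y := V x t ^+ 2 + W x t ^+ 2; pose h := 2 * (X x t * V x t + Y x t * W x t).
have y0 : 0 <= y by rewrite addr_ge0 ?sqr_ge0.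
have hh : h ^+ 2 <= 4 * uu x t * y.
  have s0 := sqr_ge0 (X x t * W x t - Y x t * V x t).
  have := mulr_ge0 (sqr_ge0 d) y0; rewrite /h /uu /y; nra.
have := powR_expand_le q1 (uu_gt0 x t) y0 hh.
have -> : uu x t + h + y = (X x t + V x t) ^+ 2 + (Y x t + W x t) ^+ 2 + d ^+ 2.
  by rewrite /uu /h /y; ring.
rewrite /Nnew /NN /incr -/y => /le_trans; apply; rewrite lerD2r lerD2l /h1 /h.
by rewrite le_eqVlt; apply/orP; left; apply/eqP; ring.
Qed.

Variables (CT E : R).
Hypotheses (CT0 : 0 <= CT) (E0 : 0 <= E).
Hypothesis transfer_bound : forall x, b' <= x ->
  tavg (incr x) <= CT * expR (- (2 * lam * x)) * E.

Let tb_incr x : b <= x -> tbounded (incr x).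
Proof.
move=> bx; apply: tboundedD; first exact: (reg_tbounded bx rS).
have [m [B hB]] := reg_tbounded bx rD2; split; first exact: (measurableT_comp (measurable_powR q)).
exists (`|B| `^ q) => t; rewrite ger0_norm ?powR_ge0//; apply: le_powR.
- by rewrite (le_trans _ q1).
- by rewrite addr_ge0 ?sqr_ge0.
- by rewrite (le_trans (ler_norm _))// (le_trans (hB t))// ler_norm.
Qed.

Let Sx_le x : b' <= x -> Sx x <= CT * expR (- (2 * lam * x)) * E.
Proof.
move=> bx; have bx' := le_trans bb' bx; apply: le_trans (transfer_bound bx).
apply: le_tavg; [exact: (reg_tbounded bx' rS)|exact: tb_incr|move=> t].
by rewrite /incr lerDl powR_ge0.
Qed.

Let rNnew : reg b Nnew.
Proof.
apply: (reg_powR (e := d ^+ 2)); [exact: dd_gt0|by move=> x t; rewrite lerDr addr_ge0 ?sqr_ge0|].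
by apply: regD; [apply: regD; apply: regX2; exact: regD|exact: reg_cst].
Qed.

Definition step_const : R := (2 * q + 2 * q ^+ 3 * expR 1) * expR 1 + conv_hi q * expR 1.

Let Psi := xmean lam NN.

Let phi0 x : 0 <= tavg (NN x).
Proof. by apply: tavg_ge0 => t; exact: powR_ge0. Qed.

Let hNN (c l : R) : b <= c -> mu <= l -> hdec c mu (fun x => expR (- (l * x)) * tavg (NN x)).
Proof. by move=> bc ll; apply: (hdec_tavg_exp ll bc rNN). Qed.

Let theta_split (l x y : R) : l * expR (- 1 - l * x) * y = (l * expR (-1)) * (expR (- (l * x)) * y).
Proof. by rewrite expR_shift; ring. Qed.

Let exp_mean_NN : hint b (fun x => expR (- (lam * x)) * tavg (NN x)) = expR 1 / lam * Psi.
Proof.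
rewrite /Psi /xmean; under [in RHS]eq_hint do rewrite theta_split.
rewrite (hintZ mu0); last exact: hNN.
rewrite mulrA (_ : expR 1 / lam * (lam * expR (-1)) = expR 1 * expR (-1)).
  by rewrite -expRD addrN expR0 mul1r.
by field; rewrite gt_eqF.
Qed.

Let Lp0 x : 0 <= Lp x.
Proof.
apply: tavg_ge0 => t; apply: le_trans (laplacian_ge x t).
by rewrite !mulr_ge0 ?powR_ge0 ?addr_ge0 ?sqr_ge0// (le_trans _ q1).
Qed.

Let rLp : reg b (fun x t => N2s x t + N2t x t). Proof. exact: regD. Qed.

Let hrho (c : R) (k : R -> R -> R) : b <= c -> reg b k -> hdec c mu (fun x => rho x * tavg (k x)).
Proof.
move=> bc rk; rewrite (_ : (fun x => _) = fun x => (lam^-1 * expR (-1)) * (expR (- (lam * x)) * tavg (k x))).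
  by apply: hdecZ; exact: (hdec_tavg_exp ml bc rk).
by apply/funext => x; rewrite /rho expR_shift; ring.
Qed.

Let hgain : hdec b' mu (fun x => 2^-1 * (rho x * Lp x)).
Proof. by apply: hdecZ; exact: hrho. Qed.

(** Comparing the two expansions at [0]: the Laplacian makes the mean decrease. *)
Let mean_compare : xmean lam' NN + hint b' (fun x => 2^-1 * (rho x * Lp x)) <= Psi + lam^-2 * Psi.
Proof.
have bT : measurable_fun setT (fun x => tavg (N2s x)) /\ exists B, forall x, b <= x -> `|tavg (N2s x)| <= B.
  exact: bounded_tavg.
have [mT [B hB]] := bT.
have hx : hdec b mu (fun x => xi lam x * tavg (N2s x)) by apply: hdec_xi => //; exists B.
have hx' : hdec b' mu (fun x => xi lam' x * tavg (N2s x)).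
  by apply: hdec_xi => //; exists B => x bx; apply: hB; exact: le_trans bx.
rewrite /Psi /xmean (tavg_expansion mu0 ml' bb' rNN rN1s rN2s d_NN_s d_N1s).
rewrite {1}(tavg_expansion mu0 ml (lexx b) rNN rN1s rN2s d_NN_s d_N1s).
rewrite -!addrA lerD2l -/b -/b'.
have -> : lam^-2 * hint b (fun x => lam * expR (- 1 - lam * x) * tavg (NN x)) =
    hint b (fun x => rho x * tavg (NN x)).
  rewrite -(hintZ mu0).
    by apply: eq_hint => x _; rewrite /rho; field; rewrite gt_eqF.
  by under eq_fun do rewrite theta_split; apply: hdecZ; exact: hNN.
rewrite (hint_restrict _ bb') [X in _ + X <= _](hint_restrict _ bb').
have h1' := hdec_restrict b hx'; have h2' := hdec_restrict b hgain.
have hr := hrho (lexx b) rNN.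
rewrite -(hintD mu0 h1' h2') -(hintD mu0 hx hr).
apply: (le_hint mu0); [exact: hdecD|exact: hdecD|move=> x bx].
have T1 := tavg_N2s_ge bx; have L0 := Lp0 x; have p0 := phi0 x; have r0 := rho0 x.
have xi_le : xi lam x <= rho x.
  by rewrite /xi -/(rho x) gerDl; have [x0|x0] := leP x 0; rewrite /= ?mul1r ?mul0r.
have xi0 : 0 <= xi lam x by exact: xi_ge0.
move: T1 L0 p0; set T := tavg (N2s x); set P := tavg (NN x); set L := Lp x => T1 L0 p0.
have [b'x|b'x] := leP b' x; rewrite /= ?mul1r ?mul0r.
  pose r' := lam'^-1 * expR (- 1 - lam' * x).
  have r'0 : 0 <= r' by rewrite mulr_ge0 ?expR_ge0// invr_ge0 ltW.
  have r'r : r' <= 2^-1 * rho x.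
    have e4 : expR (- (7 * (lam * x))) <= 4.
      have : - (7 / 8) <= 7 * (lam * x).
        have : lam * b' <= lam * x by rewrite ler_pM2l.
        rewrite {1}/b' /lam' mulrN (_ : lam * (8 * lam)^-1 = 8^-1); last by field; rewrite gt_eqF.
        by lra.
      move=> h; have h2 : expR (- (7 * (lam * x))) <= expR (7 / 16) * expR (7 / 16).
        by rewrite -expRD ler_expR; lra.
      apply: le_trans h2 _.
      have : expR (7 / 16) <= 1 + 2 * (7 / 16) :> R by apply: expR_le_1D2; apply/andP; split; lra.
      have := expR_ge0 (7 / 16 : R); nra.
    have -> : r' = 8^-1 * rho x * expR (- (7 * (lam * x))).
      rewrite /r' /rho (_ : - 1 - lam' * x = (- 1 - lam * x) + - (7 * (lam * x))).
        by rewrite expRD /lam'; field; rewrite gt_eqF.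
      by rewrite /lam'; ring.
    by move: e4 r0; set e := expR (- (7 * _)); set r := rho x; nra.
  have -> : xi lam' x = xi lam x - (rho x - r') by rewrite /xi -/r' -/(rho x); ring.
  have hT : (rho x - r') * (L - P) <= (rho x - r') * T by rewrite ler_wpM2l//; lra.
  have h5 : 0 <= (2^-1 * rho x - r') * L by rewrite mulr_ge0//; lra.
  have h6 : 0 <= r' * P by rewrite mulr_ge0.
  by move: hT h5 h6; lra.
rewrite addr0; have hT : xi lam x * (L - P) <= xi lam x * T by rewrite ler_wpM2l.
have h5 : 0 <= xi lam x * L by rewrite mulr_ge0.
have h6 : 0 <= (rho x - xi lam x) * P by rewrite mulr_ge0// subr_ge0.
by move: hT h5 h6; lra.
Qed.

Lemma mean_at_zero : tavg (NN 0) <= 5 * Psi.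
Proof.
have bT : measurable_fun setT (fun x => tavg (N2s x)) /\ exists B, forall x, b <= x -> `|tavg (N2s x)| <= B.
  exact: bounded_tavg.
have [mT [B hB]] := bT.
have hx : hdec b mu (fun x => xi lam x * tavg (N2s x)) by apply: hdec_xi => //; exists B.
have hr := hrho (lexx b) rNN.
have rE : hint b (fun x => rho x * tavg (NN x)) = lam^-2 * Psi.
  rewrite /Psi /xmean -(hintZ mu0).
    by apply: eq_hint => x _; rewrite /rho; field; rewrite gt_eqF.
  by under eq_fun do rewrite theta_split; apply: hdecZ; exact: hNN.
have Psi0 : 0 <= Psi.
  apply: Rintegral_ge0 => x _; apply: mulr_ge0; first exact: ler0n.
  by apply: mulr_ge0 (phi0 x); rewrite mulr_ge0 ?expR_ge0// ltW.
have li : lam^-2 * Psi <= 4 * Psi.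
  apply: ler_wpM2r => //; rewrite -exprVn expr2.
  have := lam2; have : 0 < lam^-1 by rewrite invr_gt0.
  by move: (lam^-1) => u; nra.
have e0 := tavg_expansion mu0 ml (lexx b) rNN rN1s rN2s d_NN_s d_N1s.
rewrite -/b -/(xmean lam NN) -/Psi in e0.
suff : 0 <= hint b (fun x => xi lam x * tavg (N2s x)) + hint b (fun x => rho x * tavg (NN x)).
  by rewrite rE; move: e0; lra.
rewrite -(hintD mu0 hx hr) -[leLHS](mul0r (hint b (fun x => expR (- (lam * x))))).
have hE : hdec b mu (fun x => expR (- (lam * x))) by exact: hdec_exp.
rewrite -(hintZ mu0 0 hE); apply: (le_hint mu0); [exact: hdecZ|exact: hdecD|move=> x bx].
rewrite mul0r; have T1 := tavg_N2s_ge bx; have L0 := Lp0 x; have p0 := phi0 x.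
have xi_le : xi lam x <= rho x.
  by rewrite /xi -/(rho x) gerDl; have [x0|x0] := leP x 0; rewrite /= ?mul1r ?mul0r.
have xi0 : 0 <= xi lam x by exact: xi_ge0.
move: T1 L0 p0; set T := tavg (N2s x); set P := tavg (NN x); set L := Lp x => T1 L0 p0.
have hT : xi lam x * (L - P) <= xi lam x * T by rewrite ler_wpM2l.
have h5 : 0 <= xi lam x * L by rewrite mulr_ge0.
have h6 : 0 <= (rho x - xi lam x) * P by rewrite mulr_ge0// subr_ge0.
by move: hT h5 h6; lra.
Qed.

Let e'01 x : b' <= x -> 0 <= 1 - expR (- 1 - lam' * x) <= 1.
Proof.
move=> bx; rewrite gerBl expR_ge0 andbT subr_ge0 -[leRHS]expR0 ler_expR.
have : lam' * b' <= lam' * x by rewrite ler_pM2l.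
by rewrite {1}/b' mulrN divff ?gt_eqF//; lra.
Qed.

Let cross_mean : 2 * q * xmean lam' h1 <=
  q * (expR 1 / lam * Psi) + hint b' (fun x => 2^-1 * (rho x * Lp x)) +
  (2 * q + 2 * q ^+ 3 * expR 1) * expR 1 * (CT * E).
Proof.
have q0 : 0 <= q by exact: le_trans q1.
have hA2 : hdec b' mu (fun x => tavg (fun t => `|h2 x t|)).
  by apply: (hdec_tavg bb'); [exact: reg_norm|exact: decay_norm].
have hAR : hdec b' mu (fun x => tavg (fun t => `|Rr x t|)).
  by apply: (hdec_tavg bb'); [exact: reg_norm|exact: decay_norm].
have hAA := hdecD hA2 hAR.
have hh1s : hdec b' mu (fun x => tavg (h1s x)) by exact: (hdec_tavg bb').
have me : measurable_fun setT (fun x : R => 1 - expR (- 1 - lam' * x)).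
  by apply: measurable_funB => //; have [] := expR_affine_decay b' ml'.
have he : hdec b' mu (fun x => (1 - expR (- 1 - lam' * x)) * tavg (h1s x)).
  apply: hdecM => //; exists 1 => x /e'01/andP[u0 u1]; by rewrite ger0_norm.
have step1 : xmean lam' h1 <= hint b' (fun x => tavg (fun t => `|h2 x t|) + tavg (fun t => `|Rr x t|)).
  rewrite /xmean (tavg_decay_mean mu0 ml' bb' rh1 rh1s eh1 eh1s d_h1) -/b' -[leLHS]mulN1r -(hintZ mu0 _ he).
  apply: (le_hint mu0) => //; first exact: hdecZ.
  move=> x bx; have := tavg_h1s_le (le_trans bb' bx); have /andP[u0 u1] := e'01 bx.
  move: (tavg _) (_ + _) (1 - _) u0 u1 => y z u u0 u1 h.
  rewrite mulN1r; apply: le_trans (ler_norm _) _.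
  rewrite normrN normrM (ger0_norm u0); apply: le_trans h; by rewrite ler_piMl.
apply: (le_trans (ler_wpM2l (mulr_ge0 (ler0n _ 2) q0) step1)).
have hE : hdec b' mu (fun x => expR (- (lam * x))) by exact: hdec_exp.
have hP : hdec b' mu (fun x => expR (- (lam * x)) * tavg (NN x)) by exact: hNN.
pose K := (q + 2 * q ^+ 3 * (lam * expR 1)) * (CT * E).
rewrite -(hintZ mu0 _ hAA).
apply: (@le_trans _ _ (hint b' (fun x => (q * (expR (- (lam * x)) * tavg (NN x)) +
    2^-1 * (rho x * Lp x)) + K * expR (- (lam * x))))).
  apply: (le_hint mu0); first exact: hdecZ.
    by apply: hdecD; [apply: hdecD => //|]; exact: hdecZ.
  move=> x bx; have bx' := le_trans bb' bx.
  have rhoV : (rho x)^-1 = lam * expR 1 * expR (lam * x).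
    rewrite /rho invfM invrK -expRN -mulrA -expRD; congr (_ * expR _); ring.
  pose c := q * expR (lam * x) + 2 * q ^+ 3 * (rho x)^-1.
  have c0 : 0 <= c.
    by rewrite /c addr_ge0 ?mulr_ge0 ?expR_ge0 ?exprn_ge0 ?invr_ge0// ltW.
  have key : c * Sx x <= K * expR (- (lam * x)).
    apply: le_trans (ler_wpM2l c0 (Sx_le bx)) _.
    have -> : expR (- (2 * lam * x)) = expR (- (lam * x)) * expR (- (lam * x)).
      by rewrite -expRD; congr expR; ring.
    have ee : expR (lam * x) * expR (- (lam * x)) = 1 by rewrite -expRD addrN expR0.
    rewrite /c rhoV /K le_eqVlt; apply/orP; left; apply/eqP.
    transitivity ((q + 2 * q ^+ 3 * (lam * expR 1)) * (CT * E) * expR (- (lam * x)) *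
      (expR (lam * x) * expR (- (lam * x)))); first by ring.
    by rewrite ee mulr1.
  have h := cross_absorb bx'; rewrite -/c in h.
  apply: (le_trans h); rewrite [X in X + _ <= _](_ : _ =
    q * (expR (- (lam * x)) * tavg (NN x)) + 2^-1 * (rho x * Lp x)); last by ring.
  by rewrite lerD2l.
rewrite (hintD mu0); [|by apply: hdecD => //; exact: hdecZ|exact: hdecZ].
rewrite (hintD mu0) ?(hintZ mu0 K hE) ?(hintZ mu0 q hP)//; last exact: hdecZ.
apply: lerD; first apply: lerD => //.
  rewrite ler_wpM2l// -exp_mean_NN (hint_restrict _ bb').
  apply: (le_hint mu0); [exact: hdec_restrict|exact: hNN|move=> x bx].
  have P0 : 0 <= expR (- (lam * x)) * tavg (NN x) by rewrite mulr_ge0 ?expR_ge0.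
  by have [_|_] := leP b' x; rewrite /= ?mul1r ?mul0r.
rewrite (hint_exp b' l0) /K.
have e1 : expR (- (lam * b')) <= expR 1.
  rewrite ler_expR /b' /lam' mulrN opprK (_ : lam / (8 * lam) = 8^-1); last by field; rewrite gt_eqF.
  by rewrite invf_le1// ler1n.
have li : 0 < lam^-1 by rewrite invr_gt0.
have k0 : 0 <= CT * E by rewrite mulr_ge0.
have q3 : 0 <= q ^+ 3 by exact: exprn_ge0.
have E10 := expR_gt0 (1 : R).
apply: (@le_trans _ _ ((q + 2 * q ^+ 3 * (lam * expR 1)) * (CT * E) * (expR 1 / lam))).
  apply: ler_wpM2l; first by rewrite !(mulr_ge0, addr_ge0)// ltW.
  by rewrite ler_wpM2r// ltW.
have -> : (q + 2 * q ^+ 3 * (lam * expR 1)) * (CT * E) * (expR 1 / lam) =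
   (q * lam^-1 + 2 * q ^+ 3 * expR 1) * (expR 1 * (CT * E)) by field; rewrite gt_eqF.
rewrite -[leRHS]mulrA ler_wpM2r//; first by rewrite mulr_ge0// ltW.
by rewrite lerD2r [leRHS]mulrC ler_wpM2l.
Qed.

(** One step of the recursion on blocks. *)
Lemma one_step : xmean lam' Nnew <= (1 + (2 + q * expR 1) / lam) * Psi + step_const * (CT * E).
Proof.
have q0 : 0 <= q by exact: le_trans q1.
have chi0 : 0 <= conv_hi q.
  by rewrite /conv_hi !addr_ge0 ?mulr_ge0 ?powR_ge0 ?expR_ge0 ?sqr_ge0.
have k0 : 0 <= CT * E by rewrite mulr_ge0.
have Psi0 : 0 <= Psi.
  apply: Rintegral_ge0 => x _; apply: mulr_ge0; first exact: ler0n.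
  by apply: mulr_ge0 (phi0 x); rewrite mulr_ge0 ?expR_ge0// ltW.
have hth (k : R -> R -> R) : reg b k -> hdec b' mu (fun x => lam' * expR (- 1 - lam' * x) * tavg (k x)).
  move=> rk; under eq_fun do rewrite theta_split.
  by apply: hdecZ; exact: (hdec_tavg_exp ml' bb' rk).
have hN := hth _ rNN; have hH := hth _ rh1; have hW := hth _ rNnew.
have hc : hdec b' mu (fun x => lam' * expR (- 1 - lam' * x) * tavg (fun=> 1)).
  exact: (hth _ (reg_cst b 1)).
apply: (@le_trans _ _ (xmean lam' NN + 2 * q * xmean lam' h1 +
   (conv_hi q * expR 1 * (CT * E)) * hint b' (fun x => lam' * expR (- 1 - lam' * x) * tavg (fun=> 1)))).
  have hHz := hdecZ (2 * q) hH; have hcz := hdecZ (conv_hi q * expR 1 * (CT * E)) hc.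
  have hNH := hdecD hN hHz; have hs := hdecD hNH hcz.
  rewrite /xmean -/b' -(hintZ mu0 _ hH) -(hintZ mu0 _ hc) -(hintD mu0 hN hHz) -(hintD mu0 hNH hcz).
  apply: (le_hint mu0 hW hs) => x bx.
  have bx' := le_trans bb' bx.
  have tN := reg_tbounded bx' rNN; have tH := reg_tbounded bx' rh1; have tI := tb_incr bx'.
  have tWn := reg_tbounded bx' rNnew.
  have tcH : tbounded (fun t => 2 * q * h1 x t) by apply: tboundedM => //; exact: tbounded_cst.
  have tcI : tbounded (fun t => conv_hi q * incr x t) by apply: tboundedM => //; exact: tbounded_cst.
  have : tavg (Nnew x) <= tavg (NN x) + 2 * q * tavg (h1 x) + conv_hi q * tavg (incr x).
    rewrite -(tavgZ _ tH) -(tavgZ _ tI) -(tavgD tN tcH) -(tavgD (tboundedD tN tcH) tcI).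
    apply: le_tavg => //; first by apply: tboundedD => //; exact: tboundedD.
    by move=> t; exact: Nnew_le.
  have := transfer_bound bx; rewrite tavg_cst mulr1.
  have e1 : expR (- (2 * lam * x)) <= expR 1.
    have : lam * b' <= lam * x by rewrite ler_pM2l.
    rewrite {1}/b' /lam' mulrN (_ : lam / (8 * lam) = 8^-1); last by field; rewrite gt_eqF.
    by rewrite ler_expR; lra.
  have th0 : 0 <= lam' * expR (- 1 - lam' * x) by rewrite mulr_ge0 ?expR_ge0// ltW.
  move: th0; set th := lam' * _ => th0 hI hNn.
  have hI' : tavg (incr x) <= expR 1 * (CT * E).
    apply: (le_trans hI); rewrite mulrAC mulrC ler_wpM2r//.
  have hI2 := ler_wpM2l chi0 hI'.
  apply: (le_trans (ler_wpM2l th0 hNn)).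
  have : th * (conv_hi q * tavg (incr x)) <= th * (conv_hi q * (expR 1 * (CT * E))).
    exact: ler_wpM2l.
  move: (tavg (incr x)) (tavg (NN x)) (tavg (h1 x)) => i n h; lra.
have -> : hint b' (fun x => lam' * expR (- 1 - lam' * x) * tavg (fun=> 1)) = 1.
  under eq_hint do rewrite tavg_cst theta_split mulr1.
  rewrite (hintZ mu0); last exact: hdec_exp.
  rewrite (hint_exp b' l'0) /b' mulrN opprK divff ?gt_eqF//.
  rewrite (_ : lam' * expR (-1) * (expR 1 / lam') = expR (-1) * expR 1).
    by rewrite -expRD addNr expR0.
  by field; rewrite gt_eqF.
have := mean_compare; have := cross_mean.
have li : lam^-2 * Psi <= 2 / lam * Psi.
  apply: ler_wpM2r => //; rewrite -exprVn expr2; apply: ler_wpM2r; last exact: lam2.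
  by rewrite invr_ge0 ltW.
rewrite /step_const; set G := hint b' _.
have -> : (1 + (2 + q * expR 1) / lam) * Psi = Psi + 2 / lam * Psi + q * (expR 1 / lam * Psi) by ring.
by move: (lam^-2 * Psi) (2 / lam * Psi) (expR 1 / lam * Psi) li => x1 x2 x3; lra.
Qed.

End OneStep.

Section ExponentialSums.
Variable R : realType.
Local Notation C := R[i].
Local Notation Re := complex.Re.
Local Notation Im := complex.Im.
Variable theta : R.
Local Notation nz := (nz theta).
Implicit Types (x t b : R) (s : seq nat) (c : nat -> C).

Definition esum s c x t : C := \sum_(n <- s) c n * nz x t n.

Definition dcf c n : C := ((- ln n%:R)%:C)%C * c n.

Lemma Re_dcf c n : Re (dcf c n) = - ln n%:R * Re (c n). Proof. exact: ReRl. Qed.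

Lemma Im_dcf c n : Im (dcf c n) = - ln n%:R * Im (c n). Proof. exact: ImRl. Qed.

Lemma Re_nzE x t n : Re (nz x t n) = npow (2^-1 + x) n * cos ((theta + t) * ln n%:R).
Proof. by rewrite /nz ReRl /= cosN. Qed.

Lemma Im_nzE x t n : Im (nz x t n) = - (npow (2^-1 + x) n * sin ((theta + t) * ln n%:R)).
Proof. by rewrite /nz ImRl /= sinN mulrN. Qed.

Lemma der_npow x n : is_derive x 1 (fun x : R => npow (2^-1 + x) n) (- ln n%:R * npow (2^-1 + x) n).
Proof.
have d1 : is_derive x 1 (fun x : R => - ((2^-1 + x) * ln n%:R)) (- ln n%:R).
  apply: (der_eq (derN (derM (derD (derC 2^-1 x) (derI x)) (derC (ln n%:R) x)))); ring.
by apply: (der_eq (der_comp (f := expR) (is_derive_expR _) d1)); rewrite mulrC.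
Qed.

Lemma der_nz_s x t n : is_derive x 1 (fun x : R => Re (nz x t n)) (- ln n%:R * Re (nz x t n)) /\
  is_derive x 1 (fun x : R => Im (nz x t n)) (- ln n%:R * Im (nz x t n)).
Proof.
split.
  rewrite (_ : (fun x => _) = fun x => npow (2^-1 + x) n * cos ((theta + t) * ln n%:R)).
    by apply: (der_eq (derM (der_npow x n) (derC _ x))); rewrite Re_nzE; ring.
  by apply/funext => y; rewrite Re_nzE.
rewrite (_ : (fun x => _) = fun x => npow (2^-1 + x) n * - sin ((theta + t) * ln n%:R)).
  by apply: (der_eq (derM (der_npow x n) (derC _ x))); rewrite Im_nzE; ring.
by apply/funext => y; rewrite Im_nzE mulrN.
Qed.

Lemma der_nz_t x t n : is_derive t 1 (fun t : R => Re (nz x t n)) (ln n%:R * Im (nz x t n)) /\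
  is_derive t 1 (fun t : R => Im (nz x t n)) (- ln n%:R * Re (nz x t n)).
Proof.
have dl : is_derive t 1 (fun t : R => (theta + t) * ln n%:R) (ln n%:R).
  apply: (der_eq (derM (derD (derC theta t) (derI t)) (derC (ln n%:R) t))); ring.
split.
  rewrite (_ : (fun t => _) = fun t => npow (2^-1 + x) n * cos ((theta + t) * ln n%:R)).
    apply: (der_eq (derZ _ (der_comp (f := cos) (is_derive_cos _) dl))).
    by rewrite Im_nzE; ring.
  by apply/funext => y; rewrite Re_nzE.
rewrite (_ : (fun t => _) = fun t => - (npow (2^-1 + x) n * sin ((theta + t) * ln n%:R))).
  apply: (der_eq (derN (derZ _ (der_comp (f := sin) (is_derive_sin _) dl)))).
  by rewrite Re_nzE; ring.
by apply/funext => y; rewrite Im_nzE.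
Qed.

Lemma Re_esum s c x t : Re (esum s c x t) =
  \sum_(n <- s) (Re (c n) * Re (nz x t n) - Im (c n) * Im (nz x t n)).
Proof. by rewrite Re_sum; apply: eq_bigr => n _; rewrite ReM. Qed.

Lemma Im_esum s c x t : Im (esum s c x t) =
  \sum_(n <- s) (Re (c n) * Im (nz x t n) + Im (c n) * Re (nz x t n)).
Proof. by rewrite Im_sum; apply: eq_bigr => n _; rewrite ImM. Qed.

Lemma holo_esum s c :
  holo (fun x t => Re (esum s c x t)) (fun x t => Im (esum s c x t))
    (fun x t => Re (esum s (dcf c) x t)) (fun x t => Im (esum s (dcf c) x t)).
Proof.
split=> x t.
- rewrite (_ : (fun y => _) = fun y => \sum_(n <- s) (Re (c n) * Re (nz y t n) - Im (c n) * Im (nz y t n))).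
    rewrite Re_esum; have dn n := derB (derZ (Re (c n)) (proj1 (der_nz_s x t n))) (derZ (Im (c n)) (proj2 (der_nz_s x t n))).
    apply: (der_eq (der_sum s dn)).
    by apply: eq_bigr => n _; rewrite Re_dcf Im_dcf; ring.
  by apply/funext => y; rewrite Re_esum.
- rewrite (_ : (fun y => _) = fun y => \sum_(n <- s) (Re (c n) * Im (nz y t n) + Im (c n) * Re (nz y t n))).
    rewrite Im_esum; have dn n := derD (derZ (Re (c n)) (proj2 (der_nz_s x t n))) (derZ (Im (c n)) (proj1 (der_nz_s x t n))).
    apply: (der_eq (der_sum s dn)).
    by apply: eq_bigr => n _; rewrite Re_dcf Im_dcf; ring.
  by apply/funext => y; rewrite Im_esum.
- rewrite (_ : (fun y => _) = fun y => \sum_(n <- s) (Re (c n) * Re (nz x y n) - Im (c n) * Im (nz x y n))).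
    rewrite Im_esum -sumrN; have dn n := derB (derZ (Re (c n)) (proj1 (der_nz_t x t n))) (derZ (Im (c n)) (proj2 (der_nz_t x t n))).
    apply: (der_eq (der_sum s dn)).
    by apply: eq_bigr => n _; rewrite Re_dcf Im_dcf; ring.
  by apply/funext => y; rewrite Re_esum.
- rewrite (_ : (fun y => _) = fun y => \sum_(n <- s) (Re (c n) * Im (nz x y n) + Im (c n) * Re (nz x y n))).
    rewrite Re_esum; have dn n := derD (derZ (Re (c n)) (proj2 (der_nz_t x t n))) (derZ (Im (c n)) (proj1 (der_nz_t x t n))).
    apply: (der_eq (der_sum s dn)).
    by apply: eq_bigr => n _; rewrite Re_dcf Im_dcf; ring.
  by apply/funext => y; rewrite Im_esum.
Qed.

Lemma eq_fun2 (f g : R -> R -> R) : (forall x t, f x t = g x t) -> f = g.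
Proof. by move=> fg; apply/funext => x; apply/funext => t. Qed.

Lemma reg_nz b n : reg b (fun x t => Re (nz x t n)) /\ reg b (fun x t => Im (nz x t n)).
Proof.
have bnd (x t : R) : b <= x -> normc (nz x t n) <= npow (2^-1 + b) n.
  move=> bx; rewrite /nz normcM normcR ger0_norm ?npow_ge0//.
  by rewrite [normc (cisC _)]normcE_sqn sqn_cisC sqrtr1 mulr1 npow_le// lerD2l.
have m1 : jmeas (fun x _ => npow (2^-1 + x) n : R).
  apply: (jmeas_fst (f := fun x : R => npow (2^-1 + x) n)).
  by apply: continuous_measurable_fun => x; exact: der_continuous (der_npow x n).
have mt (f : R -> R) : continuous f -> jmeas (fun _ t => f ((theta + t) * ln n%:R)).
  move=> cf; apply: (measurableT_comp (f := fun t => f ((theta + t) * ln n%:R))); last exact: measurable_snd.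
  apply: measurableT_comp; first exact: continuous_measurable_fun.
  by apply: measurable_funM => //; exact: measurable_funD.
split; split.
- rewrite (eq_fun2 (fun x t => Re_nzE x t n)).
  by apply: measurable_funM => //; apply: mt; exact: continuous_cos.
- by move=> t x; exact: der_continuous (proj1 (der_nz_s x t n)).
- by move=> x t; exact: der_continuous (proj1 (der_nz_t x t n)).
- by exists (npow (2^-1 + b) n) => x t bx; rewrite (le_trans (normRe_le _))// bnd.
- rewrite (eq_fun2 (fun x t => Im_nzE x t n)).
  apply: measurableT_comp => //.
  by apply: measurable_funM => //; apply: mt; exact: continuous_sin.
- by move=> t x; exact: der_continuous (proj2 (der_nz_s x t n)).
- by move=> x t; exact: der_continuous (proj2 (der_nz_t x t n)).
- by exists (npow (2^-1 + b) n) => x t bx; rewrite (le_trans (normIm_le _))// bnd.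
Qed.

Lemma reg_sum b (s : seq nat) (F : nat -> R -> R -> R) : (forall n, reg b (F n)) ->
  reg b (fun x t => \sum_(n <- s) F n x t).
Proof.
move=> rF; elim: s => [|n s IH].
  have -> : (fun x t => \sum_(n <- [::]) F n x t) = (fun _ _ => 0).
    by apply: eq_fun2 => x t; rewrite big_nil.
  exact: reg_cst.
have -> : (fun x t => \sum_(m <- n :: s) F m x t) = (fun x t => F n x t + \sum_(m <- s) F m x t).
  by apply: eq_fun2 => x t; rewrite big_cons.
exact: regD.
Qed.

Lemma reg_esum b s c : reg b (fun x t => Re (esum s c x t)) /\ reg b (fun x t => Im (esum s c x t)).
Proof.
split.
  rewrite (eq_fun2 (Re_esum s c)).
  apply: reg_sum => n; have [r1 r2] := reg_nz b n.
  by apply: regD; [exact: regZ|apply: regN; exact: regZ].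
rewrite (eq_fun2 (Im_esum s c)).
apply: reg_sum => n; have [r1 r2] := reg_nz b n.
by apply: regD; exact: regZ.
Qed.

Lemma decay_esum b s c : (forall n, n \in s -> (1 < n)%N) ->
  decay b (ln 2) (fun x t => Re (esum s c x t)) /\ decay b (ln 2) (fun x t => Im (esum s c x t)).
Proof.
move=> s1.
suff [K hK] : exists K, forall x t, b <= x -> normc (esum s c x t) <= K * expR (- (ln 2 * x)).
  by split; exists K => x t bx; apply: le_trans (hK x t bx); [exact: normRe_le|exact: normIm_le].
have term n : (1 < n)%N -> exists K, forall x t, b <= x -> normc (nz x t n) <= K * expR (- (ln 2 * x)).
  move=> n1; exists (npow 2^-1 n * expR (- (b * (ln n%:R - ln 2)))) => x t bx.
  rewrite /nz normcM normcR ger0_norm ?npow_ge0//.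
  rewrite [normc (cisC _)]normcE_sqn sqn_cisC sqrtr1 mulr1 /npow -!expRD ler_expR.
  have l2 : ln 2 <= ln n%:R :> R by rewrite ler_ln ?posrE ?ltr0n ?ler_nat//; exact: ltnW.
  have : b * (ln n%:R - ln 2) <= x * (ln n%:R - ln 2) by rewrite ler_wpM2r// subr_ge0.
  by lra.
elim: s s1 => [|n s IH] s1.
  exists 0 => x t bx; rewrite /esum big_nil mul0r.
  by rewrite normcE_sqn sqn0 sqrtr0.
have [A hA] := term n (s1 n (mem_head _ _)).
have [|B hB] := IH; first by move=> m ms; apply: s1; rewrite inE ms orbT.
exists (normc (c n) * A + B) => x t bx; rewrite /esum big_cons.
apply: (le_trans (le_normcD _ _)); rewrite mulrDl; apply: lerD; last exact: hB.
by rewrite normcM -mulrA ler_wpM2l ?normc_ge0// hA.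
Qed.

End ExponentialSums.

Section BlockRecursion.
Variable R : realType.
Local Notation C := R[i].
Local Notation Re := complex.Re.
Local Notation Im := complex.Im.
Local Notation point := (nat -> C).
Variable theta : R.
Local Notation nz := (nz theta).
Variables (s : seq nat) (a : nat -> C) (q d : R).
Hypotheses (s_gt0 : forall n, n \in s -> (0 < n)%N) (q1 : 1 <= q) (d0 : 0 < d).

Let z0 : point := fun=> 0.

Let z0d : in_disc z0. Proof. by move=> r; rewrite sqn0. Qed.

Definition Jk k := (8 ^ k)%N.
Definition Pk k := primes_in 0 (2 ^ Jk k).
Definition Bk k := primes_in (2 ^ Jk k) (2 ^ (8 * Jk k)).
Definition lamk k : R := (Jk k)%:R * ln 2.

Let fk k := dpoly s a (Pk k).
Let Dk k := dblock s a (Pk k) (Bk k).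

Lemma Jk_gt0 k : (0 < Jk k)%N. Proof. by rewrite expn_gt0. Qed.

Lemma PkS k : Pk k.+1 = Pk k ++ Bk k.
Proof. by rewrite /Pk /Bk /Jk expnS -primes_in_cat// leq_exp2l// leq_pmull. Qed.

Lemma Pk_uniq k : uniq (Pk k). Proof. exact: primes_in_uniq. Qed.

Lemma Pk_prime k r : r \in Pk k -> prime r. Proof. exact: primes_in_prime. Qed.

Lemma Bk_prime k r : r \in Bk k -> prime r. Proof. exact: primes_in_prime. Qed.

Lemma PBk_uniq k : uniq (Pk k ++ Bk k). Proof. by rewrite -PkS Pk_uniq. Qed.

Lemma lamkS k : lamk k.+1 = 8 * lamk k.
Proof. by rewrite /lamk /Jk expnS natrM mulrA. Qed.

Lemma lamk_ge k : ln 2 <= lamk k.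
Proof. by rewrite /lamk ler_peMl ?ln_nat_ge0// ler1n Jk_gt0. Qed.

Let ln20 : 0 < ln 2 :> R. Proof. by have := @ln2_ge R; lra. Qed.

Let lamk_inv k : (lamk k)^-1 <= 2.
Proof.
rewrite -[leRHS]invrK lef_pV2 ?posrE ?invr_gt0 ?(lt_le_trans ln20 (lamk_ge k))//.
exact: block_scale_ge (Jk_gt0 k).
Qed.

Let Freq k := [seq n <- s | smooth (Pk k) n].
Let Fnew k := [seq n <- s | smooth (Pk k ++ Bk k) n && ~~ smooth (Pk k) n].

Lemma dpoly_nz P x t : (forall r, r \in P -> prime r) -> uniq P ->
  dpoly s a P (nz x t) = esum theta [seq n <- s | smooth P n] a x t.
Proof.
move=> pP uP; rewrite /esum big_filter /dpoly big_seq_cond [RHS]big_seq_cond.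
by apply: eq_bigr => n /andP[/s_gt0 n0 sn]; rewrite mon_nz// bpart_id.
Qed.

Let Dk_nz k x t : Dk k (nz x t) = esum theta (Fnew k) a x t.
Proof.
rewrite /esum big_filter /Dk /dblock big_seq_cond [RHS]big_seq_cond.
apply: eq_bigr => n /andP[/s_gt0 n0 /andP[sn _]]; rewrite mon_nz.
  by rewrite bpart_id ?PBk_uniq//; rewrite -PkS; exact: Pk_prime.
by rewrite -PkS; exact: Pk_prime.
Qed.

Let Fnew1 k n : n \in Fnew k -> (1 < n)%N.
Proof.
rewrite mem_filter => /andP[/andP[_ ns] /s_gt0 n0]; rewrite ltn_neqAle n0 andbT.
apply: contra ns => /eqP <-; apply/smoothP => // r pr.
by rewrite Euclid_dvd1.
Qed.

Let X k x t := Re (esum theta (Freq k) a x t).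
Let Y k x t := Im (esum theta (Freq k) a x t).

Definition Nk k := NN (X k) (Y k) d q.

Let NkE k x t : Nk k x t = smooth_pow d q (fk k) (nz x t).
Proof. by rewrite /fk /smooth_pow dpoly_nz//; [exact: Pk_prime|exact: Pk_uniq]. Qed.

Definition Psik k := xmean (lamk k) (Nk k).
Definition Ek k := tmean (Pk k) (smooth_pow d q (fk k)) z0.
Definition Ik k := tmean (Pk k ++ Bk k) (increment (fk k) (Dk k) q d) z0.

Let cf k : cnice (fk k). Proof. exact: cnice_dpoly. Qed.

Let cDk k : cnice (Dk k). Proof. exact: cnice_dblock. Qed.

Let Ik0 k : 0 <= Ik k.
Proof.
apply: tmean_ge0 => //; [exact: PBk_uniq|exact: nice_increment|move=> u _].
by rewrite addr_ge0 ?mulr_ge0 ?powR_ge0 ?sqn_ge0.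
Qed.

Let Ek0 k : 0 <= Ek k.
Proof.
apply: tmean_ge0 => //; [exact: Pk_uniq| |by move=> u _; exact: powR_ge0].
by apply: nice_smooth_pow => //; exact: le_trans q1.
Qed.

Lemma Ek_step k : Ek k + conv_lo q * Ik k <= Ek k.+1.
Proof.
have BP r : r \in Bk k -> r \notin Pk k.
  move=> rB; have := PBk_uniq k; rewrite cat_uniq => /and3P[_ /hasPn h _]; exact: h.
have uB : uniq (Bk k) by exact: primes_in_uniq.
have F_past z u : (forall r, r \in Pk k -> z r = u r) -> fk k z = fk k u by exact: eq_dpoly.
have D_mean (c : C) z : in_disc z -> tmean (Bk k) (fun u => Re (c * Dk k u)) z = 0.
  by apply: dblock_mean0 => //; [exact: PBk_uniq|exact: Bk_prime].
have h := torus_step d (PBk_uniq k) q1 (cf k) (cDk k) F_past D_mean z0d.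
rewrite /Ek PkS; move: h; rewrite -/(Ik k).
have -> : tmean (Pk k ++ Bk k) (smooth_pow d q (fk k)) z0 = tmean (Pk k) (smooth_pow d q (fk k)) z0.
  rewrite tmean_cat; apply: eq_tmean => [|u _]; first exact: Pk_uniq.
  apply: tmean_const => // v [_ tv]; rewrite /smooth_pow; congr ((sqn _ + _) `^ _).
  by apply: eq_dpoly => r rP; rewrite tv//; apply/negP => /BP; rewrite rP.
move=> /le_trans; apply; rewrite le_eqVlt; apply/orP; left; apply/eqP.
rewrite /fk PkS; apply: eq_tmean => [|u _]; first exact: PBk_uniq.
by rewrite /smooth_pow (dpoly_cat a s_gt0 (PBk_uniq k)).
Qed.

Definition growth : R := 2 + q * expR 1.
Definition srate : R := step_const q * transfer_const q.

Let hX k := holo_esum theta (Freq k) a.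
Let hX1 k := holo_esum theta (Freq k) (dcf a).
Let hV k := holo_esum theta (Fnew k) a.

Lemma Psik_step k : Psik k.+1 <= (1 + growth / lamk k) * Psik k + srate * Ik k.
Proof.
have ml := lamk_ge k; set b := - (lamk k)^-1.
have [rX rY] := reg_esum theta b (Freq k) a; have [rX1 rY1] := reg_esum theta b (Freq k) (dcf a).
have [rX2 rY2] := reg_esum theta b (Freq k) (dcf (dcf a)).
have [rV rW] := reg_esum theta b (Fnew k) a; have [rV1 rW1] := reg_esum theta b (Fnew k) (dcf a).
have [eV eW] := decay_esum theta b a (@Fnew1 k); have [eV1 eW1] := decay_esum theta b (dcf a) (@Fnew1 k).
have T0 : 0 <= transfer_const q.
  rewrite /transfer_const /past_const /block_mass /block_const.
  by rewrite !(mulr_ge0, addr_ge0, powR_ge0, expR_ge0).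
have tr x : - (8 * lamk k)^-1 <= x ->
    tavg (incr (X k) (Y k) (fun x t => Re (esum theta (Fnew k) a x t))
      (fun x t => Im (esum theta (Fnew k) a x t)) d q x) <=
    transfer_const q * expR (- (2 * lamk k * x)) * Ik k.
  move=> bx; have := transfer theta a s_gt0 (Jk_gt0 k) d q1 bx z0d.
  rewrite -/(Pk k) -/(Bk k) -/(fk k) -/(Dk k) -/(Ik k) => /(le_trans _); apply.
  rewrite le_eqVlt; apply/orP; left; apply/eqP; apply: eq_tavg => t.
  by rewrite /increment /smooth_pow /incr /uu Dk_nz /fk dpoly_nz//; [exact: Pk_prime|exact: Pk_uniq].
have := one_step d0 q1 (hX k) (hX1 k) (hV k) ln20 ml (lamk_inv k) rX rY rX1 rY1 rX2 rY2
  rV rW rV1 rW1 eV eW eV1 eW1 T0 (Ik0 k) tr.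
rewrite -lamkS -/(Nk k) -/(Psik k) /srate -mulrA -/growth => /(le_trans _); apply.
rewrite le_eqVlt; apply/orP; left; apply/eqP; rewrite /Psik /xmean; congr hint.
apply/funext => x; congr (_ * _); apply: eq_tavg => t.
rewrite NkE /smooth_pow /Nnew; congr ((_ + _) `^ _).
rewrite /fk PkS (dpoly_cat a s_gt0 (PBk_uniq k)) -/(Dk k) Dk_nz dpoly_nz.
- by rewrite /sqn ReD ImD.
- exact: Pk_prime.
- exact: Pk_uniq.
Qed.

Lemma Psi_zero k : tavg (Nk k 0) <= 5 * Psik k.
Proof.
have ml := lamk_ge k; set b := - (lamk k)^-1.
have [rX rY] := reg_esum theta b (Freq k) a; have [rX1 rY1] := reg_esum theta b (Freq k) (dcf a).
have [rX2 rY2] := reg_esum theta b (Freq k) (dcf (dcf a)).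
exact: (mean_at_zero d0 q1 (hX k) (hX1 k) ln20 ml (lamk_inv k) rX rY rX1 rY1 rX2 rY2).
Qed.

Lemma Psi_base : Psik 0 = Ek 0.
Proof.
have P0 : Pk 0 = [::] by rewrite /Pk /Jk expn0 /primes_in.
have fE z : fk 0 z = fk 0 z0.
  by apply: eq_dpoly => r; rewrite P0.
have l0 : 0 < lamk 0 by exact: lt_le_trans (lamk_ge 0).
rewrite /Ek P0 /= /Psik /xmean.
have -> : (fun x => lamk 0 * expR (- 1 - lamk 0 * x) * tavg (Nk 0 x)) =
   (fun x => (lamk 0 * expR (-1) * smooth_pow d q (fk 0) z0) * expR (- (lamk 0 * x))).
  apply/funext => x; rewrite (_ : tavg _ = smooth_pow d q (fk 0) z0).
    by rewrite expR_shift; ring.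
  rewrite -[RHS]tavg_cst; apply: eq_tavg => t.
  by rewrite NkE /smooth_pow (fE (nz x t)).
rewrite (hintZ l0); last exact: hdec_exp.
rewrite (hint_exp _ l0) mulrN divff ?gt_eqF// opprK.
rewrite (_ : _ * (expR 1 / lamk 0) = (expR (-1) * expR 1) * smooth_pow d q (fk 0) z0).
  by rewrite -expRD addNr expR0 mul1r.
by field; rewrite gt_eqF.
Qed.

Definition embed_const : R := (1 + srate / conv_lo q) * expR (growth * 4).

Lemma srate_ge0 : 0 <= srate.
Proof.
have q0 : 0 <= q by exact: le_trans q1.
rewrite /srate /step_const /conv_hi /transfer_const /past_const /block_mass /block_const.
by rewrite !(mulr_ge0, addr_ge0, powR_ge0, expR_ge0, sqr_ge0, exprn_ge0).
Qed.

Lemma Psi_le k : Psik k <= embed_const * Ek k.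
Proof.
have q0 : 0 <= q by exact: le_trans q1.
have srate0 := srate_ge0.
have g0 : 0 <= growth by rewrite /growth addr_ge0 ?mulr_ge0 ?expR_ge0.
have cl := conv_lo_gt0 q.
pose S k := \sum_(j < k) (lamk j)^-1.
pose A k := (1 + srate / conv_lo q) * expR (growth * S k).
have li j : 0 < (lamk j)^-1 by rewrite invr_gt0 (lt_le_trans ln20 (lamk_ge j)).
have S0 j : 0 <= S j by apply: sumr_ge0 => i _; exact: ltW.
have S4 j : S j <= 4.
  have e0 i : 0 <= 8^-1 ^+ i :> R by rewrite exprn_ge0.
  suff : S j <= 4 - 3 * 8^-1 ^+ j by have := e0 j; lra.
  elim: j => [|j IH]; first by rewrite /S big_ord0 expr0; lra.
  rewrite /S big_ord_recr/= -/(S j).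
  have lj : (lamk j)^-1 <= 2 * 8^-1 ^+ j.
    rewrite /lamk /Jk natrX invfM -exprVn mulrC ler_wpM2r//.
    by rewrite -[leRHS]invrK lef_pV2 ?posrE ?invr_gt0//; exact: ln2_ge.
  by have := e0 j; rewrite exprS; lra.
suff h : Psik k <= A k * Ek k.
  apply: (le_trans h); rewrite ler_wpM2r// /A ler_wpM2l//.
    by rewrite addr_ge0 ?divr_ge0 ?(ltW cl).
  by rewrite ler_expR ler_wpM2l.
have c1 : 1 <= 1 + srate / conv_lo q by rewrite lerDl divr_ge0// ltW.
have A1 j : 1 + srate / conv_lo q <= A j.
  rewrite /A ler_peMr//; first lra.
  by rewrite -[leLHS]expR0 ler_expR mulr_ge0.
elim: k => [|k IH].
  by rewrite Psi_base ler_peMl// (le_trans c1)// A1.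
apply: (le_trans (Psik_step k)).
have AS : (1 + growth / lamk k) * A k <= A k.+1.
  have -> : A k.+1 = expR (growth / lamk k) * A k.
    by rewrite /A /S big_ord_recr/= -/(S k) mulrDr expRD; ring.
  apply: ler_wpM2r; last exact: expR_ge1Dx.
  by apply: le_trans (A1 k); lra.
have g1 : 0 <= 1 + growth / lamk k by rewrite addr_ge0// mulr_ge0// ltW.
have h1 : (1 + growth / lamk k) * Psik k <= A k.+1 * Ek k.
  apply: (le_trans (ler_wpM2l g1 IH)); rewrite mulrA; exact: ler_wpM2r.
have h2 : srate * Ik k <= A k.+1 * (conv_lo q * Ik k).
  rewrite mulrA ler_wpM2r// -ler_pdivrMr//; apply: le_trans (A1 k.+1); lra.
have A0 : 0 <= A k.+1 by apply: le_trans (A1 _); lra.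
have h3 := ler_wpM2l A0 (Ek_step k).
by rewrite mulrDr in h3; lra.
Qed.

End BlockRecursion.

Section Embedding.
Variable R : realType.
Local Notation C := R[i].
Local Notation Re := complex.Re.
Local Notation Im := complex.Im.
Local Notation point := (nat -> C).
Implicit Types (P : dirichlet_poly R) (p y theta : R).

Let z0 : point := fun=> 0.

Let z0d : in_disc z0. Proof. by move=> r; rewrite sqn0. Qed.

Lemma natcpow_nz theta n t : (0 < n)%N ->
  natcpow n (- (2^-1 +i* (theta + t))%C) = nz theta 0 t n.
Proof.
move=> n0; rewrite /natcpow /cexp /nz; apply: complex_ext; rewrite !(ReM, ImM) /=.
  rewrite /npow addr0 !mul0r !subr0 !mulr0 ?subr0 ?addr0.
  by congr (expR _ * cos _); ring.
rewrite /npow addr0 !mul0r !mulr0 ?subr0 ?addr0 ?add0r.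
by congr (expR _ * sin _); ring.
Qed.

Definition spectrum P : seq nat := frequencies P.

Lemma spectrum_gt0 P n : n \in spectrum P -> (0 < n)%N.
Proof. exact: frequencies_gt0. Qed.

Lemma primes_uptoE y : primes_upto y = primes_in 0 (Num.truncn y).+1.
Proof. by rewrite /primes_upto /primes_in /index_iota subn0. Qed.

Lemma dirichlet_eval_nz P theta t :
  dirichlet_eval P (2^-1 +i* (theta + t))%C = esum theta (spectrum P) (dcoef P) 0 t.
Proof.
rewrite /dirichlet_eval /esum big_seq [RHS]big_seq; apply: eq_bigr => n ns.
by rewrite natcpow_nz//; exact: spectrum_gt0 ns.
Qed.

Lemma bohr_smooth P y n : bohr_bound P y -> n \in spectrum P -> smooth (primes_upto y) n.
Proof.
move=> [y2 hy] ns; apply/smoothP => [|r pr rn]; first exact: spectrum_gt0 ns.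
by rewrite mem_primes_upto ?pr ?(hy n)// (le_trans _ y2).
Qed.

Lemma bohr_lift_dpoly P y (w : (prime_pi y).-tuple C) : bohr_bound P y ->
  bohr_lift P w = dpoly (spectrum P) (dcoef P) (primes_upto y) (assign z0 (primes_upto y) w).
Proof.
move=> hy; rewrite /bohr_lift /dpoly big_seq [RHS]big_seq_cond.
have up : uniq (primes_upto y) by rewrite primes_uptoE primes_in_uniq.
apply: eq_big => [n|n ns].
  by rewrite andb_idr// => ns; exact (bohr_smooth hy ns).
congr (_ * _); rewrite /mon (big_nth 0%N) big_mkord; apply: eq_bigr => j _.
congr (_ ^+ _); rewrite assign_in ?size_tuple//; last exact: mem_nth.
by rewrite index_uniq// (tnth_nth 0).
Qed.

Lemma hardy_tmean P y p : 0 <= p -> bohr_bound P y ->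
  hardy_normXp P y p = (tmean (primes_upto y) (fun z =>
    sqn (dpoly (spectrum P) (dcoef P) (primes_upto y) z) `^ (p / 2)) z0)%:E.
Proof.
move=> p0 hy; rewrite -torus_haar_tmean//; last 2 first.
- by apply: nice_sqn_powR; [rewrite divr_ge0|exact: cnice_dpoly].
- by move=> u; exact: powR_ge0.
apply: eq_integral => w _; rewrite normc_powR bohr_lift_dpoly//.
Qed.

Lemma tmean_widen P y p K : bohr_bound P y -> (Num.truncn y < 2 ^ Jk K)%N ->
  tmean (Pk K) (fun z => sqn (dpoly (spectrum P) (dcoef P) (Pk K) z) `^ p) z0 =
  tmean (primes_upto y) (fun z => sqn (dpoly (spectrum P) (dcoef P) (primes_upto y) z) `^ p) z0.
Proof.
move=> hy yK; have PE : Pk K = primes_upto y ++ primes_in (Num.truncn y).+1 (2 ^ Jk K).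
  by rewrite primes_uptoE /Pk -primes_in_cat.
have uPK : uniq (Pk K) by exact: primes_in_uniq.
have disj r : r \in primes_in (Num.truncn y).+1 (2 ^ Jk K) -> r \notin primes_upto y.
  rewrite primes_uptoE !mem_primes_in => /and3P[_ h _]; apply/negP => /and3P[_ _ h'].
  by move: (leq_trans h' h); rewrite ltnn.
have fE z : dpoly (spectrum P) (dcoef P) (Pk K) z =
    dpoly (spectrum P) (dcoef P) (primes_upto y) z.
  rewrite /dpoly big_seq_cond [RHS]big_seq_cond; apply: eq_big => n.
    have [ns|//] := boolP (n \in spectrum P); rewrite /= (bohr_smooth hy ns).
    by apply: smooth_sub (bohr_smooth hy ns); [exact: spectrum_gt0 ns|
      move=> r ry; rewrite PE mem_cat ry].
  move=> /andP[ns _]; rewrite PE mon_cat (mon_coprime z (spectrum_gt0 ns) (bohr_smooth hy ns) disj).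
  by rewrite mulr1.
rewrite (eq_tmean (h := fun z => sqn (dpoly (spectrum P) (dcoef P) (primes_upto y) z) `^ p) uPK); last first.
  by move=> u _; rewrite fE.
rewrite PE tmean_cat; apply: eq_tmean => [|u _]; first by rewrite primes_uptoE primes_in_uniq.
apply: tmean_const => [|v [_ tv]]; first exact: primes_in_uniq.
congr (sqn _ `^ _); apply: eq_dpoly => r ry.
by rewrite tv//; apply/negP => /disj; rewrite ry.
Qed.

Definition vertical_const (q : R) : R := 5 * embed_const q * 2 `^ q.

(** The embedding with the smooth weight [exp (- |t|) / 2] instead of the
indicator of an interval. *)
Lemma tavg_embedding P y theta p : 2 <= p -> bohr_bound P y ->
  tavg (fun t => sqn (esum theta (spectrum P) (dcoef P) 0 t) `^ (p / 2)) <=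
  vertical_const (p / 2) * tmean (primes_upto y) (fun z =>
    sqn (dpoly (spectrum P) (dcoef P) (primes_upto y) z) `^ (p / 2)) z0.
Proof.
move=> p2 hy; set q := p / 2; have q1 : 1 <= q by rewrite /q ler_pdivlMr// mul1r.
have q0 : 0 <= q by exact: le_trans q1.
set H := tmean _ _ _.
pose K := Num.truncn y.
have yK : (Num.truncn y < 2 ^ Jk K)%N.
  apply: (@leq_trans (2 ^ K)); first exact: ltn_expl.
  by rewrite leq_exp2l// ltnW// ltn_expl.
pose F := dpoly (spectrum P) (dcoef P) (Pk K).
have cF : cnice F by exact: cnice_dpoly.
have uPK : uniq (Pk K) by exact: primes_in_uniq.
have nF : nice (fun z => sqn (F z) `^ q) by exact: nice_sqn_powR.
have HE : tmean (Pk K) (fun z => sqn (F z) `^ q) z0 = H by exact: tmean_widen.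
have em0 : 0 <= embed_const q.
  have cl := conv_lo_gt0 q.
  rewrite /embed_const mulr_ge0 ?expR_ge0// addr_ge0// divr_ge0 ?(ltW cl)//.
  exact: (@srate_ge0 _ _ q1).
have allsm : [seq n <- spectrum P | smooth (Pk K) n] = spectrum P.
  apply/all_filterP/allP => n ns; apply: smooth_sub (bohr_smooth hy ns); first exact: spectrum_gt0 ns.
  move=> r; rewrite primes_uptoE !mem_primes_in => /and3P[-> _ h] /=.
  exact: leq_trans h yK.
apply/ler_addgt0Pr => e e0.
have V0 : 0 < vertical_const q + 1.
  apply: ltr_wpDl => //; rewrite /vertical_const.
  by apply: mulr_ge0 (powR_ge0 _ _); exact: mulr_ge0.
pose d := (e / (vertical_const q + 1)) `^ (2 * q)^-1.
have q2 : 0 < 2 * q by rewrite mulr_gt0// (lt_le_trans _ q1).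
have d0 : 0 < d by rewrite powR_gt0// divr_gt0.
have dq : (d ^+ 2) `^ q = e / (vertical_const q + 1).
  have qn : q != 0 by rewrite gt_eqF// (lt_le_trans _ q1).
  have -> : d ^+ 2 = (e / (vertical_const q + 1)) `^ q^-1.
    rewrite -(powR_mulrn 2 (ltW d0)) /d -powRrM; congr (_ `^ _).
    by field.
  by rewrite -powRrM mulVf// powRr1// divr_ge0 ?(ltW e0) ?(ltW V0).
have h1 := Psi_zero theta (spectrum P) (dcoef P) q1 d0 K.
have h2 := Psi_le theta (dcoef P) (@spectrum_gt0 P) q1 d0 K.
have h3 : Ek (spectrum P) (dcoef P) q d K <= 2 `^ q * (H + (d ^+ 2) `^ q).
  rewrite -HE -[X in _ + X](tmean_cst (Pk K) _ z0) -tmeanD//; last exact: nice_cst.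
  rewrite -tmeanZ//; last by apply: niceD => //; exact: nice_cst.
  apply: le_tmean => //.
  - exact: nice_smooth_pow.
  - by apply: niceZ; apply: niceD => //; exact: nice_cst.
  by move=> u _; apply: powR_sum2_le => //; [exact: sqn_ge0|exact: sqr_ge0].
have h0 : tavg (fun t => sqn (esum theta (spectrum P) (dcoef P) 0 t) `^ q) <=
    tavg (Nk theta (spectrum P) (dcoef P) q d K 0).
  have [rX rY] := reg_esum theta 0 (spectrum P) (dcoef P).
  have rs : reg 0 (fun x t => sqn (esum theta (spectrum P) (dcoef P) x t)).
    by apply: regD; exact: regX2.
  apply: le_tavg.
  - have [m [B hB]] := reg_tbounded (lexx 0) rs; split; first exact: (measurableT_comp (measurable_powR q)).
    exists (`|B| `^ q) => t; rewrite ger0_norm ?powR_ge0//; apply: le_powR => //; first exact: sqn_ge0.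
    by rewrite (le_trans (ler_norm _))// (le_trans (hB t))// ler_norm.
  - have rN : reg 0 (Nk theta (spectrum P) (dcoef P) q d K).
      rewrite /Nk allsm; apply: (reg_powR (e := d ^+ 2)); first exact: exprn_gt0.
        by move=> x t; exact: uu_ge.
      by apply: regD; [exact: rs|exact: reg_cst].
    exact: (reg_tbounded (lexx 0) rN).
  move=> t; rewrite /Nk allsm /NN; apply: le_powR => //; first exact: sqn_ge0.
  by rewrite lerDl sqr_ge0.
apply: (le_trans h0); apply: (le_trans h1).
have h4 := ler_wpM2l em0 h3; have h5 := le_trans h2 h4.
have : vertical_const q * (e / (vertical_const q + 1)) <= e.
  by rewrite mulrCA ler_piMr ?(ltW e0)// ler_pdivrMr// mul1r lerDl.
rewrite -dq; move: h5; rewrite /vertical_const.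
by move: (embed_const q) (2 `^ q) ((d ^+ 2) `^ q) (Psik _ _ _ _ _ _) => x1 x2 x3 x4; lra.
Qed.

End Embedding.

Section LocalEmbedding.
Variable R : realType.
Local Notation leb := (@lebesgue_measure R).

Lemma unit_interval_tavg (G : R -> R) : (forall t, 0 <= G t) -> tbounded G ->
  (\int[leb]_(t in `[0%R, 1%R]) (G t)%:E <= (2 * expR 1 * tavg G)%:E)%E.
Proof.
move=> G0 bG; have [b1 b2] := tbounded_on bG; have [mG _] := bG.
have w1 := ew_weight 0 (ltr01 : 0 < (1 : R)).
have ii := wint_integrable w1 b1.
have LE : (\int[leb]_t (ew 1 0 t * G t)%:E = (Lt G)%:E)%E.
  by rewrite /Lt /wint /Rintegral fineK//; exact: integrable_fin_num.
apply: (@le_trans _ _ ((expR 1 * Lt G)%:E)); last first.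
  rewrite lee_fin /tavg; have : 0 <= Lt (fun t => G (- t)).
    by apply: wint_ge0 => //; exact: ew_ge0.
  have e0 := expR_gt0 (1 : R); move: (Lt G) (Lt _) => x y y0; nra.
have mwG : measurable_fun setT (fun t => ew 1 0 t * G t).
  by apply: measurable_funM => //; exact: weight_measurable w1.
have pos t : (0 <= (ew 1 0 t * G t)%:E)%E by rewrite lee_fin mulr_ge0// ew_ge0.
have mE : measurable_fun setT (fun t => (ew 1 0 t * G t)%:E) by exact/measurable_EFinP.
have eE : (0 <= (expR 1 : R)%:E)%E by rewrite lee_fin expR_ge0.
rewrite EFinM -LE -(ge0_integralZl leb measurableT mE (fun t _ => pos t) eE).
rewrite [leLHS]integral_mkcond; apply: ge0_le_integral => //.
- by move=> t _; rewrite patchE; case: ifP => // _; rewrite lee_fin.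
- apply/(measurable_restrictT (fun t => (G t)%:E) (measurable_itv _)).
  by apply: measurable_funTS; exact/measurable_EFinP.
- by apply: measurable_funeM; exact/measurable_EFinP.
move=> t _; rewrite patchE mem_setE/= in_itv/=.
have p0 : 0 <= expR 1 * (ew 1 0 t * G t) by rewrite !mulr_ge0 ?expR_ge0 ?ew_ge0.
case: ifP => [/andP[t0 t1]|_]; rewrite -EFinM lee_fin//.
rewrite ewE// mul1r mulrA -expRD ler_peMl// -[leLHS]expR0 ler_expR; lra.
Qed.

Lemma integral_shift (G : R -> R) (theta : R) : continuous G ->
  (\int[leb]_(t in `[theta, (theta + 1)%R]) (G t)%:E =
   \int[leb]_(t in `[0%R, 1%R]) (G (theta + t))%:E)%E.
Proof.
move=> cG; pose F (x : R) := theta + x.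
have dF (x : R) : is_derive x 1 F 1.
  by apply: (der_eq (derD (derC theta x) (derI x))); rewrite add0r.
have F' : derive1 F = cst 1.
  by apply/funext => x; rewrite derive1E; have [_ ->] := dF x.
have := @integration_by_substitution_increasing R F G 0 1 ler01.
rewrite /F addr0 => ->.
- by apply: eq_integral => x _; rewrite -/F F' /= /F mulr1.
- by move=> x y _ _; rewrite ltrD2l.
- by rewrite -/F F' => x _; exact: cst_continuous.
- by rewrite -/F F'; exact: is_cvg_cst.
- by rewrite -/F F'; exact: is_cvg_cst.
- have cF (x : R) : {for x, continuous F} by exact: der_continuous (dF x).
  split; first by move=> x _; have [] := dF x.
  + by apply: cvg_at_right_filter; exact: cF.
  + by apply: cvg_at_left_filter; exact: cF.
- exact: continuous_subspaceT.
Qed.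

Lemma continuous_powR0 (p : R) (y : R) : 0 < p -> {for y, continuous (fun z : R => `|z| `^ p)}.
Proof.
move=> p0; have [->|y0] := eqVneq y 0.
  apply/cvgrPdist_lt => e e0; rewrite normr0 powR0 ?gt_eqF//.
  near=> z; rewrite sub0r normrN ger0_norm ?powR_ge0//.
  have : `|z| < e `^ p^-1 by near: z; apply: cvgr0_norm_lt; [exact: cvg_id|exact: powR_gt0].
  move=> /(gt0_ltr_powR p0); rewrite !nnegrE powR_ge0 normr_ge0 => /(_ isT isT).
  by rewrite -powRrM mulVf ?gt_eqF// powRr1// ltW.
apply: (@continuous_comp _ _ _ (fun z : R => `|z|) (fun z : R => z `^ p) y).
  exact: norm_continuous.
have yy : 0 < `|y| by rewrite normr_gt0.
by have := is_derive1_powR p yy; exact: der_continuous.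
Unshelve. all: by end_near.
Qed.

Lemma dirichlet_integral (P : dirichlet_poly R) (p theta : R) : 0 < p ->
  (\int[leb]_(t in `[theta, (theta + 1)%R]) (normc (dirichlet_eval P (2^-1 +i* t)%C) `^ p)%R%:E =
   \int[leb]_(t in `[0%R, 1%R]) (sqn (esum theta (spectrum P) (dcoef P) 0 t) `^ (p / 2))%:E)%E /\
  tbounded (fun t => sqn (esum theta (spectrum P) (dcoef P) 0 t) `^ (p / 2)).
Proof.
move=> p0; have p2 : 0 < p / 2 by rewrite divr_gt0.
have regs th : reg 0 (fun x t => sqn (esum th (spectrum P) (dcoef P) x t)).
  by have [rX rY] := reg_esum th 0 (spectrum P) (dcoef P); apply: regD; exact: regX2.
pose g t := sqn (esum 0 (spectrum P) (dcoef P) 0 t) `^ (p / 2).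
have gE t : normc (dirichlet_eval P (2^-1 +i* t)%C) `^ p = g t.
  by rewrite normc_powR -[t]add0r dirichlet_eval_nz add0r.
have gs t : g (theta + t) = sqn (esum theta (spectrum P) (dcoef P) 0 t) `^ (p / 2).
  by rewrite -gE normc_powR dirichlet_eval_nz.
have cg : continuous g.
  have [_ _ c _] := regs 0; move=> t.
  have -> : g = (fun z => `|z| `^ (p / 2)) \o (fun t => sqn (esum 0 (spectrum P) (dcoef P) 0 t)).
    by apply/funext => u; rewrite /= ger0_norm ?sqn_ge0.
  apply: continuous_comp; first exact: c.
  exact: continuous_powR0.
split.
  under eq_integral do rewrite gE.
  rewrite (integral_shift theta cg); apply: eq_integral => t _; by rewrite gs.
have [m [B hB]] := reg_tbounded (lexx 0) (regs theta); split; first exact: (measurableT_comp (measurable_powR _)).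
exists (`|B| `^ (p / 2)) => t; rewrite ger0_norm ?powR_ge0//; apply: le_powR; [exact: ltW|exact: sqn_ge0|].
by rewrite (le_trans (ler_norm _))// (le_trans (hB t))// ler_norm.
Qed.

Lemma local_embedding (p : R) : 2 <= p ->
  exists C : R, forall (P : dirichlet_poly R) (y : R), bohr_bound P y ->
    (ereal_sup [set \int[leb]_(t in `[theta, (theta + 1)%R])
                     (normc (dirichlet_eval P (2^-1 +i* t)%C) `^ p)%R%:E
                | theta in [set: R]]
     <= C%:E * hardy_normXp P y p)%E.
Proof.
move=> p2; have p0 : 0 < p by exact: lt_le_trans p2.
exists (2 * expR 1 * vertical_const (p / 2)) => P y hy.
apply: ge_ereal_sup => _ [theta _ <-].
have [-> bG] := dirichlet_integral P theta p0.
apply: (le_trans (unit_interval_tavg _ bG)); first by move=> t; exact: powR_ge0.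
rewrite hardy_tmean ?(ltW p0)// -EFinM lee_fin -[leRHS]mulrA ler_pM2l ?mulr_gt0 ?expR_gt0//.
exact: tavg_embedding.
Qed.

End LocalEmbedding.

Section CircleMoments.
Variable R : realType.
Local Notation C := R[i].
Local Notation Re := complex.Re.
Local Notation Im := complex.Im.

Definition cmean (g : circle R -> R) := wint (circle_haar R) (fun=> 1) g.

Definition cbounded (g : circle R -> R) := bounded_on (fun=> 1 : R) g.

Let hw : weight (circle_haar R) (fun=> 1). Proof. exact: haar_weight. Qed.

Lemma cmeanD f g : cbounded f -> cbounded g -> cmean (fun z => f z + g z) = cmean f + cmean g.
Proof. exact: wintD. Qed.

Lemma cmeanZ c f : cbounded f -> cmean (fun z => c * f z) = c * cmean f.
Proof. exact: wintZ. Qed.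

Lemma le_cmean f g : cbounded f -> cbounded g -> (forall z, f z <= g z) -> cmean f <= cmean g.
Proof. by move=> bf bg fg; apply: le_wint => // z _; exact: ler01. Qed.

Lemma cmean_cst c : cmean (fun=> c) = c. Proof. exact: haar_cst. Qed.

Lemma eq_cmean f g : (forall z, f z = g z) -> cmean f = cmean g.
Proof. by move=> fg; apply: eq_wint => z _. Qed.

Lemma cmean_Re (c : C) k l : cmean (fun z => Re (c * (circle_val z ^+ k * (circle_val z)^*%C ^+ l))) =
  if k == l then Re c else 0.
Proof. exact: wint_circle_monomial. Qed.

Lemma cb_mono (c : C) k l :
  cbounded (fun z => Re (c * (circle_val z ^+ k * (circle_val z)^*%C ^+ l))).
Proof. exact: nice_circle_monomial. Qed.

Variables (h s : R) (om u v : C).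
Hypotheses (h0 : 0 < h) (h1 : h <= 128^-1) (s0 : 0 < s) (s1 : s <= 20^-1).
Hypotheses (omE : sqn om = h ^+ 2) (uE : sqn u <= h ^+ 2) (vE : sqn v <= h ^+ 4).
Hypothesis uom : h ^+ 2 / 2 <= Re (u * om^*%C).

Definition tilt (z : C) : R := sqn (1 + om * z) / (1 + h ^+ 2).
Definition expo (z : C) : R := 2 * Re (u * z) - Re (v * z ^+ 2).
Definition drift : R := 2 / (1 + h ^+ 2) * Re (u * om^*%C).

Let kap : R := 2 / (1 + h ^+ 2).

Let h2p : 0 < 1 + h ^+ 2. Proof. by rewrite ltr_pwDl// sqr_ge0. Qed.

Let kap2 : 0 < kap <= 2.
Proof.
rewrite divr_gt0//= ler_pdivrMr//; have := sqr_ge0 h; lra.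
Qed.

Lemma tiltE (z : circle R) : tilt (circle_val z) = 1 + kap * Re (om * circle_val z).
Proof.
rewrite /tilt sqnD sqn1 sqnM sqn_circle omE mulr1 rmorph1 mul1r /kap.
by field; rewrite gt_eqF.
Qed.

Lemma absRe_le (a z : C) (b : R) : 0 <= b -> sqn a <= b ^+ 2 -> sqn z = 1 -> `|Re (a * z)| <= b.
Proof.
move=> b0 ab z1; apply: le_sqr_nneg => //; rewrite real_normK ?num_real//.
by apply: le_trans (sqr_Re_le _) _; rewrite sqnM z1 mulr1.
Qed.

Let om_le (z : circle R) : `|Re (om * circle_val z)| <= h.
Proof. by apply: absRe_le; rewrite ?sqn_circle ?omE// ltW. Qed.

Let u_le (z : circle R) : `|Re (u * circle_val z)| <= h.
Proof. by apply: absRe_le; rewrite ?sqn_circle// ltW. Qed.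

Let v_le (z : circle R) : `|Re (v * circle_val z ^+ 2)| <= h ^+ 2.
Proof. by apply: absRe_le; rewrite ?sqnX ?sqn_circle ?expr1n// -?exprM// sqr_ge0. Qed.

Lemma tilt_ge (z : circle R) : 2^-1 <= tilt (circle_val z).
Proof.
rewrite tiltE; have := om_le z; rewrite ler_norml => /andP[a1 a2].
by have /andP[k0 k2] := kap2; have := h1; nra.
Qed.

Let muE : `|drift| <= 2 * h ^+ 2.
Proof.
have uo : `|Re (u * om^*%C)| <= h ^+ 2.
  apply: le_sqr_nneg; first exact: sqr_ge0.
  rewrite real_normK ?num_real//; apply: le_trans (sqr_Re_le _) _.
  by rewrite sqnM sqnJ omE -[leRHS]/(h ^+ 2 * h ^+ 2) ler_wpM2r// sqr_ge0.
rewrite /drift -/kap normrM; have /andP[k0 k2] := kap2.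
rewrite (gtr0_norm k0); apply: ler_pM => //; exact: ltW.
Qed.

Lemma expo_drift_le (z : circle R) : `|expo (circle_val z) - drift| <= 3 * h.
Proof.
have := u_le z; have := v_le z; have := muE; rewrite /expo.
move: (Re (u * _)) (Re (v * _)) drift => a b m.
rewrite !ler_norml => /andP[m1 m2] /andP[b1 b2] /andP[a1 a2].
have hh : 3 * h ^+ 2 <= h by have := h1; have := h0; nra.
by apply/andP; split; lra.
Qed.

Let cb_cst c : cbounded (fun=> c). Proof. exact: bounded_on_cst. Qed.

Let cbD f g : cbounded f -> cbounded g -> cbounded (fun z => f z + g z).
Proof. exact: bounded_onD. Qed.

Let cbM f g : cbounded f -> cbounded g -> cbounded (fun z => f z * g z).
Proof. exact: bounded_onM. Qed.

Let cbZ c f : cbounded f -> cbounded (fun z => c * f z). Proof. exact: cbM. Qed.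

Let lin (a : C) (z : circle R) : Re (a * circle_val z) =
  Re (a * (circle_val z ^+ 1 * (circle_val z)^*%C ^+ 0)).
Proof. by rewrite expr1 expr0 mulr1. Qed.

Let quad (a : C) (z : circle R) : Re (a * circle_val z ^+ 2) =
  Re (a * (circle_val z ^+ 2 * (circle_val z)^*%C ^+ 0)).
Proof. by rewrite expr0 mulr1. Qed.

Let cb_lin (a : C) : cbounded (fun z => Re (a * circle_val z)).
Proof.
have -> : (fun z : circle R => Re (a * (circle_val z))) =
  fun z => Re (a * (circle_val z ^+ 1 * (circle_val z)^*%C ^+ 0)).
  by apply/funext => z; exact: lin.
exact: cb_mono.
Qed.

Let cb_quad (a : C) : cbounded (fun z => Re (a * circle_val z ^+ 2)).
Proof.
have -> : (fun z : circle R => Re (a * (circle_val z ^+ 2))) =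
  fun z => Re (a * (circle_val z ^+ 2 * (circle_val z)^*%C ^+ 0)).
  by apply/funext => z; exact: quad.
exact: cb_mono.
Qed.

Lemma cmean_lin (a : C) : cmean (fun z => Re (a * circle_val z)) = 0.
Proof. by rewrite (eq_cmean (lin a)) cmean_Re. Qed.

Lemma cmean_quad (a : C) : cmean (fun z => Re (a * circle_val z ^+ 2)) = 0.
Proof. by rewrite (eq_cmean (quad a)) cmean_Re. Qed.

Lemma cmean_lin_lin (a b : C) :
  cmean (fun z => Re (a * circle_val z) * Re (b * circle_val z)) = 2^-1 * Re (a * b^*%C).
Proof.
rewrite (@eq_cmean _ (fun z => 2^-1 * Re (a * b * (circle_val z ^+ 2 * (circle_val z)^*%C ^+ 0)) +
   2^-1 * Re (a * b^*%C * (circle_val z ^+ 1 * (circle_val z)^*%C ^+ 1)))).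
  rewrite cmeanD; [|by apply: cbZ; exact: cb_mono|by apply: cbZ; exact: cb_mono].
  rewrite !cmeanZ; [|exact: cb_mono|exact: cb_mono].
  by rewrite !cmean_Re/= mulr0 add0r.
move=> z; have z1 := sqn_circle z; rewrite !expr1 expr0 mulr1 mulJc z1.
have -> : a * b^*%C * (1%:C)%C = a * b^*%C by rewrite mulr1.
move: z1; case: a => a1 a2; case: b => b1 b2; case: (circle_val z) => x y.
rewrite /sqn expr2 !(ReM, ImM, ReJ, ImJ) /= => z1.
have -> : 2^-1 * (a1 * b1 - a2 * - b2) = 2^-1 * (a1 * b1 + a2 * b2) * (x ^+ 2 + y ^+ 2).
  by rewrite z1; ring.
by field.
Qed.

Lemma cmean_quad_lin (a b : C) :
  cmean (fun z => Re (a * circle_val z ^+ 2) * Re (b * circle_val z)) = 0.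
Proof.
rewrite (@eq_cmean _ (fun z => 2^-1 * Re (a * b * (circle_val z ^+ 3 * (circle_val z)^*%C ^+ 0)) +
   2^-1 * Re (a * b^*%C * (circle_val z ^+ 2 * (circle_val z)^*%C ^+ 1)))).
  rewrite cmeanD; [|by apply: cbZ; exact: cb_mono|by apply: cbZ; exact: cb_mono].
  rewrite !cmeanZ; [|exact: cb_mono|exact: cb_mono].
  by rewrite !cmean_Re/= !mulr0 add0r.
move=> z; rewrite !expr1 !expr0 !mulr1.
have -> : circle_val z ^+ 3 = circle_val z * circle_val z * circle_val z.
  by rewrite !exprS expr0 mulr1 mulrA.
have -> : circle_val z ^+ 2 = circle_val z * circle_val z by rewrite expr2.
case: a => a1 a2; case: b => b1 b2; case: (circle_val z) => x y.
by rewrite !(ReM, ImM, ReJ, ImJ) /=; field.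
Qed.

Let cb_tilt : cbounded (fun z => tilt (circle_val z)).
Proof.
rewrite (_ : (fun _ => _) = fun z => 1 + kap * Re (om * circle_val z)).
  by apply: cbD; [exact: cb_cst|apply: cbZ; exact: cb_lin].
by apply/funext => z; exact: tiltE.
Qed.

Lemma cmean_tilt : cmean (fun z => tilt (circle_val z)) = 1.
Proof.
rewrite (eq_cmean tiltE) cmeanD; [|exact: cb_cst|by apply: cbZ; exact: cb_lin].
by rewrite cmean_cst cmeanZ; [rewrite cmean_lin mulr0 addr0|exact: cb_lin].
Qed.

Let x (z : circle R) := expo (circle_val z) - drift.

Let cb_expo : cbounded (fun z => expo (circle_val z)).
Proof.
apply: cbD; first by apply: cbZ; exact: cb_lin.
by apply: bounded_onN; exact: cb_quad.
Qed.

Let cb_x : cbounded x. Proof. by apply: cbD => //; exact: cb_cst. Qed.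

Lemma cmean_tilt_centered : cmean (fun z => tilt (circle_val z) * x z) = 0.
Proof.
have b1 := cb_lin u; have b2 := cb_quad v; have b3 := cb_lin om.
have b4 := cbM b1 b3; have b5 := cbM b2 b3.
rewrite (@eq_cmean _ (fun z => (2 * Re (u * circle_val z) + -1 * Re (v * circle_val z ^+ 2)) +
   ((2 * kap) * (Re (u * circle_val z) * Re (om * circle_val z)) +
    (- kap) * (Re (v * circle_val z ^+ 2) * Re (om * circle_val z))) +
   - drift * tilt (circle_val z))); last first.
  by move=> z; rewrite /x /expo tiltE; ring.
have z1 := cbZ 2 b1; have z2 := cbZ (-1) b2; have z3 := cbZ (2 * kap) b4.
have z4 := cbZ (- kap) b5; have z5 := cbZ (- drift) cb_tilt.
rewrite (cmeanD (cbD (cbD z1 z2) (cbD z3 z4)) z5) (cmeanD (cbD z1 z2) (cbD z3 z4)).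
rewrite (cmeanD z1 z2) (cmeanD z3 z4) !cmeanZ//.
rewrite cmean_lin cmean_quad cmean_lin_lin cmean_quad_lin cmean_tilt /drift -/kap.
by field.
Qed.

Lemma cmean_tilt_var : h ^+ 2 / 16 <= cmean (fun z => tilt (circle_val z) * x z ^+ 2).
Proof.
have usq : h ^+ 2 / 4 <= sqn u.
  have : Re (u * om^*%C) ^+ 2 <= sqn u * h ^+ 2.
    by apply: le_trans (sqr_Re_le _) _; rewrite sqnM sqnJ omE.
  have := uom; have hh : 0 < h ^+ 2 by exact: exprn_gt0.
  move: (Re _) (sqn u) (h ^+ 2) hh => a b k k0 ak akk.
  have : (k / 2) ^+ 2 <= b * k by nra.
  by rewrite -(ler_pM2r k0); nra.
apply: (@le_trans _ _ (cmean (fun z => Re (u * circle_val z) * Re (u * circle_val z) + - (9 / 2 * h ^+ 4)))).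
  rewrite cmeanD; [|exact: cbM|exact: cb_cst].
  rewrite cmean_lin_lin cmean_cst mulJc /=.
  have h4 : h ^+ 4 <= h ^+ 2 / 128 ^+ 2.
    have -> : h ^+ 4 = h ^+ 2 * h ^+ 2 by rewrite -exprD.
    rewrite -exprVn ler_wpM2l ?sqr_ge0//; have := h1; have := h0; nra.
  by have := sqr_ge0 h; lra.
apply: le_cmean.
- by apply: cbD; [exact: cbM|exact: cb_cst].
- by apply: cbM => //; exact: cbM.
move=> z; have w2 := tilt_ge z; rewrite /x.
apply: (@le_trans _ _ (2^-1 * (expo (circle_val z) - drift) ^+ 2)); last first.
  by rewrite ler_wpM2r ?sqr_ge0.
have := v_le z; have := muE; rewrite /expo.
move: (Re (u * _)) (Re (v * _)) drift => a b m.
rewrite !ler_norml => /andP[m1 m2] /andP[b1 b2].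
have e1 : (b + m) ^+ 2 <= 9 * h ^+ 4.
  have -> : 9 * h ^+ 4 = (3 * h ^+ 2) ^+ 2 by ring.
  have : (3 * h ^+ 2 - (b + m)) * (3 * h ^+ 2 + (b + m)) >= 0 by rewrite mulr_ge0//; lra.
  by nra.
have := sqr_ge0 (a - (b + m)); nra.
Qed.

Let cb_exp k : cbounded (fun z => expR (k * x z)).
Proof.
have [mx [B hB]] := cb_x; split.
  apply: (measurableT_comp (f := fun y => expR (k * y))) => //; exact: measurable_expM.
exists (expR (`|k| * B)) => z _; rewrite ger0_norm ?expR_ge0// ler_expR.
apply: le_trans (ler_norm _) _; rewrite normrM ler_wpM2l//; apply: hB.
exact: oner_neq0.
Qed.

Lemma tilt_exp_le : cmean (fun z => tilt (circle_val z) * expR (2 * s * x z)) <=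
  expR (72 * s ^+ 2 * h ^+ 2).
Proof.
have bx := cbM cb_tilt cb_x; have b1 := cbZ (2 * s) bx; have b2 := cbZ (72 * s ^+ 2 * h ^+ 2) cb_tilt.
apply: (@le_trans _ _ (1 + 72 * s ^+ 2 * h ^+ 2)); last exact: expR_ge1Dx.
have <- : cmean (fun z => tilt (circle_val z) + 2 * s * (tilt (circle_val z) * x z) +
   72 * s ^+ 2 * h ^+ 2 * tilt (circle_val z)) = 1 + 72 * s ^+ 2 * h ^+ 2.
  rewrite (cmeanD (cbD cb_tilt b1) b2) (cmeanD cb_tilt b1) !cmeanZ//.
  by rewrite cmean_tilt cmean_tilt_centered mulr0 addr0 mulr1.
apply: le_cmean.
- by apply: cbM => //; exact: cb_exp.
- exact: cbD (cbD cb_tilt b1) b2.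
move=> z; have w0 : 0 <= tilt (circle_val z) by have := tilt_ge z; lra.
have xb := expo_drift_le z; rewrite -/(x z) in xb.
rewrite (_ : _ + _ = tilt (circle_val z) * (1 + 2 * s * x z + 72 * s ^+ 2 * h ^+ 2)); last by ring.
apply: (ler_wpM2l w0); apply: le_trans (expR_taylor2 _) _; rewrite lerD2l.
have sx : `|2 * s * x z| <= 1 / 2.
  have s2 : 0 < 2 * s by rewrite mulr_gt0.
  rewrite normrM (gtr0_norm s2).
  have := normr_ge0 (x z); move: xb; have := h1; have := s1; have := s0; nra.
have e2 : expR `|2 * s * x z| <= 1 + 2 * `|2 * s * x z|.
  by apply: expR_le_1D2; rewrite normr_ge0 /=; lra.
have x2 : x z ^+ 2 <= 9 * h ^+ 2.
  by rewrite -real_normK ?num_real//; have := normr_ge0 (x z); nra.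
have q0 : 0 <= (2 * s * x z) ^+ 2 by exact: sqr_ge0.
apply: (@le_trans _ _ ((2 * s * x z) ^+ 2 * 2)); first by apply: (ler_wpM2l q0); lra.
have : 8 * s ^+ 2 * x z ^+ 2 <= 8 * s ^+ 2 * (9 * h ^+ 2).
  by apply: ler_wpM2l => //; rewrite mulr_ge0 ?sqr_ge0.
by rewrite (_ : (2 * s * x z) ^+ 2 * 2 = 8 * s ^+ 2 * x z ^+ 2); [lra|ring].
Qed.

Lemma tilt_exp_ge : expR (s ^+ 2 * h ^+ 2 / 128) <=
  cmean (fun z => tilt (circle_val z) * expR (s * x z)).
Proof.
have bx := cbM cb_tilt cb_x; have b1 := cbZ s bx.
have bxx : cbounded (fun z => tilt (circle_val z) * x z ^+ 2).
  by apply: cbM => //; exact: cbM cb_x cb_x.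
have b2 := cbZ (s ^+ 2 / 4) bxx.
apply: (@le_trans _ _ (cmean (fun z => tilt (circle_val z) + s * (tilt (circle_val z) * x z) +
   s ^+ 2 / 4 * (tilt (circle_val z) * x z ^+ 2)))).
  rewrite (cmeanD (cbD cb_tilt b1) b2) (cmeanD cb_tilt b1).
  rewrite (cmeanZ _ bx) (cmeanZ _ bxx) cmean_tilt cmean_tilt_centered.
  have vv := cmean_tilt_var; have s20 : 0 <= s ^+ 2 / 4 by rewrite divr_ge0 ?sqr_ge0.
  have := ler_wpM2l s20 vv; move: (cmean _) => V hV.
  pose q := s ^+ 2 * h ^+ 2; have q0 : 0 <= q by rewrite mulr_ge0 ?sqr_ge0.
  have sh : s * h <= 1 / 2 by have := s1; have := s0; have := h1; have := h0; nra.
  have sh0 : 0 <= s * h by rewrite mulr_ge0 ?ltW.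
  have q1 : q / 128 <= 2^-1.
    by rewrite /q -exprMn_comm; [nra|exact: mulrC].
  have e1 : expR (q / 128) <= 1 + 2 * (q / 128) by apply: expR_le_1D2; rewrite divr_ge0.
  have : s ^+ 2 / 4 * (h ^+ 2 / 16) = q / 64 by rewrite /q; field.
  rewrite -/q; lra.
apply: le_cmean.
- exact: cbD (cbD cb_tilt b1) b2.
- by apply: cbM => //; exact: cb_exp.
move=> z; have w0 : 0 <= tilt (circle_val z) by have := tilt_ge z; lra.
have xb := expo_drift_le z; rewrite -/(x z) in xb.
rewrite (_ : _ + _ = tilt (circle_val z) * (1 + s * x z / 2) ^+ 2); last by field.
apply: (ler_wpM2l w0).
have xh : `|x z| <= 1 by apply: le_trans xb _; have := h1; lra.
have sx : 0 <= 1 + s * x z / 2.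
  by move: xh; rewrite ler_norml => /andP[x1 x2]; have := s1; have := s0; nra.
have -> : expR (s * x z) = expR (s * x z / 2) ^+ 2 by rewrite -expRM_natl; congr expR; field.
by rewrite lerXn2r ?nnegrE ?expR_ge0// expR_ge1Dx.
Qed.
End CircleMoments.

Section MertensLower.
Variable R : realType.
Implicit Types (m n a b r : nat).

Lemma iota1S n : iota 1 n.+1 = iota 1 n ++ [:: n.+1].
Proof. by rewrite -(addn1 n) iotaD /= add1n addn1. Qed.

Lemma ln_le_harmonic n : ln (n.+1%:R : R) <= \sum_(k <- iota 1 n) npow 1 k.
Proof.
elim: n => [|n IH]; first by rewrite ln1 big_nil.
rewrite iota1S big_cat /= big_seq1 npow_inv//.
have n0 : 0 < n.+1%:R :> R by rewrite ltr0n.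
have i0 : 0 <= (n.+1%:R : R)^-1 by rewrite invr_ge0 ltW.
have -> : n.+2%:R = n.+1%:R * (1 + (n.+1%:R)^-1) :> R.
  by rewrite mulrDr mulr1 divff ?gt_eqF// natr1.
have l1 : 0 < 1 + (n.+1%:R : R)^-1 by rewrite ltr_pwDl.
rewrite lnM ?posrE//.
by apply: lerD IH _; apply: le_ln1Dx; apply: lt_le_trans i0; rewrite ltrN10.
Qed.

(** Comparison with a telescoping sum. *)
Lemma sum_npow32_le m n : \sum_(r <- primes_in m n) npow (3 / 2) r <= 3 :> R.
Proof.
have tele k : \sum_(r <- iota 1 k.+1) npow (3 / 2) r <= 3 - 2 * npow 2^-1 k.+1 :> R.
  elim: k => [|k IH]; first by rewrite big_seq1 !npow1; lra.
  rewrite iota1S big_cat /= big_seq1.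
  have h2 : (0 : R) < 2^-1 by rewrite invr_gt0.
  have := npow_telescope h2 (ltn0Sn k).
  by rewrite (_ : 1 + 2^-1 = 3 / 2 :> R); [lra|field].
apply: (@le_trans _ _ (\sum_(r <- iota 1 n.+1) npow (3 / 2) r)).
  apply: ler_sum_subset => [|r|r]; [exact: primes_in_uniq| |exact: npow_ge0].
  rewrite mem_primes_in => /and3P[pr _ rn].
  by rewrite mem_iota prime_gt0//= add1n ltnW// ltnS ltnW.
by apply: le_trans (tele n) _; have := npow_ge0 (2^-1 : R) n.+1; lra.
Qed.

Lemma inv_sqr_le_npow32 r : (0 < r)%N -> (r%:R : R)^-1 ^+ 2 <= npow (3 / 2) r.
Proof.
move=> r0; have -> : (r%:R : R)^-1 = npow 1 r by rewrite npow_inv.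
rewrite expr2 -npowD; apply: npow_le; lra.
Qed.

Lemma one_sub_ge (x : R) : 0 <= x -> x <= 2^-1 -> expR (- (x + 2 * x ^+ 2)) <= 1 - x.
Proof.
move=> x0 x2; rewrite expRN; have p0 : 0 < 1 - x by lra.
rewrite -[leRHS]invrK lef_pV2 ?posrE ?invr_gt0 ?expR_gt0//.
apply: le_trans (expR_ge1Dx _); rewrite -div1r ler_pdivrMr//; nra.
Qed.

Lemma primes_in_ge2 m n r : r \in primes_in m n -> (0 < r)%N /\ (r%:R : R)^-1 <= 2^-1.
Proof.
rewrite mem_primes_in => /andP[pr _]; have r1 := prime_gt1 pr.
split; first exact: prime_gt0.
by rewrite lef_pV2 ?posrE ?ltr0n ?prime_gt0// ler_nat.
Qed.

Lemma pow2_le_expR_primes b : b%:R / 2 <= expR (\sum_(r <- primes_in 0 (2 ^ b)) (r%:R)^-1 + 6) :> R.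
Proof.
set ps := primes_in 0 (2 ^ b).
have pps r : r \in ps -> prime r by exact: primes_in_prime.
have sm : \sum_(n <- iota 1 (2 ^ b).-1 | smooth ps n) npow (1 : R) n =
    \sum_(n <- iota 1 (2 ^ b).-1) npow 1 n.
  rewrite big_seq_cond [RHS]big_seq; apply: eq_bigl => n.
  case: (boolP (n \in _)) => //=; rewrite mem_iota add1n => /andP[n0 nb].
  apply/smoothP => // r pr rn; rewrite mem_primes_in pr leq0n /=.
  by apply: (leq_ltn_trans (dvdn_leq n0 rn)); rewrite prednK ?expn_gt0 in nb.
have h := smooth_sum_le (2 ^ b).-1 (@ltr01 R) pps; rewrite sm in h.
have hb : b%:R / 2 <= \sum_(n <- iota 1 (2 ^ b).-1) npow 1 n :> R.
  apply: le_trans (ln_le_harmonic _); rewrite prednK ?expn_gt0// ln_natX//.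
  by rewrite ler_wpM2l// ln2_ge.
have pr0 : expR (- (\sum_(r <- ps) (r%:R)^-1 + 6)) <= \prod_(r <- ps) (1 - npow (1 : R) r).
  apply: (@le_trans _ _ (\prod_(r <- ps) expR (- ((r%:R)^-1 + 2 * (r%:R)^-1 ^+ 2)))).
    rewrite -expR_sum ler_expR sumrN lerN2 big_split/= lerD2l -mulr_sumr.
    have : \sum_(r <- ps) (r%:R : R)^-1 ^+ 2 <= \sum_(r <- ps) npow (3 / 2) r.
      rewrite big_seq [leRHS]big_seq; apply: ler_sum => r /primes_in_ge2[r0 _].
      exact: inv_sqr_le_npow32.
    by have := sum_npow32_le 0 (2 ^ b); rewrite -/ps; lra.
  rewrite big_seq [leRHS]big_seq; apply: ler_prod => r rps.
  have [r0 r2] := primes_in_ge2 rps; rewrite expR_ge0 npow_inv//=.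
  by apply: one_sub_ge => //; rewrite invr_ge0.
have S0 : 0 <= b%:R / 2 :> R by rewrite divr_ge0.
have e0 : 0 < expR (- (\sum_(r <- ps) (r%:R)^-1 + 6)) :> R by exact: expR_gt0.
have := le_trans (ler_pM (ltW e0) S0 pr0 hb) h.
by rewrite expRN mulrC ler_pdivrMr ?expR_gt0// mul1r.
Qed.

Lemma mertens_lower a : exists2 A : R, 0 < A & forall b, (a <= b)%N ->
  b%:R <= A * expR (\sum_(r <- primes_in (2 ^ a) (2 ^ b)) (r%:R)^-1).
Proof.
exists (2 * expR (6 + \sum_(r <- primes_in 0 (2 ^ a)) (r%:R)^-1)); first by rewrite mulr_gt0 ?expR_gt0.
move=> b ab; have := pow2_le_expR_primes b.
rewrite (@primes_in_cat _ (2 ^ a) _ (leq0n _)) ?leq_exp2l// big_cat /= -mulrA -expRD.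
by rewrite ler_pdivrMr// mulrC; rewrite (_ : _ + 6 = 6 + \sum_(r <- primes_in 0 (2 ^ a)) (r%:R)^-1 +
  \sum_(r <- primes_in (2 ^ a) (2 ^ b)) (r%:R)^-1)//; ring.
Qed.

Lemma sum_ln_sqr_primes m b : \sum_(r <- primes_in m (2 ^ b)) ln (r%:R : R) ^+ 2 / r%:R <= 3 * b%:R ^+ 2.
Proof.
apply: (@le_trans _ _ (\sum_(r <- primes_in m (2 ^ b)) b%:R * (ln (r%:R : R) / r%:R))).
  rewrite big_seq [leRHS]big_seq; apply: ler_sum => r.
  rewrite mem_primes_in => /and3P[pr _ rb]; rewrite expr2 -mulrA.
  apply: ler_wpM2r; first by rewrite divr_ge0 ?ln_nat_ge0.
  apply: le_trans (ln_block_le R (prime_gt0 pr) (ltnW rb)) _.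
  by apply: ler_piMr => //; exact: ln2_le1.
rewrite -mulr_sumr expr2 mulrCA; apply: ler_wpM2l => //.
apply: (@le_trans _ _ (\sum_(r <- primes_in 0 (2 ^ b)) ln (r%:R : R) / r%:R)).
  apply: ler_sum_subset => [|r|r]; [exact: primes_in_uniq| |by rewrite divr_ge0 ?ln_nat_ge0].
  by rewrite !mem_primes_in => /and3P[-> _ ->].
rewrite /primes_in big_filter; apply: le_trans (sum_ln_div_primes R b) _.
by apply: ler_wpM2r => //; have := ln2_le1 R; lra.
Qed.

End MertensLower.

Section EulerWeights.
Variable R : realType.
Local Notation C := R[i].
Local Notation Re := complex.Re.
Local Notation Im := complex.Im.
Local Notation point := (nat -> C).
Implicit Types (z u : point) (L : seq nat).

Lemma nice_ler (M : R) (g : point -> R) : nice g -> nice (fun u => (M <= g u)%R%:R).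
Proof.
move=> [_ mg]; split; first by exists 1 => z _; rewrite ger0_norm//; case: (M <= g z).
move=> d T zeta mz; have mG := mg d T zeta mz.
rewrite (_ : _ \o _ = \1_((g \o zeta) @^-1` `[M, +oo[)).
  by apply: measurable_indic; rewrite -[X in measurable X]setTI; exact: mG.
apply/funext => x; rewrite indicE /=; congr ((nat_of_bool _)%:R).
by apply/idP/idP; rewrite inE/= in_itv/= andbT.
Qed.

Lemma nice_expR (g : point -> R) : nice g -> nice (fun u => expR (g u)).
Proof.
move=> [[B gB] mg]; split; last first.
  by move=> d T zeta mz; apply: (measurableT_comp (@measurable_expR R)); exact: mg.
exists (expR B) => z zd; rewrite ger0_norm ?expR_ge0// ler_expR.
by apply: le_trans (ler_norm _) (gB _ zd).
Qed.

(** Independence of the coordinates. *)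
Lemma tmean_prod L (g : nat -> C -> R) z : uniq L ->
  (forall r, nice (fun u : point => g r (u r))) -> in_disc z ->
  tmean L (fun u => \prod_(r <- L) g r (u r)) z =
  \prod_(r <- L) cmean (fun w => g r (circle_val w)).
Proof.
move=> + ng; elim: L z => [|r L IH] z /=; first by move=> _ _; rewrite !big_nil.
move=> /andP[rL uL] zd; rewrite big_cons.
have nP : nice (fun u : point => \prod_(q <- L) g q (u q)) by exact: nice_prod.
rewrite (_ : wint _ _ _ = wint (circle_haar R) (fun=> 1)
    (fun w => (\prod_(q <- L) cmean (fun w => g q (circle_val w))) * g r (circle_val w))).
  rewrite wintZ 1?mulrC//; first exact: haar_weight.
  have := nice_set_coord r (ng r) zd.
  rewrite (_ : (fun w : circle R => _) = fun w => g r (circle_val w))//.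
  by apply/funext => w; rewrite /set_coord eqxx.
apply: eq_wint => w _; have zd' : in_disc (set_coord z r (circle_val w)).
  by apply: in_disc_set => //; rewrite sqn_circle.
rewrite -(IH _ uL zd') mulrC -tmeanZ//.
apply: eq_tmean => // u [_ u2].
by rewrite big_cons (u2 r rL) /set_coord eqxx.
Qed.

(** The coefficient [r ^ (- 1/2 + i tau)]. *)
Definition wgt (tau : R) (r : nat) : C := nz (- tau) 0 0 r.

Lemma sqn_wgt tau r : (0 < r)%N -> sqn (wgt tau r) = (r%:R)^-1.
Proof. by move=> r0; rewrite /wgt sqn_nz mulr0 addr0 npow_inv. Qed.

Definition hh (r : nat) : R := npow 2^-1 r.

Lemma hh_sqr r : (0 < r)%N -> hh r ^+ 2 = (r%:R)^-1.
Proof.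
move=> r0; have -> : (r%:R : R)^-1 = npow 1 r by rewrite npow_inv.
by rewrite expr2 /hh -npowD (_ : 2^-1 + 2^-1 = 1 :> R)//; field.
Qed.

Lemma hh_cube r : hh r ^+ 3 = npow (3 / 2) r.
Proof. by rewrite !exprS expr0 mulr1 /hh -!npowD (_ : 2^-1 + (2^-1 + 2^-1) = 3 / 2 :> R)//; field. Qed.

Lemma hh_gt0 r : 0 < hh r. Proof. exact: npow_gt0. Qed.

Lemma hh_small r : (2 ^ 14 <= r)%N -> hh r <= 128^-1.
Proof.
move=> r14; have r0 : (0 < r)%N by apply: leq_trans r14.
apply: le_sqr_nneg; first by rewrite invr_ge0.
rewrite hh_sqr// exprVn lef_pV2 ?posrE ?ltr0n ?exprn_gt0//.
by rewrite -natrX ler_nat.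
Qed.

(** One factor [|1 + w_r|^2 / (1 + 1/r)] of the Euler product; its mean over the
circle is one. *)
Definition rfac tau r (c : C) : R := tilt (hh r) (wgt tau r) c.
Definition rprod tau L z : R := \prod_(r <- L) rfac tau r (z r).

Let den0 r : 0 < 1 + hh r ^+ 2. Proof. by rewrite ltr_pwDl ?sqr_ge0. Qed.

Lemma rfac_ge0 tau r c : 0 <= rfac tau r c.
Proof. by rewrite divr_ge0 ?sqn_ge0// ltW. Qed.

Lemma rprod_ge0 tau L z : 0 <= rprod tau L z.
Proof. by apply: prodr_ge0 => r _; exact: rfac_ge0. Qed.

Lemma rprod_cat tau L L' z : rprod tau (L ++ L') z = rprod tau L z * rprod tau L' z.
Proof. exact: big_cat. Qed.

Lemma cnice_lin (a : C) r : cnice (fun u : point => a * u r).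
Proof. by apply: cniceM; [exact: cnice_cst|exact: cnice_coord]. Qed.

Lemma nice_rfac tau r : nice (fun u : point => rfac tau r (u r)).
Proof.
rewrite /rfac /tilt; under eq_fun do rewrite mulrC.
apply/niceZ/nice_sqn/cniceD; [exact: cnice_cst|exact: cnice_lin].
Qed.

Lemma nice_rprod tau L : nice (rprod tau L).
Proof. by apply: nice_prod => r _; exact: nice_rfac. Qed.

Lemma eq_rprod tau L z u : (forall r, r \in L -> z r = u r) -> rprod tau L z = rprod tau L u.
Proof. by move=> zu; rewrite /rprod big_seq [RHS]big_seq; apply: eq_bigr => r /zu ->. Qed.

Section large_primes.
Variable L : seq nat.
Hypotheses (uL : uniq L) (L14 : forall r, r \in L -> (2 ^ 14 <= r)%N).

Let L0 r : r \in L -> (0 < r)%N. Proof. by move=> /L14; apply: leq_trans. Qed.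

Lemma tmean_rprod tau z : in_disc z -> tmean L (rprod tau L) z = 1.
Proof.
move=> zd; rewrite /rprod tmean_prod// => [|r]; last exact: nice_rfac.
rewrite big_seq big1// => r rL; apply: (@cmean_tilt _ (hh r) (wgt tau r)).
by rewrite sqn_wgt ?L0// hh_sqr ?L0.
Qed.

(** Pointwise lower bound of one factor: second order expansion of the
logarithm. *)
Lemma rfac_ge tau r (c : C) : r \in L -> sqn c = 1 ->
  expR (2 * Re (wgt tau r * c) - Re (wgt tau r ^+ 2 * c ^+ 2) - hh r ^+ 2 - 4 * hh r ^+ 3) <=
  rfac tau r c.
Proof.
move=> rL c1; have h0 := hh_gt0 r; have h1 := hh_small (L14 rL).
set w := wgt tau r * c; have sw : sqn w = hh r ^+ 2.
  by rewrite /w sqnM c1 mulr1 sqn_wgt ?L0// hh_sqr ?L0.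
have nw : normc (- w) = hh r by rewrite normcE_sqn sqnN sw sqrtr_sqr gtr0_norm.
have hlt : hh r < 1 by lra.
have := @ln_sqn_taylor R (- w) 2; rewrite nw => /(_ hlt).
rewrite opprK !big_nat_recl// big_geq// invr1 mul1r expr1 addr0.
have -> : (- w) ^+ 2 = w ^+ 2 by rewrite sqrrN.
rewrite ReN ler_norml => /andP[+ _].
have e3 : hh r ^+ 3 / (1 - hh r) <= 2 * hh r ^+ 3.
  rewrite ler_pdivrMr; last by lra.
  have : 0 <= hh r ^+ 3 by rewrite exprn_ge0// ltW.
  by nra.
set l := ln _ => hl.
have wE : wgt tau r ^+ 2 * c ^+ 2 = w ^+ 2 by rewrite /w !expr2 mulrACA.
rewrite wE.
have s1 : 0 < sqn (1 + w).
  rewrite lt_neqAle sqn_ge0 andbT eq_sym sqn_eq0; apply/eqP => e.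
  have : sqn w = 1 by rewrite (_ : w = -1) ?sqnN ?sqn1//; apply/eqP; rewrite -addr_eq0 addrC e.
  by rewrite sw; nra.
rewrite /rfac /tilt -/w ler_pdivlMr//.
apply: (@le_trans _ _ (expR (l - hh r ^+ 2) * (1 + hh r ^+ 2))).
  rewrite ler_pM2r// ler_expR; lra.
rewrite expRD /l lnK ?posrE// -mulrA; apply: ler_piMr; first exact: ltW.
rewrite expRN mulrC ler_pdivrMr ?expR_gt0// mul1r; exact: expR_ge1Dx.
Qed.

Definition rfloor : R := \prod_(r <- L) ((1 - hh r) ^+ 2 / (1 + hh r ^+ 2)).

Lemma rfloor_gt0 : 0 < rfloor.
Proof.
rewrite /rfloor big_seq; apply: prodr_gt0 => r rL.
by rewrite divr_gt0// exprn_gt0//; have := hh_small (L14 rL); lra.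
Qed.

Lemma rfloor_le tau u : (forall r, r \in L -> sqn (u r) = 1) -> rfloor <= rprod tau L u.
Proof.
move=> u1; rewrite /rfloor /rprod big_seq [leRHS]big_seq; apply: ler_prod => r rL.
apply/andP; split; first by apply: divr_ge0; [exact: sqr_ge0|exact: ltW].
apply: ler_wpM2r; first by rewrite invr_ge0 ltW.
set w := wgt tau r * u r; have sw : sqn w = hh r ^+ 2.
  by rewrite /w sqnM u1// mulr1 sqn_wgt ?L0// hh_sqr ?L0.
have h0 := hh_gt0 r; have h1 := hh_small (L14 rL).
rewrite sqnD sqn1 sw rmorph1 mul1r.
have : `|Re w| <= hh r.
  apply: le_sqr_nneg; first exact: ltW.
  rewrite real_normK ?num_real//; apply: le_trans (sqr_Re_le _) _; by rewrite sw.
by rewrite ler_norml => /andP[]; nra.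
Qed.

End large_primes.

(** Means over finite sets of indices *)
Section averages.
Variables (T : Type) (S : seq T) (m : R) (m0 : 0 < m) (Sm : \sum_(i <- S) 1 = m).
Implicit Type a : T -> R.

Lemma avg_exp_ge a : expR (m^-1 * \sum_(i <- S) a i) <= m^-1 * \sum_(i <- S) expR (a i).
Proof.
set A := m^-1 * _; have mA : m * A = \sum_(i <- S) a i by rewrite mulVKf// gt_eqF.
have -> : expR A = m^-1 * \sum_(i <- S) (expR A * (1 + (a i - A))).
  rewrite -mulr_sumr big_split/= Sm big_split/= -mA sumrN -(mul1r A) -mulr_suml Sm mul1r.
  by field; rewrite gt_eqF.
apply: ler_wpM2l; first by rewrite invr_ge0 ltW.
apply: ler_sum => i _; rewrite -[in leRHS](subrK A (a i)) expRD mulrC.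
by apply: ler_wpM2r; [exact: expR_ge0|exact: expR_ge1Dx].
Qed.

Lemma avg_sqr_le a : (m^-1 * \sum_(i <- S) a i) ^+ 2 <= m^-1 * \sum_(i <- S) a i ^+ 2.
Proof.
set A := m^-1 * _; have mA : m * A = \sum_(i <- S) a i by rewrite mulVKf// gt_eqF.
have -> : A ^+ 2 = m^-1 * \sum_(i <- S) (2 * A * a i - A ^+ 2 * 1).
  by rewrite sumrB -!mulr_sumr Sm -mA; field; rewrite gt_eqF.
apply: ler_wpM2l; first by rewrite invr_ge0 ltW.
by apply: ler_sum => i _; have := sqr_ge0 (a i - A); nra.
Qed.

Lemma sqn_avg_le (w : T -> C) :
  sqn ((m^-1)%:C%C * \sum_(i <- S) w i) <= m^-1 * \sum_(i <- S) sqn (w i).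
Proof.
rewrite /sqn ReRl ImRl Re_sum Im_sum big_split/= mulrDr.
by apply: lerD; exact: avg_sqr_le.
Qed.

End averages.

Lemma cos_ge_quadratic (x : R) : 1 - x ^+ 2 / 2 <= cos x.
Proof.
wlog x0 : x / 0 <= x => [hw|].
  have [|x0] := leP 0 x; first exact: hw.
  by have := hw (- x); rewrite cosN sqrrN; apply; rewrite oppr_ge0 ltW.
have sinle (y : R) : 0 <= y -> sin y <= y.
  move=> y0; rewrite -subr_ge0.
  have hd (t : R) : is_derive t 1 (fun t => t - sin t) (1 - cos t).
    by apply: derB.
  have cc : {within `[0, y], continuous (fun t : R => t - sin t)}.
    by apply: continuous_subspaceT => t; exact: der_continuous (hd t).
  have [d _ e] := MVT_segment y0 (fun t _ => hd t) cc.
  have : y - sin y = (1 - cos d) * y by move: e; rewrite sin0 !subr0.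
  by move=> ->; rewrite mulr_ge0// subr_ge0 cos_le1.
have hd (t : R) : is_derive t 1 (fun t : R => cos t + 2^-1 * t ^+ 2) (- sin t + 2^-1 * (2 * t ^+ 1)).
  by apply: derD; apply: derZ; exact: (derX t 1).
have cc : {within `[0, x], continuous (fun t : R => cos t + 2^-1 * t ^+ 2)}.
  by apply: continuous_subspaceT => t; exact: der_continuous (hd t).
have [d d1 e] := MVT_segment x0 (fun t _ => hd t) cc.
move: d1; rewrite in_itv/= => /andP[d0 _]; have := sinle d d0.
move: e; rewrite cos0 expr1 expr0n/= mulr0 addr0 subr0 => e ds.
have : 0 <= (- sin d + 2^-1 * (2 * d)) * x by rewrite mulr_ge0//; lra.
lra.
Qed.

End EulerWeights.

Section Excursion.
Variable R : realType.
Local Notation C := R[i].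
Local Notation Re := complex.Re.
Local Notation Im := complex.Im.
Local Notation point := (nat -> C).
Implicit Types (z u : point) (L : seq nat).

Definition grid K (I : nat) : R := I%:R / (2 ^ K)%:R.

Definition gavg K (c : nat -> R) L u : R :=
  ((2 ^ K)%:R)^-1 * \sum_(I <- iota 0 (2 ^ K)) c I * rprod (grid K I) L u.

Definition excur_const : R := (expR (72 * 256) + expR 1 ^+ 2)^-1.

Lemma excur_const_gt0 : 0 < excur_const.
Proof. by rewrite invr_gt0 addr_gt0 ?exprn_gt0 ?expR_gt0. Qed.

Section tilted.
Variables (L : seq nat) (uL : uniq L) (L14 : forall r, r \in L -> (2 ^ 14 <= r)%N).
Variables (tau s : R) (U V : nat -> C).
Hypotheses (s0 : 0 < s) (s1 : s <= 20^-1).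
Hypothesis UE : forall r, r \in L -> sqn (U r) <= hh R r ^+ 2.
Hypothesis VE : forall r, r \in L -> sqn (V r) <= hh R r ^+ 4.
Hypothesis Uom : forall r, r \in L -> hh R r ^+ 2 / 2 <= Re (U r * (wgt tau r)^*%C).
Hypothesis sV : s ^+ 2 * \sum_(r <- L) hh R r ^+ 2 = 256.

Definition xr r (c : C) : R := expo (U r) (V r) c - drift (hh R r) (wgt tau r) (U r).

Definition walk u : R := \sum_(r <- L) xr r (u r).

Let L0 r : r \in L -> (0 < r)%N. Proof. by move=> /L14; apply: leq_trans. Qed.

Let F k u : R := \prod_(r <- L) (rfac tau r (u r) * expR (k * xr r (u r))).

Let FE k u : F k u = rprod tau L u * expR (k * walk u).
Proof. by rewrite /F big_split/= -expR_sum -mulr_sumr. Qed.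

Let nf k r : nice (fun u : point => rfac tau r (u r) * expR (k * xr r (u r))).
Proof.
apply: niceM; first exact: nice_rfac.
apply/nice_expR/niceZ/niceD; last exact: nice_cst.
apply: niceD; first by apply/niceZ/nice_Re/cnice_lin.
by apply/niceN/nice_Re/cniceM; [exact: cnice_cst|apply/cniceX/cnice_coord].
Qed.

Let nF k : nice (F k). Proof. by apply: nice_prod => r _; exact: nf. Qed.

Let omE r : r \in L -> sqn (wgt tau r) = hh R r ^+ 2.
Proof. by move=> rL; rewrite sqn_wgt ?hh_sqr ?L0. Qed.

Let F1_ge z : in_disc z -> expR 2 <= tmean L (F s) z.
Proof.
move=> zd; rewrite /F (tmean_prod (g := fun r c => rfac tau r c * expR (s * xr r c)))//.
apply: (@le_trans _ _ (\prod_(r <- L) expR (s ^+ 2 * hh R r ^+ 2 / 128))).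
  rewrite -expR_sum ler_expR -mulr_suml -mulr_sumr sV; lra.
rewrite big_seq [leRHS]big_seq; apply: ler_prod => r rL; rewrite expR_ge0 /=.
exact: tilt_exp_ge (hh_gt0 R r) (hh_small R (L14 rL)) s0 s1 (omE rL) (UE rL) (VE rL) (Uom rL).
Qed.

Let F2_le z : in_disc z -> tmean L (F (2 * s)) z <= expR (72 * 256).
Proof.
move=> zd; rewrite /F (tmean_prod (g := fun r c => rfac tau r c * expR (2 * s * xr r c)))//.
apply: (@le_trans _ _ (\prod_(r <- L) expR (72 * s ^+ 2 * hh R r ^+ 2))); last first.
  by rewrite -expR_sum ler_expR -mulr_sumr -mulrA sV.
rewrite big_seq [leRHS]big_seq; apply: ler_prod => r rL; apply/andP; split; last first.
  exact: tilt_exp_le (hh_gt0 R r) (hh_small R (L14 rL)) s0 s1 (omE rL) (UE rL) (VE rL).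
have zz : in_disc (fun=> 0 : C) by move=> q; rewrite sqn0.
rewrite -(tmean_cst [::] 0 z) -[leRHS](big_seq1 *%R r (fun r => cmean (fun w =>
  rfac tau r (circle_val w) * expR (2 * s * xr r (circle_val w))))).
rewrite -(@tmean_prod _ [:: r] (fun r c => rfac tau r c * expR (2 * s * xr r c)) _ _ _ zz)//.
apply: tmean_ge0 => //; first by apply: nice_prod => q _; exact: nf.
by move=> u _; rewrite big_seq1 mulr_ge0 ?rfac_ge0 ?expR_ge0.
Qed.

(** A second moment argument under the probability of density [rprod tau L]. *)
Lemma tilted_excursion (G : point -> R) z : in_disc z -> nice G -> (forall u, 0 <= G u) ->
  (forall u, torus_pt L z u -> 1 <= s * walk u -> 1 <= G u) ->
  excur_const <= tmean L (fun u => rprod tau L u * G u) z.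
Proof.
move=> zd nG G0 G1; set lam := excur_const; have lam0 := excur_const_gt0; rewrite -/lam in lam0.
pose ee := expR 1 : R; have ee2 : 2 <= ee by have := expR_ge1Dx (1 : R); rewrite /ee; lra.
have lamE : lam * (expR (72 * 256) + ee ^+ 2) = 1.
  by rewrite mulVf// gt_eqF// -invr_gt0.
pose k3 := - (2 * lam * ee + lam ^+ 2 * ee ^+ 2).
have nR := nice_rprod tau L.
have n1 := niceZ (2 * lam) (nF s); have n2 := niceZ (- lam ^+ 2) (nF (2 * s)); have n3 := niceZ k3 nR.
apply: (@le_trans _ _ (tmean L (fun u => 2 * lam * F s u + - lam ^+ 2 * F (2 * s) u + k3 * rprod tau L u) z)).
  rewrite (tmeanD _ (niceD n1 n2) n3 zd) (tmeanD _ n1 n2 zd).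
  rewrite (tmeanZ _ _ (nF s) zd) (tmeanZ _ _ (nF (2 * s)) zd) (tmeanZ _ _ nR zd).
  rewrite (tmean_rprod uL L14)// mulr1.
  have f1 := F1_ge zd; have f2 := F2_le zd.
  have e2 : expR 2 = ee ^+ 2 :> R by rewrite /ee -expRM_natl mulr1.
  rewrite e2 in f1; have g1 := ler_wpM2l (ltW lam0) f1.
  have l2 : 0 <= lam ^+ 2 by exact: sqr_ge0.
  have g2 := ler_wpM2l l2 f2.
  have l3 : lam ^+ 2 * expR (72 * 256) + lam ^+ 2 * ee ^+ 2 = lam.
    by rewrite -mulrDr expr2 -mulrA lamE mulr1.
  have g4 : lam <= lam * (ee ^+ 2 - ee) by rewrite ler_peMr ?(ltW lam0)//; nra.
  rewrite /k3; move: g1 g2 l3 g4; move: (expR _) (tmean _ _ _) (tmean _ _ _) => X0 X1 X2.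
  by move: (lam ^+ 2 * ee ^+ 2) (lam ^+ 2 * X0) (lam ^+ 2 * X2) => y1 y2 y3; rewrite mulrBr; lra.
apply: le_tmean => //; [exact: niceD (niceD n1 n2) n3|exact: niceM|].
move=> u ut; rewrite !FE.
have -> : expR (2 * s * walk u) = expR (s * walk u) ^+ 2 by rewrite -expRM_natl mulrA.
set Y := expR (s * walk u); have Y0 : 0 < Y by exact: expR_gt0.
have P0 := rprod_ge0 tau L u.
rewrite (_ : _ + _ = rprod tau L u * (2 * lam * Y - lam ^+ 2 * Y ^+ 2 + k3)); last by ring.
apply: (ler_wpM2l P0); rewrite /k3.
have [Ye|Ye] := leP ee Y.
  apply: (@le_trans _ _ 1); last by apply: G1 => //; rewrite -ler_expR.
  have := sqr_ge0 (1 - lam * (Y - ee)); have : 0 <= lam ^+ 2 * (Y * ee).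
    by rewrite mulr_ge0 ?sqr_ge0// mulr_ge0 ?ltW//; lra.
  by nra.
apply: le_trans (G0 u).
have := mulr_ge0 (sqr_ge0 lam) (sqr_ge0 Y); have := mulr_ge0 (sqr_ge0 lam) (sqr_ge0 ee).
have : 2 * lam * Y <= 2 * lam * ee by rewrite ler_wpM2l ?ltW// mulr_gt0.
lra.
Qed.

End tilted.
End Excursion.

Section ExcursionLemma.
Variable R : realType.
Local Notation C := R[i].
Local Notation Re := complex.Re.
Local Notation Im := complex.Im.
Local Notation point := (nat -> C).
Local Notation hh := (hh R).
Local Notation grid := (grid R).
Implicit Types (z u : point) (L : seq nat) (c : nat -> R) (K e : nat).

Lemma Re_wgtJ (t t' : R) r : Re (wgt t' r * (wgt t r)^*%C) = hh r ^+ 2 * cos ((t' - t) * ln r%:R).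
Proof.
rewrite /wgt /nz polarMJ ReRl /cisC /= /hh addr0 expr2; congr (_ * cos _); ring.
Qed.

Section window.
Variables (K e I : nat) (eK : (e <= K)%N) (IK : (I < 2 ^ K)%N).
Variables (L : seq nat) (uL : uniq L) (L14 : forall r, r \in L -> (2 ^ 14 <= r)%N).
Hypotheses (Lp : forall r, r \in L -> prime r) (Lb : forall r, r \in L -> (r < 2 ^ 2 ^ e)%N).

Let m := (2 ^ (K - e))%N.
Let J0 := (I %/ m * m)%N.
Let S := iota J0 m.

Let m0 : (0 < m)%N. Proof. by rewrite expn_gt0. Qed.
Let mR : 0 < m%:R :> R. Proof. by rewrite ltr0n. Qed.
Let KE : (2 ^ K = 2 ^ e * m)%N. Proof. by rewrite -expnD subnKC. Qed.

Let Sm : \sum_(J <- S) 1 = m%:R :> R.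
Proof. by rewrite big_const_seq count_predT size_iota iter_addr_0. Qed.

Let S_sub : {subset S <= iota 0 (2 ^ K)}.
Proof.
move=> J; rewrite !mem_iota leq0n add0n /= => /andP[_]; rewrite /J0 -mulSnr => h.
by apply: (leq_trans h); rewrite KE leq_pmul2r// ltn_divLR// -KE.
Qed.

Let S_close J : J \in S -> `|grid K J - grid K I| <= ((2 ^ e)%:R)^-1.
Proof.
rewrite mem_iota => /andP[h1 h2].
have i1 : (J0 <= I)%N by rewrite /J0 leq_trunc_div.
have i2 : (I < J0 + m)%N by rewrite /J0 {1}(divn_eq I m) ltn_add2l ltn_pmod.
rewrite /grid -mulrBl normrM (gtr0_norm (_ : 0 < ((2 ^ K)%:R)^-1)); last by rewrite invr_gt0 ltr0n expn_gt0.
have -> : ((2 ^ e)%:R)^-1 = m%:R / (2 ^ K)%:R :> R.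
  by rewrite KE natrM invfM mulrCA divff ?mulr1// gt_eqF.
apply: ler_wpM2r => //.
have : (J%:R : R) <= I%:R + m%:R by rewrite -natrD ler_nat; lia.
have : (I%:R : R) <= J%:R + m%:R by rewrite -natrD ler_nat; lia.
by move=> ? ?; rewrite ler_norml; apply/andP; split; lra.
Qed.

Definition win_lin r : C := ((m%:R)^-1)%:C%C * \sum_(J <- S) wgt (grid K J) r.
Definition win_quad r : C := ((m%:R)^-1)%:C%C * \sum_(J <- S) wgt (grid K J) r ^+ 2.

Let L0 r : r \in L -> (0 < r)%N. Proof. by move=> /L14; apply: leq_trans. Qed.

Let L_sub : {subset L <= primes_in 0 (2 ^ 2 ^ e)}.
Proof. by move=> r rL; rewrite mem_primes_in Lp// Lb. Qed.

Let avg_cst (k : R) : (m%:R)^-1 * \sum_(J <- S) k = k.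
Proof.
rewrite (_ : \sum_(J <- S) k = \sum_(J <- S) k * 1); last by apply: eq_bigr => J _; rewrite mulr1.
by rewrite -mulr_sumr Sm mulrCA mulVf ?mulr1// gt_eqF.
Qed.

Lemma win_lin_le r : r \in L -> sqn (win_lin r) <= hh r ^+ 2.
Proof.
move=> rL; apply: le_trans (sqn_avg_le mR Sm _) _.
rewrite -[leRHS]avg_cst; apply: ler_wpM2l; first by rewrite invr_ge0.
by apply: ler_sum => J _; rewrite sqn_wgt ?hh_sqr ?L0.
Qed.

Lemma win_quad_le r : r \in L -> sqn (win_quad r) <= hh r ^+ 4.
Proof.
move=> rL; apply: le_trans (sqn_avg_le mR Sm _) _.
rewrite -[leRHS]avg_cst; apply: ler_wpM2l; first by rewrite invr_ge0.
apply: ler_sum => J _; rewrite sqnX sqn_wgt ?L0// -hh_sqr ?L0// -exprM//.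
Qed.

Let rho r : R := ln r%:R / (2 ^ e)%:R.

Let rho01 r : r \in L -> 0 <= rho r <= 1.
Proof.
move=> rL; have b0 : 0 < (2 ^ e)%:R :> R by rewrite ltr0n expn_gt0.
rewrite divr_ge0 ?ln_nat_ge0//= ler_pdivrMr// mul1r.
apply: le_trans (ln_block_le R (L0 rL) (ltnW (Lb rL))) _.
by apply: ler_piMr => //; exact: ln2_le1.
Qed.

Lemma win_lin_Re r : r \in L ->
  hh r ^+ 2 * (1 - rho r ^+ 2 / 2) <= Re (win_lin r * (wgt (grid K I) r)^*%C).
Proof.
move=> rL; rewrite /win_lin -mulrA mulr_suml ReRl Re_sum.
rewrite -[leLHS]avg_cst; apply: ler_wpM2l; first by rewrite invr_ge0.
rewrite big_seq [leRHS]big_seq; apply: ler_sum => J JS; rewrite Re_wgtJ.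
apply: ler_wpM2l; first exact: sqr_ge0.
apply: le_trans (cos_ge_quadratic _); rewrite lerB//.
apply: ler_wpM2r => //; rewrite -[leLHS]real_normK ?num_real// lerXn2r ?nnegrE//.
  by have /andP[] := rho01 rL.
rewrite normrM [rho r]mulrC (ger0_norm (ln_nat_ge0 _ r)).
by apply: ler_wpM2r; [exact: ln_nat_ge0|exact: S_close].
Qed.

Lemma win_drift_ge r : r \in L ->
  hh r ^+ 2 - hh r ^+ 2 * rho r ^+ 2 - 6 * hh r ^+ 3 <=
  drift (hh r) (wgt (grid K I) r) (win_lin r) - hh r ^+ 2 - 4 * hh r ^+ 3.
Proof.
move=> rL; have := win_lin_Re rL; have h0 := hh_gt0 R r; have h1 := hh_small R (L14 rL).
have /andP[r0 r1] := rho01 rL; rewrite /drift.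
have k3 : hh r ^+ 2 * hh r ^+ 2 <= hh r ^+ 3.
  rewrite (_ : hh r ^+ 2 * hh r ^+ 2 = hh r * hh r ^+ 3); last by rewrite -exprD -exprS.
  by apply: ler_piMl; [apply: exprn_ge0; exact: ltW|lra].
have : 0 <= rho r ^+ 2 <= 1 by rewrite sqr_ge0 expr_le1.
have k0 : 0 < hh r ^+ 2 by exact: exprn_gt0.
move: (Re _) (rho r ^+ 2) (hh r ^+ 3) k3 => X q h3; move: (hh r ^+ 2) k0 => k k0 k3 /andP[q0 q1] hX.
have d1 : 2 * (1 - k) <= 2 / (1 + k) by rewrite ler_pdivlMr; nra.
have X0 : 0 <= X by nra.
have := ler_wpM2r X0 d1; have [k1|k1] := leP k 1; first by nra.
have : 0 <= 2 / (1 + k) * X by rewrite mulr_ge0// divr_ge0//; lra.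
nra.
Qed.

Lemma win_Re_half r : r \in L -> hh r ^+ 2 / 2 <= Re (win_lin r * (wgt (grid K I) r)^*%C).
Proof.
move=> rL; apply: le_trans (win_lin_Re rL); apply: ler_wpM2l; first exact: sqr_ge0.
have /andP[r0 r1] := rho01 rL; have : rho r ^+ 2 <= 1 by rewrite expr_le1.
lra.
Qed.

Let kr r : R := hh r ^+ 2 + 4 * hh r ^+ 3.
Let aa u J : R := \sum_(r <- L) (2 * Re (wgt (grid K J) r * u r) - Re (wgt (grid K J) r ^+ 2 * u r ^+ 2) - kr r).

Let aaE u : (m%:R)^-1 * \sum_(J <- S) aa u J =
  \sum_(r <- L) (2 * Re (win_lin r * u r) - Re (win_quad r * u r ^+ 2) - kr r).
Proof.
rewrite /aa exchange_big mulr_sumr; apply: eq_bigr => r _ /=.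
rewrite !sumrB -mulr_sumr !mulrBr avg_cst; congr (_ - _ - _).
  by rewrite /win_lin -mulrA mulr_suml ReRl Re_sum mulrCA.
by rewrite /win_quad -mulrA mulr_suml ReRl Re_sum.
Qed.

Lemma gavg_ge_walk (f : R) (c : nat -> R) u : 0 < f -> (forall J, f <= c J) ->
  (forall r, r \in L -> sqn (u r) = 1) ->
  f / (2 ^ e)%:R * expR (walk L (grid K I) win_lin win_quad u + \sum_(r <- L) hh r ^+ 2 - 21) <=
  gavg K c L u.
Proof.
move=> f0 fc u1.
apply: (@le_trans _ _ (f / (2 ^ e)%:R * expR ((m%:R)^-1 * \sum_(J <- S) aa u J))).
  apply: ler_wpM2l; first by rewrite divr_ge0// ltW.
  rewrite ler_expR aaE /walk /xr.
  have s3 : \sum_(r <- L) hh r ^+ 3 <= 3.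
    under eq_bigr do rewrite hh_cube.
    apply: le_trans (sum_npow32_le R 0 (2 ^ 2 ^ e)); apply: ler_sum_subset => //.
    by move=> r; exact: npow_ge0.
  have s2 : \sum_(r <- L) hh r ^+ 2 * rho r ^+ 2 <= 3.
    have b0 : 0 < (2 ^ e)%:R :> R by rewrite ltr0n expn_gt0.
    rewrite (_ : \sum_(r <- L) _ = (\sum_(r <- L) ln (r%:R : R) ^+ 2 / r%:R) / (2 ^ e)%:R ^+ 2).
      rewrite ler_pdivrMr ?exprn_gt0//; apply: le_trans (sum_ln_sqr_primes R 0 (2 ^ e)).
      apply: ler_sum_subset => // r; by rewrite divr_ge0 ?sqr_ge0.
    rewrite mulr_suml big_seq [RHS]big_seq; apply: eq_bigr => r rL.
    by rewrite hh_sqr ?L0// /rho expr_div_n mulrA [_^-1 * _]mulrC.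
  have dd : \sum_(r <- L) (hh r ^+ 2 - hh r ^+ 2 * rho r ^+ 2 - 6 * hh r ^+ 3) <=
    \sum_(r <- L) (drift (hh r) (wgt (grid K I) r) (win_lin r) - kr r).
    rewrite big_seq [leRHS]big_seq; apply: ler_sum => r rL; rewrite /kr opprD addrA.
    exact: win_drift_ge.
  rewrite !sumrB -!mulr_sumr in dd.
  rewrite /expo !sumrB; move: dd s2 s3.
  by move: (\sum_(r <- L) hh r ^+ 3) (\sum_(r <- L) drift _ _ _) => X Y; lra.
apply: (@le_trans _ _ (f / (2 ^ e)%:R * ((m%:R)^-1 * \sum_(J <- S) expR (aa u J)))).
  apply: ler_wpM2l; first by rewrite divr_ge0// ltW.
  exact: avg_exp_ge.
rewrite /gavg KE natrM invfM -!mulrA mulrCA; apply: ler_wpM2l; first by rewrite invr_ge0.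
rewrite mulrCA; apply: ler_wpM2l; first by rewrite invr_ge0.
apply: (@le_trans _ _ (\sum_(J <- S) c J * rprod (grid K J) L u)); last first.
  rewrite -KE; apply: ler_sum_subset => //; first exact: iota_uniq.
  by move=> J; rewrite mulr_ge0 ?rprod_ge0// (le_trans _ (fc J))// ltW.
rewrite mulr_sumr; apply: ler_sum => J _; apply: ler_pM; [exact: ltW|exact: expR_ge0|exact: fc|].
rewrite /aa expR_sum /rprod big_seq [leRHS]big_seq; apply: ler_prod => r rL.
rewrite expR_ge0 /= /kr opprD addrA; apply: (rfac_ge L14) => //; exact: u1.
Qed.

End window.

Lemma nice_gavg K c L : nice (gavg K c L).
Proof. by apply/niceZ/nice_sum => I _; apply/niceZ/nice_rprod. Qed.

(** Under the probability of density [rprod (grid K I) L], the mean over the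
grid exceeds any level [M] with a probability bounded below: the logarithm of
the product over a window of length about [1 / ln r] around [I] has large
fluctuations. *)
Lemma excursion (f M : R) a : 0 < f -> (14 <= a)%N ->
  exists2 e, (a <= 2 ^ e)%N & forall K (c : nat -> R) I z, (e <= K)%N ->
    (forall J, f <= c J) -> (I < 2 ^ K)%N -> in_disc z ->
    excur_const R <= tmean (primes_in (2 ^ a) (2 ^ 2 ^ e)) (fun u =>
      rprod (grid K I) (primes_in (2 ^ a) (2 ^ 2 ^ e)) u *
      (M <= gavg K c (primes_in (2 ^ a) (2 ^ 2 ^ e)) u)%R%:R) z.
Proof.
move=> f0 a14; have [A A0 mert] := mertens_lower R a.
pose B := Num.max 20 (M * A * expR 21 / f); pose V0 : R := (16 * B) ^+ 2.
pose e := (a + (Num.truncn (A * expR V0)).+1)%N.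
have ae : (a <= 2 ^ e)%N by apply: ltnW; apply: leq_ltn_trans (ltn_expl e (ltnSn 1)); exact: leq_addr.
exists e => // K c I z eK fc IK zd.
set L := primes_in _ _; set b := (2 ^ e)%N in L ae *.
have uL : uniq L by exact: primes_in_uniq.
have Lp r : r \in L -> prime r by exact: primes_in_prime.
have Lb r : r \in L -> (r < 2 ^ b)%N by rewrite mem_primes_in => /and3P[].
have L14 r : r \in L -> (2 ^ 14 <= r)%N.
  by rewrite mem_primes_in => /and3P[_ h _]; apply: leq_trans h; rewrite leq_exp2l.
have b0 : 0 < b%:R :> R by rewrite ltr0n expn_gt0.
pose Vs := \sum_(r <- L) hh r ^+ 2.
have bA : b%:R <= A * expR Vs.
  apply: le_trans (mert b ae) _; rewrite (_ : \sum_(r <- _) _ = Vs)// /Vs big_seq [RHS]big_seq.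
  by apply: eq_bigr => r /Lp pr; rewrite hh_sqr ?prime_gt0.
have VV : V0 <= Vs.
  rewrite -ler_expR -(ler_pM2l A0); apply: le_trans bA.
  apply: ltW; apply: lt_le_trans (truncnS_gt _) _; rewrite ler_nat /b.
  apply: ltnW; apply: leq_ltn_trans (ltn_expl e (ltnSn 1)); exact: leq_addl.
have B20 : 20 <= B by rewrite le_max lexx.
have BM : M * A * expR 21 / f <= B by rewrite le_max lexx orbT.
have sqV : 16 * B <= Num.sqrt Vs.
  by apply: le_sqr_nneg; rewrite ?sqrtr_ge0// sqr_sqrtr// (le_trans _ VV)// sqr_ge0.
have Vs0 : 0 <= Vs by apply: le_trans VV; exact: sqr_ge0.
have sV0 : 0 < Num.sqrt Vs by lra.
pose s := 16 / Num.sqrt Vs.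
have s0 : 0 < s by rewrite divr_gt0.
have s1 : s <= 20^-1 by rewrite ler_pdivrMr//; lra.
have sV : s ^+ 2 * \sum_(r <- L) hh r ^+ 2 = 256.
  rewrite -/Vs /s expr_div_n sqr_sqrtr// -mulrA mulVf ?mulr1; first by ring.
  by rewrite gt_eqF// -sqrtr_gt0.
apply: (@tilted_excursion _ L uL L14 (grid K I) s (win_lin K e I) (win_quad K e I)) => //.
- by move=> r rL; first [by apply: win_lin_le rL | by apply: win_lin_le rL; eauto | by eapply win_lin_le; eauto].
- by move=> r rL; first [by apply: win_quad_le rL | by apply: win_quad_le rL; eauto | by eapply win_quad_le; eauto].
- by move=> r rL; first [by apply: win_Re_half rL | by apply: win_Re_half rL; eauto | by eapply win_Re_half; eauto].
- exact/nice_ler/nice_gavg.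
move=> u [u1 _]; set T := walk _ _ _ _ _ => sT.
have TB : B <= T.
  rewrite -(ler_pM2l s0); apply: le_trans sT; rewrite /s mulrAC ler_pdivrMr// mul1r; lra.
suff Mg : M <= gavg K c L u by rewrite Mg.
have gw : f / b%:R * expR (T + Vs - 21) <= gavg K c L u.
  by rewrite /T /Vs /b; first [exact: gavg_ge_walk|apply: gavg_ge_walk].
apply: le_trans gw.
have eT : B <= expR T by apply: le_trans TB _; have := expR_ge1Dx T; lra.
have -> : T + Vs - 21 = Vs + (T - 21) by ring.
rewrite expRD mulrA (_ : f / b%:R * expR Vs = f * (expR Vs / b%:R)); last by ring.
have vb : A^-1 <= expR Vs / b%:R by rewrite ler_pdivlMr// mulrC ler_pdivrMr// mulrC.
apply: (@le_trans _ _ (f * A^-1 * (B * expR (- 21)))); last first.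
  apply: ler_pM; [by rewrite mulr_ge0 ?invr_ge0 ?ltW|by rewrite mulr_ge0 ?expR_ge0//; lra| |].
    by apply: ler_wpM2l vb; exact: ltW.
  by rewrite expRD; apply: ler_wpM2r => //; exact: expR_ge0.
have fA : 0 <= f * A^-1 by rewrite mulr_ge0 ?invr_ge0 ?ltW.
have := ler_wpM2l fA (ler_wpM2r (expR_ge0 (- 21)) BM); apply: le_trans.
have e21 : expR 21 * expR (- 21) = 1 :> R by rewrite -expRD subrr expR0.
have fld (E1 E2 : R) : f * A^-1 * (M * A * E1 / f * E2) = M * (E1 * E2).
  by field; rewrite !gt_eqF.
by rewrite fld e21 mulr1.
Qed.
End ExcursionLemma.

Section MassDecay.
Variable R : realType.
Local Notation C := R[i].
Local Notation point := (nat -> C).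
Local Notation grid := (grid R).
Local Notation kap := (excur_const R).
Implicit Types (z u : point) (L : seq nat) (c : nat -> R) (K e : nat).

Lemma excur_const_le1 : kap <= 1.
Proof.
rewrite /excur_const -[leRHS]invr1 lef_pV2 ?posrE ?addr_gt0 ?exprn_gt0 ?expR_gt0//.
have := expR_ge1Dx (1 : R); have := expR_ge0 (72 * 256 : R); nra.
Qed.

Lemma tmean_concave L (g : point -> R) (al : R) z : 0 < al -> al <= 1 -> uniq L -> nice g ->
  (forall u, 0 <= g u) -> in_disc z -> tmean L (fun u => g u `^ al) z <= (tmean L g z) `^ al.
Proof.
move=> a0 a1 uL ng g0 zd.
have q1 : 1 <= al^-1 by rewrite -[leLHS]invr1 lef_pV2 ?posrE.
have ng' : nice (fun u => g u `^ al) by apply: nice_powR => //; exact: ltW.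
have E0 : 0 <= tmean L (fun u => g u `^ al) z by apply: tmean_ge0 => // u _; exact: powR_ge0.
have := tmean_jensen q1 uL ng' (fun u => powR_ge0 _ _) zd.
rewrite (eq_tmean (g := fun u => g u `^ al `^ al^-1) (h := g) uL) => [h|u _]; last by rewrite -powRrM mulfV ?powRr1// gt_eqF.
have := le_powR (ltW a0) (powR_ge0 _ _) h.
by rewrite -powRrM mulVf ?powRr1// gt_eqF.
Qed.

Definition gmean K (c : nat -> R) : R := ((2 ^ K)%:R)^-1 * \sum_(I <- iota 0 (2 ^ K)) c I.

Lemma gmean_ge0 K c : (forall J, 0 <= c J) -> 0 <= gmean K c.
Proof. by move=> c0; rewrite mulr_ge0 ?invr_ge0// sumr_ge0. Qed.

Lemma gavg_ge0 K c L u : (forall J, 0 <= c J) -> 0 <= gavg K c L u.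
Proof. by move=> c0; apply: gmean_ge0 => J; rewrite mulr_ge0 ?rprod_ge0. Qed.

Lemma tmean_gavg K c L z : uniq L -> (forall r, r \in L -> (2 ^ 14 <= r)%N) -> in_disc z ->
  tmean L (gavg K c L) z = gmean K c.
Proof.
move=> uL L14 zd; have nR I := nice_rprod (grid K I) L.
rewrite /gavg tmeanZ//; last by apply: nice_sum => I _; exact: niceZ.
rewrite tmean_sum//; last by move=> I _; exact: niceZ.
congr (_ * _); apply: eq_bigr => I _.
by rewrite (tmeanZ _ _ (nR I) zd) (tmean_rprod uL L14 _ zd) mulr1.
Qed.

Lemma powR_le_linear (al M x : R) : 0 < al -> al < 1 -> 0 < M -> M <= x ->
  x `^ al <= M `^ (al - 1) * x.
Proof.
move=> a0 a1 M0 Mx; have x0 : 0 < x by exact: lt_le_trans Mx.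
have -> : x `^ al = x `^ (al - 1) * x.
  by rewrite -{3}[x]powRr1 ?ltW// -powRD ?subrK//; apply/implyP; rewrite gt_eqF.
apply: ler_wpM2r; first exact: ltW.
rewrite (_ : al - 1 = - (1 - al)); last by rewrite opprB.
rewrite !powRN lef_pV2 ?posrE ?powR_gt0//; apply: le_powR => //; [by rewrite subr_ge0 ltW|exact: ltW].
Qed.

Section decay.
Variables (al M eta : R).
Hypotheses (al0 : 0 < al) (al1 : al < 1) (M0 : 0 < M) (eta0 : 0 < eta).

Let disc_torus L z u : in_disc z -> torus_pt L z u -> in_disc u.
Proof.
move=> zd [u1 u2] r; have [rL|rL] := boolP (r \in L); first by rewrite u1.
by rewrite u2.
Qed.

Let blk a e := primes_in (2 ^ a) (2 ^ 2 ^ e).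

Let blk14 a e r : (14 <= a)%N -> r \in blk a e -> (2 ^ 14 <= r)%N.
Proof.
by move=> a14; rewrite mem_primes_in => /and3P[_ h _]; apply: leq_trans h; rewrite leq_exp2l.
Qed.

Let gavg_split K c L1 L2 u v : uniq (L1 ++ L2) -> torus_pt L2 u v ->
  gavg K c (L1 ++ L2) v = gavg K (fun I => c I * rprod (grid K I) L1 u) L2 v.
Proof.
rewrite cat_uniq => /and3P[_ /hasPn d _] [_ h]; congr (_ * _); apply: eq_bigr => I _.
rewrite rprod_cat mulrA; congr (_ * _ * _); apply: eq_rprod => r r1; apply: h.
by apply/negP => /d /=; rewrite r1.
Qed.

(** Each block of primes is either useless, when the mean over the grid is
already at least [M], or loses the proportion [kap] of the mass below [M]. *)
Lemma mass_decay n f a : 0 < f -> (14 <= a)%N ->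
  exists2 e, (a <= 2 ^ e)%N & forall K (c : nat -> R) z, (e <= K)%N ->
    (forall J, f <= c J) -> in_disc z ->
    tmean (primes_in (2 ^ a) (2 ^ 2 ^ e))
      (fun u => gavg K c (primes_in (2 ^ a) (2 ^ 2 ^ e)) u `^ al) z <=
    (M `^ (al - 1) + eta `^ (al - 1) * (1 - kap) ^+ n) * gmean K c + eta `^ al.
Proof.
elim: n f a => [|n IH] f a f0 a14.
  exists a => [|K c z aK fc zd]; first exact: ltnW (ltn_expl a (ltnSn 1)).
  rewrite -/(blk a a); have uL : uniq (blk a a) by exact: primes_in_uniq.
  have L14 r := @blk14 a a r a14.
  have c0 J : 0 <= c J by apply: le_trans (fc J); exact: ltW.
  have nG := nice_gavg K c (blk a a).
  apply: (@le_trans _ _ (tmean (blk a a) (fun u => eta `^ (al - 1) * gavg K c (blk a a) u + eta `^ al) z)).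
    apply: le_tmean => //; [by apply: nice_powR => // [|u]; [exact: ltW|exact: gavg_ge0]|
      by apply: niceD; [exact: niceZ|exact: nice_cst]|].
    move=> u _; have X0 := gavg_ge0 K (blk a a) u c0.
    have [Xe|Xe] := leP eta (gavg K c (blk a a) u).
      by apply: le_trans (powR_le_linear al0 al1 eta0 Xe) _; rewrite lerDl powR_ge0.
    apply: (@le_trans _ _ (eta `^ al)); first by apply: le_powR => //; exact: ltW.
    by rewrite lerDr mulr_ge0 ?powR_ge0.
  rewrite (tmeanD _ (niceZ _ nG) (nice_cst _) zd) (tmeanZ _ _ nG zd) tmean_cst (tmean_gavg K c uL L14 zd).
  rewrite expr0 mulr1 lerD2r; apply: ler_wpM2r; first exact: gmean_ge0.
  by rewrite lerDr powR_ge0.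
have [e1 ae1 exc] := excursion M f0 a14.
rewrite -/(blk a e1) in exc; set L1 := blk a e1 in exc.
have uL1 : uniq L1 by exact: primes_in_uniq.
have L14 r := @blk14 a e1 r a14; rewrite -/L1 in L14.
have fl0 := rfloor_gt0 R L14; set fl := rfloor R L1 in fl0.
have ff0 : 0 < f * fl by exact: mulr_gt0.
have a14' : (14 <= 2 ^ e1)%N by exact: leq_trans ae1.
have [e e1e hIH] := IH _ _ ff0 a14'.
exists e => [|K c z eK fc zd]; first exact: leq_trans e1e.
set L2 := primes_in (2 ^ 2 ^ e1) (2 ^ 2 ^ e) in hIH.
have LE : primes_in (2 ^ a) (2 ^ 2 ^ e) = L1 ++ L2 by apply: primes_in_cat; rewrite leq_exp2l.
have uL : uniq (L1 ++ L2) by rewrite -LE primes_in_uniq.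
have uL2 : uniq L2 by exact: primes_in_uniq.
have e1K : (e1 <= K)%N by apply: leq_trans eK; rewrite -(@leq_exp2l 2).
have c0 J : 0 <= c J by apply: le_trans (fc J); exact: ltW.
have L14' r : r \in L2 -> (2 ^ 14 <= r)%N.
  by rewrite mem_primes_in => /and3P[_ h _]; apply: leq_trans h; rewrite leq_exp2l.
rewrite LE tmean_cat.
set W := M `^ (al - 1); set H := eta `^ (al - 1) * (1 - kap) ^+ n.
have k1 : 0 <= 1 - kap by rewrite subr_ge0 excur_const_le1.
have H0 : 0 <= H by rewrite mulr_ge0 ?powR_ge0// exprn_ge0.
pose ind u : R := (M <= gavg K c L1 u)%R%:R.
have nG := nice_gavg K c L1; have nI : nice (fun u => gavg K c L1 u * ind u).
  by apply: niceM => //; exact: nice_ler.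
have nB : nice (fun u => (W + H) * gavg K c L1 u + (- H) * (gavg K c L1 u * ind u) + eta `^ al).
  by apply: niceD; [apply: niceD; exact: niceZ|exact: nice_cst].
have nX : nice (tmean L2 (fun v => gavg K c (L1 ++ L2) v `^ al)).
  apply: nice_tmean; apply: nice_powR; [exact: ltW|by move=> u; exact: gavg_ge0|exact: nice_gavg].
apply: (@le_trans _ _ (tmean L1 (fun u => (W + H) * gavg K c L1 u + (- H) * (gavg K c L1 u * ind u) + eta `^ al) z)).
  apply: le_tmean => // u ut; have ud := disc_torus zd ut.
  pose c' I := c I * rprod (grid K I) L1 u.
  have fc' J : f * fl <= c' J.
    apply: ler_pM; [exact: ltW|exact: ltW|exact: fc|apply: rfloor_le => //].
    by case: ut.
  have c'0 J : 0 <= c' J by rewrite mulr_ge0 ?rprod_ge0.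
  rewrite (eq_tmean (h := fun v => gavg K c' L2 v `^ al) uL2); last first.
    by move=> v vt; rewrite (gavg_split _ _ uL vt).
  have -> : gavg K c L1 u = gmean K c' by [].
  have E0 : 0 <= eta `^ al by exact: powR_ge0.
  have [MX|MX] := leP M (gavg K c L1 u); rewrite /ind.
    rewrite MX mulr1.
    have -> : (W + H) * gmean K c' + - H * gmean K c' + eta `^ al = W * gmean K c' + eta `^ al by ring.
    apply: le_trans (tmean_concave al0 (ltW al1) uL2 (nice_gavg K c' L2) (fun v => gavg_ge0 K L2 v c'0) ud) _.
    rewrite (tmean_gavg K c' uL2 L14' ud).
    by apply: le_trans (powR_le_linear al0 al1 M0 MX) _; rewrite lerDl.
  have -> : (M <= gavg K c L1 u) = false by rewrite leNgt MX.
  by rewrite /= !mulr0 addr0; exact: hIH.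
rewrite (tmeanD _ (niceD (niceZ _ nG) (niceZ _ nI)) (nice_cst _) zd) (tmeanD _ (niceZ _ nG) (niceZ _ nI) zd).
rewrite (tmeanZ _ _ nG zd) (tmeanZ _ _ nI zd) tmean_cst (tmean_gavg K c uL1 L14 zd) lerD2r.
have key : kap * gmean K c <= tmean L1 (fun u => gavg K c L1 u * ind u) z.
  have nRI I : nice (fun u => rprod (grid K I) L1 u * ind u).
    by apply: niceM; [exact: nice_rprod|exact: nice_ler].
  rewrite (eq_tmean (h := fun u => ((2 ^ K)%:R)^-1 * \sum_(I <- iota 0 (2 ^ K)) c I * (rprod (grid K I) L1 u * ind u)) uL1).
    rewrite tmeanZ//; last by apply: nice_sum => I _; exact: niceZ.
    rewrite tmean_sum//; last by move=> I _; exact: niceZ.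
    rewrite /gmean mulrCA; apply: ler_wpM2l; first by rewrite invr_ge0.
    rewrite mulr_sumr big_seq [leRHS]big_seq; apply: ler_sum => I; rewrite mem_iota add0n => /andP[_ IK].
    by rewrite tmeanZ// mulrC; apply: ler_wpM2l; [exact: c0|exact: exc].
  move=> u _; rewrite /gavg -mulrA mulr_suml; congr (_ * _).
  by apply: eq_bigr => I _; rewrite mulrA.
have := ler_wpM2l H0 key; rewrite exprS (mulrCA _ (1 - kap)) -/H.
move: (tmean _ _ _) (gmean K c) => X Y; lra.
Qed.

End decay.

(** Moments of order less than one of the normalized mean over the grid are
arbitrarily small. *)
Lemma moment_small (al d : R) : 0 < al -> al < 1 -> 0 < d ->
  exists2 e, (4 <= e)%N & forall z : point, in_disc z ->
    tmean (primes_in (2 ^ 14) (2 ^ 2 ^ e))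
      (fun u => gavg e (fun=> 1) (primes_in (2 ^ 14) (2 ^ 2 ^ e)) u `^ al) z <= d.
Proof.
move=> al0 al1 d0; pose d3 := d / 3; have d30 : 0 < d3 by rewrite divr_gt0.
pose M := d3 `^ (al - 1)^-1; pose eta := d3 `^ al^-1.
have M0 : 0 < M by exact: powR_gt0.
have eta0 : 0 < eta by exact: powR_gt0.
have ME : M `^ (al - 1) = d3 by rewrite -powRrM mulVf ?powRr1 ?ltW// lt_eqF// subr_lt0.
have eE : eta `^ al = d3 by rewrite -powRrM mulVf ?powRr1 ?ltW// gt_eqF.
set Q := eta `^ (al - 1); have Q0 : 0 < Q by exact: powR_gt0.
have k0 := excur_const_gt0 R; have k1 := excur_const_le1.
pose n := (Num.truncn (Q / (kap * d3))).+1.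
have hn : Q * (1 - kap) ^+ n <= d3.
  have n0 : Q / (kap * d3) < n%:R by exact: truncnS_gt.
  rewrite ltr_pdivrMr ?mulr_gt0// in n0.
  have e1 : (1 - kap) ^+ n <= expR (- (n%:R * kap)).
    rewrite -mulrN expRM_natl lerXn2r ?nnegrE ?expR_ge0 ?subr_ge0//; exact: expR_ge1Dx.
  have e2 : expR (- (n%:R * kap)) * (n%:R * kap) <= 1.
    rewrite expRN mulrC ler_pdivrMr ?expR_gt0// mul1r.
    by apply: le_trans (expR_ge1Dx _); rewrite lerDr.
  have p0 := expR_ge0 (- (n%:R * kap)).
  have := ler_wpM2l (ltW Q0) e1; move: (expR _) p0 e2 => X X0 X1 X2; apply: le_trans X2 _.
  apply: (@le_trans _ _ (X * (n%:R * kap) * d3)); last by apply: ler_piMl X1; exact: ltW.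
  rewrite (_ : X * (n%:R * kap) * d3 = n%:R * (kap * d3) * X); last by ring.
  have Qn : 0 <= n%:R * (kap * d3) - Q by rewrite subr_ge0 ltW.
  by rewrite -subr_ge0 -mulrBl mulr_ge0.
have [e ae h] := mass_decay al0 al1 M0 eta0 n ltr01 (leqnn 14).
exists e => [|z zd]; first by rewrite leqNgt; apply/negP => e4; move: ae; rewrite leqNgt (leq_ltn_trans (leq_pexp2l (m := 2) (n2 := 3) _ _))//.
apply: le_trans (h e (fun=> 1) z (leqnn e) (fun _ => lexx 1) zd) _.
have -> : gmean e (fun=> 1) = 1.
  rewrite /gmean big_const_seq count_predT size_iota iter_addr_0.
  by apply: mulVf; apply: lt0r_neq0; rewrite ltr0n expn_gt0.
rewrite mulr1 ME eE; move: hn; rewrite -/Q; rewrite /d3; move: (Q * _) => X; lra.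
Qed.

End MassDecay.

Section Signs.
Variable R : realType.
Local Notation C := R[i].
Local Notation Re := complex.Re.

Fixpoint signs n : seq (seq R) :=
  if n is n'.+1 then [seq 1 :: e | e <- signs n'] ++ [seq -1 :: e | e <- signs n'] else [:: [::]].

Definition ssum n (e : seq R) (a : nat -> C) : C := \sum_(0 <= I < n) (nth 0 e I)%:C%C * a I.

Lemma size_signs n : (size (signs n))%:R = 2 ^+ n :> R.
Proof.
by elim: n => [|n IH] /=; rewrite ?expr0// size_cat !size_map natrD IH exprS mulrDl mul1r.
Qed.

Lemma ssumS n x e (a : nat -> C) : ssum n.+1 (x :: e) a = x%:C%C * a 0%N + ssum n e (fun I => a I.+1).
Proof. by rewrite /ssum big_nat_recl. Qed.

Let sgnC (w : C) : ((1 : R)%:C)%C * w = w /\ ((-1 : R)%:C)%C * w = - w.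
Proof. by split; apply: complex_ext; rewrite ?ReRl ?ImRl ?ReN ?ImN; ring. Qed.

Lemma signs_split n (G : C -> R) x (a : nat -> C) :
  \sum_(e <- signs n.+1) G (x + ssum n.+1 e a) =
  \sum_(e <- signs n) G (x + a 0%N + ssum n e (fun I => a I.+1)) +
  \sum_(e <- signs n) G (x - a 0%N + ssum n e (fun I => a I.+1)).
Proof.
have [s1 s2] := sgnC (a 0%N); rewrite /= big_cat !big_map /=; congr (_ + _); apply: eq_bigr => e _.
  by rewrite ssumS s1 addrA.
by rewrite ssumS s2 addrA.
Qed.

Let parallelogram (x a : C) : sqn (x + a) + sqn (x - a) = 2 * (sqn x + sqn a).
Proof. by rewrite /sqn !(ReD, ImD, ReN, ImN); ring. Qed.

Lemma signs_sqn n x (a : nat -> C) :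
  \sum_(e <- signs n) sqn (x + ssum n e a) = 2 ^+ n * (sqn x + \sum_(0 <= I < n) sqn (a I)).
Proof.
elim: n x a => [|n IH] x a; first by rewrite big_seq1 /ssum !big_geq// !addr0 expr0 mul1r.
rewrite signs_split !IH big_nat_recl// exprS -mulrDr.
rewrite (_ : _ + _ + (_ + _) = 2 * (sqn x + (sqn (a 0%N) + \sum_(0 <= i < n) sqn (a i.+1)))).
  by ring.
have := parallelogram x (a 0%N); move: (sqn (_ + _)) (sqn (_ - _)) => X Y; lra.
Qed.

Lemma signs_powR_ge n x (a : nat -> C) J (al : R) : 0 <= al -> (J < n)%N ->
  2 ^+ n * sqn (a J) `^ al <= 2 * \sum_(e <- signs n) sqn (x + ssum n e a) `^ al.
Proof.
move=> al0; elim: n x a J => [//|n IH] x a [|J] Jn.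
  rewrite (signs_split n (fun w => sqn w `^ al)) -big_split/= exprS -mulrA.
  apply: ler_wpM2l => //.
  rewrite -size_signs -sum1_size natr_sum mulr_suml; apply: ler_sum => e _; rewrite mul1r.
  set w := ssum _ _ _; have := parallelogram (x + w) (a 0%N).
  rewrite (_ : x + w + a 0%N = x + a 0%N + w); last by rewrite addrAC.
  rewrite (_ : x + w - a 0%N = x - a 0%N + w); last by rewrite addrAC.
  have := sqn_ge0 (x + w); have := sqn_ge0 (a 0%N).
  move: (sqn _) (sqn (x + w)) (sqn (x + a 0%N + w)) (sqn (x - a 0%N + w)) (sqn_ge0 (x + a 0%N + w))
    (sqn_ge0 (x - a 0%N + w)) => A X P Q P0 Q0 A0 X0 h.
  have [AP|AP] := leP A P.
    by apply: le_trans (le_powR al0 A0 AP) _; rewrite lerDl powR_ge0.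
  have AQ : A <= Q by lra.
  by apply: le_trans (le_powR al0 A0 AQ) _; rewrite lerDr powR_ge0.
rewrite (signs_split n (fun w => sqn w `^ al)) exprS.
have := IH (x + a 0%N) (fun I => a I.+1) J Jn; have := IH (x - a 0%N) (fun I => a I.+1) J Jn.
lra.
Qed.

(** Jensen's inequality for a concave power and a finite mean. *)
Lemma sum_powR_concave (T : eqType) (s : seq T) (x : T -> R) (m A al : R) : 0 < al -> al <= 1 ->
  \sum_(i <- s) 1 = m -> \sum_(i <- s) x i = m * A -> (forall i, 0 <= x i) -> 0 < A ->
  \sum_(i <- s) x i `^ al <= m * A `^ al.
Proof.
move=> a0 a1 sm sx x0 A0; have q1 : 1 <= al^-1 by rewrite -[leLHS]invr1 lef_pV2 ?posrE.
pose k := al^-1 * (A `^ al) `^ (al^-1 - 1).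
have k0 : 0 < k by rewrite mulr_gt0 ?powR_gt0 ?invr_gt0.
have h i : A + k * (x i `^ al - A `^ al) <= x i.
  have cancel (y : R) : 0 <= y -> (y `^ al) `^ al^-1 = y.
    by move=> y0; rewrite -powRrM mulfV ?powRr1// gt_eqF.
  have := powR_tangent q1 (powR_ge0 A al) (powR_ge0 (x i) al).
  by rewrite (cancel _ (ltW A0)) (cancel _ (x0 i)) -/k.
rewrite -subr_le0 -(pmulr_rle0 _ k0).
have : \sum_(i <- s) (A * 1 + k * (x i `^ al - A `^ al * 1)) <= \sum_(i <- s) x i.
  by apply: ler_sum => i _; rewrite !mulr1; exact: h.
rewrite big_split/= -!mulr_sumr sumrB -mulr_sumr sm sx.
by rewrite [A * m]mulrC [A `^ al * m]mulrC; lra.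
Qed.

End Signs.

Section SquarefreeProducts.
Variable R : realType.
Local Notation C := R[i].

Fixpoint sqf (ps : seq nat) : seq nat :=
  if ps is r :: ps' then sqf ps' ++ [seq (r * n)%N | n <- sqf ps'] else [:: 1%N].

Lemma sqf_prime_dvd ps n : (forall r, r \in ps -> prime r) -> n \in sqf ps ->
  (0 < n)%N /\ forall q, prime q -> (q %| n)%N -> q \in ps.
Proof.
elim: ps n => [|r ps IH] n pps /=.
  by rewrite inE => /eqP ->; split => // q pq; rewrite dvdn1 => /eqP q1; rewrite q1 in pq.
have pps' q : q \in ps -> prime q by move=> qp; apply: pps; rewrite inE qp orbT.
have pr : prime r by apply: pps; rewrite inE eqxx.
rewrite mem_cat => /orP[/(IH _ pps')[n0 h]|/mapP[m /(IH _ pps')[m0 h] ->]].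
  by split => // q pq qn; rewrite inE h ?orbT.
split=> [|q pq]; first by rewrite muln_gt0 m0 prime_gt0.
by rewrite Euclid_dvdM// dvdn_prime2// inE => /orP[->//|/h -> //]; rewrite orbT.
Qed.

Lemma sqf_uniq ps : uniq ps -> (forall r, r \in ps -> prime r) -> uniq (sqf ps).
Proof.
elim: ps => [//|r ps IH] /= /andP[rps ups] pps.
have pps' q : q \in ps -> prime q by move=> qp; apply: pps; rewrite inE qp orbT.
have pr : prime r by apply: pps; rewrite inE eqxx.
rewrite cat_uniq IH// map_inj_uniq ?IH//=; last first.
  by move=> m n /eqP; rewrite eqn_pmul2l ?prime_gt0// => /eqP.
rewrite andbT; apply/hasPn => _ /mapP[m ms ->]; apply/negP => /= /(sqf_prime_dvd pps')[_ h].
by move/negP: rps; apply; apply: h => //; exact: dvdn_mulr.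
Qed.

Lemma sum_sqf (g : nat -> C) ps : (forall r, r \in ps -> prime r) -> g 1%N = 1 ->
  (forall m n, (0 < m)%N -> (0 < n)%N -> g (m * n)%N = g m * g n) ->
  \sum_(n <- sqf ps) g n = \prod_(r <- ps) (1 + g r).
Proof.
move=> + g1 gM; elim: ps => [|r ps IH] pps /=; first by rewrite big_seq1 big_nil.
have pps' q : q \in ps -> prime q by move=> qp; apply: pps; rewrite inE qp orbT.
have pr : prime r by apply: pps; rewrite inE eqxx.
rewrite big_cat big_map /= big_cons -(IH pps') mulrDl mul1r; congr (_ + _).
rewrite mulr_sumr big_seq [RHS]big_seq; apply: eq_bigr => n /(sqf_prime_dvd pps')[n0 _].
by rewrite gM// prime_gt0.
Qed.

Variables (K : nat) (ps : seq nat) (e : seq R).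
Hypotheses (pps : forall r, r \in ps -> prime r) (ups : uniq ps).
Let freq := [fset n in [seq n <- sqf ps | (0 < n)%N]]%fset.

Lemma sign_freq_gt0 n : n \in freq -> (0 < n)%N.
Proof. by rewrite in_fset /= mem_filter => /andP[]. Qed.

(** [sum_I e_I prod_r (1 + r ^ (- s + i t_I - ...))] over the grid points
[t_I], expanded into a Dirichlet polynomial. *)
Definition sign_poly : dirichlet_poly R :=
  DirichletPoly sign_freq_gt0
    (fun n => ssum (2 ^ K) e (fun I => wgt (grid R K I) n)).

Lemma sum_spectrum (F : nat -> C) : \sum_(n <- spectrum sign_poly) F n = \sum_(n <- sqf ps) F n.
Proof.
apply: perm_big; apply: uniq_perm; [exact: fset_uniq|exact: sqf_uniq|].
move=> n; rewrite /spectrum in_fset /= mem_filter.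
by apply/andP/idP => [[]//|ns]; split => //; have [] := sqf_prime_dvd pps ns.
Qed.

Lemma mem_spectrum n : n \in spectrum sign_poly -> n \in sqf ps.
Proof. by rewrite /spectrum in_fset /= mem_filter => /andP[]. Qed.

Lemma sum_sign_poly (g : nat -> C) : g 1%N = 1 ->
  (forall m n, (0 < m)%N -> (0 < n)%N -> g (m * n)%N = g m * g n) ->
  \sum_(n <- spectrum sign_poly) dcoef sign_poly n * g n =
  ssum (2 ^ K) e (fun I => \prod_(r <- ps) (1 + wgt (grid R K I) r * g r)).
Proof.
move=> g1 gM; rewrite sum_spectrum /= /ssum.
under eq_bigr do rewrite mulr_suml.
rewrite exchange_big; apply: eq_bigr => I _ /=.
rewrite -(@sum_sqf (fun n => wgt (grid R K I) n * g n))//.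
- by rewrite mulr_sumr; apply: eq_bigr => n _; rewrite mulrA.
- by rewrite /wgt nz1 mul1r.
- by move=> m n m0 n0; rewrite gM// /wgt nzM// mulrACA.
Qed.

Lemma esum_sign_poly t : esum 0 (spectrum sign_poly) (dcoef sign_poly) 0 t =
  ssum (2 ^ K) e (fun I => \prod_(r <- ps) (1 + wgt (grid R K I) r * nz 0 0 t r)).
Proof. by apply: sum_sign_poly; [exact: nz1|move=> m n m0 n0; exact: nzM]. Qed.

Lemma dpoly_sign_poly Q z : uniq Q -> (forall r, r \in Q -> prime r) -> {subset ps <= Q} ->
  dpoly (spectrum sign_poly) (dcoef sign_poly) Q z =
  ssum (2 ^ K) e (fun I => \prod_(r <- ps) (1 + wgt (grid R K I) r * z r)).
Proof.
move=> uQ pQ psQ; rewrite /dpoly (_ : \sum_(n <- _ | _) _ =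
  \sum_(n <- spectrum sign_poly) dcoef sign_poly n * mon Q n z); last first.
  rewrite big_seq_cond [RHS]big_seq; apply: eq_bigl => n.
  case: (boolP (n \in _)) => //= /mem_spectrum /(sqf_prime_dvd pps)[n0 h].
  by apply/smoothP => // r pr /(h _ pr) /psQ.
rewrite sum_sign_poly; first last.
- move=> m n m0 n0; rewrite /mon -big_split/=; apply: eq_bigr => r _.
  by rewrite lognM// exprD.
- by rewrite /mon big1// => r _; rewrite logn1 expr0.
congr ssum; apply/funext => I; rewrite big_seq [RHS]big_seq; apply: eq_bigr => r rps.
congr (1 + _ * _); have rQ := psQ _ rps; have pr := pps rps.
rewrite /mon (bigD1_seq r)//= logn_prime// eqxx expr1 big_seq_cond big1 ?mulr1//.
by move=> q /andP[qQ qr]; rewrite logn_prime ?pQ// (negbTE qr) expr0.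
Qed.

End SquarefreeProducts.

Section Failure.
Variable R : realType.
Local Notation C := R[i].
Local Notation Re := complex.Re.
Local Notation point := (nat -> C).
Local Notation hh := (hh R).
Local Notation grid := (grid R).
Local Notation leb := (@lebesgue_measure R).
Implicit Types (z u : point) (s : seq R) (t tau : R).

Definition eulerZ (L : seq nat) : R := \prod_(r <- L) (1 + hh r ^+ 2).

Lemma eulerZ_gt0 L : 0 < eulerZ L.
Proof. by apply: prodr_gt0 => r _; rewrite ltr_pwDl ?sqr_ge0. Qed.

Definition efac tau L z : C := \prod_(r <- L) (1 + wgt tau r * z r).

Lemma sqn_efac tau L z : sqn (efac tau L z) = eulerZ L * rprod tau L z.
Proof.
rewrite /efac sqn_prod /eulerZ /rprod -big_split/=; apply: eq_bigr => r _.
by rewrite /rfac /tilt [RHS]mulrC divfK// gt_eqF// ltr_pwDl ?sqr_ge0.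
Qed.

Lemma sum_sqn_efac K L z : \sum_(0 <= I < 2 ^ K) sqn (efac (grid K I) L z) =
  eulerZ L * (2 ^ K)%:R * gavg K (fun=> 1) L z.
Proof.
have N0 : (2 ^ K)%:R != 0 :> R by rewrite pnatr_eq0 expn_eq0.
rewrite /gavg -mulrA (mulrA (2 ^ K)%:R) divff// mul1r mulr_sumr /index_iota subn0.
by apply: eq_bigr => I _; rewrite sqn_efac mul1r.
Qed.

Lemma nz_conj_wgt t r : nz 0 0 t r = (wgt t r)^*%C.
Proof.
rewrite /wgt /nz; apply: complex_ext; rewrite ?(ReM, ImM, ReJ, ImJ) /=.
  by rewrite !(add0r, addr0) mulNr opprK cosN; ring.
by rewrite !(add0r, addr0) mulNr opprK sinN; ring.
Qed.

Lemma efac_near tau t r : (2 ^ 14 <= r)%N -> `|(tau - t) * ln r%:R| <= 1 ->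
  (1 + hh r ^+ 2) ^+ 2 * expR (- (2 * (hh r ^+ 2 * ((tau - t) * ln r%:R) ^+ 2))) <=
  sqn (1 + wgt tau r * nz 0 0 t r).
Proof.
move=> r14 ph; have r0 : (0 < r)%N by apply: leq_trans r14.
have h0 := hh_gt0 R r; have h1 := hh_small R r14.
rewrite nz_conj_wgt sqnD sqn1 rmorph1 mul1r Re_wgtJ sqnM sqnJ !sqn_wgt// -!hh_sqr//.
have := cos_ge_quadratic ((tau - t) * ln r%:R); set q := (tau - t) * _ in ph *.
have q1 : q ^+ 2 <= 1 by rewrite -real_normK ?num_real// expr_le1.
have k0 : 0 < hh r ^+ 2 by exact: exprn_gt0.
have k1 : hh r ^+ 2 <= 2^-1 by nra.
have q0 := sqr_ge0 q; move: (cos q) (q ^+ 2) (hh r ^+ 2) q0 q1 k0 k1 => c b k b0 b1 k0 k1 hc.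
have y0 : 0 <= k * b by rewrite mulr_ge0// ltW.
have y1 : k * b <= 2^-1 by nra.
have e1 : expR (- (2 * (k * b))) <= 1 - k * b.
  by apply: le_trans (one_sub_ge y0 y1); rewrite ler_expR; nra.
apply: (@le_trans _ _ ((1 + k) ^+ 2 * (1 - k * b))).
  by apply: ler_wpM2l => //; exact: sqr_ge0.
have : k * (1 - b / 2) <= k * c by apply: ler_wpM2l => //; exact: ltW.
have : 0 <= k * b * (2 * k + k ^+ 2) by rewrite mulr_ge0// addr_ge0 ?sqr_ge0// mulr_ge0// ltW.
nra.
Qed.

Section scale.
Variables (e : nat) (e4 : (4 <= e)%N).
Let N := (2 ^ e)%N.
Let L := primes_in (2 ^ 14) (2 ^ 2 ^ e).
Let Z := eulerZ L.

Let N0 : 0 < N%:R :> R. Proof. by rewrite ltr0n expn_gt0. Qed.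
Let uL : uniq L. Proof. exact: primes_in_uniq. Qed.
Let Lp r : r \in L -> prime r. Proof. exact: primes_in_prime. Qed.
Let L14 r : r \in L -> (2 ^ 14 <= r)%N.
Proof. by rewrite mem_primes_in => /and3P[]. Qed.
Let Lb r : r \in L -> (r < 2 ^ 2 ^ e)%N.
Proof. by rewrite mem_primes_in => /and3P[]. Qed.

Lemma efac_grid_large (t : R) : 0 <= t -> t <= 1 -> exists2 J, (J < 2 ^ e)%N &
  Z ^+ 2 * expR (- 6) <= sqn (efac (grid e J) L (nz 0 0 t)).
Proof.
move=> t0 t1.
have [J JN Jt] : exists2 J, (J < 2 ^ e)%N & `|grid e J - t| <= N%:R^-1.
  have tN0 : 0 <= t * N%:R by rewrite mulr_ge0.
  have /andP[k1 k2] := truncn_itv tN0; set k := Num.truncn _ in k1 k2.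
  have dist (j : nat) : `|j%:R - t * N%:R| <= 1 -> `|grid e j - t| <= N%:R^-1.
    move=> h; rewrite (_ : grid e j - t = (j%:R - t * N%:R) / N%:R); last first.
      by rewrite mulrBl mulfK// gt_eqF.
    by rewrite normrM (ger0_norm (_ : 0 <= N%:R^-1)) ?invr_ge0// -[leRHS]mul1r; apply: ler_wpM2r.
  have [kN|kN] := ltnP k N.
    exists k => //; apply: dist; rewrite -natr1 in k2; rewrite ler_norml; apply/andP; split; lra.
  exists N.-1; first by rewrite prednK ?expn_gt0.
  apply: dist; have NE : N%:R = N.-1%:R + 1 :> R by rewrite natr1 prednK ?expn_gt0.
  have : N%:R <= t * N%:R by apply: le_trans k1; rewrite ler_nat.
  have : t * N%:R <= N%:R by rewrite ler_piMl.
  by rewrite ler_norml => ? ?; apply/andP; split; lra.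
exists J => //; set tau := grid e J in Jt *.
have ph r : r \in L -> `|(tau - t) * ln r%:R| <= ln r%:R / N%:R.
  move=> rL; rewrite normrM (ger0_norm (ln_nat_ge0 _ r)) mulrC.
  by apply: ler_wpM2l => //; exact: ln_nat_ge0.
have ph1 r : r \in L -> `|(tau - t) * ln r%:R| <= 1.
  move=> rL; apply: le_trans (ph r rL) _; rewrite ler_pdivrMr// mul1r.
  apply: le_trans (ln_block_le R (prime_gt0 (Lp rL)) (ltnW (Lb rL))) _.
  by apply: ler_piMr => //; exact: ln2_le1.
have S3 : \sum_(r <- L) hh r ^+ 2 * ((tau - t) * ln r%:R) ^+ 2 <= 3.
  apply: (@le_trans _ _ ((\sum_(r <- L) ln (r%:R : R) ^+ 2 / r%:R) / N%:R ^+ 2)).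
    rewrite mulr_suml big_seq [leRHS]big_seq; apply: ler_sum => r rL.
    rewrite hh_sqr ?prime_gt0 ?Lp//.
    have -> : ln (r%:R : R) ^+ 2 / r%:R / N%:R ^+ 2 = r%:R^-1 * (ln r%:R / N%:R) ^+ 2.
      by rewrite expr_div_n; ring.
    apply: ler_wpM2l; first by rewrite invr_ge0.
    rewrite -real_normK ?num_real// lerXn2r ?nnegrE//; last exact: ph.
    by rewrite divr_ge0 ?ln_nat_ge0.
  by rewrite ler_pdivrMr ?exprn_gt0//; exact: sum_ln_sqr_primes.
apply: (@le_trans _ _ (\prod_(r <- L) ((1 + hh r ^+ 2) ^+ 2 *
    expR (- (2 * (hh r ^+ 2 * ((tau - t) * ln r%:R) ^+ 2)))))).
  rewrite big_split/= prodrXl -/(eulerZ L) -/Z -expR_sum; apply: ler_wpM2l; first exact: sqr_ge0.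
  by rewrite ler_expR sumrN -mulr_sumr; lra.
rewrite /efac sqn_prod big_seq [leRHS]big_seq; apply: ler_prod => r rL.
rewrite mulr_ge0 ?sqr_ge0 ?expR_ge0//=; apply: efac_near; [exact: L14|exact: ph1].
Qed.

Let y : R := (2 ^ 2 ^ e)%:R.
Let Q := primes_upto y.
Let z0 : point := fun=> 0.
Let z0d : in_disc z0. Proof. by move=> r; rewrite sqn0. Qed.
Let P (s : seq R) := sign_poly e L s.

Let split3 a b : (a <= b)%N ->
  primes_in 0 b.+1 = primes_in 0 a ++ (primes_in a b ++ primes_in b b.+1).
Proof.
move=> ab; rewrite (@primes_in_cat 0 a b.+1 (leq0n a) (leqW ab)).
by rewrite (@primes_in_cat a b b.+1 ab (leqnSn b)).
Qed.

Let QE : Q = primes_in 0 (2 ^ 14) ++ (L ++ primes_in (2 ^ 2 ^ e) (2 ^ 2 ^ e).+1).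
Proof.
have e14 : (14 <= 2 ^ e)%N by apply: (@leq_trans (2 ^ 4)) => //; rewrite leq_exp2l.
have le14 : (2 ^ 14 <= 2 ^ 2 ^ e)%N by rewrite leq_exp2l.
by rewrite /Q primes_uptoE natrK (split3 le14).
Qed.

Let uQ : uniq Q. Proof. by rewrite /Q primes_uptoE primes_in_uniq. Qed.
Let pQ r : r \in Q -> prime r. Proof. by rewrite /Q primes_uptoE; exact: primes_in_prime. Qed.
Let LQ : {subset L <= Q}. Proof. by move=> r rL; rewrite QE !mem_cat rL orbT. Qed.

Lemma bohr_bound_sign_poly s : bohr_bound (P s) y.
Proof.
split; first by rewrite ler_nat -[2%N]expn1 leq_exp2l// expn_gt0.
move=> n r /mem_spectrum /(sqf_prime_dvd Lp)[_ h] pr rn; rewrite ler_nat.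
by apply: ltnW; apply: Lb; exact: h.
Qed.

Variables (al d : R) (al0 : 0 < al) (al1 : al < 1).
Hypothesis small : forall z, in_disc z -> tmean L (fun u => gavg e (fun=> 1) L u `^ al) z <= d.

Let G u : R := gavg e (fun=> 1) L u `^ al.
Let G0 u : 0 <= gavg e (fun=> 1) L u. Proof. by apply: gavg_ge0 => _; exact: ler01. Qed.
Let nG : nice G. Proof. by apply: nice_powR => //; [exact: ltW|exact: nice_gavg]. Qed.

Let tmeanQ : tmean Q G z0 <= d.
Proof.
rewrite QE tmean_cat -(tmean_cst (primes_in 0 (2 ^ 14)) d z0).
apply: le_tmean; [exact: primes_in_uniq|apply: nice_tmean; exact: nG|exact: nice_cst|exact: z0d|].
move=> u [u1 u2]; have ud : in_disc u.
  move=> r; have [rA|rA] := boolP (r \in primes_in 0 (2 ^ 14)); first by rewrite u1.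
  by rewrite u2// sqn0.
rewrite tmean_cat; apply: le_trans (small ud); rewrite le_eqVlt; apply/orP; left; apply/eqP.
apply: eq_tmean => // v _; apply: tmean_const; first exact: primes_in_uniq.
move=> w [_ w2]; rewrite /G /gavg; congr (_ `^ _); congr (_ * _); apply: eq_bigr => I _.
congr (_ * _); apply: eq_rprod => r rL; apply: w2.
by rewrite mem_primes_in negb_and orbC negb_and -ltnNge Lb.
Qed.

Lemma sum_torus_means :
  \sum_(s <- signs R N) tmean Q (fun z => sqn (dpoly (spectrum (P s)) (dcoef (P s)) Q z) `^ al) z0 <=
  2 ^+ N * ((Z * N%:R) `^ al * d).
Proof.
have nd s : nice (fun z => sqn (dpoly (spectrum (P s)) (dcoef (P s)) Q z) `^ al).
  by apply: nice_sqn_powR; [exact: ltW|exact: cnice_dpoly].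
have ZN0 : 0 < Z * N%:R by rewrite mulr_gt0 ?eulerZ_gt0.
rewrite -tmean_sum//.
have c0 : 0 <= 2 ^+ N * (Z * N%:R) `^ al by rewrite mulr_ge0 ?exprn_ge0 ?powR_ge0.
apply: (@le_trans _ _ (tmean Q (fun z => 2 ^+ N * (Z * N%:R) `^ al * G z) z0)); last first.
  rewrite (tmeanZ _ _ nG z0d) (mulrA (2 ^+ N)); apply: (ler_wpM2l c0); exact: tmeanQ.
apply: le_tmean => //; [by apply: nice_sum => s _; exact: nd|exact: niceZ|].
move=> u [u1 _].
under eq_bigr => s _ do rewrite (dpoly_sign_poly e s Lp uL u uQ pQ LQ).
have EF := sum_sqn_efac e L u.
have A0 : 0 < Z * N%:R * gavg e (fun=> 1) L u.
  rewrite -EF big_ltn ?expn_gt0//; apply: ltr_pwDl; last by apply: sumr_ge0 => I _; exact: sqn_ge0.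
  rewrite sqn_efac mulr_gt0 ?eulerZ_gt0//; apply: lt_le_trans (rfloor_gt0 R L14) _.
  by apply: rfloor_le => // r /LQ; exact: u1.
rewrite -mulrA /G -powRM ?(ltW ZN0)//.
have s1 : \sum_(s <- signs R N) 1 = 2 ^+ N :> R by rewrite -size_signs -sum1_size natr_sum.
apply: (sum_powR_concave (x := fun s => sqn (ssum N s (fun I => efac (grid e I) L u))) al0 (ltW al1) s1) => //.
  have := signs_sqn N 0 (fun I => efac (grid e I) L u); rewrite sqn0 add0r EF => <-.
  by apply: eq_bigr => s _; rewrite add0r.
by move=> s; exact: sqn_ge0.
Qed.

Lemma sum_line_values t : 0 <= t -> t <= 1 -> 2 ^+ N * (Z ^+ 2 * expR (- 6)) `^ al <=
  2 * \sum_(s <- signs R N) sqn (esum 0 (spectrum (P s)) (dcoef (P s)) 0 t) `^ al.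
Proof.
move=> t0 t1; have [J JN h] := efac_grid_large t0 t1.
have := signs_powR_ge 0 (fun I => efac (grid e I) L (nz 0 0 t)) (ltW al0) JN.
have E : \sum_(s <- signs R N) sqn (0 + ssum N s (fun I => efac (grid e I) L (nz 0 0 t))) `^ al =
    \sum_(s <- signs R N) sqn (esum 0 (spectrum (P s)) (dcoef (P s)) 0 t) `^ al.
  by apply: eq_bigr => s _; rewrite add0r (esum_sign_poly e s Lp uL).
rewrite -/N E; apply: le_trans; apply: ler_wpM2l; first exact: exprn_ge0.
by apply: le_powR h; [exact: ltW|rewrite mulr_ge0 ?sqr_ge0 ?expR_ge0].
Qed.

End scale.

Lemma eulerZ_large : exists2 A : R, 0 < A & forall e, (4 <= e)%N ->
  (2 ^ e)%:R <= A * eulerZ (primes_in (2 ^ 14) (2 ^ 2 ^ e)).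
Proof.
have [A A0 h] := mertens_lower R 14; exists (A * expR 3); first by rewrite mulr_gt0 ?expR_gt0.
move=> e e4; have e14 : (14 <= 2 ^ e)%N by apply: (@leq_trans (2 ^ 4)) => //; rewrite leq_exp2l.
apply: le_trans (h _ e14) _; rewrite -mulrA; apply: ler_wpM2l; first exact: ltW.
set L := primes_in _ _; have L2 r : r \in L -> (0 < r)%N /\ (r%:R : R)^-1 <= 2^-1 by exact: primes_in_ge2.
have s3 := sum_npow32_le R (2 ^ 14) (2 ^ 2 ^ e); rewrite -/L in s3.
apply: (@le_trans _ _ (expR (3 + \sum_(r <- L) ((r%:R)^-1 - (r%:R)^-1 ^+ 2)))).
  rewrite ler_expR sumrB; suff : \sum_(r <- L) (r%:R : R)^-1 ^+ 2 <= 3 by lra.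
  apply: le_trans s3; rewrite big_seq [leRHS]big_seq; apply: ler_sum => r /L2[r0 _].
  exact: inv_sqr_le_npow32.
rewrite expRD; apply: ler_wpM2l; first exact: expR_ge0.
rewrite expR_sum /eulerZ big_seq [leRHS]big_seq; apply: ler_prod => r /L2[r0 r2].
rewrite expR_ge0 hh_sqr//=; have x0 : 0 <= (r%:R : R)^-1 by rewrite invr_ge0.
move: (_^-1) x0 r2 => x x0 x2.
have h2 := expR_ge1Dx (- (x - x ^+ 2)).
have E12 : expR (x - x ^+ 2) * expR (- (x - x ^+ 2)) = 1 by rewrite -expRD subrr expR0.
have E10 := expR_gt0 (x - x ^+ 2).
move: h2 E12 E10; set E1 := expR (x - _); set E2 := expR (- _) => h2 E12 E10.
have x3 : 0 <= x ^+ 3 by exact: exprn_ge0.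
have h3 : E1 * (1 - x + x ^+ 2) <= 1 by rewrite -[leRHS]E12; apply: ler_wpM2l; [exact: ltW|lra].
have h4 : 0 < 1 - x + x ^+ 2 by nra.
rewrite -(ler_pM2r h4); apply: le_trans h3 _; nra.
Qed.

End Failure.

Section NoEmbedding.
Variable R : realType.
Local Notation leb := (@lebesgue_measure R).

Lemma no_local_embedding (p : R) : 0 < p -> p < 2 ->
  ~ exists C : R, forall (P : dirichlet_poly R) (y : R), bohr_bound P y ->
    (ereal_sup [set \int[leb]_(t in `[theta, (theta + 1)%R])
                     (normc (dirichlet_eval P (2^-1 +i* t)%C) `^ p)%R%:E
                | theta in [set: R]]
     <= C%:E * hardy_normXp P y p)%E.
Proof.
move=> p0 p2 [C hC]; pose al := p / 2.
have al0 : 0 < al by rewrite divr_gt0.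
have al1 : al < 1 by rewrite ltr_pdivrMr// mul1r.
pose D := Num.max C 0 + 1; have D0 : 0 < D by rewrite ltr_wpDl// le_max lexx orbT.
have CD : C <= D by rewrite ler_wpDr// le_max lexx.
have [A A0 hA] := eulerZ_large R.
pose E6 : R := expR (- 6) `^ al; have E60 : 0 < E6 by rewrite powR_gt0 ?expR_gt0.
have Aal : 0 < A `^ al by exact: powR_gt0.
pose d := E6 / (4 * D * A `^ al).
have d0 : 0 < d by rewrite divr_gt0// !mulr_gt0.
have [e e4 small] := moment_small al0 al1 d0.
pose N := (2 ^ e)%N; pose L := primes_in (2 ^ 14) (2 ^ 2 ^ e); pose Z := eulerZ R L.
have Z0 : 0 < Z by exact: eulerZ_gt0.
pose y : R := (2 ^ 2 ^ e)%:R.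
pose P (s : seq R) := sign_poly e L s.
pose f s t := sqn (esum 0 (spectrum (P s)) (dcoef (P s)) 0 t) `^ al.
pose H s := tmean (primes_upto y) (fun z => sqn (dpoly (spectrum (P s)) (dcoef (P s)) (primes_upto y) z) `^ al) (fun=> 0).
have H0 s : 0 <= H s.
  apply: tmean_ge0; [by rewrite primes_uptoE primes_in_uniq| | |by move=> u _; exact: powR_ge0].
    by apply: nice_sqn_powR; [exact: ltW|exact: cnice_dpoly].
  by move=> r; rewrite sqn0.
have fI s : (\int[leb]_(t in `[0%R, 1%R]) (f s t)%:E <= (D * H s)%:E)%E.
  have [I1 _] := dirichlet_integral (P s) 0 p0.
  have bb : bohr_bound (P s) y by exact: bohr_bound_sign_poly.
  have h := hC (P s) y bb; rewrite (hardy_tmean (ltW p0) bb) in h.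
  rewrite /f -I1; apply: le_trans (le_trans _ h) _; first by apply: ereal_sup_ubound; exists 0.
  rewrite -EFinM lee_fin; apply: (ler_wpM2r (H0 s)); exact: CD.
have mf s : measurable_fun setT (f s) by have [_ []] := dirichlet_integral (P s) 0 p0.
pose K := 2 ^+ N * (Z ^+ 2 * expR (- 6)) `^ al / 2.
have lo : (K%:E <= \sum_(s <- signs R N) \int[leb]_(t in `[0%R, 1%R]) (f s t)%:E)%E.
  rewrite -ge0_integral_sum//=; last 2 first.
  - by move=> s; apply: measurable_funTS; apply/measurable_EFinP; exact: mf.
  - by move=> s t _; rewrite lee_fin powR_ge0.
  apply: (@le_trans _ _ (\int[leb]_(t in `[0%R, 1%R]) K%:E)%E).
    rewrite integral_cst//= lebesgue_measure_itv/= lte01 oppr0 adde0 mule1//.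
  apply: ge0_le_integral => //=.
  - by move=> t _; rewrite lee_fin /K divr_ge0// mulr_ge0 ?exprn_ge0 ?powR_ge0.
  - apply: emeasurable_sum => s; apply: measurable_funTS; apply/measurable_EFinP; exact: mf.
  move=> t; rewrite in_itv/= => /andP[t0 t1]; rewrite sumEFin lee_fin /K ler_pdivrMr// [leRHS]mulrC.
  exact: sum_line_values.
have up : (\sum_(s <- signs R N) \int[leb]_(t in `[0%R, 1%R]) (f s t)%:E <=
    (D * (2 ^+ N * ((Z * N%:R) `^ al * d)))%:E)%E.
  apply: (@le_trans _ _ (\sum_(s <- signs R N) (D * H s)%:E)%E); first by apply: lee_sum => s _; exact: fI.
  rewrite sumEFin lee_fin -mulr_sumr; apply: ler_wpM2l; first exact: ltW.
  exact: sum_torus_means.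
have := le_trans lo up; rewrite lee_fin /K => KK.
have q0 : 0 < 2 ^+ N :> R by rewrite exprn_gt0.
have ZZ0 : 0 < (Z ^+ 2) `^ al by rewrite powR_gt0// exprn_gt0.
have zn : (Z * N%:R) `^ al <= A `^ al * (Z ^+ 2) `^ al.
  rewrite -powRM ?(ltW A0) ?sqr_ge0//; apply: le_powR; [exact: ltW|by rewrite mulr_ge0// ltW|].
  by rewrite expr2 mulrCA; apply: ler_wpM2l; [exact: ltW|exact: hA].
rewrite powRM ?sqr_ge0 ?expR_ge0// -/E6 in KK.
have : D * (2 ^+ N * ((Z * N%:R) `^ al * d)) <= D * (2 ^+ N * (A `^ al * (Z ^+ 2) `^ al * d)).
  apply: ler_wpM2l; first exact: ltW.
  apply: ler_wpM2l; first exact: ltW.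
  by apply: ler_wpM2r; [exact: ltW|].
have -> : D * (2 ^+ N * (A `^ al * (Z ^+ 2) `^ al * d)) = 2 ^+ N * (Z ^+ 2) `^ al * E6 / 4.
  by rewrite /d; field; rewrite !gt_eqF.
have pos : 0 < 2 ^+ N * (Z ^+ 2) `^ al * E6 by rewrite !mulr_gt0.
rewrite mulrA in KK; lra.
Qed.

End NoEmbedding.

Theorem corollary1p2 (R : realType) (p : R) (p_gt0 : 0 < p) :
  (exists C : R, forall (P : dirichlet_poly R) (y : R), bohr_bound P y ->
    (ereal_sup [set \int[lebesgue_measure]_(t in `[theta, (theta + 1)%R])
                     (normc (dirichlet_eval P (2^-1 +i* t)%C) `^ p)%R%:E
                | theta in [set: R]]
     <= C%:E * hardy_normXp P y p)%E)
  <-> 2 <= p.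
Proof.
split=> [h|]; last exact: local_embedding.
by rewrite leNgt; apply/negP => p2; exact: no_local_embedding p_gt0 p2 h.
Qed.
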